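(* Let $p\in(0,\infty)$, $\varepsilon,C>0$, let $K$ be a compact subset of $\overline{\Lambda_+}$, and fix $\nu\in\mathcal M_+(E\times F_{\mathbb C})$. For every $\mu\in\mathcal M_+(E\times F_{\mathbb C})$ and every $R>0$ define $$G_{\mu,R}=\{(\zeta,z)\in E\times F_{\mathbb C}:\ M_R(\mu)(\zeta,z)\geq\varepsilon\}.$$ Then there is $R>0$ such that, for every $R'>0$, every $\mu\in\mathcal M_+(E\times F_{\mathbb C})$ such that $\rho(\operatorname{Supp}\mu)$ is bounded, $$M_1(\mu)\in L^\infty(E\times F_{\mathbb C}),$$ and $$\nu\big(G_{\mu,R}\cap B((\zeta,x+i\Phi(\zeta)),R)\big)\geq C\qquad\text{for every }(\zeta,x)\in\mathcal N\setminus B_{\mathcal N}((0,0),R'),$$ is a strongly $p$-sampling measure for $\mathcal B^p_K(\mathcal N)$.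
   Context: Setting. $E$ is a complex Hilbert space of finite dimension $n\geq 0$, $F$ is a real Hilbert space of finite dimension $m$, $F'$ is the dual of $F$, $F_{\mathbb C}$ its complexification, and $\Phi\colon E\times E\to F_{\mathbb C}$ is a hermitian map ($\mathbb C$-linear in the first variable, $\Phi(\zeta',\zeta)=\overline{\Phi(\zeta,\zeta')}$); $\Phi(\zeta):=\Phi(\zeta,\zeta)\in F$. The open convex cone $\Lambda_+=\{\lambda\in F':\ \langle\lambda,\Phi(\zeta)\rangle>0\ \ \forall\zeta\in E\setminus\{0\}\}$ is assumed non-empty; $\overline{\Lambda_+}$ is its closure. Set $\rho(\zeta,z)=\operatorname{Im}z-\Phi(\zeta)\in F$ for $(\zeta,z)\in E\times F_{\mathbb C}$. $\mathcal N=E\times F$ is the Lie group with product $(\zeta,x)(\zeta',x')=(\zeta+\zeta',x+x'+2\operatorname{Im}\Phi(\zeta,\zeta'))$, and $E\times F_{\mathbb C}$ is the Lie group with product $(\zeta,z)(\zeta',z')=(\zeta+\zeta',z+z'+2i\Phi(\zeta',\zeta))$. For a function $f$ on $E\times F_{\mathbb C}$ and $h\in F$, $f_h(\zeta,x)=f(\zeta,x+i\Phi(\zeta)+ih)$ for $(\zeta,x)\in\mathcal N$. $L^p(\mathcal N)$ and $L^p(E\times F_{\mathbb C})$ are taken with respect to Lebesgue (= Haar) measure. Bernstein spaces. For $K\subseteq F'$ compact, $H_K(h)=\sup_{\lambda\in -K}\langle\lambda,h\rangle\in[-\infty,\infty)$, $h\in F$. A $C^1$ function on $\mathcal N$ is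 CR if it is annihilated by $\overline{Z_v}$ for all $v\in E$, where $Z_v$ is the left-invariant vector field on $\mathcal N$ equal at the origin to the Wirtinger derivative $\frac12(\partial_v-i\partial_{iv})$. $\mathcal O_K(\mathcal N)$ is the space of $C^\infty$ CR functions on $\mathcal N$ growing at most polynomially together with every left-invariant derivative, such that the Fourier transform on $F$ (with kernel $e^{-i\langle\lambda,x\rangle}$) of $f(\zeta,\cdot)$ is supported in $K$ for every $\zeta\in E$. $\operatorname{Hol}_K(E\times F_{\mathbb C})$ is the set of holomorphic $f$ on $E\times F_{\mathbb C}$ such that $|f(\zeta,z)|\leq C(1+|\zeta|+|z|)^Ne^{H_K(\rho(\zeta,z))}$ for some $N,C>0$ and $f_0\in\mathcal O_K(\mathcal N)$. For $p\in(0,\infty]$, $\mathcal B^p_K(\mathcal N)=\{f\in\operatorname{Hol}_K(E\times F_{\mathbb C}): f_0\in L^p(\mathcal N)\}$ with (quasi-)norm $\|f\|_{\mathcal B^p_K(\mathcal N)}=\|f_0\|_{L^p(\mathcal N)}$. Distances. Set $\theta=\frac12$ if $n>0$, $\theta=1$ if $n=0$. $d_{\mathcal N}$ is a fixed left-invariant distance on $\mathcal N$ which is $\theta$-homogeneous: $d_{\mathcal N}(t\cdot a,t\cdot b)=t^\theta d_{\mathcal N}(a,b)$ with $t\cdot(\zeta,x)=(t^{1/2}\zeta,tx)$, $t>0$; $B_{\mathcal N}(\cdot,R)$ denotes open $d_{\mathcal N}$-balls. $E\times F_{\mathbb C}$ is endowed with $d((\zeta,z),(\zeta',z'))=\max\big(d_{\mathcal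 N}((\zeta,\operatorname{Re}z),(\zeta',\operatorname{Re}z')),|\rho(\zeta,z)-\rho(\zeta',z')|\big)$; $B(\cdot,R)$ and $\overline B(\cdot,R)$ denote open and closed $d$-balls. Measures. $\mathcal M_+(E\times F_{\mathbb C})$ is the set of positive Radon measures on $E\times F_{\mathbb C}$, and $M_R(\mu)(\zeta,z)=\mu(\overline B((\zeta,z),R))$. $\mu$ is $p$-sampling for $\mathcal B^p_K(\mathcal N)$ if $\mathcal B^p_K(\mathcal N)\subseteq L^p(\mu)$ continuously and the canonical mapping $\mathcal B^p_K(\mathcal N)\to L^p(\mu)$ is an isomorphism onto its image; it is strongly $p$-sampling if moreover $\mathcal B^p_K(\mathcal N)=\{f\in\operatorname{Hol}_K(E\times F_{\mathbb C}): f\in L^p(\mu)\}$.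
   Formalization: The spaces E and F are assumed not to be both zero; when E = F = 0 the set 𝒩∖B((0,0),R') is empty, so μ = 0 with K = {0} meets every hypothesis but is not sampling. *)

(* Defs.v *)
From HB Require Import structures.
From mathcomp Require Import all_boot all_order all_algebra.
From mathcomp Require Import complex.
From mathcomp Require Import all_classical all_reals all_analysis.
From mathcomp Require Import measurable_realfun ess_sup_inf.

Set Implicit Arguments.
Unset Strict Implicit.
Unset Printing Implicit Defensive.

Import Order.TTheory GRing.Theory Num.Theory.
Import numFieldNormedType.Exports.

Local Open Scope classical_set_scope.
Local Open Scope ring_scope.
Local Open Scope complex_scope.

Notation Re := complex.Re.
Notation Im := complex.Im.
(* The R-valued modulus; the norm `|z| of R[i] is R[i]-valued. *)
Notation normc := ComplexField.Normc.normc.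

(* The library equips R[i]^o, but not R[i], with its topology and norm. *)
HB.instance Definition _ (R : rcfType) := NormedModule.copy R[i] R[i]^o.

(* The finite-dimensional Hilbert spaces are given by coordinates in an
   orthonormal basis: E = C^n, F = R^m, F_C = C^m, and F' = R^m in the dual
   basis. *)
Notation Espace R n := 'rV[R[i]]_n.
Notation Fspace R m := 'rV[R]_m.
Notation FCspace R m := 'rV[R[i]]_m.
Notation Ngroup R n m := (Espace R n * Fspace R m)%type.
Notation EFC R n m := (Espace R n * FCspace R m)%type.

Notation Borel T := (g_sigma_algebraType (@open T)).
Notation Rtuple R k := (k.-tuple (measurableTypeR R)).

Section coordinates.
Variable R : realType.

Definition ReV k (z : 'rV[R[i]]_k) : 'rV[R]_k := map_mx (@Re R) z.
Definition ImV k (z : 'rV[R[i]]_k) : 'rV[R]_k := map_mx (@Im R) z.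
Definition complexV k (x y : 'rV[R]_k) : 'rV[R[i]]_k :=
  \row_j (x ord0 j +i* y ord0 j).

(* Hilbert norms; the library norm on row vectors is the max norm. *)
Definition normR k (x : 'rV[R]_k) : R := Num.sqrt (\sum_j x ord0 j ^+ 2).
Definition normC k (z : 'rV[R[i]]_k) : R :=
  Num.sqrt (\sum_j normc (z ord0 j) ^+ 2).

Definition pairing k (l x : 'rV[R]_k) : R := \sum_j l ord0 j * x ord0 j.

End coordinates.

Section lebesgue.
Variable R : realType.
Local Open Scope ereal_scope.

Section step.
Variables (k : nat) (mu : {sigma_finite_measure set (Rtuple R k) -> \bar R}).

Definition consR (x : measurableTypeR R * Rtuple R k) : Rtuple R k.+1 :=
  [tuple of x.1 :: x.2].

Definition unconsR (t : Rtuple R k.+1) : measurableTypeR R * Rtuple R k :=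
  (thead t, [tuple of behead t]).

Lemma measurable_consR : measurable_fun [set: _] consR.
Proof. exact: measurable_cons. Qed.

Lemma measurable_unconsR : measurable_fun [set: _] unconsR.
Proof.
apply/measurable_fun_pairP; split; first exact: measurable_tnth.
exact: measurable_behead.
Qed.

Lemma consRK : cancel consR unconsR.
Proof.
move=> [x t]; rewrite /unconsR /consR /= theadE; congr pair.
exact: val_inj.
Qed.

Lemma unconsRK : cancel unconsR consR.
Proof. by move=> t; rewrite /consR /=; apply/esym; exact: tuple_eta. Qed.

Definition leb_step : set (Rtuple R k.+1) -> \bar R :=
  pushforward (@lebesgue_measure R \x mu) consR.

Let mcons A : measurable A -> measurable (consR @^-1` A).
Proof. by move=> mA; rewrite -[X in measurable X]setTI; exact: measurable_consR. Qed.

Let leb_step0 : leb_step set0 = 0.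
Proof. by rewrite /leb_step /pushforward preimage_set0 measure0. Qed.

Let leb_step_ge0 A : 0 <= leb_step A.
Proof. exact: (measure_ge0 (@lebesgue_measure R \x mu)). Qed.

Let leb_step_sigma_additive : semi_sigma_additive leb_step.
Proof.
move=> F mF tF mUF; rewrite /leb_step /pushforward preimage_bigcup.
apply: measure_semi_sigma_additive.
- by move=> i; exact: mcons.
- apply/trivIsetP => /= i j _ _ ij; rewrite -preimage_setI.
  by move/trivIsetP : tF => /(_ _ _ _ _ ij) ->//; rewrite preimage_set0.
- by rewrite -preimage_bigcup; exact: mcons.
Qed.

HB.instance Definition _ := isMeasure.Build _ _ _ leb_step
  leb_step0 leb_step_ge0 leb_step_sigma_additive.

Let leb_step_sigma_finite : sigma_finite setT leb_step.
Proof.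
have /sigma_finiteP[F [TF ndF Foo]] := sigma_finiteT (@lebesgue_measure R).
have /sigma_finiteP[G [TG ndG Goo]] := sigma_finiteT mu.
exists (fun i => unconsR @^-1` (F i `*` G i)).
  apply/esym; rewrite -preimage_bigcup -subTset => t _.
  have [i _ Fi] : (\bigcup_i F i) (unconsR t).1 by rewrite -TF.
  have [j _ Gj] : (\bigcup_i G i) (unconsR t).2 by rewrite -TG.
  exists (maxn i j) => //; split.
    by move: Fi; exact/subsetPset/ndF/leq_maxl.
  by move: Gj; exact/subsetPset/ndG/leq_maxr.
move=> i; have [mFi Fioo] := Foo i; have [mGi Gioo] := Goo i.
have mFG : measurable (F i `*` G i) by exact: measurableX.
split; first by rewrite -[X in measurable X]setTI; exact: measurable_unconsR.
rewrite /leb_step /pushforward -comp_preimage.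
rewrite (_ : unconsR \o consR = id); last by apply/funext => x; exact: consRK.
by rewrite preimage_id product_measure1E// lte_mul_pinfty// ge0_fin_numE.
Qed.

HB.instance Definition _ := Measure_isSigmaFinite.Build _ _ _ leb_step
  leb_step_sigma_finite.

End step.

Fixpoint leb (k : nat) : {sigma_finite_measure set (Rtuple R k) -> \bar R} :=
  match k with
  | 0 => @dirac _ (Rtuple R 0) [tuple] R
  | k'.+1 => leb_step (leb k')
  end.

End lebesgue.

Section complex_functions.
Variable R : realType.

Definition pointR k (t : Rtuple R k) : 'rV[R]_k := \row_j tnth t j.

Definition integralC k (g : Rtuple R k -> R[i]) : R[i] :=
  (\int[leb R k]_(t in setT) Re (g t)) +i* (\int[leb R k]_(t in setT) Im (g t)).

(* A vector field on V is given through curves: [line a v t] is a curve through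
   a at t = 0, and the field indexed by v differentiates along it at t = 0. *)
Section derivatives.
Variables (V : topologicalType) (line : V -> V -> R -> V).
Implicit Types (v a : V) (g : V -> R[i]).

Definition line_derivable v g a : Prop :=
  derivable (fun t => Re (g (line a v t))) 0 1 /\
  derivable (fun t => Im (g (line a v t))) 0 1.

Definition line_deriv v g : V -> R[i] := fun a =>
  derive1 (fun t => Re (g (line a v t))) 0 +i*
  derive1 (fun t => Im (g (line a v t))) 0.

Definition iter_deriv (s : seq V) g : V -> R[i] := foldr line_deriv g s.

Definition smooth g : Prop := forall s : seq V,
  continuous (iter_deriv s g) /\
  forall v a, line_derivable v (iter_deriv s g) a.

End derivatives.

Definition lineF m (x v : Fspace R m) (t : R) : Fspace R m := x + t *: v.

Definition scaleN n m (t : R) (a : Ngroup R n m) : Ngroup R n m :=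
  (t%:C *: a.1, t *: a.2).

Definition lineN n m (a v : Ngroup R n m) (t : R) : Ngroup R n m :=
  a + scaleN t v.

Definition fourierF m (phi : Fspace R m -> R[i]) (x : Fspace R m) : R[i] :=
  integralC (fun t : Rtuple R m => let l := pointR t in
    phi l * (cos (pairing l x) -i* sin (pairing l x))).

Definition test_function_off m (K : set (Fspace R m))
    (phi : Fspace R m -> R[i]) : Prop :=
  [/\ smooth (@lineF m) phi,
      compact (closure [set l | phi l != 0]) &
      closure [set l | phi l != 0] `&` K = set0].

(* The Fourier transform of u, as a tempered distribution, is supported in K. *)
Definition spectrum_in m (K : set (Fspace R m)) (u : Fspace R m -> R[i]) :=
  forall phi, test_function_off K phi ->
    integralC (fun t : Rtuple R m => u (pointR t) * fourierF phi (pointR t)) = 0.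

End complex_functions.

Section group.
Variables (R : realType) (n m : nat).
Variable Phi : Espace R n -> Espace R n -> FCspace R m.

Definition hermitian_map : Prop :=
  (forall zeta', linear (Phi^~ zeta')) /\
  (forall zeta zeta', Phi zeta' zeta = map_mx conjc (Phi zeta zeta')).

(* Phi zeta zeta has zero imaginary part when Phi is hermitian. *)
Definition quad (zeta : Espace R n) : Fspace R m := ReV (Phi zeta zeta).

Definition Lambda_plus : set (Fspace R m) :=
  [set l | forall zeta, zeta != 0 -> 0 < pairing l (quad zeta)].

Definition rho (q : EFC R n m) : Fspace R m := ImV q.2 - quad q.1.

Definition mulN (a b : Ngroup R n m) : Ngroup R n m :=
  (a.1 + b.1, a.2 + b.2 + 2 *: ImV (Phi a.1 b.1)).

(* [slice f h] is f_h. *)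
Definition slice (f : EFC R n m -> R[i]) (h : Fspace R m) : Ngroup R n m -> R[i] :=
  fun a => f (a.1, complexV a.2 (quad a.1 + h)).

(* The left-invariant vector field equal to the derivative along v at the
   origin: t |-> (t v) is a one-parameter subgroup of N. *)
Definition leftN (a v : Ngroup R n m) (t : R) : Ngroup R n m :=
  mulN a (scaleN t v).

Definition Zbar (v : Espace R n) (g : Ngroup R n m -> R[i]) :
    Ngroup R n m -> R[i] := fun a =>
  2^-1 * (line_deriv leftN (v, 0) g a +
          (0 +i* 1) * line_deriv leftN ((0 +i* 1) *: v, 0) g a).

Definition CR (g : Ngroup R n m -> R[i]) : Prop := forall v a, Zbar v g a = 0.

(* The left-invariant differential operators are spanned by the iterates
   [iter_deriv leftN s]. *)
Definition slow_growth (g : Ngroup R n m -> R[i]) : Prop :=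
  forall s : seq (Ngroup R n m), exists N C : R, forall a,
    normc (iter_deriv leftN s g a) <= C * (1 + normC a.1 + normR a.2) `^ N.

Variable K : set (Fspace R m).

Definition calOK (g : Ngroup R n m -> R[i]) : Prop :=
  [/\ smooth (@lineN R n m) g, CR g, slow_growth g &
      forall zeta, spectrum_in K (fun x => g (zeta, x))].

Definition Hsupp (h : Fspace R m) : \bar R :=
  ereal_sup [set (pairing (- l) h)%:E | l in K].

Definition HolK (f : EFC R n m -> R[i]) : Prop :=
  [/\ forall q, differentiable f q,
      exists N C : R, [/\ 0 < N, 0 < C & forall q,
        ((normc (f q))%:E <=
         (C * (1 + normC q.1 + normC q.2) `^ N)%:E * expeR (Hsupp (rho q)))%E] &
      calOK (slice f 0)].

End group.

Section Lp.
Variables (R : realType) (d : measure_display) (T : measurableType d).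
Variable mu : {measure set T -> \bar R}.

Definition LpnormC (p : \bar R) (g : T -> R[i]) : \bar R :=
  Lnorm mu p (fun x => (normc (g x))%:E).

Definition LpC (p : \bar R) (g : T -> R[i]) : Prop :=
  [/\ measurable_fun setT (fun x => Re (g x)),
      measurable_fun setT (fun x => Im (g x)) &
      (LpnormC p g < +oo)%E].

Definition Linfty (g : T -> \bar R) : Prop :=
  measurable_fun setT g /\ (Lnorm mu +oo g < +oo)%E.

End Lp.

Section lebesgue_group.
Variables (R : realType) (n m : nat).
Local Open Scope ereal_scope.

(* Lebesgue measure in the real coordinates (Re zeta, Im zeta, x) of N and
   (Re zeta, Im zeta, Re z, Im z) of E x F_C. *)
Definition lebN := (leb R n \x leb R n) \x leb R m.
HB.instance Definition _ := Measure.on lebN.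
Definition pointN (t : Rtuple R n * Rtuple R n * Rtuple R m) : Ngroup R n m :=
  (complexV (pointR t.1.1) (pointR t.1.2), pointR t.2).

Definition lebEFC := ((leb R n \x leb R n) \x leb R m) \x leb R m.
HB.instance Definition _ := Measure.on lebEFC.
Definition pointEFC (t : Rtuple R n * Rtuple R n * Rtuple R m * Rtuple R m) :
    EFC R n m :=
  (complexV (pointR t.1.1.1) (pointR t.1.1.2),
   complexV (pointR t.1.2) (pointR t.2)).

End lebesgue_group.

Arguments lebN R n m : clear implicits.
Arguments lebEFC R n m : clear implicits.

Section distances.
Variables (R : realType) (n m : nat).
Variable Phi : Espace R n -> Espace R n -> FCspace R m.

Definition dilation (t : R) (a : Ngroup R n m) : Ngroup R n m :=
  ((Num.sqrt t)%:C *: a.1, t *: a.2).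

Definition theta : R := if n == 0%N then 1 else 2^-1.

Definition homogeneous_distance (dN : Ngroup R n m -> Ngroup R n m -> R) :=
  [/\ [/\ forall a b, 0 <= dN a b,
          forall a b, dN a b = 0 <-> a = b,
          forall a b, dN a b = dN b a &
          forall a b c, dN a c <= dN a b + dN b c],
      forall c a b, dN (mulN Phi c a) (mulN Phi c b) = dN a b &
      forall t a b, 0 < t ->
        dN (dilation t a) (dilation t b) = t `^ theta * dN a b].

Variable dN : Ngroup R n m -> Ngroup R n m -> R.

Definition ballN (a : Ngroup R n m) (r : R) : set (Ngroup R n m) :=
  [set b | dN a b < r].

Definition dEFC (q q' : EFC R n m) : R :=
  Num.max (dN (q.1, ReV q.2) (q'.1, ReV q'.2))
          (normR (rho Phi q - rho Phi q')).

Definition ballEFC (q : EFC R n m) (r : R) : set (EFC R n m) :=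
  [set q' | dEFC q q' < r].

Definition closed_ballEFC (q : EFC R n m) (r : R) : set (EFC R n m) :=
  [set q' | dEFC q q' <= r].

End distances.

Section radon.
Variables (R : realType) (n m : nat).
Local Notation T := (EFC R n m).
Variable mu : {measure set (Borel T) -> \bar R}.

Definition radon : Prop :=
  (forall A : set T, compact A -> (mu A < +oo)%E) /\
  (forall A : set (Borel T), measurable A ->
     mu A = ereal_sup [set mu B | B in [set B : set T | compact B /\ B `<=` A]]).

Definition msupport : set T :=
  [set x | forall U : set T, open U -> U x -> (0 < mu U)%E].

End radon.

Section sampling.
Variables (R : realType) (n m : nat).
Variable Phi : Espace R n -> Espace R n -> FCspace R m.

Section ball_mass.
Variable dN : Ngroup R n m -> Ngroup R n m -> R.
Variable mu : {measure set (Borel (EFC R n m)) -> \bar R}.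

Definition ball_mass (r : R) (q : EFC R n m) : \bar R :=
  mu (closed_ballEFC Phi dN q r).

Definition Gset (eps r : R) : set (EFC R n m) :=
  [set q | (eps%:E <= ball_mass r q)%E].

End ball_mass.

Variables (p : \bar R) (K : set (Fspace R m)).

Definition bernstein_norm (f : EFC R n m -> R[i]) : \bar R :=
  LpnormC (lebN R n m) p (slice Phi f 0 \o @pointN R n m).

Definition bernstein (f : EFC R n m -> R[i]) : Prop :=
  HolK Phi K f /\ LpC (lebN R n m) p (slice Phi f 0 \o @pointN R n m).

Variable mu : {measure set (Borel (EFC R n m)) -> \bar R}.

Definition sampling : Prop :=
  [/\ forall f, bernstein f -> LpC mu p f,
      exists2 c : R, 0 < c & forall f, bernstein f ->
        (LpnormC mu p f <= c%:E * bernstein_norm f)%E &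
      exists2 c : R, 0 < c & forall f, bernstein f ->
        (bernstein_norm f <= c%:E * LpnormC mu p f)%E].

Definition strongly_sampling : Prop :=
  sampling /\ forall f, bernstein f <-> HolK Phi K f /\ LpC mu p f.

End sampling.

(* Main.v *)
Require Import Defs.
From HB Require Import structures.
From mathcomp Require Import all_boot all_order all_algebra.
From mathcomp Require Import complex.
From mathcomp Require Import all_classical all_reals all_analysis.
From mathcomp Require Import measurable_realfun ess_sup_inf.
From mathcomp Require Import ring lra.

(** The theorem compares two norms on Hol_K: the L^p norm on the boundary
    N = {rho = 0} with respect to Lebesgue measure, and the L^p norm with respect to
    mu. The only property of f in Hol_K that enters is that f is holomorphic on
    complex lines and bounded by a polynomial times exp (A |rho|), where A depends on
    the compact set K only (expclass, HolK_expclass). This class is invariant under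
    the left translations by N.

    Pointwise estimates. On the complex line through q in the direction rho(q) the
    boundary is the real axis, so Phragmen-Lindelof extends bounds from the boundary
    (strip_bound), and a two-constants estimate shows that a neighbourhood of the
    zeros of a linear form u0 can be left out when taking the supremum over the
    boundary (sup_removal). Schwarz's lemma on complex lines controls the
    oscillation of f by its supremum; hence a function stays large near a point where
    it is large, and the supremum is bounded by an L^p norm (sup_le_Lp), for every
    p > 0. To apply this to functions of polynomial growth one multiplies them by
    chi_d, a product of functions (exp v - 1) / v at multiples of linear forms. As
    Lambda_+ is open and not empty, there are enough linear forms that are
    nonnegative on the values of Phi (frame_exists): on the boundary chi_d is at most
    1 and decays, its type is small, and it tends to 1 as d tends to 0. The outcome is
    that |f(q)|^p, for q near a boundary point a, is bounded by the average V(a) of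
    |f|^p around a with respect to an integrable weight (weighted_estimate,
    tau_le_Vp).

    Upper bound. The measure mu lives on a strip |rho| <= H and unit balls have
    bounded mass almost everywhere, so the pointwise estimate can be integrated
    with respect to mu (carleson).

    Lower bound. The condition on nu puts into the ball of radius r around each
    boundary point outside B(0, r') the centre of a ball of radius r and mass at
    least eps; the ball of radius 2 r around the boundary point is then heavy
    (heavy_ball). If q lies in this ball, then |f(a)|^p <= C1 r^p V(a) + 2^p |f(q)|^p
    (sampling_point). Integration over the ball with respect to mu and over a gives

      int_(outside B(0, r')) |f|^p <= C1 I r^p int_N |f|^p + C3 int |f|^p dmu

    (sampling_integrated), and r is chosen such that C1 I r^p <= 1/4. This choice
    depends on the type and on p only. What is missing is the integral over
    B(0, r'), where nothing is sampled, and it has to be recovered without changing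
    r. For this f is multiplied by a power of a function gL of small type that
    vanishes with u0: on B(0, r') it is small in comparison with its values where u0
    is large, so that for the product the ball contributes less than its
    complement (zero_removal), and the first term on the right can be absorbed. Then
    one divides by gL where u0 is large, and the integral over the remaining points
    is bounded by the integral over the points where u0 is large (tail_estimate).
    The absorption needs finite integrals, which is achieved with chi_d once more
    (unregularize). *)

Import Order.TTheory GRing.Theory Num.Theory.
Import numFieldNormedType.Exports.

Set Implicit Arguments.
Unset Strict Implicit.
Unset Printing Implicit Defensive.

Local Open Scope classical_set_scope.
Local Open Scope ring_scope.
Local Open Scope complex_scope.

Local Notation Re := complex.Re.
Local Notation Im := complex.Im.
Local Notation normc := ComplexField.Normc.normc.

Local Notation ReV := Defs.ReV.
Local Notation ImV := Defs.ImV.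

(** * Integrals of continuous functions over segments *)

Section interval_integral.
Context {R : realType}.
Implicit Types (f g : R -> R) (a b c : R).

Definition segint f a b : R := (\int[@lebesgue_measure R]_(x in `[a, b]) f x)%R.

Lemma segint_integrable f a b : continuous f ->
  (@lebesgue_measure R).-integrable `[a, b] (EFin \o f).
Proof.
move=> cf; apply: continuous_compact_integrable; first exact: segment_compact.
exact: continuous_subspaceT.
Qed.

Lemma segintB f g a b : continuous f -> continuous g ->
  segint (fun x => f x - g x) a b = segint f a b - segint g a b.
Proof. by move=> cf cg; rewrite /segint RintegralB//; exact: segint_integrable. Qed.

Lemma segint_cst k a b : a <= b -> segint (fun=> k) a b = k * (b - a).
Proof.
move=> ab; rewrite /segint Rintegral_cst//= lebesgue_measure_itv/= lte_fin.
case: ltP => [//|ba]; have -> : a = b by apply/eqP; rewrite eq_le ab.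
by rewrite subrr mulr0.
Qed.

Lemma segint_split f a c b : continuous f -> a <= c -> c <= b ->
  segint f a b = segint f a c + segint f c b.
Proof.
move=> cf ac cb; apply/eqP; rewrite addrC -subr_eq; apply/eqP.
rewrite /segint Rintegral_itvB//; last exact: segint_integrable.
rewrite Rintegral_itv_obnd_cbnd//.
by apply: integrableS (segint_integrable c b cf) => //; exact: subset_itv_oc_cc.
Qed.

Lemma segint_le f g a b : continuous f -> continuous g ->
  (forall x, a <= x <= b -> f x <= g x) -> segint f a b <= segint g a b.
Proof.
move=> cf cg fg; apply: le_Rintegral => //.
- exact: segint_integrable.
- exact: segint_integrable.

Qed.

Lemma segint_eq f g a b : (forall x, a <= x <= b -> f x = g x) ->
  segint f a b = segint g a b.
Proof.
move=> fg; apply: eq_Rintegral => x; rewrite inE/= in_itv/=; exact: fg.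
Qed.

Lemma segint_bound f a b M : continuous f -> a <= b ->
  (forall x, a <= x <= b -> `|f x| <= M) -> `|segint f a b| <= M * (b - a).
Proof.
move=> cf ab fM; rewrite ler_norml; apply/andP; split.
  rewrite -mulNr -segint_cst//; apply: segint_le => //; first exact: cst_continuous.
  by move=> x /fM; rewrite ler_norml => /andP[].
rewrite -segint_cst//; apply: segint_le => //; first exact: cst_continuous.
by move=> x /fM; rewrite ler_norml => /andP[].
Qed.

Lemma segint_affine k l a b : a < b ->
  segint (fun x => k + l * x) a b = k * (b - a) + l * (b * b - a * a) / 2.
Proof.
move=> ab.
have dF x : is_derive x (1 : R) (fun x => k * x + l / 2 * (x * x)) (k + l * x).
  have h1 : is_derive x (1 : R) (fun x : R => x) 1 by exact: is_derive_id.
  have h2 := is_deriveD (is_deriveZ k h1) (is_deriveZ (l / 2) (is_deriveM h1 h1)).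
  by apply: (is_derive_eq h2); rewrite /GRing.scale/= !mulr1; field.
have cF : continuous (fun x : R => k * x + l / 2 * (x * x)).
  by move=> x; apply/differentiable_continuous/derivable1_diffP; have [] := dF x.
have ca : continuous (fun x : R => k + l * x).
  by move=> x; apply: cvgD; [exact: cvg_cst|apply: cvgM; [exact: cvg_cst|exact: cvg_id]].
rewrite /segint /Rintegral (@continuous_FTC2 _ _ (fun x => k * x + l / 2 * (x * x)))//=.
- by field.
- exact: continuous_subspaceT.
- split.
  + by move=> x _; have [] := dF x.
  + by apply: cvg_at_right_filter; exact: cF.
  + by apply: cvg_at_left_filter; exact: cF.
- by move=> x _; rewrite derive1E; have [] := dF x.
Qed.

End interval_integral.

(** * u and v are the left ends and the lengths of the nested intervals; the
    supremum of the left ends lies in all of them. *)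

(** u and v are the left ends and the lengths of the nested intervals; the
    supremum of the left ends lies in all of them. *)
Lemma nested_halving {R : realType} (u v : nat -> R) :
  (forall k, 0 < v k) -> (forall k, v k = v k.+1 + v k.+1) ->
  (forall k, u k <= u k.+1 <= u k + v k.+1) ->
  exists z, forall k, u k <= z <= u k + v k.
Proof.
move=> v0 vS uS.
have dec k : u k.+1 + v k.+1 <= u k + v k by have := vS k; have := uS k; lra.
have up j k : u k <= u (j + k)%N /\ u (j + k)%N + v (j + k)%N <= u k + v k.
  elim: j => [|j [IH1 IH2]]; first by rewrite add0n.
  rewrite addSn; split; first by have := uS (j + k)%N; lra.
  by have := dec (j + k)%N; lra.
have ub k j : u j <= u k + v k.
  have [jk|kj] := leqP j k.
    have [+ _] := up (k - j)%N j; rewrite subnK// => /le_trans; apply.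
    by rewrite lerDl ltW.
  have [_ +] := up (j - k)%N k; rewrite subnK ?(ltnW kj)// => h1.
  by have := v0 j; lra.
exists (sup (range u)) => k; apply/andP; split.
  apply: ub_le_sup; last by exists k.
  by exists (u 0%N + v 0%N) => _ [j _ <-]; exact: ub.
by apply: ge_sup; [exists (u 0%N); exists 0%N|move=> _ [j _ <-]; exact: ub].
Qed.

Section goursat.
Context {R : realType}.
Variables P Q : R -> R -> R.
Implicit Types a b c d : R.

Definition rectint a b c d : R :=
  segint (P^~ c) a b + segint (Q b) c d - segint (P^~ d) a b - segint (Q a) c d.

Lemma rectint_hsplit a b c d u :
  (forall x, a <= x <= b -> continuous (Q x)) ->
  (forall y, c <= y <= d -> continuous (P^~ y)) ->
  c <= d -> a <= u -> u <= b ->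
  rectint a b c d = rectint a u c d + rectint u b c d.
Proof.
move=> cQ cP cd au ub; rewrite /rectint.
rewrite (@segint_split _ (P^~ c) a u b)//; last by apply: cP; rewrite lexx.
rewrite (@segint_split _ (P^~ d) a u b)//; last by apply: cP; rewrite lexx andbT.
by ring.
Qed.

Lemma rectint_vsplit a b c d u :
  (forall x, a <= x <= b -> continuous (Q x)) ->
  (forall y, c <= y <= d -> continuous (P^~ y)) ->
  a <= b -> c <= u -> u <= d ->
  rectint a b c d = rectint a b c u + rectint a b u d.
Proof.
move=> cQ cP ab cu ud; rewrite /rectint.
rewrite (@segint_split _ (Q a) c u d)//; last by apply: cQ; rewrite lexx.
rewrite (@segint_split _ (Q b) c u d)//; last by apply: cQ; rewrite lexx andbT.
by ring.
Qed.

(** The contributions of inner sides cancel, so the largest quarter carries at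
    least a quarter of the integral. *)
Lemma rectint_quarter a b c d u v :
  (forall x, a <= x <= b -> continuous (Q x)) ->
  (forall y, c <= y <= d -> continuous (P^~ y)) ->
  a <= u -> u <= b -> c <= v -> v <= d ->
  rectint a b c d = rectint a u c v + rectint u b c v +
    (rectint a u v d + rectint u b v d).
Proof.
move=> cQ cP au ub cv vd.
rewrite (@rectint_vsplit a b c d v)//; last exact: le_trans ub.
rewrite (@rectint_hsplit a b c v u)//; last first.
  by move=> y yI; apply: cP; lra.
rewrite (@rectint_hsplit a b v d u)//.
by move=> y yI; apply: cP; lra.
Qed.

(** The integral of a closed affine form along the boundary vanishes, so only
    the deviation from the affine part counts. *)
Lemma rectint_near_affine a b c d x0 y0 p0 p1 q0 q1 r e :
  a < b -> c < d ->
  (forall x, a <= x <= b -> continuous (Q x)) ->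
  (forall y, c <= y <= d -> continuous (P^~ y)) ->
  (forall x y, a <= x <= b -> c <= y <= d ->
    `|P x y - (p0 + p1 * (x - x0) + r * (y - y0))| <= e /\
    `|Q x y - (q0 + r * (x - x0) + q1 * (y - y0))| <= e) ->
  `|rectint a b c d| <= 2 * e * ((b - a) + (d - c)).
Proof.
move=> ab cd cQ cP H.
have caff (k l : R) : continuous (fun x : R => k + l * x).
  by move=> x; apply: cvgD; [exact: cvg_cst|apply: cvgM; [exact: cvg_cst|exact: cvg_id]].
have bP y : c <= y <= d ->
    `|segint (P^~ y) a b - ((p0 + r * (y - y0) - p1 * x0) * (b - a) + p1 * (b * b - a * a) / 2)|
    <= e * (b - a).
  move=> yI; rewrite -segint_affine// -segintB//; last exact: cP.
  apply: segint_bound; [by move=> x; apply: cvgB; [exact: (cP _ yI)|exact: caff]|exact: ltW|].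
  move=> x xI; have [+ _] := H x y xI yI.
  by rewrite (_ : p0 + p1 * (x - x0) + r * (y - y0) = p0 + r * (y - y0) - p1 * x0 + p1 * x)//; ring.
have bQ x : a <= x <= b ->
    `|segint (Q x) c d - ((q0 + r * (x - x0) - q1 * y0) * (d - c) + q1 * (d * d - c * c) / 2)|
    <= e * (d - c).
  move=> xI; rewrite -segint_affine// -segintB//; last exact: cQ.
  apply: segint_bound; [by move=> y; apply: cvgB; [exact: (cQ _ xI)|exact: caff]|exact: ltW|].
  move=> y yI; have [_ +] := H x y xI yI.
  by rewrite (_ : q0 + r * (x - x0) + q1 * (y - y0) = q0 + r * (x - x0) - q1 * y0 + q1 * y)//; ring.
have aI : a <= a <= b by rewrite lexx ltW.
have bI : a <= b <= b by rewrite lexx ltW.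
have cI : c <= c <= d by rewrite lexx ltW.
have dI : c <= d <= d by rewrite lexx ltW.
move: (bP _ cI) (bP _ dI) (bQ _ aI) (bQ _ bI); rewrite /rectint !ler_norml.
move: (segint _ _ _) (segint _ _ _) (segint _ _ _) (segint _ _ _) => s1 s2 s3 s4.
by move=> /andP[u1 u2] /andP[v1 v2] /andP[w1 w2] /andP[z1 z2]; apply/andP; split; nra.
Qed.

(** P dx + Q dy is differentiable at (x0, y0) within the rectangle and closed
    there: r is the common value of dP/dy and dQ/dx. *)
Definition closed_at a b c d x0 y0 := exists p1 r q1 : R,
  forall e : R, 0 < e -> exists2 dl : R, 0 < dl & forall x y, a <= x <= b -> c <= y <= d ->
    `|x - x0| <= dl -> `|y - y0| <= dl ->
    `|P x y - (P x0 y0 + p1 * (x - x0) + r * (y - y0))| <= e * (`|x - x0| + `|y - y0|) /\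
    `|Q x y - (Q x0 y0 + r * (x - x0) + q1 * (y - y0))| <= e * (`|x - x0| + `|y - y0|).

(** Goursat's lemma for a real form P dx + Q dy that is differentiable with
    dP/dy = dQ/dx at every point of the rectangle; no continuity of the partial
    derivatives is assumed. *)
Lemma goursat a b c d : a < b -> c < d ->
  (forall x, a <= x <= b -> continuous (Q x)) ->
  (forall y, c <= y <= d -> continuous (P^~ y)) ->
  (forall x y, a <= x <= b -> c <= y <= d -> closed_at a b c d x y) ->
  rectint a b c d = 0.
Proof.
move=> ab cd cQ cP H; apply/eqP; apply: contraT => B0.
pose w k : R := (b - a) / 2 ^+ k; pose h k : R := (d - c) / 2 ^+ k.
have w0 k : 0 < w k by rewrite divr_gt0 ?exprn_gt0// subr_gt0.
have h0 k : 0 < h k by rewrite divr_gt0 ?exprn_gt0// subr_gt0.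
have wS k : w k = w k.+1 + w k.+1 by rewrite /w exprS; field; rewrite lt0r_neq0// exprn_gt0.
have hS k : h k = h k.+1 + h k.+1 by rewrite /h exprS; field; rewrite lt0r_neq0// exprn_gt0.
pose eta := `|rectint a b c d| / (w 0%N * h 0%N).
have eta0 : 0 < eta by rewrite divr_gt0 ?normr_gt0// mulr_gt0.
(* the integral over a quarter is at least eta times its area, at every scale *)
pose Good k (s : R * R) := [/\ a <= s.1, s.1 + w k <= b, c <= s.2, s.2 + h k <= d &
  eta * (w k * h k) <= `|rectint s.1 (s.1 + w k) s.2 (s.2 + h k)|].
have step k s : exists s', Good k s -> [/\ Good k.+1 s',
    s.1 <= s'.1 <= s.1 + w k.+1 & s.2 <= s'.2 <= s.2 + h k.+1].
  have [G|nG] := pselect (Good k s); last by exists s => /nG.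
  case: G => a1 b1 c1 d1 big.
  set x := s.1 in a1 b1 big *; set y := s.2 in c1 d1 big *.
  have w1 := w0 k.+1; have h1 := h0 k.+1; have wk := wS k; have hk := hS k.
  have cQ' u : x <= u <= x + w k -> continuous (Q u).
    by move=> /andP[u1 u2]; apply: cQ; rewrite (le_trans a1 u1) (le_trans u2 b1).
  have cP' u : y <= u <= y + h k -> continuous (P^~ u).
    by move=> /andP[u1 u2]; apply: cP; rewrite (le_trans c1 u1) (le_trans u2 d1).
  have E : rectint x (x + w k) y (y + h k) =
     rectint x (x + w k.+1) y (y + h k.+1) +
     rectint (x + w k.+1) (x + w k.+1 + w k.+1) y (y + h k.+1) +
     (rectint x (x + w k.+1) (y + h k.+1) (y + h k.+1 + h k.+1) +
     rectint (x + w k.+1) (x + w k.+1 + w k.+1) (y + h k.+1) (y + h k.+1 + h k.+1)).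
    have e1 : x + w k = x + w k.+1 + w k.+1 by rewrite wk; ring.
    have e2 : y + h k = y + h k.+1 + h k.+1 by rewrite hk; ring.
    rewrite -e1 -e2; apply: rectint_quarter => //; lra.
  have A : w k * h k = 4 * (w k.+1 * h k.+1) by rewrite wk hk; ring.
  set t := eta * (w k.+1 * h k.+1).
  have big4 : 4 * t <= `|rectint x (x + w k) y (y + h k)|.
    by apply: le_trans big; rewrite A /t; lra.
  have pick x' y' : (x' = x \/ x' = x + w k.+1) -> (y' = y \/ y' = y + h k.+1) ->
     t <= `|rectint x' (x' + w k.+1) y' (y' + h k.+1)| ->
     exists s', Good k s -> [/\ Good k.+1 s',
    x <= s'.1 <= x + w k.+1 & y <= s'.2 <= y + h k.+1].
    move=> hx hy ht; exists (x', y') => _.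
    have [x1 x2] : x <= x' /\ x' <= x + w k.+1 by case: hx => ->; lra.
    have [y1 y2] : y <= y' /\ y' <= y + h k.+1 by case: hy => ->; lra.
    by split => /=; [split => //=; lra|rewrite x1|rewrite y1].
  have [l1|l1] := leP t `|rectint x (x + w k.+1) y (y + h k.+1)|.
    by apply: (pick x y) => //; left.
  have [l2|l2] := leP t `|rectint (x + w k.+1) (x + w k.+1 + w k.+1) y (y + h k.+1)|.
    by apply: (pick (x + w k.+1) y) => //; [right|left].
  have [l3|l3] := leP t `|rectint x (x + w k.+1) (y + h k.+1) (y + h k.+1 + h k.+1)|.
    by apply: (pick x (y + h k.+1)) => //; [left|right].
  apply: (pick (x + w k.+1) (y + h k.+1)); [by right|by right|].
  move: big4; rewrite E; move: l1 l2 l3.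
  move: (rectint _ _ _ _) (rectint _ _ _ _) (rectint _ _ _ _) (rectint _ _ _ _) => r1 r2 r3 r4.
  move=> l1 l2 l3 big4.
  have n1 := ler_normD (r4 + r3) (r2 + r1); have n2 := ler_normD r4 r3; have n3 := ler_normD r2 r1.
  clear -l1 l2 l3 big4 n1 n2 n3; lra.
have [g gP] := choice (fun ks : nat * (R * R) => step ks.1 ks.2).
pose fix s k : R * R := if k is k'.+1 then g (k', s k') else (a, c).
have sG k : Good k (s k).
  elim: k => [|k IH].
    have e1 : a + w 0%N = b by rewrite /w expr0 divr1; ring.
    have e2 : c + h 0%N = d by rewrite /h expr0 divr1; ring.
    rewrite /Good/= e1 e2; split => //.
    by rewrite /eta divfK// mulf_neq0// gt_eqF.
  by have [] := gP (k, s k) IH.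
have sx k : (s k).1 <= (s k.+1).1 <= (s k).1 + w k.+1 by have [] := gP (k, s k) (sG k).
have sy k : (s k).2 <= (s k.+1).2 <= (s k).2 + h k.+1 by have [] := gP (k, s k) (sG k).
have [x0 x0P] := nested_halving (u := fun k => (s k).1) w0 wS sx.
have [y0 y0P] := nested_halving (u := fun k => (s k).2) h0 hS sy.
have x0I : a <= x0 <= b by have := x0P 0%N; have [] := sG 0%N; rewrite /=; lra.
have y0I : c <= y0 <= d by have := y0P 0%N; have [] := sG 0%N; rewrite /=; lra.
have [p1 [r [q1 Hd]]] := H _ _ x0I y0I.
pose S := w 0%N + h 0%N.
have S0 : 0 < S by rewrite addr_gt0.
(* small enough that the affine approximation contradicts the choice of eta *)
pose e := eta * (w 0%N * h 0%N) / (4 * (S * S)).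
have e0 : 0 < e.
  by apply: divr_gt0; apply: mulr_gt0 => //; apply: mulr_gt0.
have [dl dl0 Hdl] := Hd e e0.
have [k [wk hk]] : exists k, w k <= dl /\ h k <= dl.
  have [k kP] : exists k : nat, S / dl <= 2 ^+ k.
    exists (Num.truncn (S / dl)).+1; apply: ltW; apply: lt_trans (truncnS_gt _) _.
    by rewrite -natrX ltr_nat ltn_expl.
  have Sk : S <= dl * 2 ^+ k by rewrite mulrC -ler_pdivrMr.
  exists k; rewrite /w /h !ler_pdivrMr ?exprn_gt0//.
  move: Sk (w0 0%N) (h0 0%N); rewrite /S /w /h !expr0 !divr1; lra.
have [ak bk ck dk big] := sG k.
move: (x0P k) (y0P k) => xk yk.
have : `|rectint (s k).1 ((s k).1 + w k) (s k).2 ((s k).2 + h k)| <=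
    2 * (e * (w k + h k)) * (((s k).1 + w k - (s k).1) + ((s k).2 + h k - (s k).2)).
  apply: (@rectint_near_affine _ _ _ _ x0 y0 (P x0 y0) p1 (Q x0 y0) q1 r).
  - by rewrite ltrDl.
  - by rewrite ltrDl.
  - by move=> u uI; apply: cQ; lra.
  - by move=> u uI; apply: cP; lra.
  - move=> x y xI yI.
    have hx : `|x - x0| <= w k by rewrite ler_norml; lra.
    have hy : `|y - y0| <= h k by rewrite ler_norml; lra.
    have [||||h1 h2] := Hdl x y; [lra|lra|lra|lra|].
    by split; [apply: le_trans h1 _|apply: le_trans h2 _];
      rewrite ler_pM2l// lerD.
move/(le_trans big).
have -> : (s k).1 + w k - (s k).1 + ((s k).2 + h k - (s k).2) = w k + h k by ring.
have e2k : (2 ^+ k : R) != 0 by rewrite expf_neq0.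
have -> : w k = w 0%N / 2 ^+ k by rewrite /w expr0 divr1.
have -> : h k = h 0%N / 2 ^+ k by rewrite /h expr0 divr1.
have -> : w 0%N / 2 ^+ k + h 0%N / 2 ^+ k = S / 2 ^+ k by rewrite /S mulrDl.
have -> : 2 * (e * (S / 2 ^+ k)) * (S / 2 ^+ k) =
  2^-1 * (eta * (w 0%N / 2 ^+ k * (h 0%N / 2 ^+ k))).
  by rewrite /e; field; rewrite e2k gt_eqF.
suff : 0 < eta * (w 0%N / 2 ^+ k * (h 0%N / 2 ^+ k)) by lra.
by have p2 : (0 : R) < 2 ^+ k by [exact: exprn_gt0]; apply: mulr_gt0 => //; apply: mulr_gt0; apply: divr_gt0.
Qed.

End goursat.

(** * Complex numbers: modulus, continuity, differentiability *)

Section complex_norm.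
Context {R : realType}.
Local Notation C := R[i].
Implicit Types (x y z w : C).

Lemma normc_ge0 z : 0 <= normc z.
Proof. by case: z => a b; exact: sqrtr_ge0. Qed.

Lemma normcM z w : normc (z * w) = normc z * normc w.
Proof. exact: ComplexField.Normc.normcM. Qed.

Lemma normcX z k : normc (z ^+ k) = normc z ^+ k.
Proof.
elim: k => [|k IH]; first by rewrite !expr0 ComplexField.Normc.normc1.
by rewrite !exprS normcM IH.
Qed.

Lemma normcV z : normc z^-1 = (normc z)^-1.
Proof. exact: ComplexField.Normc.normcV. Qed.

Lemma normcB z w : normc (z - w) = normc (w - z).
Proof. by rewrite -normcN opprB. Qed.

Lemma normc_eq0 z : (normc z == 0) = (z == 0).
Proof.
apply/eqP/eqP => [/ComplexField.Normc.eq0_normc//|->].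
exact: ComplexField.Normc.normc0.
Qed.

Lemma normc_gt0 z : (0 < normc z) = (z != 0).
Proof. by rewrite lt_def normc_ge0 andbT normc_eq0. Qed.

Lemma normcR (a : R) : normc a%:C = `|a|.
Proof. by rewrite /= expr0n/= addr0 sqrtr_sqr. Qed.

Lemma normci : normc ('i : C) = 1.
Proof. by rewrite /= expr0n/= add0r expr1n sqrtr1. Qed.

Lemma normc_Re z : `|Re z| <= normc z.
Proof.
case: z => a b /=; rewrite -sqrtr_sqr ler_sqrt ?addr_ge0 ?sqr_ge0//.
by rewrite lerDl sqr_ge0.
Qed.

Lemma normc_Im z : `|Im z| <= normc z.
Proof.
case: z => a b /=; rewrite -sqrtr_sqr ler_sqrt ?addr_ge0 ?sqr_ge0//.
by rewrite lerDr sqr_ge0.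
Qed.

Lemma normc_le z : normc z <= `|Re z| + `|Im z|.
Proof.
case: z => a b /=; rewrite -[leRHS]ger0_norm ?addr_ge0// -sqrtr_sqr.
rewrite ler_sqrt ?sqr_ge0// sqrrD !real_normK ?num_real//.
by rewrite lerD2r lerDl mulrn_wge0// mulr_ge0.
Qed.

Lemma normc_sqr z : normc z ^+ 2 = Re z ^+ 2 + Im z ^+ 2.
Proof. by case: z => a b /=; rewrite sqr_sqrtr// addr_ge0// sqr_ge0. Qed.

Lemma cReM z w : Re (z * w) = Re z * Re w - Im z * Im w.
Proof. by case: z => a b; case: w. Qed.

Lemma cImM z w : Im (z * w) = Re z * Im w + Im z * Re w.
Proof. by case: z => a b; case: w. Qed.

Lemma cReD z w : Re (z + w) = Re z + Re w.
Proof. by case: z => a b; case: w. Qed.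

Lemma cImD z w : Im (z + w) = Im z + Im w.
Proof. by case: z => a b; case: w. Qed.

Lemma cReB z w : Re (z - w) = Re z - Re w.
Proof. by case: z => a b; case: w. Qed.

Lemma cImB z w : Im (z - w) = Im z - Im w.
Proof. by case: z => a b; case: w. Qed.

(** The scalar is conj z / |z|, or 1 when z = 0. *)
Lemma normc_rot z : exists2 c : C, normc c = 1 & Re (c * z) = normc z.
Proof.
have [->|z0] := eqVneq z 0.
  exists 1; first exact: ComplexField.Normc.normc1.
  by rewrite mulr0 ComplexField.Normc.normc0.
have n0 : 0 < normc z by rewrite normc_gt0.
exists ((normc z)^-1%:C * z^*).
  rewrite normcM normcR ger0_norm ?invr_ge0 ?normc_ge0//.
  have -> : normc z^* = normc z by case: (z) => a b /=; rewrite sqrrN.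
  by rewrite mulVf// gt_eqF.
rewrite -mulrA cReM /= mul0r subr0 mulrC cReM.
have -> : Re z^* * Re z - Im z^* * Im z = normc z ^+ 2.
  by rewrite normc_sqr; case: (z) => a b /=; ring.
by rewrite expr2 -mulrA divff ?mulr1// gt_eqF.
Qed.

Lemma ler_normcB z w : normc z - normc w <= normc (z - w).
Proof. by rewrite lerBlDr; apply: le_trans (le_normcD _ _); rewrite subrK. Qed.

End complex_norm.

Section complex_derivative.
Context {R : realType}.
Local Notation C := R[i].
Implicit Types (f g : C -> C) (z w : C).

Definition ccont f z := forall e : R, 0 < e ->
  exists2 d : R, 0 < d & forall w, normc (w - z) < d -> normc (f w - f z) < e.

Lemma ccont_cst c z : ccont (fun=> c) z.
Proof.
move=> e e0; exists 1 => // w _.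
by rewrite subrr ComplexField.Normc.normc0.
Qed.

Lemma ccont_id z : ccont id z.
Proof. by move=> e e0; exists e. Qed.

Lemma ccont_eq f g z : ccont f z -> f =1 g -> ccont g z.
Proof. by move=> cf fg; have -> : g = f by apply/funext => w; rewrite fg. Qed.

Lemma ccontD f g z : ccont f z -> ccont g z -> ccont (fun w => f w + g w) z.
Proof.
move=> cf cg e e0; have e2 : 0 < e / 2 by lra.
have [d1 d10 H1] := cf _ e2; have [d2 d20 H2] := cg _ e2.
exists (Num.min d1 d2); first by rewrite lt_min d10.
move=> w; rewrite lt_min => /andP[/H1 h1 /H2 h2].
have -> : f w + g w - (f z + g z) = (f w - f z) + (g w - g z) by ring.
by apply: le_lt_trans (le_normcD _ _) _; lra.
Qed.

Lemma ccontM f g z : ccont f z -> ccont g z -> ccont (fun w => f w * g w) z.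
Proof.
move=> cf cg e e0.
set a := normc (f z); set b := normc (g z).
have a0 : 0 <= a := normc_ge0 _; have b0 : 0 <= b := normc_ge0 _.
have e1 : 0 < e / (2 * (b + 1)) by rewrite divr_gt0//; lra.
have e2 : 0 < Num.min 1 (e / (2 * (a + 1))).
  by rewrite lt_min ltr01/= divr_gt0//; lra.
have [d1 d10 H1] := cf _ e1; have [d2 d20 H2] := cg _ e2.
exists (Num.min d1 d2); first by rewrite lt_min d10.
move=> w; rewrite lt_min => /andP[/H1 h1 /H2]; rewrite lt_min => /andP[h2 h3].
have -> : f w * g w - f z * g z = (f w - f z) * g w + f z * (g w - g z) by ring.
apply: le_lt_trans (le_normcD _ _) _; rewrite !normcM -/a.
have gw : normc (g w) <= b + 1.
  by have := ler_normcB (g w) (g z); rewrite -/b; lra.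
have t1 : normc (f w - f z) * normc (g w) <= e / 2.
  apply: le_trans (_ : e / (2 * (b + 1)) * (b + 1) <= _).
    by apply: ler_pM => //; [exact: normc_ge0|exact: normc_ge0|exact: ltW].
  by rewrite le_eqVlt; apply/orP; left; apply/eqP; field; lra.
have t2 : a * normc (g w - g z) < e / 2.
  have [->|an0] := eqVneq a 0; first by rewrite mul0r; lra.
  apply: le_lt_trans (_ : a * (e / (2 * (a + 1))) < _).
    by rewrite ler_wpM2l// ltW.
  have -> : a * (e / (2 * (a + 1))) = e / 2 * (a / (a + 1)) by field; lra.
  by rewrite gtr_pMr ?ltr_pdivrMr; lra.
lra.
Qed.

Lemma ccontV f z : ccont f z -> f z != 0 -> ccont (fun w => (f w)^-1) z.
Proof.
move=> cf fz e e0; set a := normc (f z).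
have a0 : 0 < a by rewrite normc_gt0.
have d0 : 0 < Num.min (a / 2) (e * (a * a) / 2).
  by rewrite lt_min; apply/andP; split; apply: divr_gt0 => //; apply: mulr_gt0 => //; apply: mulr_gt0.
have [d1 d10 H1] := cf _ d0; exists d1 => // w /H1; rewrite lt_min => /andP[h1 h2].
have fw : a / 2 < normc (f w).
  by have := ler_normcB (f z) (f w); rewrite -/a normcB; lra.
have fw0 : f w != 0 by rewrite -normc_gt0; lra.
have -> : (f w)^-1 - (f z)^-1 = - ((f w - f z) * (f w)^-1 * (f z)^-1) by field; rewrite ?fw0 ?fz.
rewrite normcN !normcM !normcV -/a.
have afw : 0 < normc (f w) by lra.
rewrite ltr_pdivrMr// ltr_pdivrMr//.
apply: lt_le_trans h2 _.
have -> : e * (a * a) / 2 = e * a * (a / 2) by field.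
by rewrite ler_wpM2l ?ltW// mulr_gt0.
Qed.

Lemma ccont_comp f g z : ccont f z -> ccont g (f z) -> ccont (g \o f) z.
Proof.
move=> cf cg e /cg[d d0 H]; have [d1 d10 H1] := cf _ d0.
by exists d1 => // w /H1 /H.
Qed.

(** Caratheodory's form of complex differentiability: the chain and product
    rules become identities between difference quotients. *)
Definition cdiff f z := exists q, ccont q z /\ forall w, f w = f z + q w * (w - z).

Lemma cdiff_cont f z : cdiff f z -> ccont f z.
Proof.
move=> [q [cq fq]]; apply: (@ccont_eq (fun w => f z + q w * (w - z))).
  apply: ccontD; first exact: ccont_cst.
  apply: ccontM => //; apply: ccontD; [exact: ccont_id|exact: ccont_cst].
by move=> w; rewrite -fq.
Qed.

Lemma cdiff_cst c z : cdiff (fun=> c) z.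
Proof. by exists (fun=> 0); split; [exact: ccont_cst|move=> w; ring]. Qed.

Lemma cdiff_id z : cdiff id z.
Proof. by exists (fun=> 1); split; [exact: ccont_cst|move=> w; ring]. Qed.

Lemma cdiff_eq f g z : cdiff f z -> f =1 g -> cdiff g z.
Proof. by move=> cf fg; have -> : g = f by apply/funext => w; rewrite fg. Qed.

Lemma cdiffD f g z : cdiff f z -> cdiff g z -> cdiff (fun w => f w + g w) z.
Proof.
move=> [q [cq fq]] [r [cr gr]]; exists (fun w => q w + r w); split.
  exact: ccontD.
by move=> w; rewrite (fq w) (gr w); ring.
Qed.

Lemma cdiffM f g z : cdiff f z -> cdiff g z -> cdiff (fun w => f w * g w) z.
Proof.
move=> [q [cq fq]] [r [cr gr]].
exists (fun w => f z * r w + q w * (g z + r w * (w - z))); split.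
  apply: ccontD; apply: ccontM => //; first exact: ccont_cst.
  apply: ccontD; first exact: ccont_cst.
  apply: ccontM => //; apply: ccontD; [exact: ccont_id|exact: ccont_cst].
by move=> w; rewrite (fq w) (gr w); ring.
Qed.

Lemma cdiffX f k z : cdiff f z -> cdiff (fun w => f w ^+ k) z.
Proof.
move=> df; elim: k => [|k IH]; first exact: cdiff_cst.
by apply: (cdiff_eq (cdiffM df IH)) => w; rewrite exprS.
Qed.

(** Away from z the difference quotient is defined by division, so only its
    continuity at z has to be known. *)
Lemma cdiff_local f z q (d : R) : 0 < d -> ccont q z ->
  (forall w, normc (w - z) < d -> f w = f z + q w * (w - z)) -> cdiff f z.
Proof.
move=> d0 cq fq.
exists (fun w => if normc (w - z) < d then q w else (f w - f z) / (w - z)); split.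
  move=> e /cq[d1 d10 H]; exists (Num.min d d1); first by rewrite lt_min d0.
  move=> w; rewrite lt_min => /andP[wd /H]; rewrite wd subrr ComplexField.Normc.normc0.
  by rewrite d0.
move=> w; case: ifPn => [wd|]; first exact: fq.
rewrite -leNgt => dw; rewrite divfK ?subrK//; first by rewrite addrC subrK.
by rewrite -normc_gt0 (lt_le_trans d0).
Qed.

Lemma cdiff_near f g z (d : R) : 0 < d ->
  (forall w, normc (w - z) < d -> f w = g w) -> cdiff f z -> cdiff g z.
Proof.
move=> d0 fg [q [cq fq]].
have fgz : f z = g z by apply: fg; rewrite subrr ComplexField.Normc.normc0.
by apply: (cdiff_local d0 cq) => w wd; rewrite -fg// -fgz fq.
Qed.

Lemma cdiffV f z : cdiff f z -> f z != 0 -> cdiff (fun w => (f w)^-1) z.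
Proof.
move=> df fz; have [q [cq fq]] := df.
have fz0 : 0 < normc (f z) by rewrite normc_gt0.
have [d d0 fn0] := cdiff_cont df fz0.
apply: (@cdiff_local _ _ (fun w => - (q w * (f w)^-1 * (f z)^-1)) _ d0).
  apply: (@ccont_eq (fun w => (-1) * (q w * (f w)^-1 * (f z)^-1))); last by move=> w; ring.
  apply: ccontM; [exact: ccont_cst|apply: ccontM; last exact: ccont_cst].
  by apply: ccontM => //; apply: ccontV => //; exact: cdiff_cont.
move=> w /fn0 wd; have fw : f w != 0.
  by apply: contraTneq wd => ->; rewrite sub0r normcN ltxx.
have h := fq w.
have -> : - (q w / f w / f z) * (w - z) = - (q w * (w - z)) / f z / f w by field; rewrite fz fw.
have -> : q w * (w - z) = f w - f z by rewrite h; ring.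
by field; rewrite fz fw.
Qed.

Lemma cdiff_comp f g z : cdiff f z -> cdiff g (f z) -> cdiff (g \o f) z.
Proof.
move=> df; have [q [cq fq]] := df => - [r [cr gr]].
exists (fun w => r (f w) * q w); split.
  by apply: ccontM => //; apply: (@ccont_comp f r) => //; exact: cdiff_cont.
by move=> w /=; rewrite (gr (f w)) {2}(fq w); ring.
Qed.

Lemma cdiff_affine a b z : cdiff (fun w => a * w + b) z.
Proof.
apply: cdiffD; last exact: cdiff_cst.
by apply: cdiffM; [exact: cdiff_cst|exact: cdiff_id].
Qed.

Lemma lipschitz_ccont f z (K : R) :
  (forall w, normc (w - z) < 1 -> normc (f w - f z) <= K * normc (w - z)) ->
  ccont f z.
Proof.
move=> H e e0; have K0 : 0 < Num.max K 1 by rewrite lt_max ltr01 orbT.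
exists (Num.min 1 (e / Num.max K 1)); first by rewrite lt_min ltr01 divr_gt0.
move=> w; rewrite lt_min => /andP[/H h1 h2]; apply: le_lt_trans h1 _.
apply: le_lt_trans (_ : Num.max K 1 * normc (w - z) < _).
  by rewrite ler_wpM2r ?normc_ge0// le_max lexx.
by rewrite mulrC -ltr_pdivlMr.
Qed.

End complex_derivative.

(** * Paths and the complex exponential *)

Lemma real_complex0 {R : realType} : (0 : R)%:C = 0 :> R[i]. Proof. by []. Qed.

Lemma real_complex1 {R : realType} : (1 : R)%:C = 1 :> R[i]. Proof. by []. Qed.

Section complex_paths.
Context {R : realType}.
Local Notation C := R[i].
Implicit Types (g h : R -> C) (v z w : C).

Definition cpath g dg := forall t : R,
  is_derive t (1 : R) (fun s => Re (g s)) (Re (dg t)) /\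
  is_derive t (1 : R) (fun s => Im (g s)) (Im (dg t)).

(** The mean value inequality: test the increment against the unit scalar that
    makes it real. *)
Lemma cpath_mvt g dg M : cpath g dg ->
  (forall t, 0 <= t <= 1 -> normc (dg t) <= M) -> normc (g 1 - g 0) <= M.
Proof.
move=> gd dM; have [c c1 cE] := normc_rot (g 1 - g 0).
have D t : is_derive t (1 : R) (fun s => Re (c * g s)) (Re (c * dg t)).
  have [D1 D2] := gd t.
  have h := is_deriveB (is_deriveZ (Re c) D1) (is_deriveZ (Im c) D2).
  rewrite (_ : (fun s => Re (c * g s)) = fun s => Re c * Re (g s) - Im c * Im (g s)).
    by apply: (is_derive_eq h); rewrite cReM.
  by apply/funext => s; rewrite cReM.
have [|t /[!in_itv]/= /andP[t0 t1]] := @MVT R (fun s => Re (c * g s)) _ 0 1 ltr01 (fun t _ => D t).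
  apply: continuous_subspaceT => t; apply/differentiable_continuous/derivable1_diffP.
  by have [] := D t.
rewrite subr0 mulr1 -cE mulrBr cReB => ->.
apply: le_trans (dM t _); last by rewrite !ltW.
apply: le_trans (ler_norm _) _; apply: le_trans (normc_Re _) _.
by rewrite normcM c1 mul1r.
Qed.

Lemma cpathD g h dg dh : cpath g dg -> cpath h dh ->
  cpath (fun t => g t + h t) (fun t => dg t + dh t).
Proof.
move=> G H t; have [g1 g2] := G t; have [h1 h2] := H t; split.
  rewrite cReD (_ : (fun s => _) = fun s => Re (g s) + Re (h s)); first exact: is_deriveD.
  by apply/funext => s; rewrite cReD.
rewrite cImD (_ : (fun s => _) = fun s => Im (g s) + Im (h s)); first exact: is_deriveD.
by apply/funext => s; rewrite cImD.
Qed.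

Lemma cpath_scale (u du : R -> R) v : (forall t : R, is_derive t (1 : R) u (du t)) ->
  cpath (fun t => (u t)%:C * v) (fun t => (du t)%:C * v).
Proof.
move=> h t; split.
  rewrite cReM/= mul0r subr0 (_ : (fun s => _) = (fun s => Re v *: u s)).
    by apply: (is_derive_eq (is_deriveZ (Re v) (h t))); rewrite mulrC.
  by apply/funext => s; rewrite cReM/= mul0r subr0 mulrC.
rewrite cImM/= mul0r addr0 (_ : (fun s => _) = (fun s => Im v *: u s)).
  by apply: (is_derive_eq (is_deriveZ (Im v) (h t))); rewrite mulrC.
by apply/funext => s; rewrite cImM/= mul0r addr0 mulrC.
Qed.

Lemma cpath_linear v : cpath (fun t => t%:C * v) (fun=> v).
Proof.
move=> t; have := @cpath_scale id (fun=> 1) v (fun t => is_derive_id t (1 : R)) t.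
by rewrite /= mul1r.
Qed.

Lemma cpath_square v : cpath (fun t => (t * t)%:C * v) (fun t => (t + t)%:C * v).
Proof.
apply: cpath_scale => t; have h := is_derive_id t (1 : R).
by apply: (is_derive_eq (is_deriveM h h)); rewrite /GRing.scale/= mulr1.
Qed.

Lemma cpath_cst v : cpath (fun=> v) (fun=> 0).
Proof. by move=> t; split; exact: is_derive_cst. Qed.

End complex_paths.

Section complex_exponential.
Context {R : realType}.
Local Notation C := R[i].
Implicit Types (v z w : C).

Definition cexp z : C := (expR (Re z) * cos (Im z)) +i* (expR (Re z) * sin (Im z)).

Lemma cexp0 : cexp 0 = 1.
Proof. by rewrite /cexp/= expR0 cos0 sin0 mulr1 mulr0. Qed.

Lemma cexpD z w : cexp (z + w) = cexp z * cexp w.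
Proof.
apply/eqP; rewrite eq_complex cReM cImM/= cReD cImD expRD cosD sinD.
by apply/andP; split; apply/eqP; ring.
Qed.

Lemma normc_cexp z : normc (cexp z) = expR (Re z).
Proof.
rewrite /= !exprMn -mulrDr cos2Dsin2 mulr1 sqrtr_sqr.
by rewrite ger0_norm// expR_ge0.
Qed.

Lemma cpath_cexp v : cpath (fun t => cexp (t%:C * v)) (fun t => v * cexp (t%:C * v)).
Proof.
move=> t.
have Re_tv (s : R) : Re (s%:C * v) = s * Re v by rewrite cReM/= mul0r subr0.
have Im_tv (s : R) : Im (s%:C * v) = s * Im v by rewrite cImM/= mul0r addr0.
have dl (a : R) : is_derive t (1 : R) (fun s => s * a) a.
  rewrite (_ : (fun s => _) = (fun s => a *: s)); last by apply/funext => s; rewrite mulrC.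
  by apply: (is_derive_eq (is_deriveZ a (is_derive_id t (1 : R)))); rewrite /GRing.scale/= mulr1.
have de : is_derive t (1 : R) (fun s => expR (s * Re v)) (expR (t * Re v) * Re v).
  exact: (@is_derive1_comp _ expR (fun s => s * Re v) t _ _ (is_derive_expR (t * Re v)) (dl (Re v))).
have dc : is_derive t (1 : R) (fun s => cos (s * Im v)) (- sin (t * Im v) * Im v).
  exact: (@is_derive1_comp _ cos (fun s => s * Im v) t _ _ (is_derive_cos (t * Im v)) (dl (Im v))).
have ds : is_derive t (1 : R) (fun s => sin (s * Im v)) (cos (t * Im v) * Im v).
  exact: (@is_derive1_comp _ sin (fun s => s * Im v) t _ _ (is_derive_sin (t * Im v)) (dl (Im v))).
split.
  rewrite (_ : (fun s => _) = (fun s => expR (s * Re v)) * (fun s => cos (s * Im v))).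
    apply: (is_derive_eq (is_deriveM de dc)).
    by rewrite cReM /= Re_tv Im_tv /GRing.scale/=; ring.
  by apply/funext => s /=; rewrite Re_tv Im_tv.
rewrite (_ : (fun s => _) = (fun s => expR (s * Re v)) * (fun s => sin (s * Im v))).
  apply: (is_derive_eq (is_deriveM de ds)).
  by rewrite cImM /= Re_tv Im_tv /GRing.scale/=; ring.
by apply/funext => s /=; rewrite Re_tv Im_tv.
Qed.

Lemma normc_cexpB1 v : normc (cexp v - 1) <= normc v * expR (Num.max (Re v) 0).
Proof.
have h := cpathD (cpath_cexp v) (cpath_cst (-1)).
have := @cpath_mvt R _ _ (normc v * expR (Num.max (Re v) 0)) h.
rewrite real_complex0 real_complex1 mul0r mul1r cexp0 subrr subr0; apply=> t /andP[t0 t1].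
rewrite addr0 normcM ler_wpM2l ?normc_ge0// normc_cexp ler_expR cReM/= mul0r subr0.
have [v0|v0] := leP 0 (Re v).
  by rewrite ler_piMl.
by rewrite mulr_ge0_le0// ltW.
Qed.

Lemma Re_le_normc v : Num.max (Re v) 0 <= normc v.
Proof. by rewrite ge_max normc_ge0 andbT (le_trans (ler_norm _)) ?normc_Re. Qed.

(** The Taylor remainder vanishes at t = 0 along t v, and its derivative is the
    previous remainder times v; hence the mean value inequality raises the order
    of the remainder by one. *)
Lemma normc_cexp_taylor1 v : normc (cexp v - 1 - v) <= normc v ^+ 2 * expR (normc v).
Proof.
have h := cpathD (cpath_cexp v) (cpathD (cpath_cst (-1)) (cpath_linear (- v))).
have := @cpath_mvt R _ _ (normc v ^+ 2 * expR (normc v)) h.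
rewrite real_complex0 real_complex1 !mul0r !mul1r cexp0 addr0 subrr subr0 addrA; apply=> t /andP[t0 t1].
rewrite add0r -[X in _ - X]mulr1 -mulrBr normcM expr2 -mulrA.
rewrite ler_wpM2l ?normc_ge0//.
have tv : normc (t%:C * v) <= normc v.
  by rewrite normcM normcR ger0_norm// ler_piMl// normc_ge0.
apply: le_trans (normc_cexpB1 _) _; apply: ler_pM; rewrite ?normc_ge0 ?expR_ge0//.
by rewrite ler_expR; apply: le_trans (Re_le_normc _) _.
Qed.

Lemma normc_cexp_taylor2 v :
  normc (cexp v - 1 - v - v ^+ 2 / 2) <= normc v ^+ 3 * expR (normc v).
Proof.
have h := cpathD (cpathD (cpath_cexp v) (cpathD (cpath_cst (-1)) (cpath_linear (- v))))
  (cpath_square (- (v ^+ 2 / 2))).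
have := @cpath_mvt R _ _ (normc v ^+ 3 * expR (normc v)) h.
rewrite !mulr0 !mulr1 real_complex0 real_complex1 !mul0r !mul1r cexp0 !addr0 subrr subr0 !addrA; apply=> t /andP[t0 t1].
have -> : v * cexp (t%:C * v) + (0 - v) + (t + t)%:C * - (v ^+ 2 / 2) =
   v * (cexp (t%:C * v) - 1 - t%:C * v).
  by rewrite rmorphD/=; field.
rewrite normcM exprS -mulrA ler_wpM2l ?normc_ge0//.
have tv : normc (t%:C * v) <= normc v.
  by rewrite normcM normcR ger0_norm// ler_piMl// normc_ge0.
apply: le_trans (normc_cexp_taylor1 _) _; apply: ler_pM.
- by rewrite exprn_ge0// normc_ge0.
- exact: expR_ge0.
- by rewrite lerXn2r// ?nnegrE ?normc_ge0.
- by rewrite ler_expR.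
Qed.

(** sigma is the average of the exponentials exp (t v), t in [0,1]: bounded by
    one on the left half-plane, yet decaying like 1/|v|. *)
Definition sigma v : C := if v == 0 then 1 else (cexp v - 1) / v.

Lemma sigma_mul v : sigma v * v = cexp v - 1.
Proof.
rewrite /sigma; have [->|v0] := eqVneq v 0; last by rewrite divfK.
by rewrite cexp0 subrr mulr0.
Qed.

Lemma normc_sigma v : normc (sigma v) <= expR (Num.max (Re v) 0).
Proof.
rewrite /sigma; have [->|v0] := eqVneq v 0.
  by rewrite ComplexField.Normc.normc1 /= maxxx expR0.
by rewrite normcM normcV ler_pdivrMr ?normc_gt0// mulrC normc_cexpB1.
Qed.

Lemma normc_sigma_decay v : normc (sigma v) * normc v <= 2 * expR (Num.max (Re v) 0).
Proof.
rewrite -normcM sigma_mul; apply: le_trans (le_normcD _ _) _.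
rewrite normcN ComplexField.Normc.normc1 normc_cexp.
have h1 : expR (Re v) <= expR (Num.max (Re v) 0) by rewrite ler_expR le_max lexx.
have h2 : 1 <= expR (Num.max (Re v) 0) by rewrite -expR0 ler_expR le_max lexx orbT.
lra.
Qed.

Lemma normc_sigmaB1 v : normc (sigma v - 1) <= normc v * expR (normc v).
Proof.
rewrite /sigma; have [->|v0] := eqVneq v 0.
  by rewrite subrr ComplexField.Normc.normc0 mul0r.
have -> : (cexp v - 1) / v - 1 = (cexp v - 1 - v) / v by field.
rewrite normcM normcV ler_pdivrMr ?normc_gt0//.
by apply: le_trans (normc_cexp_taylor1 _) _; rewrite expr2 mulrAC.
Qed.

Lemma ccont_sigma0 : ccont sigma 0.
Proof.
apply: (@lipschitz_ccont _ _ _ (expR 1)) => w; rewrite subr0 => w1.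
have -> : sigma 0 = 1 by rewrite /sigma eqxx.
apply: le_trans (normc_sigmaB1 _) _.
by rewrite mulrC ler_wpM2r ?normc_ge0// ler_expR ltW.
Qed.

Lemma cdiff_cexp z : cdiff cexp z.
Proof.
exists (fun w => cexp z * sigma (w - z)); split.
  apply: ccontM; first exact: ccont_cst.
  apply: (@ccont_comp _ (fun w => w - z) sigma).
    by apply: ccontD; [exact: ccont_id|exact: ccont_cst].
  by rewrite subrr; exact: ccont_sigma0.
move=> w; rewrite -mulrA sigma_mul mulrBr mulr1 -cexpD addrC subrK.
by rewrite addrC subrK.
Qed.

Lemma cdiff_sigma z : cdiff sigma z.
Proof.
have [->|z0] := eqVneq z 0.
  exists (fun w => if w == 0 then 2^-1 else (cexp w - 1 - w) / w ^+ 2); split.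
    apply: (@lipschitz_ccont _ _ _ (expR 1)) => w; rewrite subr0 eqxx => w1.
    have [->|w0] := eqVneq w 0.
      by rewrite subrr ComplexField.Normc.normc0 mulr0.
    have -> : (cexp w - 1 - w) / w ^+ 2 - 2^-1 = (cexp w - 1 - w - w ^+ 2 / 2) / w ^+ 2 by field.
    rewrite normcM normcV normcX ler_pdivrMr ?exprn_gt0 ?normc_gt0//.
    apply: le_trans (normc_cexp_taylor2 _) _.
    rewrite -[leRHS]mulrA -[normc w * normc w ^+ 2]exprS mulrC.
    by rewrite ler_wpM2r ?exprn_ge0 ?normc_ge0// ler_expR ltW.
  move=> w; rewrite /sigma eqxx subr0.
  have [->|w0] := eqVneq w 0; first by rewrite mulr0 addr0.
  by field.
have z1 : 0 < normc z by rewrite normc_gt0.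
apply: (@cdiff_near _ (fun w => (cexp w - 1) * w^-1) _ _ _ z1).
  move=> w wz; rewrite /sigma; case: eqVneq => // w0.
  by move: wz; rewrite w0 sub0r normcN ltxx.
apply: cdiffM.
  by apply: cdiffD; [exact: cdiff_cexp|exact: cdiff_cst].
by apply: cdiffV => //; exact: cdiff_id.
Qed.

End complex_exponential.

(** * Mean values and the maximum principle *)

Section circle_mean.
Context {R : realType}.
Local Notation C := R[i].
Implicit Types (X : C -> C) (c z w : C).

(** Continuity on complex discs gives continuity along any path with continuous
    coordinates; this feeds complex functions to real integrals. *)
Lemma ccont_path X (g : R -> C) (t : R) : ccont X (g t) ->
  {for t, continuous (fun s => Re (g s))} -> {for t, continuous (fun s => Im (g s))} ->
  {for t, continuous (fun s => Re (X (g s)))} /\ {for t, continuous (fun s => Im (X (g s)))}.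
Proof.
move=> cX /cvgrPdist_lt cR /cvgrPdist_lt cI.
suff H (e : R) : 0 < e -> \forall s \near t, normc (X (g s) - X (g t)) < e.
  split; apply/cvgrPdist_lt => e /H; apply: filterS => s hs; rewrite distrC.
    by rewrite -cReB; apply: le_lt_trans (normc_Re _) _.
  by rewrite -cImB; apply: le_lt_trans (normc_Im _) _.
move=> /cX[d d0 H]; have d2 : 0 < d / 2 by lra.
near=> s; apply: H.
have h1 : `|Re (g t) - Re (g s)| < d / 2 by near: s; exact: cR.
have h2 : `|Im (g t) - Im (g s)| < d / 2 by near: s; exact: cI.
by apply: le_lt_trans (normc_le _) _; rewrite cReB cImB distrC [X in _ + X]distrC; lra.
Unshelve. all: by end_near. Qed.

Definition circ (r t : R) : C := cexp (ln r +i* t).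

Lemma normc_circ r t : 0 < r -> normc (circ r t) = r.
Proof. by move=> r0; rewrite normc_cexp/= lnK. Qed.

(** The mean value property. In the coordinate z + exp (s + i t) the punctured
    disc becomes a half-strip and circles become vertical segments, so
    Goursat's lemma on a rectangle says that the mean does not depend on the
    radius; continuity at the centre identifies it. The centre may be a point
    where differentiability is not known. *)
Lemma circle_mean X z (r : R) : 0 < r -> ccont X z ->
  (forall w, 0 < normc (w - z) <= r -> cdiff X w) ->
  segint (fun t => Re (X (z + circ r t))) 0 (2 * pi) = 2 * pi * Re (X z).
Proof.
move=> r0 cXz dX.
pose F w := X (z + cexp w); pose L := ln r.
have [T0 [cosT sinT]] : 0 < 2 * pi :> R /\ cos (2 * pi : R) = 1 /\ sin (2 * pi : R) = 0.
  by rewrite mulrC mulr_natr cos2pi sin2pi mulrn_wgt0// pi_gt0.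
move: T0 cosT sinT; set T : R := 2 * pi; clearbody T => T0 cosT sinT.
have dF w : Re w <= L -> cdiff F w.
  move=> wL; apply: (@cdiff_comp _ (fun w => z + cexp w) X).
    by apply: cdiffD; [exact: cdiff_cst|exact: cdiff_cexp].
  apply: dX; rewrite addrC addKr normc_cexp expR_gt0/=.
  by rewrite -[leRHS]lnK// ler_expR.
(* the minimum with L makes P and Q continuous everywhere *)
pose P x y := Im (F (Num.min x L +i* y)); pose Q x y := Re (F (Num.min x L +i* y)).
have mL (x : R) : Num.min x L <= L by rewrite ge_min lexx orbT.
have cmin : continuous (fun x : R => Num.min x L).
  by move=> x; apply: (@continuous_min R R id (cst L)); [exact: cvg_id|exact: cvg_cst].
have cQ x : continuous (Q x).
  move=> y; have [] := @ccont_path F (fun y => Num.min x L +i* y) y _ _ _ => //.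
  - exact: (cdiff_cont (dF (Num.min x L +i* y) (mL x))).
  - exact: cvg_cst.
have cP y : continuous (P^~ y).
  move=> x; have [] := @ccont_path F (fun x => Num.min x L +i* y) x _ _ _ => //.
  - exact: (cdiff_cont (dF (Num.min x L +i* y) (mL x))).
  - exact: cmin.
  - exact: cvg_cst.
have cl a x0 y0 : a <= x0 <= L -> 0 <= y0 <= T -> closed_at P Q a L 0 T x0 y0.
  move=> /andP[_ x0L] _; have [q [cq Fq]] := dF (x0 +i* y0) x0L.
  set d := q (x0 +i* y0) in cq.
  exists (Im d), (Re d), (- Im d) => e e0.
  have [dl dl0 H] := cq e e0; exists (dl / 4); first lra.
  move=> x y /andP[_ xL] _ hx hy.
  have -> : P x y = Im (F (x +i* y)) by rewrite /P min_l.
  have -> : P x0 y0 = Im (F (x0 +i* y0)) by rewrite /P min_l.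
  have -> : Q x y = Re (F (x +i* y)) by rewrite /Q min_l.
  have -> : Q x0 y0 = Re (F (x0 +i* y0)) by rewrite /Q min_l.
  set u := (x +i* y) - (x0 +i* y0).
  have nu : normc u <= `|x - x0| + `|y - y0| by apply: le_trans (normc_le _) _.
  have E : F (x +i* y) = F (x0 +i* y0) + d * u + (q (x +i* y) - d) * u.
    by rewrite (Fq (x +i* y)) -/u; ring.
  have small : normc ((q (x +i* y) - d) * u) <= e * (`|x - x0| + `|y - y0|).
    rewrite normcM; apply: ler_pM; rewrite ?normc_ge0//.
    by apply/ltW/H; apply: le_lt_trans nu _; lra.
  split; apply: le_trans small.
    apply: le_trans (normc_Im _); rewrite E !cImD cImM/=.
    by rewrite le_eqVlt; apply/orP; left; apply/eqP; congr (`|_|); ring.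
  apply: le_trans (normc_Re _); rewrite E !cReD cReM/=.
  by rewrite le_eqVlt; apply/orP; left; apply/eqP; congr (`|_|); ring.
(* horizontal sides cancel by periodicity of the exponential *)
have cst a : a < L -> segint (Q L) 0 T = segint (Q a) 0 T.
  move=> aL; have := goursat aL T0 (fun x _ => cQ x) (fun y _ => cP y) (cl a).
  rewrite /rectint.
  have -> : segint (P^~ T) a L = segint (P^~ 0) a L.
    apply: segint_eq => x _; rewrite /P /F; congr (Im (X (_ + _))).
    by rewrite /cexp/= cosT sinT cos0 sin0.
  move: (segint _ _ _) (segint _ _ _) (segint _ _ _) => s1 s2 s3; clear; lra.
have EL : segint (fun t => Re (X (z + circ r t))) 0 T = segint (Q L) 0 T.
  by apply: segint_eq => t _; rewrite /Q (min_l (lexx L)).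
rewrite EL; apply/eqP; rewrite -subr_eq0 -normr_eq0 eq_le normr_ge0 andbT.
apply/ler_addgt0Pl => e e0; rewrite addr0.
have e1 : 0 < e / T by rewrite divr_gt0.
have [d d0 H] := cXz _ e1.
have [a [aL ad]] : exists a, a < L /\ expR a < d.
  exists (Num.min (L - 1) (ln (d / 2))); split.
    by rewrite gt_min ltrBlDr ltrDl ltr01.
  have d2 : 0 < d / 2 by exact: divr_gt0.
  apply: le_lt_trans (_ : expR (ln (d / 2)) < _); first by rewrite ler_expR ge_min lexx orbT.
  by clear -d0 d2; rewrite lnK// ltr_pdivrMr// ltr_pMr// ltr1n.
rewrite (cst _ aL); clear cl dX dF mL cmin cP EL cst.
have -> : T * Re (X z) = segint (fun=> Re (X z)) 0 T.
  by rewrite segint_cst ?ltW// subr0 mulrC.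
rewrite -segintB//; last exact: cst_continuous.
have -> : e = e / T * (T - 0) by rewrite subr0 divfK// gt_eqF.
apply: segint_bound; [|exact: ltW|].
  by move=> y; apply: cvgB; [exact: cQ|exact: cvg_cst].
move=> y _; have -> : Q a y - Re (X z) = Re (F (a +i* y) - X z).
  by rewrite cReB /Q (min_l (ltW aL)).
apply: le_trans (normc_Re _) _.
by apply/ltW/H; rewrite addrC addKr normc_cexp.
Qed.

Definition box (x1 x2 y1 y2 : R) : set C :=
  [set w | x1 <= Re w <= x2 /\ y1 <= Im w <= y2].

Lemma box_evt (u : C -> R) x1 x2 y1 y2 : x1 <= x2 -> y1 <= y2 ->
  (forall w, box x1 x2 y1 y2 w -> forall e : R, 0 < e -> exists2 d : R, 0 < d &
     forall w', normc (w' - w) < d -> `|u w' - u w| < e) ->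
  exists2 w, box x1 x2 y1 y2 w & forall w', box x1 x2 y1 y2 w' -> u w' <= u w.
Proof.
move=> x12 y12 cu.
pose D : set (R * R) := `[x1, x2] `*` `[y1, y2].
have cD : compact D by apply: compact_setX; exact: segment_compact.
pose g (p : R * R) : R := u (p.1 +i* p.2).
have D0 : D !=set0 by exists (x1, y1); split; rewrite /= in_itv/= lexx.
have cg : {within D, continuous g}.
  apply: continuous_in_subspaceT => p /set_mem[/=]; rewrite !in_itv/= => p1 p2.
  apply/cvgrPdist_lt => e /(cu (p.1 +i* p.2) (conj p1 p2) _)[d d0 H].
  have d2 : 0 < d / 2 by lra.
  near=> q; rewrite distrC; apply: H; apply: le_lt_trans (normc_le _) _.
  rewrite cReB cImB/=.
  have h1 : `|q.1 - p.1| < d / 2.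
    near: q; have /cvgrPdist_lt/(_ _ d2) : (fun q : R * R => q.1) q @[q --> p] --> p.1 by exact: cvg_fst.
    by apply: filterS => q; rewrite distrC.
  have h2 : `|q.2 - p.2| < d / 2.
    near: q; have /cvgrPdist_lt/(_ _ d2) : (fun q : R * R => q.2) q @[q --> p] --> p.2 by exact: cvg_snd.
    by apply: filterS => q; rewrite distrC.
  lra.
have [p Dp pmax] := compact_EVT_max D0 cD cg.
exists (p.1 +i* p.2).
  by move: Dp => /set_mem [/=]; rewrite !in_itv/= => h1 h2; split.
move=> [x y] [/= h1 h2]; apply: (pmax (x, y)).
by apply/mem_set; split => /=; rewrite in_itv.
Unshelve. all: by end_near. Qed.

End circle_mean.

Section maximum_principle.
Context {R : realType}.
Local Notation C := R[i].
Implicit Types (X g : C -> C) (c z w : C).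

Lemma box_normc_le x1 x2 y1 y2 w : box x1 x2 y1 y2 w ->
  normc w <= `|x1| + `|x2| + `|y1| + `|y2|.
Proof.
move=> [/andP[h1 h2] /andP[h3 h4]]; apply: le_trans (normc_le _) _.
have a1 : `|Re w| <= `|x1| + `|x2|.
  rewrite ler_norml; have := ler_norm x2; have := ler_norm (- x1); rewrite normrN.
  by have := normr_ge0 x1; have := normr_ge0 x2; move=> *; apply/andP; split; lra.
have a2 : `|Im w| <= `|y1| + `|y2|.
  rewrite ler_norml; have := ler_norm y2; have := ler_norm (- y1); rewrite normrN.
  by have := normr_ge0 y1; have := normr_ge0 y2; move=> *; apply/andP; split; lra.
lra.
Qed.

(** At an interior maximum w of |X| + e |.|^2 the mean value property applied to
    the holomorphic function c X + 2 e conj(w) id, with c rotating X(w) to a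
    positive number, would give a gain of e r^2 on a circle of radius r. *)
Lemma box_maxmod X (p : C) x1 x2 y1 y2 (M : R) :
  (forall w, box x1 x2 y1 y2 w -> ccont X w) ->
  (forall w, box x1 x2 y1 y2 w -> w != p -> cdiff X w) ->
  (forall w, box x1 x2 y1 y2 w ->
     [\/ Re w = x1, Re w = x2, Im w = y1 | Im w = y2] -> normc (X w) <= M) ->
  forall w, box x1 x2 y1 y2 w -> normc (X w) <= M.
Proof.
move=> cX dX bX w0 Bw0; rewrite leNgt; apply/negP => big.
have [x12 y12] : x1 <= x2 /\ y1 <= y2.
  by case: Bw0 => /andP[h1 h2] /andP[h3 h4]; split; [exact: le_trans h2|exact: le_trans h4].
(* S bounds |w|^2 on the box, so the perturbation e |w|^2 stays below the excess over M *)
pose S := (`|x1| + `|x2| + `|y1| + `|y2|) ^+ 2 + 1.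
have S0 : 0 < S by rewrite ltr_wpDl// sqr_ge0.
pose e := (normc (X w0) - M) / (2 * S).
have e0 : 0 < e by apply: divr_gt0; [rewrite subr_gt0|exact: mulr_gt0].
have eS : e * S < normc (X w0) - M.
  have -> : e * S = (normc (X w0) - M) / 2 by rewrite /e; field; rewrite gt_eqF.
  by rewrite ltr_pdivrMr// ltr_pMr ?ltr1n// subr_gt0.
have nS w : box x1 x2 y1 y2 w -> normc w ^+ 2 <= S.
  move=> /box_normc_le h; rewrite /S; apply: le_trans (_ : _ <= (`|x1| + `|x2| + `|y1| + `|y2|) ^+ 2) _.
    by rewrite lerXn2r// ?nnegrE ?normc_ge0// !addr_ge0.
  by rewrite lerDl.
(* u has a maximum on the box, which the boundary bound pushes into the interior *)
pose u w := normc (X w) + e * normc w ^+ 2.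
have cu w : box x1 x2 y1 y2 w -> forall e : R, 0 < e -> exists2 d : R, 0 < d &
     forall w', normc (w' - w) < d -> `|u w' - u w| < e.
  have nl (a b : C) : `|normc a - normc b| <= normc (a - b).
    rewrite ler_norml ler_normcB andbT; have := ler_normcB b a; rewrite normcB; clear; lra.
  move=> Bw e' e'0; have e2 : 0 < e' / 2 by exact: divr_gt0.
  have [d1 d10 H1] := cX w Bw _ e2.
  have e3 : 0 < e' / 2 / e by exact: divr_gt0.
  have [d2 d20 H2] := ccontM (@ccont_id _ w) (@ccont_id _ w) e3.
  exists (Num.min d1 d2); first by rewrite lt_min d10.
  move=> w'; rewrite lt_min => /andP[/H1 h1 /H2 h2]; rewrite /u.
  have -> : normc (X w') + e * normc w' ^+ 2 - (normc (X w) + e * normc w ^+ 2) =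
    (normc (X w') - normc (X w)) + e * (normc (w' * w') - normc (w * w)).
    by rewrite !normcM; ring.
  apply: le_lt_trans (ler_normD _ _) _.
  have k1 : `|e * (normc (w' * w') - normc (w * w))| <= e * normc (w' * w' - w * w).
    by rewrite normrM (gtr0_norm e0) ler_pM2l.
  have k2 : e * normc (w' * w' - w * w) < e' / 2 by rewrite mulrC -ltr_pdivlMr.
  move: (nl (X w') (X w)) h1 k1 k2; clear.
  by move: (normc (X w' - X w)) (e * normc _) `|_| `|_| => *; lra.
have [ws Bws umax] := box_evt x12 y12 cu.
have Xws : normc (X w0) <= normc (X ws) + e * normc ws ^+ 2.
  apply: le_trans (umax _ Bw0); rewrite /u lerDl mulr_ge0 ?sqr_ge0//; exact: ltW.
have nb : ~ [\/ Re ws = x1, Re ws = x2, Im ws = y1 | Im ws = y2].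
  move=> /(bX _ Bws) h; have h2 : e * normc ws ^+ 2 <= e * S by rewrite ler_pM2l// nS.
  move: Xws eS h h2; clear; move: (e * S) (e * _) => *; lra.
have Bin : [/\ x1 < Re ws, Re ws < x2, y1 < Im ws & Im ws < y2].
  case: Bws => /andP[h1 h2] /andP[h3 h4].
  rewrite !lt_neqAle h1 h2 h3 h4 !andbT.
  split; apply/negP => /eqP h; apply: nb.
  - by constructor 1.
  - by constructor 2.
  - by constructor 3.
  - by constructor 4.
case: Bin => i1 i2 i3 i4.
(* the circle around ws avoids p unless ws = p *)
pose dp := if ws == p then 1 else normc (ws - p) / 2.
have dp0 : 0 < dp by rewrite /dp; case: eqVneq => // h; rewrite divr_gt0// normc_gt0 subr_eq0.
pose r := Num.min dp (Num.min (Num.min (Re ws - x1) (x2 - Re ws))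
                              (Num.min (Im ws - y1) (y2 - Im ws))).
have r0 : 0 < r by rewrite !lt_min dp0 !subr_gt0 i1 i2 i3 i4.
have [rp [r1 r2] [r3 r4]] : [/\ r <= dp, r <= Re ws - x1 /\ r <= x2 - Re ws &
    r <= Im ws - y1 /\ r <= y2 - Im ws].
  by rewrite /r; split; rewrite ?ge_min ?lexx ?orbT//; split; rewrite !ge_min lexx ?orbT.
have inbox w : normc (w - ws) <= r -> box x1 x2 y1 y2 w.
  move=> h; have := le_trans (normc_Re _) h; have := le_trans (normc_Im _) h.
  rewrite cReB cImB !ler_norml; move: r1 r2 r3 r4; rewrite /box/=; clear.
  by move: (r) (Re w) (Re ws) (Im w) (Im ws) => *; split; lra.
have diffin w : 0 < normc (w - ws) <= r -> cdiff X w.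
  move=> /andP[w1 w2]; apply: dX; first exact: inbox.
  apply/eqP => wp; move: w1 w2 rp; rewrite wp /dp; case: eqVneq => [->|wsp].
    by rewrite subrr ComplexField.Normc.normc0 ltxx.
  rewrite normcB; clear; move: (normc _) => *; lra.
have [c c1 cE] := normc_rot (X ws).
(* Re Y <= u + e |ws|^2 - e |w - ws|^2, with equality at ws *)
pose Y w := c * X w + (2 * e)%:C * ws^* * w.
have cY : ccont Y ws.
  apply: ccontD; apply: ccontM.
  - exact: ccont_cst.
  - exact: cX.
  - exact: ccont_cst.
  - exact: ccont_id.
have dY w : 0 < normc (w - ws) <= r -> cdiff Y w.
  move=> /diffin dw; apply: cdiffD; apply: cdiffM => //.
  - exact: cdiff_cst.
  - exact: cdiff_cst.
  - exact: cdiff_id.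
have pi0 : 0 < 2 * pi :> R by rewrite mulr_gt0// pi_gt0.
have := circle_mean r0 cY dY; move: (2 * pi) pi0 => T T0 mean.
have Yle w : normc (w - ws) = r -> Re (Y w) <= Re (Y ws) - e * r ^+ 2.
  move=> wr; have wB : box x1 x2 y1 y2 w by apply: inbox; rewrite wr.
  have := umax _ wB; rewrite /u => hu.
  have cle : Re (c * X w) <= normc (X w).
    by apply: le_trans (ler_norm _) _; apply: le_trans (normc_Re _) _; rewrite normcM c1 mul1r.
  have id1 : r ^+ 2 = normc w ^+ 2 + normc ws ^+ 2 - 2 * Re (ws^* * w).
    by rewrite -wr !normc_sqr cReB cImB cReM; case: (ws) => a b /=; ring.
  have id2 : Re (Y ws) = normc (X ws) + 2 * e * normc ws ^+ 2.
    by rewrite /Y cReD cE -mulrA cReM/= mul0r subr0 normc_sqr cReM; case: (ws) => a b /=; ring.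
  have id3 : Re (Y w) = Re (c * X w) + 2 * e * Re (ws^* * w).
    by rewrite /Y cReD -mulrA [Re ((2 * e)%:C * _)]cReM/= mul0r subr0.
  rewrite id1 id2 id3; move: hu cle; clear.
  by move: (Re (c * X w)) (Re (_ * w)) (normc (X w)) => *; lra.
have contY t : {for t, continuous (fun t => Re (Y (ws + circ r t)))}.
  have [] := @ccont_path _ Y (fun t => ws + circ r t) t; last by [].
  - have n := normc_circ t r0; apply: cdiff_cont; apply: dY.
    by rewrite addrC addKr n r0 lexx.
  - have := @ccont_path _ (fun w => ws + cexp w) (fun t => ln r +i* t) t.
    case=> //.
    + by apply: cdiff_cont; apply: cdiffD; [exact: cdiff_cst|exact: cdiff_cexp].
    + exact: cvg_cst.
  - have := @ccont_path _ (fun w => ws + cexp w) (fun t => ln r +i* t) t.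
    case=> //.
    + by apply: cdiff_cont; apply: cdiffD; [exact: cdiff_cst|exact: cdiff_cexp].
    + exact: cvg_cst.
have : segint (fun t => Re (Y (ws + circ r t))) 0 T <= segint (fun=> Re (Y ws) - e * r ^+ 2) 0 T.
  apply: segint_le => //; first exact: cst_continuous.
  by move=> t _; apply: Yle; rewrite addrC addKr normc_circ.
rewrite mean segint_cst; last exact: ltW.
rewrite subr0 [T * _]mulrC ler_pM2r// => h.
have : 0 < e * r ^+ 2 by rewrite mulr_gt0// exprn_gt0.
by move: h; clear; move: (Re _) (e * _) => *; lra.
Qed.

(** Schwarz's lemma for the difference quotient at 0, at whose pole it is only
    continuous. *)
Lemma schwarz g (M : R) : (forall w, cdiff g w) -> (forall w, normc w <= 1 -> normc (g w) <= M) ->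
  forall w, normc w <= 1 -> normc (g w - g 0) <= 4 * M * normc w.
Proof.
move=> dg gM.
have g0M : normc (g 0) <= M by apply: gM; rewrite ComplexField.Normc.normc0.
have M0 : 0 <= M by apply: le_trans g0M; exact: normc_ge0.
have trivial w : normc w <= 1 -> normc (g w - g 0) <= 2 * M.
  move=> /gM h; apply: le_trans (le_normcD _ _) _; rewrite normcN.
  by move: h g0M; clear; move: (normc _) (normc _) => *; lra.
have [q [cq gq]] := dg 0.
have dq w : w != 0 -> cdiff q w.
  move=> w0; have nw : 0 < normc w by rewrite normc_gt0.
  apply: (@cdiff_near _ (fun v => (g v - g 0) * v^-1) _ _ _ nw).
    move=> v vw; have v0 : v != 0.
      by apply: contraTneq vw => ->; rewrite sub0r normcN ltxx.
    by rewrite (gq v) subr0 addrC addKr mulfK.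
  apply: cdiffM; last by apply: cdiffV => //; exact: cdiff_id.
  by apply: cdiffD => //; exact: cdiff_cst.
pose h := (2^-1 : R).
have inb w : box (- h) h (- h) h w -> normc w <= 1.
  move=> [h1 h2]; apply: le_trans (normc_le _) _.
  have : `|Re w| <= h by rewrite ler_norml.
  have : `|Im w| <= h by rewrite ler_norml.
  by rewrite /h; clear; move: `|_| `|_| => *; lra.
have bq : forall w, box (- h) h (- h) h w -> normc (q w) <= 4 * M.
  apply: (@box_maxmod q 0).
  - by move=> w _; have [->//|w0] := eqVneq w 0; exact: cdiff_cont (dq _ w0).
  - by move=> w _ w0; exact: dq.
  - move=> w Bw bd.
    have hw : h <= normc w.
      have hh : h = `|h| by rewrite ger0_norm// invr_ge0.
      case: bd => e; [| |  |].
      + by apply: le_trans (normc_Re _); rewrite e normrN -hh.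
      + by apply: le_trans (normc_Re _); rewrite e -hh.
      + by apply: le_trans (normc_Im _); rewrite e normrN -hh.
      + by apply: le_trans (normc_Im _); rewrite e -hh.
    have := trivial _ (inb _ Bw); rewrite (gq w) subr0 addrC addKr normcM.
    have qn := normc_ge0 (q w); move: hw qn; rewrite /h; clear.
    move: (normc (q w)) (normc w) => a b hb ha hab.
    have : a * 2^-1 <= a * b by rewrite ler_wpM2l.
    lra.
move=> w w1; have nw := normc_ge0 w.
have [hw|hw] := leP (2^-1) (normc w).
  apply: le_trans (trivial _ w1) _; have : M * 2^-1 <= M * normc w by rewrite ler_wpM2l.
  by clear; move: (normc w) => *; lra.
rewrite (gq w) subr0 addrC addKr normcM ler_wpM2r//; apply: bq.
have h1 := le_trans (normc_Re w) (ltW hw); have h2 := le_trans (normc_Im w) (ltW hw).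
by rewrite /box/= /h -!ler_norml.
Qed.

End maximum_principle.

(** * Phragmen-Lindelof estimates *)

Section phragmen_lindelof.
Context {R : realType}.
Local Notation C := R[i].
Implicit Types (G g : C -> C) (c z w : C).

Lemma cImV w : Im w^-1 = - (Im w / (Re w ^+ 2 + Im w ^+ 2)).
Proof. by case: w. Qed.

(** Letting d tend to 0 in x <= M exp (d c). *)
Lemma le_of_le_expR (x M c : R) : 0 <= c -> 0 <= x ->
  (forall d, 0 < d -> d <= 1 -> x <= M * expR (d * c)) -> x <= M.
Proof.
move=> c0 x0 H.
have M0 : 0 <= M.
  have := H 1 ltr01 (lexx _); rewrite mul1r => h.
  by rewrite -(@pmulr_lge0 _ (expR c)) ?expR_gt0//; exact: le_trans h.
apply/ler_addgt0Pl => e e0.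
have xc0 : 0 <= x * c by exact: mulr_ge0.
pose d := Num.min 1 (e / (x * c + 1)).
have d0 : 0 < d by rewrite lt_min ltr01 divr_gt0// ltr_wpDl.
have d1 : d <= 1 by rewrite ge_min lexx.
have de : d * (x * c) <= e.
  apply: le_trans (_ : e / (x * c + 1) * (x * c + 1) <= _).
    apply: ler_pM => //; [exact: ltW|by rewrite ge_min lexx orbT|by rewrite lerDl].
  by rewrite divfK// gt_eqF// ltr_wpDl.
have h1 : x * expR (- (d * c)) <= M.
  apply: le_trans (_ : M * expR (d * c) * expR (- (d * c)) <= _).
    by rewrite ler_wpM2r ?expR_ge0// H.
  by rewrite -mulrA -expRD subrr expR0 mulr1.
have h2 : 1 - d * c <= expR (- (d * c)) by exact: expR_ge1Dx.
have h3 : x * (1 - d * c) <= x * expR (- (d * c)) by rewrite ler_wpM2l.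
move: de h1 h3; clear; move: (expR _) => t; lra.
Qed.

(** Phragmen-Lindelof for functions of polynomial growth on the closed upper
    half-plane: damp by a power of i / (d w + i), apply the maximum principle
    on large boxes, and let d tend to 0. *)
Lemma pl_halfplane G (K M : R) (N : nat) : 0 <= K ->
  (forall w, 0 <= Im w -> cdiff G w) ->
  (forall w, 0 <= Im w -> normc (G w) <= K * (1 + normc w) ^+ N) ->
  (forall x : R, normc (G x%:C) <= M) ->
  forall w, 0 <= Im w -> normc (G w) <= M.
Proof.
move=> K0 dG growth real w0 Iw0.
have M0 : 0 <= M by apply: le_trans (real 0); exact: normc_ge0.
apply: (@le_of_le_expR _ _ (N.+1%:R * normc w0)); [|exact: normc_ge0|].
  by rewrite mulr_ge0// normc_ge0.
move=> d d0 d1.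
(* D does not vanish on the half-plane and has modulus at least 1 there *)
pose D w := d%:C * w + 'i.
have ImD w : Im (D w) = d * Im w + 1 by rewrite /D cImD cImM/= mul0r addr0.
have ReD w : Re (D w) = d * Re w by rewrite /D cReD cReM/= mul0r subr0 addr0.
have D1 w : 0 <= Im w -> 1 <= normc (D w).
  move=> Iw; apply: le_trans (normc_Im _); rewrite ImD ger0_norm ?lerDr ?mulr_ge0//; try exact: ltW.
  by rewrite addr_ge0// mulr_ge0// ltW.
have D0 w : 0 <= Im w -> D w != 0 by move=> /D1 h; rewrite -normc_gt0 (lt_le_trans ltr01).
pose H w := G w * (D w)^-1 ^+ N.+1.
have dH w : 0 <= Im w -> cdiff H w.
  move=> Iw; apply: cdiffM; first exact: dG.
  by apply: cdiffX; apply: cdiffV; [exact: cdiff_affine|exact: D0].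
have Hn w : 0 <= Im w -> normc (H w) * normc (D w) ^+ N.+1 = normc (G w).
  move=> Iw; rewrite /H normcM normcX normcV exprVn mulfVK// expf_neq0// normc_eq0; exact: D0.
have HG w : 0 <= Im w -> normc (H w) <= normc (G w).
  move=> Iw; rewrite -(Hn w Iw) ler_peMr ?normc_ge0// exprn_ege1//; exact: D1.
suff key : normc (H w0) <= M.
  rewrite -(Hn w0 Iw0); apply: ler_pM => //; rewrite ?exprn_ge0 ?normc_ge0//.
  apply: le_trans (_ : (1 + d * normc w0) ^+ N.+1 <= _).
    rewrite lerXn2r// ?nnegrE ?normc_ge0//.
      by rewrite addr_ge0// mulr_ge0 ?normc_ge0// ltW.
    rewrite /D addrC; apply: le_trans (le_normcD _ _) _.
    by rewrite normci normcM normcR gtr0_norm.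
  have -> : d * (N.+1%:R * normc w0) = N.+1%:R * (d * normc w0) by ring.
  rewrite expRM_natl lerXn2r// ?nnegrE ?expR_ge0// ?expR_ge1Dx//.
  by rewrite addr_ge0// mulr_ge0 ?normc_ge0// ltW.
apply/ler_addgt0Pr => e e0.
pose k := K * 3 ^+ N / d ^+ N.+1.
have k0 : 0 <= k by rewrite /k divr_ge0 ?mulr_ge0 ?exprn_ge0//; exact: ltW.
(* on the sides of a box of this size the damping beats the growth *)
pose r := 1 + normc w0 + k / e.
have r1 : 1 <= r by rewrite /r -addrA lerDl addr_ge0 ?normc_ge0// divr_ge0// ltW.
have r0 : 0 < r by exact: lt_le_trans r1.
have rw : normc w0 <= r.
  by rewrite /r addrAC lerDr addr_ge0// divr_ge0// ltW.
have rk : k <= e * r.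
  have : k / e <= r by rewrite /r lerDr addr_ge0// normc_ge0.
  by rewrite ler_pdivrMr// mulrC.
have far w : 0 <= Im w -> normc w <= 2 * r -> d * r <= normc (D w) -> normc (H w) <= e.
  move=> Iw wr Dr; have Dn0 : 0 < normc (D w) ^+ N.+1.
    by rewrite exprn_gt0// (lt_le_trans _ (D1 _ Iw)).
  have := Hn w Iw => /(canRL (mulfK (lt0r_neq0 Dn0))) ->.
  have dr0 : 0 < (d * r) ^+ N.+1 by rewrite exprn_gt0// mulr_gt0.
  apply: le_trans (_ : K * (3 * r) ^+ N / (d * r) ^+ N.+1 <= _).
    apply: ler_pM; rewrite ?invr_ge0 ?normc_ge0//; first exact: ltW.
      apply: le_trans (growth _ Iw) _; rewrite ler_wpM2l// lerXn2r// ?nnegrE.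
      - by rewrite addr_ge0// normc_ge0.
      - by rewrite mulr_ge0// ltW.
      - by move: r1 wr; clear; move: (normc w) => *; lra.
    by rewrite lef_pV2 ?posrE// lerXn2r// ?nnegrE ?normc_ge0// mulr_ge0 ?ltW.
  have -> : K * (3 * r) ^+ N / (d * r) ^+ N.+1 = k / r.
    rewrite /k !exprMn [r ^+ N.+1]exprS; field.
    by rewrite !expf_neq0 ?gt_eqF.
  by rewrite ler_pdivrMr.
have boxH : forall w, box (- r) r 0 r w -> normc (H w) <= M + e.
  apply: (@box_maxmod _ H 0).
  - by move=> w [_ /andP[Iw _]]; exact: cdiff_cont (dH _ Iw).
  - by move=> w [_ /andP[Iw _]] _; exact: dH.
  - move=> w Bw; have [/andP[h1 h2] /andP[Iw h4]] := Bw.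
    have w2 : normc w <= 2 * r.
      apply: le_trans (normc_le _) _.
      have a1 : `|Re w| <= r by rewrite ler_norml h1.
      by rewrite (ger0_norm Iw); move: a1 h4; clear; move: `|_| => *; lra.
    have He : d * r <= normc (D w) -> normc (H w) <= M + e.
      by move=> h; apply: le_trans (far _ Iw w2 h) _; rewrite lerDr.
    have side : `|Re w| = r -> normc (H w) <= M + e.
      move=> h; apply: He; apply: le_trans (normc_Re _).
      by rewrite ReD normrM gtr0_norm// h.
    case=> h.
    + by apply: side; rewrite h normrN gtr0_norm.
    + by apply: side; rewrite h gtr0_norm.
    + apply: le_trans (_ : M <= _); last by rewrite lerDl ltW.
      apply: le_trans (HG _ Iw) _.
      have -> : w = (Re w)%:C by apply/eqP; rewrite eq_complex/= h !eqxx.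
      exact: real.
    + apply: He; apply: le_trans (normc_Im _).
      by rewrite ImD h ger0_norm ?lerDl// addr_ge0// mulr_ge0 ?ltW.
apply: boxH; split; last first.
  by rewrite Iw0 (le_trans (ler_norm _)) ?(le_trans (normc_Im _)).
by rewrite -ler_norml (le_trans (normc_Re _)).
Qed.

(** Entire functions of exponential type A with polynomial growth along the
    real axis. *)
Definition exptype (A : R) g := (forall w, cdiff g w) /\
  exists2 K : R, 0 <= K & exists N : nat, forall w,
    normc (g w) <= K * (1 + normc w) ^+ N * expR (A * `|Im w|).

(** exp (i A w), which trades the exponential growth of a function of type A on
    the upper half-plane for boundedness. *)
Definition ishift (A : R) w : C := cexp (A%:C * 'i * w).

Lemma normc_ishift A w : normc (ishift A w) = expR (- (A * Im w)).
Proof.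
rewrite normc_cexp !cReM !cImM/=; congr expR; ring.
Qed.

Lemma cdiff_ishift A w : cdiff (ishift A) w.
Proof.
apply: (@cdiff_comp _ (fun w => A%:C * 'i * w) cexp); last exact: cdiff_cexp.
by apply: cdiffM; [exact: cdiff_cst|exact: cdiff_id].
Qed.

Lemma exptype_opp A g : exptype A g -> exptype A (fun w => g (- w)).
Proof.
move=> [dg [K K0 [N growth]]]; split.
  move=> w; apply: (@cdiff_comp _ (fun w => - w) g) => //.
  by apply: (cdiff_eq (cdiff_affine (-1) 0 w)) => v; ring.
by exists K => //; exists N => w; have := growth (- w); rewrite normcN raddfN/= normrN.
Qed.

(** On the upper half-plane exp (i A w) g has polynomial growth and the modulus of
    g on the real line. *)
Lemma pl_upper A g (M : R) : 0 <= A -> exptype A g ->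
  (forall x : R, normc (g x%:C) <= M) ->
  forall w, 0 <= Im w -> normc (g w) <= M * expR (A * Im w).
Proof.
move=> A0 [dg [K K0 [N growth]]] real w Iw.
have : normc (g w * ishift A w) <= M.
  apply: (@pl_halfplane (fun w => g w * ishift A w) K M N) => //.
  - by move=> v _; apply: cdiffM; [exact: dg|exact: cdiff_ishift].
  - move=> v Iv; rewrite normcM normc_ishift.
    apply: le_trans (_ : K * (1 + normc v) ^+ N * expR (A * `|Im v|) * expR (- (A * Im v)) <= _).
      by rewrite ler_wpM2r ?expR_ge0.
    by rewrite (ger0_norm Iv) -mulrA -expRD subrr expR0 mulr1.
  - by move=> x; rewrite normcM normc_ishift/= mulr0 oppr0 expR0 mulr1.
by rewrite normcM normc_ishift expRN ler_pdivrMr ?expR_gt0.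
Qed.

Lemma pl_exptype A g (M : R) : 0 <= A -> exptype A g ->
  (forall x : R, normc (g x%:C) <= M) ->
  forall w, normc (g w) <= M * expR (A * `|Im w|).
Proof.
move=> A0 tg real w; have [Iw|Iw] := leP 0 (Im w); first by rewrite (ger0_norm Iw); exact: (pl_upper A0 tg real).
have := @pl_upper A (fun w => g (- w)) M A0 (exptype_opp tg) _ (- w).
rewrite opprK raddfN/= oppr_ge0 (ltW Iw) (ltr0_norm Iw); apply=> //.
by move=> x; have := real (- x); rewrite rmorphN.
Qed.

(** Two-constants estimate. The Poisson kernel U of the upper half-plane,
    lowered by T and scaled to be at least 1 on [-T,T], is at most 1/2 at height
    3T; multiplying by exp (- ln (M0/M1) (U + iV)) therefore trades the weaker
    bound on [-T,T] for a square root at that height. *)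
Lemma two_constants A g (T M0 M1 : R) : 0 <= A -> exptype A g -> 0 < T -> 0 < M1 -> M1 <= M0 ->
  (forall x : R, normc (g x%:C) <= M0) ->
  (forall x : R, T < `|x| -> normc (g x%:C) <= M1) ->
  normc (g 0) ^+ 2 <= expR (12 * A * T) * M0 * M1.
Proof.
move=> A0 tg T0 M10 M1M0 real0 real1.
have [dg [K K0 [N growth]]] := tg.
have M00 : 0 < M0 by exact: lt_le_trans M1M0.
pose k := ln (M0 / M1).
have Ek : expR k = M0 / M1 by rewrite lnK// posrE divr_gt0.
have k0 : 0 <= k by rewrite ln_ge0// ler_pdivlMr// mul1r.
pose D w : C := w + T%:C * 'i.
have ImD w : Im (D w) = Im w + T by rewrite /D cImD cImM/=; ring.
have ReD w : Re (D w) = Re w by rewrite /D cReD cReM/=; ring.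
have D0 w : 0 <= Im w -> D w != 0.
  by move=> Iw; apply/eqP => h; have := ImD w; rewrite h/= => /eqP; rewrite lt_eqF// ltr_wpDl.
(* Re Psi is the multiple of the Poisson kernel at height T that is 1 at the ends of [-T,T] *)
pose Psi w := (2 * T)%:C * 'i * (D w)^-1.
have RePsi w : 0 <= Im w -> Re (Psi w) = 2 * T * (Im w + T) / (Re w ^+ 2 + (Im w + T) ^+ 2).
  move=> Iw; rewrite /Psi -(ImD w) -(ReD w) !cReM !cImM cImV/=.
  by rewrite -[RHS]mulrA; move: (Im (D w) / _) (Re (D w)^-1) => x y; ring.
have P0 w : 0 <= Im w -> 0 <= Re (Psi w).
  move=> Iw; rewrite RePsi// divr_ge0 ?addr_ge0 ?sqr_ge0//.
  by rewrite mulr_ge0 ?addr_ge0 ?mulr_ge0// ltW.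
pose G w := g w * ishift A w * cexp ((- k)%:C * Psi w).
have nG w : normc (G w) = normc (g w) * expR (- (A * Im w)) * expR (- k * Re (Psi w)).
  by rewrite /G !normcM normc_ishift normc_cexp cReM/= mul0r subr0.
have e1 w : 0 <= Im w -> expR (- k * Re (Psi w)) <= 1.
  by move=> Iw; rewrite -expR0 ler_expR mulNr oppr_le0 mulr_ge0// P0.
have GM1 : forall w, 0 <= Im w -> normc (G w) <= M1.
  apply: (@pl_halfplane G K M1 N) => //.
  - move=> w Iw; apply: cdiffM.
      by apply: cdiffM; [exact: dg|exact: cdiff_ishift].
    apply: (@cdiff_comp _ (fun w => (- k)%:C * Psi w) cexp); last exact: cdiff_cexp.
    apply: cdiffM; first exact: cdiff_cst.
    apply: cdiffM; first exact: cdiff_cst.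
    apply: cdiffV; last exact: D0.
    by apply: cdiffD; [exact: cdiff_id|exact: cdiff_cst].
  - move=> w Iw; rewrite nG.
    apply: le_trans (_ : K * (1 + normc w) ^+ N * expR (A * `|Im w|) * expR (- (A * Im w)) * 1 <= _).
      apply: ler_pM; rewrite ?mulr_ge0 ?expR_ge0 ?normc_ge0//; last exact: e1.
      by rewrite ler_wpM2r ?expR_ge0.
    by rewrite (ger0_norm Iw) -mulrA mulr1 -mulrA -expRD subrr expR0 mulr1.
  - move=> x; have Ix : Im (x%:C : C) = 0 by [].
    rewrite nG Ix mulr0 oppr0 expR0 mulr1.
    have [xT|xT] := ltP T `|x|.
      apply: le_trans (_ : M1 * 1 <= _); last by rewrite mulr1.
      by apply: ler_pM; rewrite ?normc_ge0 ?expR_ge0// ?real1// e1// Ix.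
    have hP : 1 <= Re (Psi x%:C).
      rewrite RePsi//= add0r ler_pdivlMr ?mul1r; last first.
        by rewrite ltr_wpDl ?sqr_ge0// exprn_gt0.
      have : x ^+ 2 <= T ^+ 2 by rewrite -(real_normK (num_real x)) lerXn2r// nnegrE// ltW.
      clear; rewrite !expr2; move: (x * x) => y; lra.
    apply: le_trans (_ : M0 * expR (- k) <= _).
      apply: ler_pM; rewrite ?normc_ge0 ?expR_ge0//.
      by rewrite ler_expR mulNr lerN2 ler_peMr.
    by rewrite expRN Ek invf_div mulrC divfK// gt_eqF.
(* the bound on the line at height 3 T, from which one returns to 0 *)
pose B := M1 * expR (3 * A * T) * expR (k / 2).
have line (s : R) : normc (g (s%:C + (3 * T)%:C * 'i)) <= B.
  set w := s%:C + _.
  have Iw : Im w = 3 * T by rewrite /w cImD cImM/=; ring.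
  have Iw0 : 0 <= Im w by rewrite Iw mulr_ge0// ltW.
  have := GM1 w Iw0; rewrite nG Iw.
  have hP : Re (Psi w) <= 2^-1.
    rewrite RePsi// Iw ler_pdivrMr; last first.
      by rewrite ltr_wpDl ?sqr_ge0// exprn_gt0// addr_gt0// mulr_gt0.
    have := sqr_ge0 (Re w); move: (Re w ^+ 2) => y; clear -T0; rewrite !expr2 => *; nra.
  have hk : expR (- (k / 2)) <= expR (- k * Re (Psi w)).
    by rewrite ler_expR mulNr lerN2 ler_wpM2l.
  move=> h; have : normc (g w) * expR (- (A * (3 * T))) * expR (- (k / 2)) <= M1.
    by apply: le_trans h; rewrite ler_wpM2l// mulr_ge0 ?normc_ge0// expR_ge0.
  by rewrite !expRN !ler_pdivrMr ?expR_gt0// /B mulrAC (_ : A * (3 * T) = 3 * A * T)//; ring.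
have th : exptype A (fun w => g (w + (3 * T)%:C * 'i)).
  split.
    move=> w; apply: (@cdiff_comp _ (fun w => w + (3 * T)%:C * 'i) g) => //.
    by apply: cdiffD; [exact: cdiff_id|exact: cdiff_cst].
  exists (K * (1 + 3 * T) ^+ N * expR (A * (3 * T))).
    by rewrite !mulr_ge0 ?expR_ge0 ?exprn_ge0// addr_ge0// mulr_ge0// ltW.
  have T30 : 0 <= 3 * T by rewrite mulr_ge0// ltW.
  exists N => w; apply: le_trans (growth _) _.
  have n3 : normc ((3 * T)%:C * 'i) = 3 * T by rewrite normcM normci mulr1 normcR ger0_norm.
  have -> : K * (1 + 3 * T) ^+ N * expR (A * (3 * T)) * (1 + normc w) ^+ N * expR (A * `|Im w|) =
    (K * ((1 + 3 * T) * (1 + normc w)) ^+ N) * expR (A * (3 * T) + A * `|Im w|).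
    by rewrite exprMn expRD; ring.
  apply: ler_pM; rewrite ?mulr_ge0 ?expR_ge0 ?exprn_ge0 ?addr_ge0 ?normc_ge0//.
    rewrite ler_wpM2l// lerXn2r// ?nnegrE ?mulr_ge0 ?addr_ge0 ?normc_ge0//.
    have := le_normcD w ((3 * T)%:C * 'i); rewrite n3.
    have := normc_ge0 w; move: T30; clear.
    move: (3 * T) (normc w) (normc (_ + _)) => a b c *.
    by have : 0 <= a * b by [exact: mulr_ge0]; lra.
  rewrite ler_expR -mulrDr ler_wpM2l// cImD cImM/= !mulr1 !mul0r addr0.
  by rewrite addrC; apply: le_trans (ler_normD _ _) _; rewrite ger0_norm.
have := pl_exptype A0 th line (- ((3 * T)%:C * 'i)).
have -> : Im (- ((3 * T)%:C * 'i)) = - (3 * T) by rewrite /=; ring.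
have T30 : 0 <= 3 * T by rewrite mulr_ge0// ltW.
rewrite addNr normrN (ger0_norm T30) => h.
apply: le_trans (_ : (B * expR (A * (3 * T))) ^+ 2 <= _).
  by rewrite lerXn2r// ?nnegrE ?normc_ge0//; apply: le_trans h; exact: normc_ge0.
rewrite /B !exprMn -!expRM_natl.
have -> : 2 * (k / 2) = k by field.
rewrite Ek le_eqVlt; apply/orP; left; apply/eqP.
have -> : expR (12 * A * T) = expR (2 * (3 * A * T)) * expR (2 * (A * (3 * T))).
  by rewrite -expRD; congr expR; ring.
by rewrite expr2; field; rewrite gt_eqF.
Qed.

End phragmen_lindelof.

(** * Complex vectors and hermitian maps *)

Section vector_size.
Context {R : realType}.
Local Notation C := R[i].

(** A real-valued norm, equivalent to the Hilbert norm, for which real and imaginary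
    parts can be treated separately. *)
Definition cn k (z : 'rV[C]_k) : R := `|ReV z| + `|ImV z|.

Variable k : nat.
Implicit Types (z w : 'rV[C]_k) (x y : 'rV[R]_k).

Lemma ReVE z j : ReV z ord0 j = Re (z ord0 j). Proof. by rewrite mxE. Qed.

Lemma ImVE z j : ImV z ord0 j = Im (z ord0 j). Proof. by rewrite mxE. Qed.

Lemma ReVD z w : ReV (z + w) = ReV z + ReV w.
Proof. by apply/rowP => j; rewrite !mxE cReD. Qed.

Lemma ImVD z w : ImV (z + w) = ImV z + ImV w.
Proof. by apply/rowP => j; rewrite !mxE cImD. Qed.

Lemma ReVZ (a : C) z : ReV (a *: z) = Re a *: ReV z - Im a *: ImV z.
Proof. by apply/rowP => j; rewrite !mxE cReM. Qed.

Lemma ImVZ (a : C) z : ImV (a *: z) = Re a *: ImV z + Im a *: ReV z.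
Proof. by apply/rowP => j; rewrite !mxE cImM. Qed.

Lemma ReV_complexV x y : ReV (complexV x y) = x.
Proof. by apply/rowP => j; rewrite !mxE. Qed.

Lemma ImV_complexV x y : ImV (complexV x y) = y.
Proof. by apply/rowP => j; rewrite !mxE. Qed.

Lemma complexV_ReIm z : complexV (ReV z) (ImV z) = z.
Proof. by apply/rowP => j; rewrite !mxE; case: (z ord0 j). Qed.

Lemma eq_complexV z w : ReV z = ReV w -> ImV z = ImV w -> z = w.
Proof. by move=> e1 e2; rewrite -(complexV_ReIm z) e1 e2 complexV_ReIm. Qed.

Lemma ReV0 : ReV (0 : 'rV[C]_k) = 0. Proof. by apply/rowP => j; rewrite !mxE. Qed.

Lemma ImV0 : ImV (0 : 'rV[C]_k) = 0. Proof. by apply/rowP => j; rewrite !mxE. Qed.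

Lemma ReV_conj z : ReV (map_mx conjc z) = ReV z.
Proof. by apply/rowP => j; rewrite !mxE; case: (z ord0 j). Qed.

Lemma ImV_conj z : ImV (map_mx conjc z) = - ImV z.
Proof. by apply/rowP => j; rewrite !mxE; case: (z ord0 j). Qed.

Lemma cn_ge0 z : 0 <= cn z. Proof. by rewrite addr_ge0. Qed.

Lemma cn0 : cn (0 : 'rV[C]_k) = 0.
Proof. by rewrite /cn ReV0 ImV0 normr0 addr0. Qed.

Lemma cn_eq0 z : cn z = 0 -> z = 0.
Proof.
move=> /eqP; rewrite paddr_eq0// !normr_eq0 => /andP[/eqP h1 /eqP h2].
by apply: eq_complexV; rewrite ?h1 ?h2 ?ReV0 ?ImV0.
Qed.

Lemma cnD z w : cn (z + w) <= cn z + cn w.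
Proof.
rewrite /cn ReVD ImVD addrACA; apply: lerD; exact: ler_normD.
Qed.

Lemma cnZ (a : C) z : cn (a *: z) <= 2 * normc a * cn z.
Proof.
rewrite /cn ReVZ ImVZ.
have h1 := ler_normB (Re a *: ReV z) (Im a *: ImV z).
have h2 := ler_normD (Re a *: ImV z) (Im a *: ReV z).
rewrite !normrZ in h1 h2.
have r := ler_wpM2r (normr_ge0 (ReV z)) (normc_Re a).
have s := ler_wpM2r (normr_ge0 (ImV z)) (normc_Re a).
have t := ler_wpM2r (normr_ge0 (ReV z)) (normc_Im a).
have u := ler_wpM2r (normr_ge0 (ImV z)) (normc_Im a).
apply: le_trans (lerD h1 h2) _; rewrite mulrDr.
move: r s t u; clear; move: (normc a) `|Re a| `|Im a| `|ReV z| `|ImV z| => n a1 a2 b1 b2.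
move=> *; lra.
Qed.

Lemma cnZR (a : R) z : cn (a%:C *: z) = `|a| * cn z.
Proof.
by rewrite /cn ReVZ ImVZ /= !scale0r subr0 addr0 !normrZ mulrDr.
Qed.

Lemma cn_conj z : cn (map_mx conjc z) = cn z.
Proof. by rewrite /cn ReV_conj ImV_conj normrN. Qed.

Lemma cn_complexV x y : cn (complexV x y) = `|x| + `|y|.
Proof. by rewrite /cn ReV_complexV ImV_complexV. Qed.

Lemma le_coord_norm (x : 'rV[R]_k) j : `|x ord0 j| <= `|x|.
Proof.
have -> : `|x| = mx_norm x by [].
by rewrite /mx_norm; apply: (le_bigmax _ (fun ij => `|x ij.1 ij.2|%:nng) (ord0, j)).
Qed.

Lemma norm_rV_le (x : 'rV[R]_k) (M : R) : 0 <= M -> (forall j, `|x ord0 j| <= M) -> `|x| <= M.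
Proof.
move=> M0 H; have -> : `|x| = mx_norm x by [].
rewrite /mx_norm -[M]/(NngNum M0)%:num num_le; apply/bigmax_leP; split.
  by rewrite -num_le/=.
by move=> [i j] _; rewrite -num_le/= (ord1 i).
Qed.

Lemma cn_coord z j : normc (z ord0 j) <= cn z.
Proof.
apply: le_trans (normc_le _) _; rewrite /cn -ReVE -ImVE.
by apply: lerD; exact: le_coord_norm.
Qed.

Lemma norm_sum_le (I : finType) (F : I -> 'rV[C]_k) : cn (\sum_i F i) <= \sum_i cn (F i).
Proof.
elim/big_ind2 : _ => [|x1 x2 y1 y2 h1 h2|//]; first by rewrite cn0.
by apply: le_trans (cnD _ _) _; exact: lerD.
Qed.

Lemma pairing_le (l x : 'rV[R]_k) : `|pairing l x| <= k%:R * `|l| * `|x|.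
Proof.
rewrite /pairing; apply: le_trans (ler_norm_sum _ _ _) _.
apply: le_trans (_ : \sum_(j < k) `|l| * `|x| <= _).
  by apply: ler_sum => j _; rewrite normrM ler_pM// le_coord_norm.
by rewrite sumr_const card_ord -mulrA mulr_natl.
Qed.

Lemma pairingD (l x y : 'rV[R]_k) : pairing l (x + y) = pairing l x + pairing l y.
Proof. by rewrite /pairing -big_split/=; apply: eq_bigr => j _; rewrite mxE mulrDr. Qed.

Lemma pairingZ (l : 'rV[R]_k) (a : R) x : pairing l (a *: x) = a * pairing l x.
Proof. by rewrite /pairing mulr_sumr; apply: eq_bigr => j _; rewrite mxE mulrCA. Qed.

Lemma pairingDl (l l' x : 'rV[R]_k) : pairing (l + l') x = pairing l x + pairing l' x.
Proof. by rewrite /pairing -big_split/=; apply: eq_bigr => j _; rewrite mxE mulrDl. Qed.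

Lemma pairingZl (a : R) (l x : 'rV[R]_k) : pairing (a *: l) x = a * pairing l x.
Proof. by rewrite /pairing mulr_sumr; apply: eq_bigr => j _; rewrite mxE mulrA. Qed.

Lemma pairing_delta (x : 'rV[R]_k) j : pairing (delta_mx ord0 j) x = x ord0 j.
Proof.
rewrite /pairing (bigD1 j)//= mxE !eqxx mul1r big1 ?addr0// => i ij.
by rewrite mxE eqxx/= (negbTE ij) mul0r.
Qed.

Lemma normr_pairing_delta (l : 'rV[R]_k) j : pairing l (delta_mx ord0 j) = l ord0 j.
Proof.
rewrite /pairing (bigD1 j)//= mxE !eqxx mulr1 big1 ?addr0// => i ij.
by rewrite mxE eqxx/= (negbTE ij) mulr0.
Qed.

End vector_size.

Section hermitian.
Context {R : realType} {n m : nat}.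
Local Notation C := R[i].
Variable Phi : Espace R n -> Espace R n -> FCspace R m.
Hypothesis hPhi : hermitian_map Phi.
Implicit Types (a b : Espace R n).

Lemma PhiDl a a' b : Phi (a + a') b = Phi a b + Phi a' b.
Proof. by have := hPhi.1 b 1 a a'; rewrite !scale1r. Qed.

Lemma Phi0l b : Phi 0 b = 0.
Proof. by apply: (addrI (Phi 0 b)); rewrite -PhiDl !addr0. Qed.

Lemma PhiZl k a b : Phi (k *: a) b = k *: Phi a b.
Proof. by have := hPhi.1 b k a 0; rewrite Phi0l !addr0. Qed.

Lemma PhiC a b : Phi a b = map_mx conjc (Phi b a).
Proof. exact: hPhi.2. Qed.

Lemma PhiDr a b b' : Phi a (b + b') = Phi a b + Phi a b'.
Proof. by rewrite PhiC PhiDl map_mxD -!PhiC. Qed.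

Lemma PhiZr k a b : Phi a (k *: b) = k^* *: Phi a b.
Proof. by rewrite PhiC PhiZl map_mxZ -PhiC. Qed.

Lemma Phi0r a : Phi a 0 = 0.
Proof. by rewrite PhiC Phi0l map_mx0. Qed.

Lemma PhiNl a b : Phi (- a) b = - Phi a b.
Proof. by rewrite -scaleN1r PhiZl scaleN1r. Qed.

Lemma PhiNr a b : Phi a (- b) = - Phi a b.
Proof. by rewrite PhiC PhiNl map_mxN -PhiC. Qed.

Lemma ReV_PhiC a b : ReV (Phi b a) = ReV (Phi a b).
Proof. by rewrite PhiC ReV_conj. Qed.

Lemma ImV_PhiC a b : ImV (Phi b a) = - ImV (Phi a b).
Proof. by rewrite PhiC ImV_conj. Qed.

Lemma ImV_Phi_diag a : ImV (Phi a a) = 0.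
Proof.
have := ImV_PhiC a a => /eqP; rewrite -addr_eq0 -mulr2n -scaler_nat scaler_eq0 pnatr_eq0/=.
by move/eqP.
Qed.

Lemma quadD a b : quad Phi (a + b) = quad Phi a + quad Phi b + 2 *: ReV (Phi a b).
Proof.
rewrite /quad PhiDl !PhiDr !ReVD (ReV_PhiC a b) scaler_nat mulr2n.
by rewrite -!addrA; congr (_ + _); rewrite addrCA addrA addrC addrA.
Qed.

Lemma quadZ (t : R) a : quad Phi (t%:C *: a) = (t ^+ 2) *: quad Phi a.
Proof.
by rewrite /quad PhiZl PhiZr scalerA ReVZ/= oppr0 !mulr0 mul0r addr0 subr0 scale0r subr0.
Qed.

Lemma quad0 : quad Phi 0 = 0.
Proof. by rewrite /quad Phi0l ReV0. Qed.

Lemma Phi_expand c b : Phi c b = \sum_(j < n) c ord0 j *: Phi (delta_mx ord0 j) b.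
Proof.
rewrite {1}(row_sum_delta c); elim/big_ind2 : _ => [|x1 x2 y1 y2 <- <-|j _].
- by rewrite Phi0l.
- by rewrite PhiDl.
- by rewrite PhiZl.
Qed.

(** Expand both arguments in the coordinate basis. *)
Lemma Phi_bound : exists2 B : R, 0 <= B & forall a b, cn (Phi a b) <= B * cn a * cn b.
Proof.
pose B0 := \sum_(j < n) \sum_(k < n) cn (Phi (delta_mx ord0 k) (delta_mx ord0 j)).
have B00 : 0 <= B0 by apply: sumr_ge0 => j _; apply: sumr_ge0 => k _; exact: cn_ge0.
exists (4 * B0); first by rewrite mulr_ge0.
move=> a b; rewrite Phi_expand; apply: le_trans (norm_sum_le _) _.
rewrite -[leRHS]mulrA [4 * B0]mulrC -mulrA mulr_suml; apply: ler_sum => j _.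
apply: le_trans (cnZ _ _) _.
have -> : cn (Phi (delta_mx ord0 j) b) = cn (Phi b (delta_mx ord0 j)).
  by rewrite [in LHS]PhiC cn_conj.
have Sj0 : 0 <= \sum_(k < n) cn (Phi (delta_mx ord0 k) (delta_mx ord0 j)).
  by apply: sumr_ge0 => k _; exact: cn_ge0.
have h : cn (Phi b (delta_mx ord0 j)) <=
    2 * cn b * \sum_(k < n) cn (Phi (delta_mx ord0 k) (delta_mx ord0 j)).
  rewrite Phi_expand; apply: le_trans (norm_sum_le _) _.
  rewrite mulr_sumr; apply: ler_sum => k _; apply: le_trans (cnZ _ _) _.
  by rewrite ler_wpM2r ?cn_ge0// ler_wpM2l// cn_coord.
have h2 : 2 * normc (a ord0 j) <= 2 * cn a by rewrite ler_wpM2l// cn_coord.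
apply: le_trans (_ : 2 * cn a * (2 * cn b *
   \sum_(k < n) cn (Phi (delta_mx ord0 k) (delta_mx ord0 j))) <= _).
  by apply: ler_pM; rewrite ?cn_ge0// mulr_ge0 ?normc_ge0.
by rewrite le_eqVlt; apply/orP; left; apply/eqP; ring.
Qed.

Lemma quad_bound (B : R) : (forall a b, cn (Phi a b) <= B * cn a * cn b) ->
  forall a, `|quad Phi a| <= B * cn a * cn a.
Proof. by move=> H a; apply: le_trans (H a a); rewrite /quad /cn lerDl. Qed.

End hermitian.

(** * The action of N and functions of exponential type *)

Lemma ImVN {R : realType} k (z : 'rV[R[i]]_k) : ImV (- z) = - ImV z.
Proof. by apply/rowP => j; rewrite !mxE; case: (z ord0 j). Qed.

Section siegel.
Context {R : realType} {n m : nat}.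
Local Notation C := R[i].
Variable Phi : Espace R n -> Espace R n -> FCspace R m.
Hypothesis hPhi : hermitian_map Phi.
Implicit Types (a b : Ngroup R n m) (q v : EFC R n m) (f : EFC R n m -> C).

(** The point of the boundary rho = 0 with coordinates a. *)
Definition bpt a : EFC R n m := (a.1, complexV a.2 (quad Phi a.1)).
(** The coordinates of the projection to the boundary along the directions i F. *)
Definition base q : Ngroup R n m := (q.1, ReV q.2).
Definition invN a : Ngroup R n m := (- a.1, - a.2).
(** The size of displacements in the vector space E x F_C; complex lines and
    Schwarz's lemma refer to it, not to the left-invariant distance. *)
Definition esize q : R := cn q.1 + cn q.2.

(** The action of N on E x F_C by left translations; it preserves rho. *)
Definition tau a q : EFC R n m :=
  (a.1 + q.1, q.2 + complexV a.2 (quad Phi a.1) + (0 +i* 2) *: Phi q.1 a.1).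

(** The linear part of the affine map tau a. *)
Definition tau_lin a v : EFC R n m := (v.1, v.2 + (0 +i* 2) *: Phi v.1 a.1).

Lemma esize_ge0 q : 0 <= esize q.
Proof. by rewrite addr_ge0 ?cn_ge0. Qed.

Lemma esize_eq0 q : esize q = 0 -> q = 0.
Proof.
move=> /eqP; rewrite paddr_eq0 ?cn_ge0// => /andP[/eqP/cn_eq0 h1 /eqP/cn_eq0 h2].
by case: q h1 h2 => x y /= -> ->.
Qed.

Lemma esizeD q v : esize (q + v) <= esize q + esize v.
Proof. by rewrite /esize [leRHS]addrACA; apply: lerD; [exact: (cnD q.1 v.1)|exact: (cnD q.2 v.2)]. Qed.

Lemma esizeZ (w : C) v : esize (w *: v) <= 2 * normc w * esize v.
Proof. by rewrite /esize mulrDr; apply: lerD; [exact: (cnZ w v.1)|exact: (cnZ w v.2)]. Qed.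

Lemma esizeZR (t : R) v : esize (t%:C *: v) = `|t| * esize v.
Proof. by rewrite /esize mulrDr -(cnZR t v.1) -(cnZR t v.2). Qed.

Lemma slice0E f a : slice Phi f 0 a = f (bpt a).
Proof. by rewrite /slice addr0. Qed.

Lemma rho_bpt a : rho Phi (bpt a) = 0.
Proof. by rewrite /rho ImV_complexV subrr. Qed.

Lemma base_bpt a : base (bpt a) = a.
Proof. by case: a => z x; rewrite /base ReV_complexV. Qed.

Lemma tau_line a q (w : C) v : tau a (q + w *: v) = tau a q + w *: tau_lin a v.
Proof.
congr pair; first by rewrite /= addrA.
change ((q.2 + w *: v.2) + complexV a.2 (quad Phi a.1) +
  (0 +i* 2) *: Phi (q.1 + w *: v.1) a.1 =
  (q.2 + complexV a.2 (quad Phi a.1) + (0 +i* 2) *: Phi q.1 a.1) +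
  w *: (v.2 + (0 +i* 2) *: Phi v.1 a.1)).
rewrite (PhiDl hPhi) (PhiZl hPhi) !scalerDr !scalerA [_ * w]mulrC -!addrA; congr (_ + _).
by rewrite addrCA; congr (_ + _); rewrite addrCA.
Qed.

Lemma rho_tau a q : rho Phi (tau a q) = rho Phi q.
Proof.
rewrite /rho /= (quadD hPhi) !ImVD ImV_complexV ImVZ/= scale0r add0r (ReV_PhiC hPhi q.1 a.1).
move: (ImV q.2) (quad _ a.1) (quad _ q.1) (2 *: ReV _) => x y z t.
by apply/rowP => j; rewrite !mxE; ring.
Qed.

Lemma base_tau a q : base (tau a q) = mulN Phi a (base q).
Proof.
rewrite /base /mulN /tau /=; congr pair.
rewrite !ReVD ReV_complexV ReVZ/= scale0r sub0r (ImV_PhiC hPhi q.1 a.1) scalerN.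
by rewrite [ReV q.2 + _]addrC.
Qed.

Lemma eqEFC q v : base q = base v -> rho Phi q = rho Phi v -> q = v.
Proof.
case: q v => [z w] [z' w'] [/= <-] h; rewrite /rho/= => /addIr h2.
by congr pair; exact: eq_complexV.
Qed.

Lemma tau_bpt a b : tau a (bpt b) = bpt (mulN Phi a b).
Proof.
by apply: eqEFC; [rewrite base_tau !base_bpt|rewrite rho_tau !rho_bpt].
Qed.

Lemma mulNA a b (c : Ngroup R n m) : mulN Phi a (mulN Phi b c) = mulN Phi (mulN Phi a b) c.
Proof.
rewrite /mulN/=; congr pair; first by rewrite addrA.
rewrite (PhiDl hPhi) (PhiDr hPhi) !ImVD !scalerDr.
move: a.2 b.2 c.2 (2 *: ImV _) (2 *: ImV _) (2 *: ImV _) => x y z r s t.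
by apply/rowP => j; rewrite !mxE; ring.
Qed.

Lemma mulVN a : mulN Phi (invN a) a = 0.
Proof.
by rewrite /mulN/= !addNr (PhiNl hPhi) ImVN (ImV_Phi_diag hPhi) oppr0 scaler0 addr0.
Qed.

Lemma mulNV a : mulN Phi a (invN a) = 0.
Proof.
by rewrite /mulN/= !subrr (PhiNr hPhi) ImVN (ImV_Phi_diag hPhi) oppr0 scaler0 addr0.
Qed.

Lemma mul0N a : mulN Phi 0 a = a.
Proof. by case: a => z x; rewrite /mulN/= (Phi0l hPhi) ImV0 scaler0 addr0 !add0r. Qed.

Lemma mulN0 a : mulN Phi a 0 = a.
Proof. by case: a => z x; rewrite /mulN/= (Phi0r hPhi) ImV0 scaler0 !addr0. Qed.

Lemma tauA a b q : tau a (tau b q) = tau (mulN Phi a b) q.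
Proof. by apply: eqEFC; [rewrite !base_tau mulNA|rewrite !rho_tau]. Qed.

Lemma tau0 q : tau 0 q = q.
Proof. by apply: eqEFC; [rewrite base_tau mul0N|rewrite rho_tau]. Qed.

Lemma tauK a q : tau a (tau (invN a) q) = q.
Proof. by rewrite tauA mulNV tau0. Qed.

Lemma bpt0 : bpt 0 = 0.
Proof.
by rewrite /bpt/= (quad0 hPhi); congr pair; apply: eq_complexV; rewrite ?ReV_complexV ?ImV_complexV ?ReV0 ?ImV0.
Qed.

Lemma tau_0 a : tau a 0 = bpt a.
Proof. by rewrite -bpt0 tau_bpt mulN0. Qed.

Lemma rho_le (B : R) q : 0 <= B -> (forall z z', cn (Phi z z') <= B * cn z * cn z') ->
  `|rho Phi q| <= esize q + B * esize q ^+ 2.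
Proof.
move=> B0 HB; apply: le_trans (ler_normB _ _) _; apply: lerD.
  by apply: le_trans (_ : cn q.2 <= _); rewrite /cn /esize ?lerDr// ?cn_ge0.
apply: le_trans (quad_bound HB _) _; rewrite -mulrA ler_wpM2l// -expr2.
by rewrite lerXn2r// ?nnegrE ?cn_ge0 ?esize_ge0// lerDl cn_ge0.
Qed.


(** What is used of the elements of Hol_K: holomorphy along complex lines and
    at most exponential growth of type A off the boundary {rho = 0}, polynomial
    along it. *)
Definition expclass (A : R) f := (forall q v w, cdiff (fun w => f (q + w *: v)) w) /\
  exists2 K : R, 0 <= K & exists N : nat, forall q,
    normc (f q) <= K * (1 + esize q) ^+ N * expR (A * `|rho Phi q|).

Lemma addr1_ge0 (x : R) : 0 <= x -> 0 <= 1 + x.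
Proof. by move=> x0; rewrite addr_ge0. Qed.

Lemma normc_2i : normc (0 +i* 2 : C) = 2.
Proof. by rewrite /= expr0n/= add0r sqrtr_sqr ger0_norm. Qed.

Lemma tau_affine a q : tau a q = bpt a + tau_lin a q.
Proof. by have := tau_line a 0 1 q; rewrite !scale1r add0r tau_0. Qed.

(** Translations distort sizes by a factor that grows linearly in the size of a;
    the polynomial factor in the class tolerates this. *)
Lemma esize_tau_lin (B : R) a : 0 <= B -> (forall z z', cn (Phi z z') <= B * cn z * cn z') ->
  forall q, esize (tau_lin a q) <= (1 + 4 * B * cn a.1) * esize q.
Proof.
move=> B0 HB q.
have h : cn (tau_lin a q).2 <= cn q.2 + 4 * B * cn q.1 * cn a.1.
  apply: le_trans (cnD _ _) _; apply: lerD => //.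
  apply: le_trans (cnZ _ _) _; rewrite normc_2i.
  by have := HB q.1 a.1; clear; move: (cn (Phi _ _)) (cn q.1) (cn a.1) => x y z h; lra.
rewrite /esize -[(tau_lin a q).1]/(q.1); apply: le_trans (lerD (lexx _) h) _.
have := cn_ge0 q.2; have := cn_ge0 a.1; have := cn_ge0 q.1.
move: (cn q.1) (cn q.2) (cn a.1) B0; clear => x y z B0 x0 z0 y0.
have : 0 <= B * z * y by rewrite !mulr_ge0.
lra.
Qed.

(** The class is invariant under N because translations preserve rho; only the
    constant of the polynomial factor changes. *)
Lemma expclass_tau A f a : expclass A f -> expclass A (fun q => f (tau a q)).
Proof.
move=> [hol [K K0 [N gr]]]; split.
  move=> q v w; apply: (@cdiff_eq _ (fun w => f (tau a q + w *: tau_lin a v))); last first.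
    by move=> w'; rewrite tau_line.
  exact: hol.
have [B B0 HB] := Phi_bound hPhi.
pose c := esize (bpt a) + (1 + 4 * B * cn a.1).
have c0 : 0 <= c.
  by rewrite /c !addr_ge0 ?cn_ge0// !mulr_ge0// cn_ge0.
exists (K * (1 + c) ^+ N); first by rewrite mulr_ge0// exprn_ge0// addr_ge0.
exists N => q; apply: le_trans (gr _) _; rewrite rho_tau ler_wpM2r ?expR_ge0//.
rewrite -mulrA -exprMn ler_wpM2l// lerXn2r// ?nnegrE.
- by apply: addr1_ge0; exact: esize_ge0.
- by apply: mulr_ge0; apply: addr1_ge0 => //; exact: esize_ge0.
rewrite tau_affine; have h1 := esizeD (bpt a) (tau_lin a q).
have h2 := esize_tau_lin a B0 HB q.
have h3 : 0 <= 4 * B * cn a.1 by rewrite !mulr_ge0// cn_ge0.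
have := esize_ge0 q; have := esize_ge0 (bpt a); move: h1 h2 h3; rewrite /c; clear.
move: (esize (bpt a + _)) (esize (tau_lin a q)) (esize (bpt a)) (esize q) (4 * B * _) => x y z t u.
move=> h1 h2 h3 h4 h5; have : 0 <= z * t by exact: mulr_ge0.
lra.
Qed.

Lemma expclassM A B f g : 0 <= A -> 0 <= B -> expclass A f -> expclass B g ->
  expclass (A + B) (fun q => f q * g q).
Proof.
move=> A0 B0 [hf [K K0 [N gf]]] [hg [L L0 [N' gg]]]; split.
  by move=> q v w; exact: cdiffM.
exists (K * L); first exact: mulr_ge0.
exists (N + N')%N => q; rewrite normcM exprD mulrDl expRD.
rewrite [leRHS](_ : _ = (K * (1 + esize q) ^+ N * expR (A * `|rho Phi q|)) *
  (L * (1 + esize q) ^+ N' * expR (B * `|rho Phi q|))); last by ring.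
by apply: ler_pM; rewrite ?normc_ge0.
Qed.

Lemma expclassW A B f : A <= B -> expclass A f -> expclass B f.
Proof.
move=> AB [hf [K K0 [N gf]]]; split => //; exists K => //; exists N => q.
apply: le_trans (gf q) _; rewrite ler_wpM2l ?ler_expR ?ler_wpM2r//.
by rewrite mulr_ge0// exprn_ge0// addr_ge0// ?esize_ge0.
Qed.

(** The direction v of F, embedded in E x F_C: the complex line through a boundary
    point in this direction meets the boundary in its real points. *)
Definition fdir (v : Fspace R m) : EFC R n m := (0, complexV v 0).

Lemma rho_fdir b (w : C) (v : Fspace R m) : rho Phi (bpt b + w *: fdir v) = Im w *: v.
Proof.
have -> : rho Phi (bpt b + w *: fdir v) =
   ImV (complexV b.2 (quad Phi b.1) + w *: complexV v 0) - quad Phi (b.1 + w *: 0) by [].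
rewrite scaler0 addr0 ImVD ImV_complexV ImVZ ReV_complexV ImV_complexV scaler0 add0r.
by rewrite addrAC subrr add0r.
Qed.

(** Along this complex line rho is Im w times v, so restriction gives an entire
    function of exponential type in one variable. *)
Lemma exptype_fdir A f b (v : Fspace R m) : 0 <= A -> expclass A f ->
  exptype (A * `|v|) (fun w => f (bpt b + w *: fdir v)).
Proof.
move=> A0 [hol [K K0 [N gr]]]; split; first by move=> w; exact: hol.
pose c := esize (bpt b) + 2 * esize (fdir v).
have c0 : 0 <= c by rewrite addr_ge0 ?mulr_ge0 ?esize_ge0.
exists (K * (1 + c) ^+ N); first by rewrite mulr_ge0// exprn_ge0// addr_ge0.
exists N => w; apply: le_trans (gr _) _.
rewrite rho_fdir normrZ (mulrAC A) -(mulrA A) ler_wpM2r ?expR_ge0//.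
rewrite -mulrA -exprMn ler_wpM2l// lerXn2r// ?nnegrE.
- by apply: addr1_ge0; exact: esize_ge0.
- by apply: mulr_ge0; apply: addr1_ge0 => //; exact: normc_ge0.
have h1 := esizeD (bpt b) (w *: fdir v); have h2 := esizeZ w (fdir v).
have h3 := esize_ge0 (bpt b); have h4 := esize_ge0 (fdir v); have h5 := normc_ge0 w.
move: h1 h2 h3 h4 h5; rewrite /c; clear.
move: (esize _) (esize (_ *: _)) (esize _) (esize _) (normc w) => x y z t u h1 h2 h3 h4 h5.
have : 0 <= z * u by exact: mulr_ge0.
lra.
Qed.

Lemma bpt_fdir b (s : R) (v : Fspace R m) : bpt b + s%:C *: fdir v = bpt (b.1, b.2 + s *: v).
Proof.
apply: eqEFC; last by rewrite rho_fdir rho_bpt /= scale0r.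
have -> : base (bpt b + s%:C *: fdir v) =
   (b.1 + s%:C *: 0, ReV (complexV b.2 (quad Phi b.1) + s%:C *: complexV v 0)) by [].
rewrite base_bpt scaler0 addr0 ReVD ReV_complexV ReVZ ReV_complexV ImV_complexV.
by rewrite scaler0 subr0.
Qed.

(** Every point is reached from its projection to the boundary by the imaginary
    direction rho(q). *)
Lemma fdir_height q : q = bpt (base q) + 'i *: fdir (rho Phi q).
Proof.
apply: eqEFC; last by rewrite rho_fdir scale1r.
have -> : base (bpt (base q) + 'i *: fdir (rho Phi q)) =
   (q.1 + 'i *: 0, ReV (complexV (ReV q.2) (quad Phi q.1) + 'i *: complexV (rho Phi q) 0)) by [].
rewrite scaler0 addr0 ReVD ReV_complexV ReVZ ReV_complexV ImV_complexV.
by rewrite scaler0 subr0 scale0r addr0.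
Qed.

(** A function of type A that is bounded on the boundary is controlled in the
    interior: Phragmen-Lindelof on the complex line in the direction rho(q). *)
Lemma strip_bound A f (M : R) : 0 <= A -> expclass A f ->
  (forall a, normc (f (bpt a)) <= M) ->
  forall q, normc (f q) <= M * expR (A * `|rho Phi q|).
Proof.
move=> A0 cf bd q.
have tg := exptype_fdir (base q) (rho Phi q) A0 cf.
have := @pl_exptype _ _ _ M _ tg _ 'i; rewrite -fdir_height /= normr1 mulr1; apply.
  by rewrite mulr_ge0.
by move=> x; rewrite bpt_fdir.
Qed.

(** The complex linear extension of the form l on F, as a function on E x F_C. *)
Definition uc (l : Fspace R m) q : C := \sum_j (l ord0 j)%:C * q.2 ord0 j.

Lemma Re_uc l q : Re (uc l q) = pairing l (ReV q.2).
Proof.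
rewrite /uc /pairing; elim/big_rec2 : _ => //= j x y _ <-.
by rewrite cReD cReM/= mul0r subr0 mxE.
Qed.

Lemma Im_uc l q : Im (uc l q) = pairing l (ImV q.2).
Proof.
rewrite /uc /pairing; elim/big_rec2 : _ => //= j x y _ <-.
by rewrite cImD cImM/= mul0r addr0 mxE.
Qed.

Lemma uc_line l q v (w : C) : uc l (q + w *: v) = uc l q + w * uc l v.
Proof.
rewrite /uc mulr_sumr -big_split/=; apply: eq_bigr => j _.
have -> : (q + w *: v).2 ord0 j = q.2 ord0 j + w * v.2 ord0 j.
  by rewrite -[(q + w *: v).2]/(q.2 + w *: v.2) !mxE.
by rewrite mulrDr mulrCA.
Qed.

Lemma Re_uc_bpt l a : Re (uc l (bpt a)) = pairing l a.2.
Proof. by rewrite Re_uc ReV_complexV. Qed.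

Lemma Im_uc_bpt l a : Im (uc l (bpt a)) = pairing l (quad Phi a.1).
Proof. by rewrite Im_uc ImV_complexV. Qed.

(** The sup over the boundary is comparable to the sup over the part of the
    boundary where the linear form u is large: on each real line transversal to
    u = const only a bounded segment is lost. *)
Lemma sup_removal (l e : Fspace R m) A f (T M1 : R) : 0 <= A -> expclass A f -> 0 < T ->
  pairing l e = 1 -> (exists M, forall a, normc (f (bpt a)) <= M) -> 0 < M1 ->
  (forall a, T < normc (uc l (bpt a)) -> normc (f (bpt a)) <= M1) ->
  forall a, normc (f (bpt a)) <= expR (12 * (A * `|e|) * (2 * T)) * M1.
Proof.
move=> A0 cf T0 le1 [M HM] M10 H1.
pose E := [set normc (f (bpt a)) | a in setT].
have E0 : E !=set0 by exists (normc (f (bpt 0))); exists 0.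
have bE : has_ubound E by exists M => _ [a _ <-].
pose M0 := sup E.
have fM0 a : normc (f (bpt a)) <= M0 by apply: ub_le_sup => //; exists a.
set c := expR _.
have c1 : 1 <= c.
  by rewrite /c -expR0 ler_expR !mulr_ge0// ltW.
have [M01|M10'] := leP M0 M1.
  move=> a; apply: le_trans (fM0 a) _; apply: le_trans M01 _.
  by rewrite ler_peMl// ltW.
(* M0^2 <= c M1 M0 gives M0 <= c M1; finiteness of M0 is essential *)
suff key a : normc (f (bpt a)) ^+ 2 <= c * M1 * M0.
  have M00 : 0 < M0 by exact: lt_trans M10'.
  suff : M0 <= c * M1 by move=> h a; exact: le_trans (fM0 a) h.
  rewrite leNgt; apply/negP => big.
  have : ~ ubound E ((M0 + c * M1) / 2).
    by move=> /(ge_sup E0); rewrite -/M0 leNgt => /negP; apply; lra.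
  apply=> _ [a _ <-]; rewrite -(@ler_pXn2r _ 2)// ?nnegrE ?normc_ge0//; last first.
    by rewrite divr_ge0// addr_ge0 ?ltW// mulr_gt0// (lt_le_trans ltr01 c1).
  apply: le_trans (key a) _; rewrite expr2.
  have k0 : 0 < c * M1 by rewrite mulr_gt0// (lt_le_trans ltr01 c1).
  move: (c * M1) k0 big; clear => k k0 big.
  have : 0 <= (M0 - k) * (M0 - k) by rewrite -expr2 sqr_ge0.
  lra.
have [ua|ua] := ltP T (normc (uc l (bpt a))).
  have h := H1 _ ua; rewrite expr2; apply: le_trans (_ : M1 * M0 <= _).
    by apply: ler_pM; rewrite ?normc_ge0.
  by rewrite ler_wpM2r// ?ler_peMl// ltW// (lt_trans M10).
have tg := exptype_fdir a e A0 cf.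
have := @two_constants _ _ _ (2 * T) M0 M1 _ tg _ M10 (ltW M10') _ _.
rewrite scale0r addr0 -/c mulrAC; apply.
- by rewrite mulr_ge0.
- by rewrite mulr_gt0.
- by move=> x; rewrite bpt_fdir.
- move=> x xT; rewrite bpt_fdir; apply: H1; rewrite -bpt_fdir uc_line.
  have -> : uc l (fdir e) = 1.
    apply/eqP; rewrite eq_complex Re_uc Im_uc ReV_complexV ImV_complexV le1 eqxx/=.
    by rewrite /pairing big1// => j _; rewrite mxE mulr0.
  have := ler_normcB (x%:C) (- uc l (bpt a)); rewrite normcR normcN opprK mulr1 [x%:C + _]addrC.
  move: (normc (_ + _)) (normc (uc _ _)) `|x| ua xT; clear => s t X ht hX h; lra.
Qed.

(** A size of displacements for which rho remains at most 1. *)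
Definition kappa (B : R) : R := (4 * (1 + B))^-1.

Lemma rho_small (B : R) q : 0 <= B -> (forall z z', cn (Phi z z') <= B * cn z * cn z') ->
  esize q <= 2 * kappa B -> `|rho Phi q| <= 1.
Proof.
move=> B0 HB sq; apply: le_trans (rho_le q B0 HB) _.
have s0 := esize_ge0 q.
have B1 : 0 < 1 + B by rewrite ltr_wpDr.
have k0 : 0 < kappa B by rewrite invr_gt0 mulr_gt0.
have k1 : kappa B * (1 + B) = 4^-1 by rewrite /kappa; field; rewrite gt_eqF.
move: sq s0 k0 k1 B0; move: (esize q) (kappa B); clear => s k sk s0 k0 k1 B0.
have k4 : k <= 4^-1 by have := mulr_ge0 (ltW k0) B0; lra.
have : s ^+ 2 <= s * 1 by rewrite expr2 ler_wpM2l//; lra.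
rewrite mulr1 => s2.
have : B * s ^+ 2 <= B * s by rewrite ler_wpM2l.
have : B * s <= B * (2 * k) by rewrite ler_wpM2l.
lra.
Qed.

(** Schwarz's lemma on complex lines: on small translates of the origin the
    oscillation is controlled by the sup. *)
Lemma oscillation (k M t : R) f a : (forall q v w, cdiff (fun w => f (q + w *: v)) w) -> 0 < k ->
  (forall q, esize q <= 2 * k -> normc (f (tau a q)) <= M) ->
  t <= 1 -> forall q, esize q <= t * k -> normc (f (tau a q) - f (bpt a)) <= 4 * M * t.
Proof.
move=> hol k0 bd t1 q qt.
have t0 : 0 <= t by rewrite -(pmulr_lge0 _ k0); exact: le_trans (esize_ge0 _) qt.
have [tz|tn0] := eqVneq t 0.
  move: qt; rewrite tz mul0r => q0.
  have -> : q = 0 by apply: esize_eq0; apply/eqP; rewrite eq_le q0 esize_ge0.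
  by rewrite tau_0 subrr ComplexField.Normc.normc0 mulr0.
pose v := (t^-1)%:C *: q.
have sv : esize v <= k.
  rewrite /v esizeZR ger0_norm ?invr_ge0// mulrC ler_pdivrMr ?lt_neqAle ?t0 ?andbT 1?eq_sym//.
  by rewrite mulrC.
have := @schwarz _ (fun w => f (tau a (0 + w *: v))) M _ _ t%:C.
have -> : 0 + t%:C *: v = q.
  by rewrite add0r /v scalerA -rmorphM/= divff// scale1r.
rewrite scale0r addr0 tau_0 normcR ger0_norm//; apply => //.
- move=> w; apply: (@cdiff_eq _ (fun w => f (tau a 0 + w *: tau_lin a v))).
    exact: hol.
  by move=> w'; rewrite tau_line.
- move=> w w1; rewrite add0r; apply: bd; apply: le_trans (esizeZ _ _) _.
  apply: le_trans (_ : 2 * 1 * k <= _); last by rewrite mulr1.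
  by apply: ler_pM; rewrite ?esize_ge0// ?mulr_ge0 ?normc_ge0// ler_wpM2l.
Qed.

End siegel.

(** * Lebesgue measure in coordinates *)

Section sigma_finite_product.
Context d1 d2 (T1 : measurableType d1) (T2 : measurableType d2) (R : realType).
Variables (m1 : {sigma_finite_measure set T1 -> \bar R})
          (m2 : {sigma_finite_measure set T2 -> \bar R}).

(** The product of two sigma-finite measures, repackaged with its own
    sigma-finiteness so that Tonelli's theorem applies to it again. *)
Definition sfprod : set (T1 * T2) -> \bar R := (m1 \x m2)%E.

HB.instance Definition _ := Measure.on sfprod.

Let sfprod_sigma_finite : sigma_finite setT sfprod.
Proof.
have [F FT Fm] := sigma_finiteT m1; have [G GT Gm] := sigma_finiteT m2.
pose H k := if @unpickle (nat * nat)%type k is Some ij then F ij.1 `*` G ij.2 else set0.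
exists H => [|k].
  apply/esym/seteqP; split => // -[x y] _.
  have [i _ Fx] : (\bigcup_i F i) x by rewrite -FT.
  have [j _ Gy] : (\bigcup_j G j) y by rewrite -GT.
  by exists (pickle (i, j)) => //; rewrite /H pickleK.
rewrite /H; case: unpickle => [[i j]|]; last by rewrite measure0.
have [mF Foo] := Fm i; have [mG Goo] := Gm j.
split; first exact: measurableX.
by rewrite /= /sfprod product_measure1E// lte_mul_pinfty// ge0_fin_numE.
Qed.

HB.instance Definition _ := Measure_isSigmaFinite.Build _ _ _ sfprod sfprod_sigma_finite.

End sigma_finite_product.

Section tuple_measure.
Context {R : realType}.
Local Open Scope ereal_scope.

Lemma integral_lebesgue_shift (h : measurableTypeR R -> \bar R) (c : R) :
  measurable_fun setT h -> (forall x, 0 <= h x) ->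
  \int[@lebesgue_measure R]_x h (x + c)%R = \int[@lebesgue_measure R]_x h x.
Proof.
move=> mh h0.
have ms : measurable_fun setT (fun x : measurableTypeR R => (x + c)%R : measurableTypeR R).
  by apply: measurable_funD => //; exact: measurable_cst.
rewrite [RHS](_ : _ = \int[pushforward (@lebesgue_measure R) (fun x => (x + c)%R : measurableTypeR R)]_x h x).
  by rewrite (ge0_integral_pushforward ms)// preimage_setT.
apply: eq_measure_integral => A mA _; apply: lebesgue_measure_unique => //= _ [[a b]] _ <-.
rewrite /pushforward.
have -> : (fun x : R => (x + c)%R) @^-1` `](a, b).1, (a, b).2] = `](a - c)%R, (b - c)%R]%classic.
  by apply/seteqP; split => x /=; rewrite !in_itv/= ltrBlDr lerBrDr.
rewrite /= !lebesgue_measure_itv/= !lte_fin ltrD2r; case: ifPn => // _.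
by rewrite -!EFinB; congr (_%:E); ring.
Qed.

Lemma integral_leb0 (h : Rtuple R 0 -> \bar R) : \int[leb R 0]_t h t = h [tuple].
Proof.
have mh : measurable_fun setT h.
  rewrite (_ : h = cst (h [tuple])); first exact: measurable_cst.
  by apply/funext => t; rewrite tuple0.
by rewrite [LHS](@integral_dirac _ _ [tuple] R setT measurableT h mh)/= diracT mul1e.
Qed.

Lemma integral_lebS k (h : Rtuple R k.+1 -> \bar R) : measurable_fun setT h ->
  (forall t, 0 <= h t) ->
  \int[leb R k.+1]_t h t =
  \int[@lebesgue_measure R]_x \int[leb R k]_t h (consR (x, t)).
Proof.
move=> mh h0.
have := @ge0_integral_pushforward _ _ _ _ R _ (@measurable_consR R k)
   (@lebesgue_measure R \x leb R k) setT h measurableT mh (fun t _ => h0 t).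
rewrite preimage_setT => e; rewrite [LHS]e.
rewrite (fubini_tonelli1 (h \o @consR R k))//.
  by apply: measurableT_comp => //; exact: measurable_consR.
by move=> x /=; exact: h0.
Qed.

Definition prodT (g : R -> R) k (t : Rtuple R k) : R := (\prod_(i < k) g (tnth t i))%R.

Lemma prodT_cons g k (x : measurableTypeR R) (t : Rtuple R k) : prodT g (consR (x, t)) = (g x * prodT g t)%R.
Proof.
rewrite /prodT big_ord_recl; congr (_ * _)%R; apply: eq_bigr => i _; congr g.
by rewrite tnthS; congr tnth; apply: val_inj.
Qed.

Lemma measurable_prodT (g : R -> R) k : measurable_fun setT g ->
  measurable_fun setT (@prodT g k).
Proof.
move=> mg; apply: measurable_prod => i _.
by apply: (measurableT_comp mg); exact: measurable_tnth.
Qed.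

Lemma integral_prodT (g : R -> R) (I : R) k : measurable_fun setT g -> (forall x, 0 <= g x)%R ->
  \int[@lebesgue_measure R]_x (g x)%:E = I%:E ->
  \int[leb R k]_t (prodT g t)%:E = (I ^+ k)%:E.
Proof.
move=> mg g0 gI; elim: k => [|k IH].
  by rewrite integral_leb0 /prodT big_ord0 expr0.
have p0 j (t : Rtuple R j) : (0 <= prodT g t)%R by apply: prodr_ge0.
rewrite integral_lebS; last 2 first.
- by apply/measurable_EFinP; exact: measurable_prodT.
- by move=> t; rewrite lee_fin.
under eq_integral => x _.
  under eq_integral => t _ do rewrite prodT_cons EFinM.
  rewrite ge0_integralZl//; last 3 first.
  - by apply/measurable_EFinP; exact: measurable_prodT.
  - by move=> t _; rewrite lee_fin.
  - by rewrite lee_fin.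
  rewrite IH.
  over.
rewrite ge0_integralZr//; last 3 first.
- by apply/measurable_EFinP.
- by move=> x _; rewrite lee_fin.
- by rewrite lee_fin exprn_ge0// -lee_fin -gI integral_ge0// => x _; rewrite lee_fin.
by rewrite gI -EFinM exprS.
Qed.

Definition addT k (c t : Rtuple R k) : Rtuple R k := [tuple (tnth t i + tnth c i)%R | i < k].

Lemma measurable_addT d (T : measurableType d) k (c t : T -> Rtuple R k) :
  measurable_fun setT c -> measurable_fun setT t ->
  measurable_fun setT (fun x => addT (c x) (t x)).
Proof.
move=> mc mt; apply/measurable_fun_tnthP => i.
rewrite (_ : _ \o _ = fun x => (tnth (t x) i + tnth (c x) i)%R); last first.
  by apply/funext => x /=; rewrite tnth_mktuple.
apply: measurable_funD.
  by apply: (measurableT_comp (measurable_tnth i)).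
by apply: (measurableT_comp (measurable_tnth i)).
Qed.

(** Translation invariance by induction on the dimension: Tonelli separates the
    first coordinate. *)
Lemma integral_leb_shift k (c : Rtuple R k) (h : Rtuple R k -> \bar R) :
  measurable_fun setT h -> (forall t, 0 <= h t) ->
  \int[leb R k]_t h (addT c t) = \int[leb R k]_t h t.
Proof.
elim: k c h => [|k IH] c h mh h0.
  by rewrite !integral_leb0 (tuple0 (addT _ _)).
have mhs : measurable_fun setT (fun t => h (addT c t)).
  by apply: (measurableT_comp mh); apply: measurable_addT => //; exact: measurable_cst.
rewrite !integral_lebS//.
have addE x t : addT c (consR (x, t)) = consR ((x + thead c)%R, addT [tuple of behead c] t).
  apply: eq_from_tnth => i; rewrite tnth_mktuple.
  have [j ->|->] := unliftP ord0 i; last by rewrite !tnth0.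
  rewrite [tnth (consR (x, t)) _]tnthS [in RHS]tnthS.
  rewrite /= tnth_mktuple; congr (_ + _)%R; rewrite {1}(tuple_eta c) tnthS.
  by congr tnth; apply: val_inj.
pose H x := \int[leb R k]_t h (consR (x, t)).
have mhc : measurable_fun setT (h \o @consR R k).
  by apply: measurableT_comp => //; exact: measurable_consR.
have mH : measurable_fun setT H.
  have := @measurable_fun_fubini_tonelli_F _ _ _ _ R (leb R k) (h \o @consR R k) mhc.
  by apply => x; exact: h0.
transitivity (\int[@lebesgue_measure R]_x H (x + thead c)%R).
  apply: eq_integral => x _; under eq_integral do rewrite addE.
  rewrite (IH _ (fun t => h (consR ((x + thead c)%R, t))))//.
  apply: (measurableT_comp mh); apply: (measurableT_comp (@measurable_consR R k)).
  exact: pair1_measurable.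
rewrite integral_lebesgue_shift// => x.
by apply: integral_ge0.
Qed.

End tuple_measure.

Section group_measure.
Context {R : realType} {n m : nat}.
Local Open Scope ereal_scope.

Definition leb2 : {sigma_finite_measure set (Rtuple R n * Rtuple R n)%type -> \bar R} :=
  sfprod (leb R n) (leb R n).

Definition lebNs : {sigma_finite_measure set (Rtuple R n * Rtuple R n * Rtuple R m)%type -> \bar R} :=
  sfprod leb2 (leb R m).

Lemma integral_lebN (h : Rtuple R n * Rtuple R n * Rtuple R m -> \bar R) :
  measurable_fun setT h -> (forall t, 0 <= h t) ->
  \int[lebN R n m]_t h t =
  \int[leb R n]_x \int[leb R n]_y \int[leb R m]_z h (x, y, z).
Proof.
move=> mh h0.
rewrite [LHS](@fubini_tonelli1 _ _ _ _ R leb2 (leb R m) h mh h0).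
rewrite (@fubini_tonelli1 _ _ _ _ R (leb R n) (leb R n) (fubini_F (leb R m) h))//.
- exact: measurable_fun_fubini_tonelli_F.
- by move=> x; apply: integral_ge0.
Qed.

(** A shift of the last coordinates that depends on the first ones is harmless,
    as the inner integral is invariant for each value of these. *)
Lemma integral_lebN_shift (c1 c2 : Rtuple R n) (s : Rtuple R n * Rtuple R n -> Rtuple R m)
  (h : Rtuple R n * Rtuple R n * Rtuple R m -> \bar R) :
  measurable_fun setT s -> measurable_fun setT h -> (forall t, 0 <= h t) ->
  \int[lebN R n m]_t h (addT c1 t.1.1, addT c2 t.1.2, addT (s t.1) t.2) =
  \int[lebN R n m]_t h t.
Proof.
move=> ms mh h0.
have mh' : measurable_fun setT (fun t : Rtuple R n * Rtuple R n * Rtuple R m =>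
    h (addT c1 t.1.1, addT c2 t.1.2, addT (s t.1) t.2)).
  apply: (measurableT_comp mh); apply/measurable_fun_pairP; split.
    apply/measurable_fun_pairP; split; apply: measurable_addT; try exact: measurable_cst.
      by apply: (measurableT_comp measurable_fst); exact: measurable_fst.
    by apply: (measurableT_comp measurable_snd); exact: measurable_fst.
  apply: measurable_addT; last exact: measurable_snd.
  by apply: (measurableT_comp ms); exact: measurable_fst.
etransitivity; first exact: (integral_lebN mh' (fun t => h0 _)).
symmetry; etransitivity; first exact: (integral_lebN mh h0).
symmetry; rewrite /=.
have mF : measurable_fun setT (fubini_F (leb R m) h) by exact: measurable_fun_fubini_tonelli_F.
pose H y := fun x => \int[leb R m]_z h (x, y, z).
transitivity (\int[leb R n]_x \int[leb R n]_y \int[leb R m]_z h (addT c1 x, addT c2 y, z)).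
  apply: eq_integral => x _; apply: eq_integral => y _.
  rewrite (@integral_leb_shift R m (s (x, y)) (fun z => h (addT c1 x, addT c2 y, z)))//.
  apply: (measurableT_comp mh); exact: pair1_measurable.
transitivity (\int[leb R n]_x \int[leb R n]_y \int[leb R m]_z h (addT c1 x, y, z)).
  apply: eq_integral => x _.
  rewrite (@integral_leb_shift R n c2 (fun y => \int[leb R m]_z h (addT c1 x, y, z)))//.
    apply: (measurableT_comp mF); exact: pair1_measurable.
  by move=> y; apply: integral_ge0.
rewrite (@integral_leb_shift R n c1 (fun x => \int[leb R n]_y \int[leb R m]_z h (x, y, z)))//.
  apply: (@measurable_fun_fubini_tonelli_F _ _ _ _ R (leb R n) (fubini_F (leb R m) h)) => //.
  by move=> t; apply: integral_ge0.
by move=> x; apply: integral_ge0 => y _; apply: integral_ge0.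
Qed.

Definition prodN (g : R -> R) (t : Rtuple R n * Rtuple R n * Rtuple R m) : R :=
  (prodT g t.1.1 * prodT g t.1.2 * prodT g t.2)%R.

Lemma measurable_prodN g : measurable_fun setT g -> measurable_fun setT (prodN g).
Proof.
move=> mg; apply: measurable_funM; first apply: measurable_funM.
- by apply: (measurableT_comp (measurable_prodT mg)); apply: (measurableT_comp measurable_fst); exact: measurable_fst.
- by apply: (measurableT_comp (measurable_prodT mg)); apply: (measurableT_comp measurable_snd); exact: measurable_fst.
- by apply: (measurableT_comp (measurable_prodT mg)); exact: measurable_snd.
Qed.

Lemma integral_prodN (g : R -> R) (I : R) : measurable_fun setT g -> (forall x, 0 <= g x)%R ->
  \int[@lebesgue_measure R]_x (g x)%:E = I%:E ->
  \int[lebN R n m]_t (prodN g t)%:E = (I ^+ n * I ^+ n * I ^+ m)%:E.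
Proof.
move=> mg g0 gI.
have p0 j (t : Rtuple R j) : (0 <= prodT g t)%R by apply: prodr_ge0.
have I0 : (0 <= I)%R by rewrite -lee_fin -gI integral_ge0// => x _; rewrite lee_fin.
have mp : measurable_fun setT (fun t => (prodN g t)%:E).
  by apply/measurable_EFinP; exact: measurable_prodN.
have pN0 (t : Rtuple R n * Rtuple R n * Rtuple R m) : 0 <= (prodN g t)%:E.
  by rewrite lee_fin !mulr_ge0.
etransitivity; first exact: (integral_lebN mp pN0).
have e j := integral_prodT j mg g0 gI.
under eq_integral => x _.
  under eq_integral => y _.
    rewrite /prodN/=; under eq_integral => z _ do rewrite EFinM.
    rewrite ge0_integralZl//; last 3 first.
    - by apply/measurable_EFinP; exact: measurable_prodT.
    - by move=> t _; rewrite lee_fin.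
    - by rewrite lee_fin mulr_ge0.
    rewrite e EFinM -muleA.
    over.
  rewrite ge0_integralZl//; last 3 first.
  - by apply: emeasurable_funM; [apply/measurable_EFinP; exact: measurable_prodT|exact: measurable_cst].
  - by move=> t _; rewrite mule_ge0// lee_fin// exprn_ge0.
  - by rewrite lee_fin.
  rewrite ge0_integralZr//; last 3 first.
  - by apply/measurable_EFinP; exact: measurable_prodT.
  - by move=> t _; rewrite lee_fin.
  - by rewrite lee_fin exprn_ge0.
  rewrite e.
  over.
rewrite ge0_integralZr//; last 3 first.
- by apply/measurable_EFinP; exact: measurable_prodT.
- by move=> t _; rewrite lee_fin.
- by rewrite -EFinM lee_fin mulr_ge0// exprn_ge0.
by rewrite e -!EFinM mulrA.
Qed.

Lemma integral_lebEFC (h : Rtuple R n * Rtuple R n * Rtuple R m * Rtuple R m -> \bar R) :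
  measurable_fun setT h -> (forall t, 0 <= h t) ->
  \int[lebEFC R n m]_t h t = \int[lebN R n m]_a \int[leb R m]_y h (a, y).
Proof.
move=> mh h0.
exact: (@fubini_tonelli1 _ _ _ _ R lebNs (leb R m) h mh h0).
Qed.

End group_measure.

(** * Measurability in coordinates *)

Section measurability.
Context {R : realType}.
Local Notation C := R[i].

Section closure.
Context d (T : measurableType d).

Definition cmeas (g : T -> C) : Prop :=
  measurable_fun setT (fun t => Re (g t)) /\ measurable_fun setT (fun t => Im (g t)).

Definition vmeas k (z : T -> 'rV[C]_k) := forall j, cmeas (fun t => z t ord0 j).

Definition rmeas k (x : T -> 'rV[R]_k) :=
  forall j, measurable_fun setT (fun t => x t ord0 j).

Lemma cmeas_cst c : cmeas (fun=> c).
Proof. by split; exact: measurable_cst. Qed.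

Lemma cmeas_eq g h : cmeas g -> g =1 h -> cmeas h.
Proof. by move=> mg gh; have -> : h = g by apply/funext => t; rewrite gh. Qed.

Lemma cmeasD g h : cmeas g -> cmeas h -> cmeas (fun t => g t + h t).
Proof.
move=> [g1 g2] [h1 h2]; split.
  by under eq_fun do rewrite cReD; exact: measurable_funD.
by under eq_fun do rewrite cImD; exact: measurable_funD.
Qed.

Lemma cmeasM g h : cmeas g -> cmeas h -> cmeas (fun t => g t * h t).
Proof.
move=> [g1 g2] [h1 h2]; split.
  by under eq_fun do rewrite cReM; apply: measurable_funB; exact: measurable_funM.
by under eq_fun do rewrite cImM; apply: measurable_funD; exact: measurable_funM.
Qed.

Lemma cmeas_conj g : cmeas g -> cmeas (fun t => (g t)^*).
Proof.
move=> [g1 g2]; split.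
  by rewrite (_ : (fun t => _) = fun t => Re (g t))//; apply/funext => t; case: (g t).
rewrite (_ : (fun t => _) = fun t => - Im (g t)); last by apply/funext => t; case: (g t).
exact: measurableT_comp.
Qed.

Lemma cmeas_sum (I : Type) (s : seq I) (g : I -> T -> C) :
  (forall i, cmeas (g i)) -> cmeas (fun t => \sum_(i <- s) g i t).
Proof.
move=> mg; elim: s => [|i s IH].
  by under eq_fun do rewrite big_nil; exact: cmeas_cst.
by under eq_fun do rewrite big_cons; exact: cmeasD.
Qed.

Lemma vmeasD k (z w : T -> 'rV[C]_k) : vmeas z -> vmeas w -> vmeas (fun t => z t + w t).
Proof.
move=> mz mw j; apply: (cmeas_eq (cmeasD (mz j) (mw j))) => t.
by rewrite mxE.
Qed.

Lemma vmeas_cst k (z : 'rV[C]_k) : vmeas (fun=> z).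
Proof. by move=> j; exact: cmeas_cst. Qed.

Lemma rmeas_cst k (z : 'rV[R]_k) : rmeas (fun=> z).
Proof. by move=> j; exact: measurable_cst. Qed.

Lemma rmeasD k (x y : T -> 'rV[R]_k) : rmeas x -> rmeas y -> rmeas (fun t => x t + y t).
Proof.
by move=> mx my j; under eq_fun do rewrite mxE; exact: measurable_funD.
Qed.

Lemma rmeasZ k (c : R) (x : T -> 'rV[R]_k) : rmeas x -> rmeas (fun t => c *: x t).
Proof.
move=> mx j; under eq_fun do rewrite mxE; apply: measurable_funM => //.
Qed.

Lemma rmeas_ReV k (z : T -> 'rV[C]_k) : vmeas z -> rmeas (fun t => ReV (z t)).
Proof. by move=> mz j; under eq_fun do rewrite ReVE; exact: (mz j).1. Qed.

Lemma rmeas_ImV k (z : T -> 'rV[C]_k) : vmeas z -> rmeas (fun t => ImV (z t)).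
Proof. by move=> mz j; under eq_fun do rewrite ImVE; exact: (mz j).2. Qed.

Lemma vmeas_complexV k (x y : T -> 'rV[R]_k) : rmeas x -> rmeas y ->
  vmeas (fun t => complexV (x t) (y t)).
Proof.
by move=> mx my j; split; under eq_fun do rewrite mxE/=; [exact: mx|exact: my].
Qed.

Lemma measurable_normc g : cmeas g -> measurable_fun setT (fun t => normc (g t)).
Proof.
move=> [g1 g2].
rewrite (_ : (fun t => _) = (fun t => Num.sqrt (Re (g t) ^+ 2 + Im (g t) ^+ 2))); last first.
  by apply/funext => t; case: (g t).
apply: (@measurableT_comp _ _ _ _ _ _ (@Num.sqrt R)).
  by apply: continuous_measurable_fun; exact: sqrt_continuous.
by apply: measurable_funD; exact: measurable_funX.
Qed.

End closure.

Lemma measurable_norm_rV d (T : measurableType d) k (x : T -> 'rV[R]_k) (c : R) : rmeas x ->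
  measurable [set t | `|x t| <= c].
Proof.
move=> mx; have [c0|c0] := leP 0 c; last first.
  rewrite (_ : [set t | _] = set0)//; apply/seteqP; split => // t /= h.
  by have := le_trans (normr_ge0 _) h; rewrite leNgt c0.
rewrite (_ : [set t | _] = \bigcap_(j in [set: 'I_k]) [set t | `|x t ord0 j| <= c]).
  apply: fin_bigcap_measurable => // j _.
  rewrite [X in measurable X](_ : _ = (fun t => `|x t ord0 j|) @^-1` `]-oo, c]); last first.
    by apply/seteqP; split => t /=; rewrite in_itv.
  rewrite -[X in measurable X]setTI.
  have h : measurable_fun setT (fun t => `|x t ord0 j|) by apply: measurableT_comp.
  exact: h.
apply/seteqP; split => t /=.
  by move=> h j _ /=; apply: le_trans h; exact: le_coord_norm.
by move=> h; apply: norm_rV_le => // j; exact: h.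
Qed.

End measurability.

Section group_measurability.
Context {R : realType} {n m : nat}.
Local Notation C := R[i].
Variable Phi : Espace R n -> Espace R n -> FCspace R m.
Hypothesis hPhi : hermitian_map Phi.

Definition emeas d (T : measurableType d) (Q : T -> EFC R n m) :=
  vmeas (fun t => (Q t).1) /\ vmeas (fun t => (Q t).2).

Definition nmeas d (T : measurableType d) (a : T -> Ngroup R n m) :=
  vmeas (fun t => (a t).1) /\ rmeas (fun t => (a t).2).

Section basic.
Context d (T : measurableType d).

Lemma vmeas_Phi (z w : T -> Espace R n) : vmeas z -> vmeas w -> vmeas (fun t => Phi (z t) (w t)).
Proof.
move=> mz mw; have lin (w' : T -> Espace R n) : vmeas w' ->
    forall c, vmeas (fun t => Phi (w' t) c).
  move=> mw' c j.
  apply: (@cmeas_eq _ _ _ (fun t => \sum_(i <- enum 'I_n) w' t ord0 i * Phi (delta_mx ord0 i) c ord0 j)).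
    by apply: cmeas_sum => i; apply: cmeasM; [exact: mw'|exact: cmeas_cst].
  move=> t; rewrite [in RHS](Phi_expand hPhi) big_enum/= summxE.
  by apply: eq_bigr => i _; rewrite mxE.
move=> j.
apply: (@cmeas_eq _ _ _ (fun t => \sum_(i <- enum 'I_n) z t ord0 i * (Phi (w t) (delta_mx ord0 i) ord0 j)^*)).
  apply: cmeas_sum => i; apply: cmeasM; first exact: mz.
  by apply: cmeas_conj; exact: lin.
move=> t; rewrite [in RHS](Phi_expand hPhi) big_enum/= summxE.
apply: eq_bigr => i _; rewrite mxE; congr (_ * _).
by rewrite (PhiC hPhi (delta_mx ord0 i)) mxE.
Qed.

Lemma rmeas_quad (z : T -> Espace R n) : vmeas z -> rmeas (fun t => quad Phi (z t)).
Proof. by move=> mz; apply: rmeas_ReV; exact: vmeas_Phi. Qed.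

Lemma emeas_bpt (a : T -> Ngroup R n m) : nmeas a -> emeas (fun t => bpt Phi (a t)).
Proof.
by move=> [m1 m2]; split => //; apply: vmeas_complexV => //; exact: rmeas_quad.
Qed.

Lemma nmeas_mulN (a b : T -> Ngroup R n m) : nmeas a -> nmeas b ->
  nmeas (fun t => mulN Phi (a t) (b t)).
Proof.
move=> [a1 a2] [b1 b2]; split; first exact: vmeasD.
apply: rmeasD; first exact: rmeasD.
by apply: rmeasZ; apply: rmeas_ImV; exact: vmeas_Phi.
Qed.

Lemma nmeas_invN (a : T -> Ngroup R n m) : nmeas a -> nmeas (fun t => invN (a t)).
Proof.
move=> [a1 a2]; split.
  move=> j; apply: (cmeas_eq (cmeasM (cmeas_cst _ (-1)) (a1 j))) => t.
  by rewrite mxE mulN1r.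
by move=> j; under eq_fun do rewrite mxE; apply: measurableT_comp.
Qed.

Lemma nmeas_cst (a : Ngroup R n m) : nmeas (fun _ : T => a).
Proof. by split; [exact: vmeas_cst|exact: rmeas_cst]. Qed.

Lemma nmeas_base (Q : T -> EFC R n m) : emeas Q -> nmeas (fun t => base (Q t)).
Proof. by move=> [m1 m2]; split => //; exact: rmeas_ReV. Qed.

Lemma rmeas_rho (Q : T -> EFC R n m) : emeas Q -> rmeas (fun t => rho Phi (Q t)).
Proof.
move=> [m1 m2]; rewrite /rho.
have h : rmeas (fun t => (-1) *: quad Phi (Q t).1) by apply: rmeasZ; exact: rmeas_quad.
by move=> j; have := rmeasD (rmeas_ImV m2) h j; under eq_fun do rewrite scaleN1r.
Qed.

End basic.

Lemma rmeas_pointR d (T : measurableType d) k (t : T -> Rtuple R k) :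
  measurable_fun setT t -> rmeas (fun x => pointR (t x)).
Proof.
move=> mt j; under eq_fun do rewrite mxE.
exact: (measurableT_comp (measurable_tnth j)).
Qed.

Lemma nmeas_pointN d (T : measurableType d) (t : T -> Rtuple R n * Rtuple R n * Rtuple R m) :
  measurable_fun setT t -> nmeas (fun x => pointN (t x)).
Proof.
move=> mt; have [/measurable_fun_pairP[h1 h2] h3] := (measurable_fun_pairP _).1 mt.
split; last exact: rmeas_pointR.
by apply: vmeas_complexV; exact: rmeas_pointR.
Qed.

Lemma emeas_pointEFC d (T : measurableType d)
  (t : T -> Rtuple R n * Rtuple R n * Rtuple R m * Rtuple R m) :
  measurable_fun setT t -> emeas (fun x => pointEFC (t x)).
Proof.
move=> mt; have [h h4] := (measurable_fun_pairP _).1 mt.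
have [/measurable_fun_pairP[h1 h2] h3] := (measurable_fun_pairP _).1 h.
by split; apply: vmeas_complexV; exact: rmeas_pointR.
Qed.

(** Continuity with respect to the size of displacements, so that moduli of
    continuity from Schwarz's lemma apply directly. *)
Definition econt (V : zmodType) (N : V -> R) (g : EFC R n m -> V) := forall q (e : R), 0 < e ->
  exists2 d : R, 0 < d & forall v, esize v < d -> N (g (q + v) - g q) < e.

(** A sum of absolute values of coordinates, whose measurability along measurable
    coordinates is immediate. *)
Definition csum (q : EFC R n m) : R :=
  \sum_j (`|Re (q.1 ord0 j)| + `|Im (q.1 ord0 j)|) +
  \sum_j (`|Re (q.2 ord0 j)| + `|Im (q.2 ord0 j)|).

Lemma csum_triangle v w u : csum (v - w) <= csum (v - u) + csum (w - u).
Proof.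
have tri k (z w' u' : 'rV[C]_k) : \sum_j (`|Re ((z - w') ord0 j)| + `|Im ((z - w') ord0 j)|) <=
     \sum_j (`|Re ((z - u') ord0 j)| + `|Im ((z - u') ord0 j)|) +
     \sum_j (`|Re ((w' - u') ord0 j)| + `|Im ((w' - u') ord0 j)|).
  rewrite -big_split/=; apply: ler_sum => i _.
  have -> : (z - w') ord0 i = (z - u') ord0 i - (w' - u') ord0 i by rewrite !mxE; ring.
  rewrite cReB cImB addrACA; apply: lerD; exact: ler_normB.
by rewrite /csum addrACA; apply: lerD; [exact: (tri _ v.1 w.1 u.1)|exact: (tri _ v.2 w.2 u.2)].
Qed.

Lemma cn_le_sum k (z : 'rV[C]_k) : cn z <= \sum_j (`|Re (z ord0 j)| + `|Im (z ord0 j)|).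
Proof.
rewrite big_split/=; apply: lerD; apply: norm_rV_le.
- by apply: sumr_ge0.
- move=> j; rewrite ReVE (bigD1 j)//= lerDl sumr_ge0//.
- by apply: sumr_ge0.
- move=> j; rewrite ImVE (bigD1 j)//= lerDl sumr_ge0//.
Qed.

Lemma esize_le_csum q : esize q <= csum q.
Proof. by apply: lerD; exact: cn_le_sum. Qed.

Definition ratV k (r : 'rV[rat]_k) : 'rV[R]_k := map_mx ratr r.

Definition ratE (r : 'rV[rat]_n * 'rV[rat]_n * ('rV[rat]_m * 'rV[rat]_m)) : EFC R n m :=
  (complexV (ratV r.1.1) (ratV r.1.2), complexV (ratV r.2.1) (ratV r.2.2)).

Lemma ratV_dense k (x : 'rV[R]_k) (e : R) : 0 < e -> exists r, forall j, `|x ord0 j - ratV r ord0 j| < e.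
Proof.
move=> e0.
have H j : exists q : rat, `|x ord0 j - ratr q| < e.
  have xe : x ord0 j < x ord0 j + e by rewrite ltrDl.
  have [q /itvP qI] := rat_in_itvoo xe.
  exists q; rewrite distrC gtr0_norm; first by rewrite ltrBlDl qI.
  by rewrite subr_gt0 qI.
have [r rP] := choice H.
exists (\row_j r j) => j; rewrite !mxE; exact: rP.
Qed.

Lemma ratE_dense q (e : R) : 0 < e -> exists r, csum (q - ratE r) < e.
Proof.
move=> e0; pose N : R := (2 * n + 2 * m + 1)%:R.
have N0 : 0 < N by rewrite ltr0n addn1.
have e1 : 0 < e / N by rewrite divr_gt0.
have [r1 h1] := ratV_dense (ReV q.1) e1; have [r2 h2] := ratV_dense (ImV q.1) e1.
have [r3 h3] := ratV_dense (ReV q.2) e1; have [r4 h4] := ratV_dense (ImV q.2) e1.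
exists ((r1, r2), (r3, r4)).
have S k (z : 'rV[C]_k) (s1 s2 : 'rV[rat]_k) :
    (forall j, `|ReV z ord0 j - ratV s1 ord0 j| < e / N) ->
    (forall j, `|ImV z ord0 j - ratV s2 ord0 j| < e / N) ->
    \sum_j (`|Re ((z - complexV (ratV s1) (ratV s2)) ord0 j)| +
            `|Im ((z - complexV (ratV s1) (ratV s2)) ord0 j)|) <= (2 * k)%:R * (e / N).
  move=> g1 g2; apply: le_trans (_ : \sum_(j < k) (2 * (e / N)) <= _); last first.
    rewrite sumr_const card_ord -(mulr_natl _ k) natrM.
    by rewrite le_eqVlt; apply/orP; left; apply/eqP; ring.
  apply: ler_sum => j _; rewrite mulr_natl mulr2n.
  have -> : (z - complexV (ratV s1) (ratV s2)) ord0 j =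
     z ord0 j - (ratV s1 ord0 j +i* ratV s2 ord0 j) by rewrite !mxE.
  rewrite cReB cImB/=; apply: lerD; apply: ltW.
    by have := g1 j; rewrite ReVE.
  by have := g2 j; rewrite ImVE.
apply: le_lt_trans (lerD (S _ q.1 r1 r2 h1 h2) (S _ q.2 r3 r4 h3 h4)) _.
rewrite -mulrDl -natrD mulrA ltr_pdivrMr// mulrC ltr_pM2l// ltr_nat addn1.
exact: ltnSn.
Qed.

(** A continuous function of measurable coordinates is measurable: its open
    level sets are countable unions of rational balls. *)
Lemma measurable_econt d (T : measurableType d) (Q : T -> EFC R n m) (g : EFC R n m -> R) :
  emeas Q -> econt Num.norm g -> measurable_fun setT (fun t => g (Q t)).
Proof.
move=> mQ cg.
have mS r : measurable_fun setT (fun t => csum (Q t - ratE r)).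
  have mz k (z : T -> 'rV[C]_k) (w : 'rV[C]_k) : vmeas z ->
      measurable_fun setT (fun t => \sum_j (`|Re ((z t - w) ord0 j)| + `|Im ((z t - w) ord0 j)|)).
    move=> mz; apply: measurable_sum => j.
    have [h1 h2] := vmeasD mz (vmeas_cst _ (- w)) j.
    by apply: measurable_funD; apply: measurableT_comp.
  by apply: measurable_funD; [exact: mz mQ.1|exact: mz mQ.2].
apply: (measurability _ (RGenOInfty.measurableE R)) => //.
move=> _ [_ [y ->] <-]; rewrite setTI.
pose I := ('rV[rat]_n * 'rV[rat]_n * ('rV[rat]_m * 'rV[rat]_m) * nat)%type.
pose good (rj : I) := forall q, csum (q - ratE rj.1) < rj.2.+1%:R^-1 -> y < g q.
pose B (rj : I) := [set t | csum (Q t - ratE rj.1) < rj.2.+1%:R^-1].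
rewrite (_ : _ @^-1` _ = \bigcup_(k in [set k | exists2 rj : I, pickle rj = k & good rj])
   (if @unpickle I k is Some rj then B rj else set0)).
  apply: bigcup_measurable => k _; case: unpickle => [rj|//].
  rewrite [X in measurable X](_ : _ = (fun t => csum (Q t - ratE rj.1)) @^-1` `]-oo, rj.2.+1%:R^-1[); last first.
    by apply/seteqP; split => t /=; rewrite in_itv.
  by rewrite -[X in measurable X]setTI; exact: mS.
apply/seteqP; split => t /=.
  rewrite in_itv/= andbT => yg.
  have [dl dl0 H] : exists2 d : R, 0 < d & forall v, esize v < d -> `|g (Q t + v) - g (Q t)| < g (Q t) - y.
    by apply: cg; rewrite subr_gt0.
  have [j jd] : exists j : nat, 2 * j.+1%:R^-1 < dl.
    exists (Num.truncn (2 / dl)); rewrite -[ltLHS]invrK invfM invrK mulrC -[ltRHS]invrK.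
    rewrite ltf_pV2 ?posrE ?invr_gt0// ?divr_gt0//.
    by rewrite ltr_pdivlMr// mulrC; exact: truncnS_gt.
  have [r rP] := @ratE_dense (Q t) j.+1%:R^-1 ltac:(by rewrite invr_gt0).
  exists (pickle (r, j)); last by rewrite pickleK.
  exists (r, j) => // q qr.
  have := H (q - Q t); rewrite (_ : Q t + (q - Q t) = q); last by rewrite addrC subrK.
  suff sm : esize (q - Q t) < dl.
    by move=> /(_ sm); rewrite ltr_norml => /andP[+ _]; clear; lra.
  apply: le_lt_trans (esize_le_csum _) _; apply: le_lt_trans jd.
  apply: le_trans (csum_triangle q (Q t) (ratE r)) _.
  by rewrite mulr_natl mulr2n; apply: lerD; exact: ltW.
move=> [k [rj <- gd]]; rewrite pickleK in_itv/= andbT => /gd.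
exact.
Qed.

Lemma cmeas_econt d (T : measurableType d) (Q : T -> EFC R n m) (f : EFC R n m -> C) :
  emeas Q -> econt (@ComplexField.Normc.normc R) f -> cmeas (fun t => f (Q t)).
Proof.
move=> mQ cf; split.
  apply: (@measurable_econt _ _ _ (fun q => Re (f q))) => // q e /(cf q)[dl dl0 H].
  by exists dl => // v /H h; rewrite -cReB; apply: le_lt_trans (normc_Re _) _.
apply: (@measurable_econt _ _ _ (fun q => Im (f q))) => // q e /(cf q)[dl dl0 H].
by exists dl => // v /H h; rewrite -cImB; apply: le_lt_trans (normc_Im _) _.
Qed.

(** Schwarz's lemma on complex lines turns local bounds into a modulus of
    continuity. *)
Lemma expclass_econt A f : 0 <= A -> expclass Phi A f -> econt (@ComplexField.Normc.normc R) f.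
Proof.
move=> A0 [hol [K K0 [N gr]]] q e e0.
have [B B0 HB] := Phi_bound hPhi.
pose S := esize q + 2.
have S0 : 0 <= S by rewrite addr_ge0// esize_ge0.
pose M := K * (1 + S) ^+ N * expR (A * (S + B * S ^+ 2)).
have M0 : 0 <= M by rewrite !mulr_ge0 ?expR_ge0// exprn_ge0// addr_ge0.
have bd v : esize v <= 2 -> normc (f (q + v)) <= M.
  move=> v2; have qv : esize (q + v) <= S by apply: le_trans (esizeD _ _) _; rewrite lerD2l.
  have qv0 := esize_ge0 (q + v).
  apply: le_trans (gr _) _; apply: ler_pM; rewrite ?expR_ge0 ?mulr_ge0 ?exprn_ge0 ?addr_ge0//.
    by rewrite ler_wpM2l// lerXn2r// ?nnegrE ?addr_ge0// lerD2l.
  rewrite ler_expR ler_wpM2l//; apply: le_trans (rho_le _ B0 HB) _.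
  by apply: lerD => //; rewrite ler_wpM2l// lerXn2r.
pose dl := Num.min 1 (e / (4 * (M + 1))).
have M1 : 0 < M + 1 by rewrite ltr_wpDl.
exists dl; first by rewrite lt_min ltr01 divr_gt0// mulr_gt0.
move=> v; rewrite lt_min => /andP[v1 v2].
have [v0|v0] := eqVneq (esize v) 0.
  have -> : v = 0 by exact: esize_eq0.
  by rewrite addr0 subrr ComplexField.Normc.normc0.
have s0 : 0 < esize v by rewrite lt_neqAle eq_sym v0 esize_ge0.
pose u := ((esize v)^-1)%:C *: v.
have su : esize u = 1 by rewrite /u esizeZR ger0_norm ?invr_ge0 ?mulVf// ltW.
have uv : (esize v)%:C *: u = v by rewrite /u scalerA -rmorphM/= divff// scale1r.
have := @schwarz _ (fun w => f (q + w *: u)) M (hol q u) _ (esize v)%:C.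
rewrite uv scale0r addr0 normcR (gtr0_norm s0) => h.
apply: le_lt_trans (h _ (ltW v1)) _.
  move=> w w1; apply: bd; apply: le_trans (esizeZ _ _) _; rewrite su mulr1.
  by rewrite -[leRHS]mulr1 ler_wpM2l.
move: v2; rewrite ltr_pdivlMr ?mulr_gt0// => v2.
apply: le_lt_trans v2; rewrite [leLHS]mulrC ler_wpM2l ?ltW//.
by rewrite ltr_pM2l// ltrDl.
Qed.

End group_measurability.

(** * Invariance of Lebesgue measure on N, and an integrable weight *)

Section group_invariance.
Context {R : realType} {n m : nat}.
Local Notation C := R[i].
Local Open Scope ereal_scope.
Local Notation TN := (Rtuple R n * Rtuple R n * Rtuple R m)%type.

Definition tupV k (x : 'rV[R]_k) : Rtuple R k := [tuple x ord0 i | i < k].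

Lemma pointR_tupV k (x : 'rV[R]_k) : pointR (tupV x) = x.
Proof. by apply/rowP => j; rewrite mxE tnth_mktuple. Qed.

Lemma pointR_addT k (c t : Rtuple R k) : pointR (addT c t) = (pointR t + pointR c)%R.
Proof. by apply/rowP => j; rewrite !mxE tnth_mktuple. Qed.

Lemma measurable_tupV d (T : measurableType d) k (x : T -> 'rV[R]_k) :
  rmeas x -> measurable_fun setT (fun t => tupV (x t)).
Proof.
move=> mx; apply/measurable_fun_tnthP => i.
rewrite (_ : _ \o _ = fun t => x t ord0 i); first exact: mx.
by apply/funext => t /=; rewrite tnth_mktuple.
Qed.

(** Triangular translations preserve Lebesgue measure on N; both left and right
    translations of the group are of this form. *)
Lemma integral_lebN_triangular (c : Espace R n) (s : Rtuple R n * Rtuple R n -> Fspace R m)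
  (h : Ngroup R n m -> \bar R) :
  rmeas s -> measurable_fun setT (h \o @pointN R n m) -> (forall a, 0 <= h a) ->
  \int[lebN R n m]_t h ((pointN t).1 + c, (pointN t).2 + s t.1)%R =
  \int[lebN R n m]_t h (pointN t).
Proof.
move=> ms mh h0.
pose c1 := tupV (ReV c); pose c2 := tupV (ImV c); pose s' x := tupV (s x).
have ms' : measurable_fun setT s' by exact: measurable_tupV.
rewrite -(@integral_lebN_shift R n m c1 c2 s' (h \o @pointN R n m))//; last first.
  by move=> t; exact: h0.
apply: eq_integral => t _; rewrite /= /pointN/=; congr (h (_, _)).
  apply: eq_complexV.
    by rewrite ReVD !ReV_complexV pointR_addT pointR_tupV.
  by rewrite ImVD !ImV_complexV pointR_addT pointR_tupV.
by rewrite pointR_addT pointR_tupV.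
Qed.

Variable Phi : Espace R n -> Espace R n -> FCspace R m.
Hypothesis hPhi : hermitian_map Phi.

Let vmeas_point : vmeas (fun x : Rtuple R n * Rtuple R n => complexV (pointR x.1) (pointR x.2)).
Proof.
by apply: vmeas_complexV; apply: rmeas_pointR; [exact: measurable_fst|exact: measurable_snd].
Qed.

Lemma integral_lebN_left (b : Ngroup R n m) (h : Ngroup R n m -> \bar R) :
  measurable_fun setT (h \o @pointN R n m) -> (forall a, 0 <= h a) ->
  \int[lebN R n m]_t h (mulN Phi b (pointN t)) = \int[lebN R n m]_t h (pointN t).
Proof.
move=> mh h0.
pose s x := (b.2 + 2 *: ImV (Phi b.1 (complexV (pointR x.1) (pointR x.2))))%R : Fspace R m.
rewrite -(@integral_lebN_triangular b.1 s h)//.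
  by apply: eq_integral => t _; rewrite /mulN /s /=; congr (h (_, _)); [rewrite addrC|rewrite addrA [(b.2 + _)%R]addrC].
apply: rmeasD; first exact: rmeas_cst.
by apply: rmeasZ; apply: rmeas_ImV; apply: vmeas_Phi => //; exact: vmeas_cst.
Qed.

Lemma integral_lebN_right (b : Ngroup R n m) (h : Ngroup R n m -> \bar R) :
  measurable_fun setT (h \o @pointN R n m) -> (forall a, 0 <= h a) ->
  \int[lebN R n m]_t h (mulN Phi (pointN t) b) = \int[lebN R n m]_t h (pointN t).
Proof.
move=> mh h0.
pose s x := (b.2 + 2 *: ImV (Phi (complexV (pointR x.1) (pointR x.2)) b.1))%R : Fspace R m.
rewrite -(@integral_lebN_triangular b.1 s h)//.
  by apply: eq_integral => t _; rewrite /mulN /s /=; congr (h (_, _)); rewrite addrA.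
apply: rmeasD; first exact: rmeas_cst.
by apply: rmeasZ; apply: rmeas_ImV; apply: vmeas_Phi => //; exact: vmeas_cst.
Qed.

End group_invariance.

Section weights.
Context {R : realType} {n m : nat}.
Local Notation C := R[i].

Definition gN (g : R -> R) (a : Ngroup R n m) : R :=
  (\prod_j g (Re (a.1 ord0 j))) * (\prod_j g (Im (a.1 ord0 j))) * \prod_j g (a.2 ord0 j).

Lemma gN_pointN g t : gN g (pointN t) = prodN g t.
Proof.
by rewrite /gN /prodN; congr (_ * _ * _); apply: eq_bigr => j _; rewrite !mxE.
Qed.

Definition smallN (c : R) (a : Ngroup R n m) : bool :=
  [forall j, `|Re (a.1 ord0 j)| <= c] && [forall j, `|Im (a.1 ord0 j)| <= c] &&
  [forall j, `|a.2 ord0 j| <= c].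

Lemma smallN_cn (c : R) a : smallN c a -> 0 <= c -> cn a.1 <= 2 * c /\ `|a.2| <= c.
Proof.
move=> /andP[/andP[/forallP h1 /forallP h2] /forallP h3] c0; split.
  rewrite /cn mulr_natl mulr2n; apply: lerD; apply: norm_rV_le => // j.
    by rewrite ReVE.
  by rewrite ImVE.
exact: norm_rV_le.
Qed.

Lemma cn_smallN (c : R) a : cn a.1 <= c -> `|a.2| <= c -> smallN c a.
Proof.
move=> h1 h2; rewrite /smallN; apply/andP; split; last first.
  by apply/forallP => j; apply: le_trans h2; exact: le_coord_norm.
apply/andP; split; apply/forallP => j; apply: le_trans h1.
  by apply: le_trans (normc_Re _) _; exact: cn_coord.
by apply: le_trans (normc_Im _) _; exact: cn_coord.
Qed.

Definition seg (c x : R) : R := if `|x| <= c then 1 else 0.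

Lemma measurable_seg c : measurable_fun setT (seg c).
Proof.
apply: measurable_fun_ifT => //.
apply: (measurable_fun_bool true).
rewrite setTI [X in measurable X](_ : _ = (fun x : R => `|x|) @^-1` `]-oo, c]); last first.
  by apply/seteqP; split => x /=; rewrite in_itv.
have h : measurable_fun setT (fun x : R => `|x|) by apply: measurableT_comp.
by rewrite -[X in measurable X]setTI; exact: h.
Qed.

Lemma integral_seg c : 0 <= c -> (\int[@lebesgue_measure R]_x (seg c x)%:E = (2 * c)%:E)%E.
Proof.
move=> c0; rewrite (_ : (fun x => _) = (fun x => (\1_(`[- c, c]%classic) x)%:E)).
  rewrite integral_indic//= setIT (lebesgue_measure_itv `[- c, c])/= lte_fin.
  case: ltP => [_|h]; first by rewrite -EFinB; congr (_%:E); ring.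
  have -> : c = 0 by apply/eqP; rewrite eq_le c0 andbT; lra.
  by rewrite mulr0.
apply/funext => x; rewrite indicE /seg; congr (_%:E).
by rewrite mem_setE in_itv/= -ler_norml; case: ifP.
Qed.

Lemma gN_seg c a : gN (seg c) a = (smallN c a)%:R.
Proof.
have P (I : finType) (u : I -> R) : \prod_i seg c (u i) = ([forall i, `|u i| <= c])%:R.
  case: (boolP [forall i, _]) => [/forallP h|].
    by rewrite big1// => i _; rewrite /seg h.
  rewrite negb_forall => /existsP[i hi]; rewrite (bigD1 i)//= /seg (negbTE hi).
  by rewrite mul0r.
by rewrite /gN !P -!natrM !mulnb.
Qed.

Lemma measurable_smallN d (T : measurableType d) c (a : T -> Ngroup R n m) : nmeas a ->
  measurable_fun setT (fun x => (smallN c (a x))%:R : R).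
Proof.
move=> [m1 m2]; under eq_fun do rewrite -gN_seg.
have ms := measurable_seg c.
apply: measurable_funM; first apply: measurable_funM.
- by apply: measurable_prod => j _; apply: (measurableT_comp ms); exact: (m1 j).1.
- by apply: measurable_prod => j _; apply: (measurableT_comp ms); exact: (m1 j).2.
- by apply: measurable_prod => j _; apply: (measurableT_comp ms); exact: m2.
Qed.

(** The Cauchy density, up to its mass pi. *)
Definition phi (x : R) : R := (1 + x ^+ 2)^-1.

Lemma phi_gt0 x : 0 < phi x.
Proof. by rewrite invr_gt0 ltr_pwDl// sqr_ge0. Qed.

Lemma measurable_phi : measurable_fun setT phi.
Proof. by apply: continuous_measurable_fun; exact: continuous_oneDsqrV. Qed.

Lemma integral_phi : (\int[@lebesgue_measure R]_x (phi x)%:E = pi%:E)%E.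
Proof.
rewrite ge0_symfun_integralT//; last 3 first.
- by move=> x; rewrite ltW// phi_gt0.
- exact: continuous_oneDsqrV.
- by move=> x /=; rewrite /phi sqrrN.
rewrite -set_itvcy; have := @integral0y_oneDsqr R; rewrite /oneDsqr /phi => ->.
by rewrite -EFinM; congr (_%:E); field.
Qed.

(** The integrable weight on N. *)
Definition W0 : Ngroup R n m -> R := gN phi.

Lemma W0_gt0 a : 0 < W0 a.
Proof. by rewrite /W0 /gN !mulr_gt0// prodr_gt0// => j _; exact: phi_gt0. Qed.

Lemma integral_W0 : exists2 I : R, 0 < I &
  (\int[lebN R n m]_t (W0 (pointN t))%:E = I%:E)%E.
Proof.
exists (pi ^+ n * pi ^+ n * pi ^+ m); first by rewrite !mulr_gt0// exprn_gt0// pi_gt0.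
under eq_integral do rewrite /W0 gN_pointN.
apply: integral_prodN; [exact: measurable_phi| |exact: integral_phi].
by move=> x; rewrite ltW// phi_gt0.
Qed.

(** W0 decays like a power of the size, of exponent twice the real dimension of N. *)
Lemma W0_lower (s : R) a : 0 <= s -> cn a.1 <= s -> `|a.2| <= s ->
  ((1 + s) ^+ (2 * (n + n + m)))^-1 <= W0 a.
Proof.
move=> s0 h1 h2.
have P x : `|x| <= s -> ((1 + s) ^+ 2)^-1 <= phi x.
  move=> xs; rewrite /phi lef_pV2 ?posrE ?ltr_pwDl ?sqr_ge0// ?exprn_gt0 ?ltr_pwDl//.
  have : x ^+ 2 <= s ^+ 2 by rewrite -(real_normK (num_real x)) lerXn2r// nnegrE.
  by rewrite !expr2; move: (x * x); clear -s0 => y; lra.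
have Q k (u : 'I_k -> R) : (forall j, `|u j| <= s) -> ((1 + s) ^+ 2)^-1 ^+ k <= \prod_j phi (u j).
  move=> hu; rewrite -[X in _ ^+ X](card_ord k) -prodr_const.
  apply: ler_prod => j _; rewrite P// invr_ge0 exprn_ge0// addr_ge0//.
have e0 : 0 <= ((1 + s) ^+ 2)^-1 by rewrite invr_ge0 exprn_ge0// addr_ge0.
rewrite exprM -exprVn !exprD; apply: ler_pM; rewrite ?mulr_ge0 ?exprn_ge0//.
  apply: ler_pM; rewrite ?exprn_ge0//; apply: Q => j; apply: le_trans h1.
    by apply: le_trans (normc_Re _) _; exact: cn_coord.
  by apply: le_trans (normc_Im _) _; exact: cn_coord.
by apply: Q => j; apply: le_trans h2; exact: le_coord_norm.
Qed.

Lemma integral_smallN c : 0 <= c ->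
  (\int[lebN R n m]_t ((smallN c (pointN t))%:R)%:E = ((2 * c) ^+ n * (2 * c) ^+ n * (2 * c) ^+ m)%:E)%E.
Proof.
move=> c0; under eq_integral do rewrite -gN_seg gN_pointN.
apply: integral_prodN; [exact: measurable_seg| |exact: integral_seg].
by move=> x; rewrite /seg; case: ifP.
Qed.

Definition smallF (c : R) (x : Fspace R m) : bool := [forall j, `|x ord0 j| <= c].

Lemma measurable_smallF d (T : measurableType d) c (x : T -> Fspace R m) : rmeas x ->
  measurable_fun setT (fun t => (smallF c (x t))%:R : R).
Proof.
move=> mx; rewrite (_ : (fun t => _) = fun t => \prod_(j < m) seg c (x t ord0 j)).
  by apply: measurable_prod => j _; apply: (measurableT_comp (measurable_seg c)); exact: mx.
apply/funext => t; rewrite /smallF; case: (boolP [forall j, _]) => [/forallP h|].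
  by rewrite big1// => j _; rewrite /seg h.
by rewrite negb_forall => /existsP[j hj]; rewrite (bigD1 j)//= /seg (negbTE hj) mul0r.
Qed.

Lemma integral_smallF c (x0 : Fspace R m) : 0 <= c ->
  (\int[leb R m]_y ((smallF c (pointR y - x0))%:R)%:E = ((2 * c) ^+ m)%:E)%E.
Proof.
move=> c0; pose h (y : Rtuple R m) : \bar R := (prodT (seg c) y)%:E.
rewrite -(@integral_prodT R (seg c) (2 * c) m)//; last 3 first.
- exact: measurable_seg.
- by move=> x; rewrite /seg; case: ifP.
- exact: integral_seg.
rewrite -(@integral_leb_shift R m (tupV (- x0)) h); last 2 first.
- by apply/measurable_EFinP; apply: measurable_prodT; exact: measurable_seg.
- by move=> t; rewrite lee_fin prodr_ge0// => i _; rewrite /seg; case: ifP.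
apply: eq_integral => y _; rewrite /h; congr (_%:E).
have -> : pointR y - x0 = pointR (addT (tupV (- x0)) y) by rewrite pointR_addT pointR_tupV.
rewrite /prodT /smallF; case: (boolP [forall j, _]) => [/forallP hj|].
  by rewrite big1// => i _; rewrite /seg; have := hj i; rewrite mxE => ->.
rewrite negb_forall => /existsP[i hi]; rewrite (bigD1 i)//= /seg.
by move: hi; rewrite mxE => /negbTE ->; rewrite mul0r.
Qed.

End weights.

(** * Radon measures on E x F_C *)

Section topology.
Context {R : realType} {n m : nat}.
Local Notation C := R[i].
Local Notation EC := (EFC R n m).

Lemma norm_cV k (z : 'rV[C]_k) : `|z| <= (cn z)%:C.
Proof.
have -> : `|z| = mx_norm z by [].
rewrite /mx_norm.
have c0 : 0 <= (cn z)%:C :> C by rewrite ler0c cn_ge0.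
rewrite -[(cn z)%:C]/(NngNum c0)%:num num_le; apply/bigmax_leP; split.
  by rewrite -num_le/=.
move=> [i j] _; rewrite -num_le/= (ord1 i).
by rewrite lecR; exact: cn_coord.
Qed.

Lemma norm_cV_ge k (z : 'rV[C]_k) j : (normc (z ord0 j))%:C <= `|z|.
Proof.
have -> : `|z| = mx_norm z by [].
by rewrite /mx_norm; apply: (le_bigmax _ (fun ij => `|z ij.1 ij.2|%:nng) (ord0, j)).
Qed.

Lemma norm_EFC (v : EC) : `|v| <= (esize v)%:C.
Proof.
have -> : `|v| = Num.max `|v.1| `|v.2| by [].
rewrite /Order.max; case: ifP => _; apply: le_trans (norm_cV _) _; rewrite lecR.
  by rewrite lerDr cn_ge0.
by rewrite lerDl cn_ge0.
Qed.

Lemma norm_EFC_ge (v : EC) : `|v.1| <= `|v| /\ `|v.2| <= `|v|.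
Proof.
have -> : `|v| = Num.max `|v.1| `|v.2| by [].
by rewrite !comparable_le_max ?lexx ?orbT//; apply: real_comparable; exact: normr_real.
Qed.

(** The product topology of the max norms is the one of esize. *)
Lemma nbhs_esizeP (q : EC) (U : set EC) :
  nbhs q U <-> exists2 e : R, 0 < e & forall v, esize v < e -> U (q + v).
Proof.
split.
  move=> /nbhs_normP [e /= e0 H].
  have [er Ie] : 0 < Re e /\ e = (Re e)%:C.
    by move: e0; rewrite ltcE/= => /andP[/eqP h ->]; split => //; move: h; case: (e) => a b /= ->.
  exists (Re e) => // v ve; apply: H => /=.
  rewrite opprD addNKr normrN Ie; apply: le_lt_trans (norm_EFC v) _.
  by rewrite ltcR.
move=> [e e0 H]; apply: (nbhs_normP q U).2; exists (e / 4)%:C => /=.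
  by rewrite ltcR divr_gt0.
move=> w /= qw; have -> : w = q + (w - q) by rewrite addrC subrK.
apply: H; move: qw; rewrite distrC; move: (w - q) => {w}v ve.
have P k (z : 'rV[C]_k) : `|z| <= `|v| -> cn z <= e / 4 + e / 4.
  move=> zv; have hj j : normc (z ord0 j) <= e / 4.
    by rewrite -lecR; apply: le_trans (norm_cV_ge z j) _; apply: le_trans zv _; exact: ltW.
  apply: lerD; apply: norm_rV_le; rewrite ?divr_ge0 ?ltW// => j.
    by rewrite ReVE; apply: le_trans (normc_Re _) _.
  by rewrite ImVE; apply: le_trans (normc_Im _) _.
have P' k (z : 'rV[C]_k) : `|z| <= `|v| -> cn z < e / 4 + e / 4.
  move=> zv.
  have [d dv de] : exists2 d : R, `|v| <= d%:C & d < e / 4.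
    exists (Re `|v|); last by move: ve; rewrite ltcE/= => /andP[].
    by rewrite RRe_real// normr_real.
  have hj j : normc (z ord0 j) <= d.
    by rewrite -lecR; apply: le_trans (norm_cV_ge z j) _; apply: le_trans zv _.
  have d0 : 0 <= d by rewrite -(@ler0c R); exact: le_trans dv.
  apply: (@le_lt_trans _ _ (d + d)); last exact: ltrD.
  apply: lerD; apply: norm_rV_le => // j.
    by rewrite ReVE; apply: le_trans (normc_Re _) _.
  by rewrite ImVE; apply: le_trans (normc_Im _) _.
have [v1 v2] := norm_EFC_ge v.
rewrite /esize; apply: lt_le_trans (ltrD (P' _ _ v1) (P' _ _ v2)) _.
by rewrite le_eqVlt; apply/orP; left; apply/eqP; field.
Qed.

Lemma open_econt (g : EC -> R) (y : R) : econt Num.norm g -> open [set q | y < g q].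
Proof.
move=> cg; rewrite openE => q /= yq; apply/nbhs_esizeP.
have [d d0 H] := cg q (g q - y) ltac:(by rewrite subr_gt0).
exists d => // v /H; rewrite ltr_norml /= => /andP[h _].
by rewrite -(ltrD2r (- g q)) -opprB.
Qed.

Lemma open_measurableE (U : set EC) : open U -> measurable (U : set (Borel EC)).
Proof. by move=> oU; apply: sub_sigma_algebra. Qed.

Lemma measurable_econt_Borel (g : EC -> R) : econt Num.norm g ->
  measurable_fun setT (g : Borel EC -> R).
Proof.
move=> cg; apply: (measurability _ (RGenOInfty.measurableE R)) => //.
move=> _ [_ [y ->] <-]; rewrite setTI; apply: open_measurableE.
rewrite (_ : _ @^-1` _ = [set q | y < g q]); first exact: open_econt.
by apply/seteqP; split => q /=; rewrite in_itv/= andbT.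
Qed.

(** The identity of E x F_C is a measurable family of points for the Borel sets,
    so the coordinate calculus also applies to Borel measures. *)
Lemma emeas_Borel : @emeas R n m _ (Borel EC) id.
Proof.
have H (P : C -> R) k (pr : EC -> 'rV[C]_k) j : (forall v w, pr (v + w) = pr v + pr w) ->
    (forall v, cn (pr v) <= esize v) -> (forall z w, P (z + w) = P z + P w) ->
    (forall z, `|P z| <= normc z) ->
    measurable_fun setT ((fun q => P (pr q ord0 j)) : Borel EC -> R).
  move=> prD prs PD Pn; apply: measurable_econt_Borel => q e e0.
  exists e => // v ve; rewrite prD mxE PD addrC addKr; apply: le_lt_trans ve.
  by apply: le_trans (Pn _) _; apply: le_trans (cn_coord _ _) _; exact: prs.
have s1 (v : EC) : cn v.1 <= esize v by rewrite lerDl cn_ge0.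
have s2 (v : EC) : cn v.2 <= esize v by rewrite lerDr cn_ge0.
have f1 (v w : EC) : (v + w).1 = v.1 + w.1 by [].
have f2 (v w : EC) : (v + w).2 = v.2 + w.2 by [].
split=> j; split.
- by apply: (H (@complex.Re R) _ fst j f1 s1); [exact: cReD|exact: normc_Re].
- by apply: (H (@complex.Im R) _ fst j f1 s1); [exact: cImD|exact: normc_Im].
- by apply: (H (@complex.Re R) _ snd j f2 s2); [exact: cReD|exact: normc_Re].
- by apply: (H (@complex.Im R) _ snd j f2 s2); [exact: cImD|exact: normc_Im].
Qed.

Definition cbox (c : R) : set C := [set z | `|Re z| <= c /\ `|Im z| <= c].

Lemma compact_cbox c : compact (cbox c).
Proof.
have -> : cbox c = [set (x.1 +i* x.2 : C) | x in `[- c, c]%classic `*` `[- c, c]%classic].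
  apply/seteqP; split => [[a b] [/= h1 h2]|_ [[a b] [/= h1 h2] <-]].
    by exists (a, b) => //=; split; rewrite /= in_itv/= -ler_norml.
  by move: h1 h2; rewrite !in_itv/= -!ler_norml; split.
apply: (@continuous_compact _ _ (fun x : R * R => x.1 +i* x.2 : C)).
  apply: continuous_subspaceT => -[a b]; apply/cvgrPdist_lt => /= e e0.
  have [er Ie] : 0 < Re e /\ e = (Re e)%:C.
    by move: e0; rewrite ltcE/= => /andP[/eqP h ->]; split => //; move: h; case: (e) => u v /= ->.
  exists (ball a (Re e / 2), ball b (Re e / 2)) => /=.
    by split; apply: nbhsx_ballx; rewrite divr_gt0.
  move=> [x y] /= [h1 h2]; rewrite Ie.
  have -> : `|(a +i* b) - (x +i* y) : C| = (normc ((a - x) +i* (b - y)))%:C by [].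
  rewrite ltcR; apply: le_lt_trans (normc_le _) _ => /=.
  by rewrite [ltRHS]splitr; apply: ltrD.
by apply: compact_setX; exact: segment_compact.
Qed.

Definition ebox (c : R) : set EC := [set q : EC | (forall j, cbox c (q.1 ord0 j)) /\ (forall j, cbox c (q.2 ord0 j))].

Lemma compact_ebox c : compact (ebox c).
Proof.
have := compact_setX (@rV_compact C n (fun=> cbox c) (fun=> @compact_cbox c)) (@rV_compact C m (fun=> cbox c) (fun=> @compact_cbox c)).
exact.
Qed.

Lemma esize_ebox (q : EC) c : esize q <= c -> ebox c q.
Proof.
move=> qc; split=> j; split.
- by apply: le_trans (normc_Re _) _; apply: le_trans (cn_coord _ _) _; apply: le_trans qc; rewrite lerDl cn_ge0.
- by apply: le_trans (normc_Im _) _; apply: le_trans (cn_coord _ _) _; apply: le_trans qc; rewrite lerDl cn_ge0.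
- by apply: le_trans (normc_Re _) _; apply: le_trans (cn_coord _ _) _; apply: le_trans qc; rewrite lerDr cn_ge0.
- by apply: le_trans (normc_Im _) _; apply: le_trans (cn_coord _ _) _; apply: le_trans qc; rewrite lerDr cn_ge0.
Qed.

Lemma open_csum r (c : R) : open [set q : EC | csum (q - ratE r) < c].
Proof.
rewrite openE => q /= yq; apply/nbhs_esizeP.
pose N : R := (2 * n + 2 * m + 1)%:R.
have N0 : 0 < N by rewrite ltr0n addn1.
exists ((c - csum (q - ratE r)) / N); first by rewrite divr_gt0// subr_gt0.
move=> v; rewrite ltr_pdivlMr// => vs /=.
have Hk k (z w : 'rV[C]_k) : \sum_j (`|Re ((z + w) ord0 j)| + `|Im ((z + w) ord0 j)|) <=
    \sum_j (`|Re (z ord0 j)| + `|Im (z ord0 j)|) + (2 * k)%:R * cn w.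
  have -> : (2 * k)%:R * cn w = \sum_(j < k) (cn w + cn w).
    by rewrite sumr_const card_ord -[RHS]mulr_natl natrM -mulr2n -[cn w *+ 2]mulr_natl mulrCA mulrA.
  rewrite -big_split; apply: ler_sum => j _ /=; rewrite !mxE cReD cImD addrACA.
  apply: le_trans (lerD (ler_normD _ _) (ler_normD _ _)) _.
  apply: lerD; rewrite lerD2l.
    by apply: le_trans (normc_Re _) _; exact: cn_coord.
  by apply: le_trans (normc_Im _) _; exact: cn_coord.
have -> : q + v - ratE r = (q - ratE r) + v by rewrite addrAC.
apply: le_lt_trans (lerD (Hk _ (q - ratE r).1 v.1) (Hk _ (q - ratE r).2 v.2)) _.
rewrite addrACA -/(csum (q - ratE r)) -ltrBrDl; apply: le_lt_trans vs.
rewrite /esize mulrDl [leRHS]addrC -[leRHS]addrC.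
have h1 := cn_ge0 v.1; have h2 := cn_ge0 v.2.
by apply: lerD; rewrite mulrC ler_wpM2l// /N ler_nat; [rewrite -addnA leq_addr|rewrite addnAC leq_addl].
Qed.

(** Rational balls form a countable base. *)
Lemma nbhs_csum (q : EC) (U : set EC) : nbhs q U -> exists r (j : nat),
  csum (q - ratE r) < j.+1%:R^-1 /\ forall w, csum (w - ratE r) < j.+1%:R^-1 -> U w.
Proof.
move=> /nbhs_esizeP[e e0 H].
have [j jd] : exists j : nat, 2 * j.+1%:R^-1 < e.
  exists (Num.truncn (2 / e)); rewrite -[ltLHS]invrK invfM invrK mulrC -[ltRHS]invrK.
  rewrite ltf_pV2 ?posrE ?invr_gt0// ?divr_gt0//.
  by rewrite ltr_pdivlMr// mulrC; exact: truncnS_gt.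
have [r rP] := @ratE_dense _ _ _ q j.+1%:R^-1 ltac:(by rewrite invr_gt0).
exists r, j; split => // w wr.
have -> : w = q + (w - q) by rewrite addrC subrK.
apply: H; apply: le_lt_trans jd; apply: le_trans (esize_le_csum _) _.
apply: le_trans (csum_triangle w q (ratE r)) _.
by rewrite mulr_natl mulr2n; apply: lerD; exact: ltW.
Qed.

Section measure.
Variable mu : {measure set (Borel EC) -> \bar R}.
Hypothesis rmu : radon mu.

Lemma measurable_ebox c : measurable (ebox c : set (Borel EC)).
Proof.
have [m1 m2] := emeas_Borel.
have H (h : Borel EC -> R) : measurable_fun setT h -> measurable [set q | `|h q| <= c].
  move=> mh; rewrite (_ : [set q | _] = (fun q => `|h q|) @^-1` `]-oo, c]); last first.
    by apply/seteqP; split => t /=; rewrite in_itv.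
  have mh' : measurable_fun setT (fun t => `|h t|) by apply: measurableT_comp.
  by rewrite -[X in measurable X]setTI; exact: mh'.
rewrite (_ : ebox c = (\bigcap_(j in [set: 'I_n]) [set q : EC | cbox c (q.1 ord0 j)]) `&`
                      (\bigcap_(j in [set: 'I_m]) [set q : EC | cbox c (q.2 ord0 j)])); last first.
  apply/seteqP; split => q /= [h1 h2]; split=> j.
  - by move=> _; exact: h1.
  - by move=> _; exact: h2.
  - exact: (h1 j I).
  - exact: (h2 j I).
apply: measurableI; apply: fin_bigcap_measurable => // j _.
  by apply: measurableI; apply: H; [exact: (m1 j).1|exact: (m1 j).2].
by apply: measurableI; apply: H; [exact: (m2 j).1|exact: (m2 j).2].
Qed.

(** E x F_C is a countable union of compact boxes. *)
Lemma radon_sigma_finite : sigma_finite setT mu.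
Proof.
exists (fun k => ebox k%:R) => [|k].
  apply/esym/seteqP; split => // q _; exists (Num.truncn (esize q)).+1 => //=.
  by apply: esize_ebox; apply: ltW; exact: truncnS_gt.
by split; [exact: measurable_ebox|apply: rmu.1; exact: compact_ebox].
Qed.

(** The complement of the support is a countable union of null balls. *)
Lemma measure_support0 (A : set (Borel EC)) : measurable A -> A `&` msupport mu = set0 -> mu A = 0%E.
Proof.
move=> mA AS.
pose I := ('rV[rat]_n * 'rV[rat]_n * ('rV[rat]_m * 'rV[rat]_m) * nat)%type.
pose B (rj : I) : set EC := [set q | csum (q - ratE rj.1) < rj.2.+1%:R^-1].
have mB rj : measurable (B rj : set (Borel EC)) by apply: open_measurableE; exact: open_csum.
pose F k : set (Borel EC) := if @unpickle I k is Some rj then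
  (if mu (B rj) == 0%E then B rj else set0) else set0.
have nF k : mu.-negligible (F k).
  rewrite /F; case: unpickle => [rj|]; last exact: negligible_set0.
  by case: eqP => [h|_]; [exists (B rj); split|exact: negligible_set0].
apply: (measure_negligible mA); apply: negligibleS (negligible_bigcup nF) => q Aq.
have : ~ msupport mu q by move=> sq; have : (A `&` msupport mu) q by []; rewrite AS.
move=> /existsNP[U /not_implyP[oU /not_implyP[Uq U0]]].
have [r [j [rP BU]]] := nbhs_csum (open_nbhs_nbhs (conj oU Uq)).
exists (pickle ((r, j) : I)); [exact: Logic.I|rewrite /F pickleK].
case: eqP => [_//|[]]; apply/eqP; rewrite -measure_le0.
have U0' : (mu U <= 0)%E by rewrite leNgt; apply/negP.
apply: le_trans U0'; apply: le_measure; rewrite ?inE//; exact: open_measurableE.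
Qed.

Variable Phi : Espace R n -> Espace R n -> FCspace R m.
Hypothesis hPhi : hermitian_map Phi.

Lemma bounded_rho_support : bounded_set (rho Phi @` msupport mu) ->
  exists2 H : R, 0 <= H & mu [set q | ~ (`|rho Phi q| <= H)] = 0%E.
Proof.
move=> [M [_ MP]]; pose H := `|M| + 1.
have H0 : 0 <= H by rewrite addr_ge0.
exists H => //; apply: measure_support0.
  have -> : [set q | ~ (`|rho Phi q| <= H)] = ~` [set q | `|rho Phi q| <= H] by [].
  apply: measurableC.
  by apply: (@measurable_norm_rV _ _ (Borel EC) _ (fun q => rho Phi q)); apply: rmeas_rho => //; exact: emeas_Borel.
apply/seteqP; split => // q [/= qH sq]; apply: qH.
apply: (MP H); last by exists q.
by rewrite (le_lt_trans (ler_norm _))// ltrDl.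
Qed.

End measure.

End topology.

(** * Linear forms that control the size of boundary points *)

Section frame.
Context {R : realType} {n m : nat}.
Local Notation C := R[i].
Local Notation EC := (EFC R n m).

Lemma econt_continuous (g : EC -> R) : econt Num.norm g -> continuous g.
Proof.
move=> cg q; apply/cvgrPdist_lt => e e0; apply/nbhs_esizeP.
by have [d d0 H] := cg q e e0; exists d => // v /H; rewrite distrC.
Qed.

Lemma econtN (g : EC -> R) : econt Num.norm g -> econt Num.norm (fun q => - g q).
Proof.
by move=> cg q e e0; have [d d0 H] := cg q e e0; exists d => // v /H; rewrite -opprD normrN.
Qed.

Lemma closed_econt (g : EC -> R) (y : R) : econt Num.norm g -> closed [set q | g q <= y].
Proof.
move=> cg; rewrite (_ : [set q | _] = ~` [set q | y < g q]); first exact/open_closedC/open_econt.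
by apply/seteqP; split => q /=; rewrite leNgt => /negP.
Qed.

Lemma econt_esize : econt Num.norm (@esize R n m).
Proof.
move=> q e e0; exists e => // v; apply: le_lt_trans; rewrite ler_norml lerBlDl esizeD andbT.
rewrite lerNl opprB lerBlDr addrC.
have := esizeD (q + v) (- v); rewrite addrK; move=> /le_trans; apply.
by rewrite lerD2l -scaleN1r -[-1](rmorphN1 (real_complex R)) esizeZR normrN1 mul1r.
Qed.

(** The extreme value theorem on the compact set where h = 1 inside a ball. *)
Lemma econt_compact_min (g h : EC -> R) (c : R) : econt Num.norm g -> econt Num.norm h ->
  (forall q, esize q <= c -> h q = 1 -> 0 < g q) ->
  exists2 d : R, 0 < d & forall q, esize q <= c -> h q = 1 -> d <= g q.
Proof.
move=> cg ch pos.
pose A : set EC := ebox c `&` ([set q : EC | esize q <= c] `&` ([set q : EC | h q <= 1] `&` [set q : EC | - h q <= -1])).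
have inA q : esize q <= c -> h q = 1 -> A q.
  by move=> h1 h2; split; [exact: esize_ebox|split => //; split; rewrite /= h2].
have cA : compact A.
  apply: compact_closedI; first exact: compact_ebox.
  apply: closedI; first exact/closed_econt/econt_esize.
  by apply: closedI; apply: closed_econt => //; exact: econtN.
have [A0|/nonemptyPn A0] := pselect (A !=set0); last first.
  by exists 1 => // q h1 h2; have := inA q h1 h2; rewrite A0.
have [q0 q0A qmin] := compact_EVT_min A0 cA (continuous_subspaceT (econt_continuous cg)).
exists (g q0).
  move: q0A; rewrite inE => -[_ [/= h1 [/= h2]]]; rewrite lerN2 => h3; apply: pos => //.
  by apply/eqP; rewrite eq_le h2.
by move=> q h1 h2; apply: qmin; rewrite inE; exact: inA.
Qed.

Variable Phi : Espace R n -> Espace R n -> FCspace R m.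
Hypothesis hPhi : hermitian_map Phi.

Lemma econt_pairing_quad l : econt Num.norm (fun q : EC => pairing l (quad Phi q.1)).
Proof.
have [B B0 HB] := Phi_bound hPhi => q e e0.
pose L := m%:R * `|l| * B * (1 + 2 * cn q.1).
have L0 : 0 <= L by rewrite !mulr_ge0// addr_ge0// mulr_ge0// cn_ge0.
exists (Num.min 1 (e / (L + 1))).
  by rewrite lt_min ltr01 divr_gt0// ltr_wpDl.
move=> v; rewrite lt_min => /andP[v1]; rewrite ltr_pdivlMr ?ltr_wpDl// => ve.
have -> : pairing l (quad Phi (q + v).1) - pairing l (quad Phi q.1) =
   pairing l (quad Phi v.1 + 2 *: ReV (Phi q.1 v.1)).
  by rewrite -[(q + v).1]/(q.1 + v.1) (quadD hPhi) -addrA (pairingD l (quad Phi q.1)) addrAC subrr add0r.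
apply: le_lt_trans (pairing_le _ _) _; apply: le_lt_trans ve.
have s0 := esize_ge0 v; have v1' : cn v.1 <= esize v by rewrite lerDl cn_ge0.
apply: le_trans (_ : m%:R * `|l| * (B * (1 + 2 * cn q.1) * esize v) <= _); last first.
  rewrite [leRHS]mulrC !mulrA; apply: ler_wpM2r => //.
  by rewrite -/L lerDl.
apply: ler_wpM2l; first by rewrite mulr_ge0.
apply: le_trans (ler_normD _ _) _; rewrite normrZ ger0_norm//.
have h1 := quad_bound HB v.1.
have h2 : `|ReV (Phi q.1 v.1)| <= B * cn q.1 * cn v.1.
  by apply: le_trans (HB _ _); rewrite /cn lerDl.
apply: le_trans (lerD h1 (ler_wpM2l _ h2)) _ => //.
have c1 := cn_ge0 v.1; have c2 := cn_ge0 q.1.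
have -> : B * cn v.1 * cn v.1 + 2 * (B * cn q.1 * cn v.1) = B * (cn v.1 + 2 * cn q.1) * cn v.1 by ring.
apply: ler_pM => //; rewrite ?mulr_ge0// ?addr_ge0// ?mulr_ge0//.
by rewrite ler_wpM2l// lerD2r; apply: ltW; exact: le_lt_trans v1.
Qed.

(** Positivity on the compact unit sphere, and homogeneity of degree two. *)
Lemma quad_coercive l : Lambda_plus Phi l ->
  exists2 c : R, 0 < c & forall z, c * cn z ^+ 2 <= pairing l (quad Phi z).
Proof.
move=> lP; have [|q q1 q1'|d d0 H] := @econt_compact_min
    (fun q => pairing l (quad Phi q.1)) (fun q => cn q.1) 1 (econt_pairing_quad l).
- move=> q e e0; exists e => // v ve.
  have /= h1 := cnD q.1 v.1; have h2 := cnD (q.1 + v.1) (- v.1).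
  have h3 : cn v.1 <= esize v by rewrite lerDl cn_ge0.
  have h4 : cn (- v.1) = cn v.1 by rewrite -scaleN1r -[-1](rmorphN1 (real_complex R)) cnZR normrN1 mul1r.
  rewrite addrK h4 in h2; apply: le_lt_trans ve; apply: le_trans h3.
  move: h1 h2; clear.
  by move: (cn (_ + _)) (cn q.1) (cn v.1) => x y z h1 h2; rewrite ler_norml; apply/andP; split; lra.
- apply: lP; apply/eqP => q0; move: q1'; rewrite q0 cn0 => /eqP.
  by rewrite eq_sym oner_eq0.
exists d => // z; have [z0|z0] := eqVneq (cn z) 0.
  rewrite (cn_eq0 z0).
  by rewrite cn0 expr0n mulr0 (quad0 hPhi) /pairing big1// => j _; rewrite mxE mulr0.
have zp : 0 < cn z by rewrite lt_neqAle eq_sym z0 cn_ge0.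
pose w := ((cn z)^-1)%:C *: z.
have w1 : cn w = 1 by rewrite cnZR gtr0_norm ?invr_gt0// mulVf.
have := H (w, 0); rewrite /esize/= w1 cn0 addr0 => /(_ (lexx _) erefl).
rewrite (quadZ hPhi) pairingZ exprVn mulrC ler_pdivlMr//.
by rewrite exprn_gt0.
Qed.

(** A family of linear forms on F that are nonnegative on the image of quad and
    control the size of the boundary points. *)
Definition frame (ls : 'I_m.+1 -> Fspace R m) (D : R) (e : Fspace R m) : Prop :=
  [/\ 0 < D, forall j z, 0 <= pairing (ls j) (quad Phi z),
      forall a, cn a.1 ^+ 2 <= D * normc (uc (ls ord0) (bpt Phi a)),
      forall a, `|a.2| <= D * \sum_j normc (uc (ls j) (bpt Phi a)) &
      pairing (ls ord0) e = 1].

(** Start from l in the open cone Lambda_+ (with l nonzero) and perturb it by small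
    multiples of the coordinate forms: coercivity keeps the perturbed forms
    nonnegative on the values of quad, while their differences recover all
    coordinates of x. *)
Lemma frame_exists : (0 < n + m)%N -> Lambda_plus Phi !=set0 ->
  exists ls D e, frame ls D e.
Proof.
move=> nm [l lP]; have [c c0 Hc] := quad_coercive lP.
have l0 : l != 0 \/ (0 < m)%N /\ n = 0%N.
  case: (posnP n) => [n0|n0]; first by right; split => //; move: nm; rewrite n0.
  left; apply/eqP => l0; have := lP (const_mx 1).
  rewrite l0 /pairing big1 ?ltxx; last by move=> j _; rewrite mxE mul0r.
  case/(_ _)/negP => //; apply/eqP => /rowP/(_ (Ordinal n0)); rewrite !mxE => /eqP.
  by rewrite oner_eq0.
have [l1 [l1P [l1n [c1 c10 Hc1]]]] : exists l1, Lambda_plus Phi l1 /\ (l1 != 0 /\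
    exists2 c : R, 0 < c & forall z, c * cn z ^+ 2 <= pairing l1 (quad Phi z)).
  case: l0 => [l0|[m0 n0]]; first by exists l; split=> //; split => //; exists c.
  have z0 (z : Espace R n) : z = 0 by apply/rowP => -[j jn]; exfalso; move: jn; rewrite n0.
  exists (const_mx 1); split; first by move=> z; rewrite (z0 z) eqxx.
  split.
    by apply/eqP => /rowP/(_ (Ordinal m0)); rewrite !mxE => /eqP; rewrite oner_eq0.
  exists 1 => // z; rewrite (z0 z) cn0 expr0n mulr0 (quad0 hPhi) /pairing big1// => j _.
  by rewrite [X in _ * X]mxE mulr0.
have [B B0 HB] := Phi_bound hPhi.
pose t := c1 / (m%:R * (1 + B) + 1).
have den : 0 < m%:R * (1 + B) + 1 by rewrite ltr_wpDl// mulr_ge0// addr_ge0.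
have t0 : 0 < t by rewrite divr_gt0.
(* the forms l1 and l1 + t e_j *)
pose ls (j : 'I_m.+1) := if unlift ord0 j is Some j' then l1 + t *: delta_mx ord0 j' else l1.
(* the vector e is a multiple of a basis vector on which l1 does not vanish *)
have [j0 lj0] : exists j, l1 ord0 j != 0.
  by apply/existsP; apply: contraNT l1n => /existsPn h; apply/eqP/rowP => j; rewrite mxE; apply/eqP; move: (h j); rewrite negbK.
exists ls, (c1^-1 + 2 * t^-1), ((l1 ord0 j0)^-1 *: delta_mx ord0 j0); split.
- by rewrite addr_gt0// ?mulr_gt0// ?invr_gt0.
- move=> j z; rewrite /ls; have hz := Hc1 z.
  have q0 : 0 <= cn z ^+ 2 by rewrite sqr_ge0.
  case: unliftP => [j' _|_]; last by apply: le_trans hz; rewrite mulr_ge0// ltW.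
  rewrite pairingDl pairingZl pairing_delta.
  have h : `|quad Phi z ord0 j'| <= B * cn z ^+ 2.
    apply: le_trans (le_coord_norm _ _) _; apply: le_trans (quad_bound HB _) _.
    by rewrite expr2 mulrA.
  have : t * B <= c1.
    rewrite /t mulrAC ler_pdivrMr// ler_wpM2l ?ltW//.
    have m1 : 1 <= m%:R :> R by rewrite ler1n (leq_ltn_trans _ (ltn_ord j')).
    have := mulr_ge0 B0 (_ : 0 <= m%:R - 1); rewrite subr_ge0 => /(_ m1).
    by move: (m%:R : R) m1 => M m1 h1; lra.
  have := ler_wpM2l (ltW t0) h; rewrite mulrA => h1 h2.
  have h3 := ler_wpM2r q0 h2; have := ler_norm (- (t * quad Phi z ord0 j')).
  rewrite normrN normrM (gtr0_norm t0); move: hz h1 h3; clear.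
  move: (t * `|quad Phi z ord0 j'|) (t * B * cn z ^+ 2) (c1 * cn z ^+ 2) (t * quad Phi z ord0 j') (pairing _ _).
  by clear => x1 x2 x3 x4 x5 *; lra.
- move=> a; have -> : ls ord0 = l1 by rewrite /ls unlift_none.
  have h : c1 * cn a.1 ^+ 2 <= normc (uc l1 (bpt Phi a)).
    apply: le_trans (Hc1 _) _; rewrite -Im_uc_bpt.
    by apply: le_trans (ler_norm _) _; exact: normc_Im.
  rewrite mulrDl; apply: le_trans (_ : c1^-1 * normc (uc l1 (bpt Phi a)) <= _).
    by rewrite -ler_pdivrMl ?invr_gt0// invrK.
  by rewrite lerDl !mulr_ge0 ?invr_ge0 ?normc_ge0// ltW.
- move=> a; set S := \sum_j _.
  have S0 : 0 <= S by apply: sumr_ge0 => j _; exact: normc_ge0.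
  have uS j : normc (uc (ls j) (bpt Phi a)) <= S.
    by rewrite /S (bigD1 j)//= lerDl sumr_ge0// => i _; exact: normc_ge0.
  have pS j : `|pairing (ls j) a.2| <= S.
    by apply: le_trans (uS j); rewrite -(Re_uc_bpt Phi); exact: normc_Re.
  rewrite mulrDl; apply: le_trans (_ : 2 * t^-1 * S <= _); last first.
    by rewrite lerDr mulr_ge0// invr_ge0 ltW.
  apply: norm_rV_le => [|j]; first by rewrite !mulr_ge0// invr_ge0 ltW.
  have h1 := pS (lift ord0 j); have h2 := pS ord0.
  rewrite /ls liftK unlift_none in h1 h2.
  rewrite pairingDl pairingZl pairing_delta in h1.
  rewrite mulrAC ler_pdivlMr// mulrC -{1}(gtr0_norm t0) -normrM.
  move: h1 h2; move: (pairing l1 a.2) (t * _) => x y; clear => h1 h2.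
  have -> : y = (x + y) - x by ring.
  by apply: le_trans (ler_normB _ _) _; lra.
- by rewrite /ls unlift_none pairingZ normr_pairing_delta mulVf.
Qed.

End frame.

(** * Holomorphic multipliers *)

Section regularizers.
Context {R : realType} {n m : nat}.
Local Notation C := R[i].
Local Notation EC := (EFC R n m).
Variable Phi : Espace R n -> Espace R n -> FCspace R m.
Hypothesis hPhi : hermitian_map Phi.

Lemma normc_uc (l : Fspace R m) (q : EC) : normc (uc l q) <= m%:R * `|l| * esize q.
Proof.
have -> : m%:R * `|l| * esize q = \sum_(j < m) (`|l| * esize q).
  by rewrite sumr_const card_ord -[RHS]mulr_natl mulrA.
rewrite /uc; apply: (@le_trans _ _ (\sum_(j < m) normc ((l ord0 j)%:C * q.2 ord0 j))).
  elim/big_rec2 : _ => [|j x y _ h]; first by rewrite ComplexField.Normc.normc0.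
  by apply: le_trans (le_normcD _ _) _; rewrite lerD2l.
apply: ler_sum => j _; rewrite normcM normcR; apply: ler_pM => //; rewrite ?normc_ge0//.
  exact: le_coord_norm.
by apply: le_trans (cn_coord _ _) _; rewrite lerDr cn_ge0.
Qed.

Lemma cdiff_uc (l : Fspace R m) (q v : EC) (a b w : C) :
  cdiff (fun w => a * uc l (q + w *: v) + b) w.
Proof.
apply: (@cdiff_eq _ (fun w => (a * uc l v) * w + (a * uc l q + b))); first exact: cdiff_affine.
by move=> z; rewrite uc_line; ring.
Qed.

Lemma Im_uc_ge (l : Fspace R m) (q : EC) : (forall z, 0 <= pairing l (quad Phi z)) ->
  - (m%:R * `|l| * `|rho Phi q|) <= Im (uc l q).
Proof.
move=> lp; rewrite Im_uc.
have -> : ImV q.2 = rho Phi q + quad Phi q.1 by rewrite /rho subrK.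
rewrite pairingD; have h := pairing_le l (rho Phi q); have := lp q.1.
move: h; rewrite ler_norml => /andP[+ _]; move: (pairing _ _) (pairing _ _) (_ * _) => x y z; lra.
Qed.

Lemma Re_i_scale (d : R) (u : C) : Re ('i * d%:C * u) = - (d * Im u).
Proof. by case: u => a b /=; ring. Qed.

Lemma normc_i_scale (d : R) (u : C) : 0 <= d -> normc ('i * d%:C * u) = d * normc u.
Proof. by move=> d0; rewrite !normcM normci normcR ger0_norm// mul1r. Qed.

Lemma cdiff_prod (I : finType) (F : I -> C -> C) w : (forall i, cdiff (F i) w) ->
  cdiff (fun z => \prod_i F i z) w.
Proof.
move=> hF; have H (s : seq I) : cdiff (fun z => \prod_(i <- s) F i z) w.
  elim: s => [|i s IH].
    by apply: (cdiff_eq (cdiff_cst 1 w)) => z; rewrite big_nil.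
  by apply: (cdiff_eq (cdiffM (hF i) IH)) => z; rewrite big_cons.
by apply: (cdiff_eq (H (enum I))) => z; rewrite big_enum.
Qed.

Lemma expclassX A f k : 0 <= A -> expclass Phi A f -> expclass Phi (k%:R * A) (fun q => f q ^+ k).
Proof.
move=> A0 cf; elim: k => [|k IH].
  split; first by move=> q v w; apply: (cdiff_eq (cdiff_cst 1 w)) => z; rewrite expr0.
  exists 1 => //; exists 0%N => q; rewrite expr0 mul0r mul0r expR0 !mulr1.
  by rewrite -real_complex1 normcR normr1.
rewrite -natr1 mulrDl mul1r addrC.
have [h1 h2] := expclassM A0 (mulr_ge0 (ler0n _ k) A0) cf IH.
by split; [move=> q v w; apply: (cdiff_eq (h1 q v w)) => z; rewrite exprS|
  case: h2 => K K0 [N h]; exists K => //; exists N => q; rewrite exprS].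
Qed.

Variables (ls : 'I_m.+1 -> Fspace R m) (D : R) (e : Fspace R m).
Hypothesis hf : frame Phi ls D e.

Let lsp j z : 0 <= pairing (ls j) (quad Phi z). Proof. by case: hf. Qed.

(** Bounds the type of the multipliers built from the frame. *)
Definition lam : R := \sum_j m%:R * `|ls j|.

Lemma lam_ge0 : 0 <= lam. Proof. by apply: sumr_ge0 => j _; rewrite mulr_ge0. Qed.

Lemma lam_ge j : m%:R * `|ls j| <= lam.
Proof. by rewrite /lam (bigD1 j)//= lerDl sumr_ge0// => i _; rewrite mulr_ge0. Qed.

(** The regularizing multiplier. On the boundary i u_j has nonpositive real part
    for each form of the frame, so every factor is at most 1 there and decays like
    1/(d |u_j|); the power N turns this into any prescribed polynomial decay. *)
Definition chi (d : R) (N : nat) (q : EC) : C := (\prod_j sigma ('i * d%:C * uc (ls j) q)) ^+ N.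

Lemma normc_prod (I : finType) (F : I -> C) : normc (\prod_i F i) = \prod_i normc (F i).
Proof.
elim/big_rec2 : _ => [|j x y _ <-]; last by rewrite normcM.
by rewrite -real_complex1 normcR normr1.
Qed.

Lemma normc_chi d N q : 0 <= d -> normc (chi d N q) <= expR (N%:R * (d * lam) * `|rho Phi q|).
Proof.
move=> d0; rewrite /chi normcX -mulrA expRM_natl; apply: lerXn2r; rewrite ?nnegrE ?normc_ge0 ?expR_ge0//.
rewrite normc_prod /lam mulr_sumr mulr_suml expR_sum; apply: ler_prod => j _; rewrite normc_ge0/=.
apply: le_trans (normc_sigma _) _; rewrite ler_expR ge_max Re_i_scale; apply/andP; split.
  have := ler_wpM2l d0 (Im_uc_ge q (@lsp j)); rewrite mulrN.
  by move=> h; rewrite -(mulrA d) lerNl.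
by rewrite !mulr_ge0.
Qed.

Lemma normc_chi_bpt d N a : 0 <= d -> normc (chi d N (bpt Phi a)) <= 1.
Proof. by move=> d0; apply: le_trans (normc_chi N _ d0) _; rewrite rho_bpt normr0 mulr0 expR0. Qed.

Lemma expclass_chi d N : 0 <= d -> expclass Phi (N%:R * (d * lam)) (chi d N).
Proof.
move=> d0; split; last first.
  by exists 1 => //; exists 0%N => q; rewrite expr0 !mul1r; exact: normc_chi.
move=> q v w; rewrite /chi; apply: cdiffX; apply: cdiff_prod => j.
apply: (@cdiff_comp _ (fun w => 'i * d%:C * uc (ls j) (q + w *: v)) sigma); last exact: cdiff_sigma.
by apply: (cdiff_eq (cdiff_uc (ls j) q v ('i * d%:C) 0 w)) => z; rewrite addr0.
Qed.

Definition S (a : Ngroup R n m) : R := \sum_j normc (uc (ls j) (bpt Phi a)).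

Lemma S_ge0 a : 0 <= S a.
Proof. by apply: sumr_ge0 => j _; exact: normc_ge0. Qed.

Lemma normc_sigma_le3 (v : C) : Re v <= 0 -> normc (sigma v) * (1 + normc v) <= 3.
Proof.
move=> v0; have := normc_sigma_decay v; have := normc_sigma v.
rewrite max_r// expR0; move: (normc (sigma v)) (normc v) => x y; lra.
Qed.

Lemma prod_1D_ge (I : finType) (x : I -> R) : (forall i, 0 <= x i) ->
  1 + \sum_i x i <= \prod_i (1 + x i).
Proof.
move=> x0; suff : 0 <= \sum_i x i /\ 1 + \sum_i x i <= \prod_i (1 + x i) by case.
elim/big_rec2 : _ => [|j s t _ [s0 st]]; first by rewrite addr0.
have xj := x0 j; split; first exact: addr_ge0.
have := ler_wpM2l (addr_ge0 ler01 xj) st; have := mulr_ge0 xj s0.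
move: (x j) xj; clear -s0 st => y y0 h1 h2; lra.
Qed.

(** Each factor decays like 3/(1 + d |u_j|), and the product of the 1 + d |u_j| is
    at least 1 + d S. *)
Lemma chi_decay d N a : 0 <= d ->
  normc (chi d N (bpt Phi a)) * (1 + d * S a) ^+ N <= (3 ^+ m.+1) ^+ N.
Proof.
move=> d0; rewrite /chi normcX -exprMn; apply: lerXn2r; rewrite ?nnegrE ?exprn_ge0//.
  by rewrite mulr_ge0 ?normc_ge0// addr_ge0// mulr_ge0// S_ge0.
rewrite normc_prod.
apply: (@le_trans _ _ (\prod_j (normc (sigma ('i * d%:C * uc (ls j) (bpt Phi a))) * (1 + d * normc (uc (ls j) (bpt Phi a)))))).
  rewrite big_split/=; apply: ler_wpM2l; first by apply: prodr_ge0 => j _; exact: normc_ge0.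
  rewrite /S mulr_sumr; apply: prod_1D_ge => j; rewrite mulr_ge0// normc_ge0//.
rewrite -[X in _ ^+ X](card_ord m.+1) -prodr_const; apply: ler_prod => j _; apply/andP; split.
  by rewrite mulr_ge0 ?normc_ge0// addr_ge0// mulr_ge0// normc_ge0.
rewrite -normc_i_scale//; apply: normc_sigma_le3.
by rewrite Re_i_scale Im_uc_bpt oppr_le0 mulr_ge0.
Qed.

(** Bernoulli's inequality. *)
Lemma bern (x : R) k : 0 <= x -> x <= 1 -> 1 - k%:R * x <= (1 - x) ^+ k.
Proof.
move=> x0 x1; elim: k => [|k IH]; first by rewrite mul0r subr0 expr0.
rewrite exprSr; have x10 : 0 <= 1 - x by rewrite subr_ge0.
have := ler_wpM2r x10 IH; have : 0 <= k%:R * x * x by rewrite !mulr_ge0.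
rewrite -natr1; move: (k%:R : R) (_ * (1 - x)) => y z; lra.
Qed.

(** Bernoulli's inequality for the (m+1) N factors, each within 2 t of 1. *)
Lemma chi_lower (d t : R) N q : 0 <= d -> 0 <= t -> t <= 4^-1 -> d * (lam * esize q) <= t ->
  1 - (m.+1 * N)%:R * (2 * t) <= normc (chi d N q).
Proof.
move=> d0 t0 t1 ht; apply: (@le_trans _ _ ((1 - 2 * t) ^+ (m.+1 * N))).
  by apply: bern; lra.
rewrite /chi normcX exprM; apply: lerXn2r; rewrite ?nnegrE ?normc_ge0 ?exprn_ge0//; first by lra.
rewrite normc_prod -[X in _ ^+ X](card_ord m.+1) -prodr_const; apply: ler_prod => j _.
apply/andP; split; first by lra.
set v := _ * uc _ _; have vt : normc v <= t.
  rewrite normc_i_scale//; apply: le_trans ht; rewrite ler_wpM2l//.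
  apply: le_trans (normc_uc _ _) _; rewrite ler_wpM2r ?esize_ge0//; exact: lam_ge.
have h1 := normc_sigmaB1 v.
have h2 : expR (normc v) <= 2.
  apply: le_trans (_ : expR (4^-1) <= 2); first by rewrite ler_expR (le_trans vt).
  have h : 1 - 4^-1 <= expR (- 4^-1) :> R by have := expR_ge1Dx (- 4^-1 : R).
  have := expRxMexpNx_1 (4^-1 : R); have := expR_gt0 (4^-1 : R).
  move: h; move: (expR (- 4^-1)) (expR 4^-1) => x y h y0 xy.
  have := ler_wpM2l (ltW y0) h; rewrite xy; lra.
have h3 : normc (sigma v - 1) <= 2 * t.
  apply: le_trans h1 _; rewrite mulrC; apply: ler_pM; rewrite ?expR_ge0 ?normc_ge0//.
have := ler_normcB 1 (1 - sigma v).
rewrite (_ : 1 - (1 - sigma v) = sigma v); last by rewrite opprB addrC subrK.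
rewrite (normcB 1) -[normc 1]/(normc (1%:C)) normcR normr1.
by move=> h; apply: le_trans h; rewrite lerD2l lerN2.
Qed.

(** The leading form of the frame, which dominates |zeta|^2 on the boundary. *)
Definition u0 (q : EC) : C := uc (ls ord0) q.

(** g L vanishes where u0 = 0 but is comparable to min(1, |u0|/L) on the boundary. *)
Definition gL (L : R) (q : EC) : C := (L^-1)%:C * u0 q * sigma ('i * (L^-1)%:C * u0 q - 1).

(** With v = i u0/L - 1 one has |gL| |v| = (|u0|/L) |exp v - 1|, where |exp v - 1|
    lies between 1/2 and 2 since Re v <= -1, and |v| between max(1, |u0|/L) and
    1 + |u0|/L. *)
Lemma gL_bpt L a : 0 < L ->
  let x := normc (u0 (bpt Phi a)) / L in
  [/\ normc (gL L (bpt Phi a)) <= 2, normc (gL L (bpt Phi a)) <= 2 * x &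
      x / (2 * (x + 1)) <= normc (gL L (bpt Phi a))].
Proof.
move=> L0; set u := u0 _ => x.
have x0 : 0 <= x by rewrite divr_ge0 ?normc_ge0// ltW.
have Li : 0 < L^-1 by rewrite invr_gt0.
set v := 'i * (L^-1)%:C * u - 1.
have nu : normc ('i * (L^-1)%:C * u) = x by rewrite normc_i_scale ?ltW// mulrC.
have Rv : Re v <= -1.
  by rewrite cReB Re_i_scale Im_uc_bpt/= lerBlDr addNr oppr_le0 mulr_ge0// ltW.
have v1 : 1 <= normc v by have := normc_Re v; have := ler_norm (- Re v); rewrite normrN; lra.
have vx : x <= normc v.
  rewrite -nu -(@ler_pXn2r _ 2)// ?nnegrE ?normc_ge0// !normc_sqr cReB cImB Re_i_scale Im_uc_bpt.
  rewrite [Re 1]/= [Im 1]/= subr0 lerD2r.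
  have : 0 <= L^-1 * pairing (ls ord0) (quad Phi a.1) by rewrite mulr_ge0// ltW.
  move=> y0; rewrite -opprD !sqrrN; apply: lerXn2r; rewrite ?nnegrE ?addr_ge0//.
  by rewrite lerDl.
have vx1 : normc v <= x + 1.
  have := ler_normcB v ('i * (L^-1)%:C * u); rewrite nu /v addrAC subrr add0r.
  by rewrite normcN -real_complex1 normcR normr1; lra.
have g : normc (gL L (bpt Phi a)) * normc v = x * normc (cexp v - 1).
  rewrite /gL -/u -/v -sigma_mul !normcM normcR (gtr0_norm Li).
  by rewrite /x; move: (normc u) (normc v) (normc (sigma v)) => y1 y2 y3; ring.
have e1 : normc (cexp v) <= 2^-1.
  rewrite normc_cexp; apply: le_trans (_ : expR (-1) <= _); first by rewrite ler_expR.
  rewrite expRN lef_pV2 ?posrE ?expR_gt0//.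
  by have := expR_ge1Dx (1 : R).
have e2 : normc (cexp v - 1) <= 2.
  apply: le_trans (le_normcD _ _) _.
  by rewrite normcN -[normc 1]/(normc (1%:C)) normcR normr1; lra.
have e3 : 2^-1 <= normc (cexp v - 1).
  rewrite normcB; apply: le_trans (ler_normcB _ _).
  by rewrite -[normc 1]/(normc (1%:C)) normcR normr1; lra.
move: g (normc_ge0 (gL L (bpt Phi a))); move: (normc (gL _ _)) (normc v) v1 vx vx1 (normc (cexp v - 1)) e2 e3 => G V v1 vx vx1 E e2 e3 g G0.
have V0 : 0 < V by exact: lt_le_trans v1.
split.
- rewrite -(ler_pM2r V0) g mulrC; apply: ler_pM => //; exact: le_trans e3.
- rewrite -(ler_pM2r V0) g; apply: (@le_trans _ _ (x * 2)); first exact: ler_wpM2l.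
  by rewrite [x * 2]mulrC ler_peMr// mulr_ge0.
- rewrite ler_pdivrMr ?mulr_gt0 ?ltr_wpDl//.
  have h : x * 2^-1 <= G * V by rewrite g; apply: ler_wpM2l.
  have h2 : G * V <= G * (x + 1) by exact: ler_wpM2l.
  by lra.
Qed.

Lemma expclass_gL L : 0 < L -> expclass Phi (L^-1 * lam) (gL L).
Proof.
move=> L0; have Li : 0 < L^-1 by rewrite invr_gt0.
split.
  move=> q v w; rewrite /gL; apply: cdiffM.
    by apply: (cdiff_eq (cdiff_uc (ls ord0) q v (L^-1)%:C 0 w)) => z; rewrite addr0.
  apply: (@cdiff_comp _ (fun w => 'i * (L^-1)%:C * u0 (q + w *: v) - 1) sigma); last exact: cdiff_sigma.
  exact: cdiff_uc.
exists (L^-1 * lam); first by rewrite mulr_ge0 ?lam_ge0// ltW.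
exists 1%N => q; rewrite expr1 /gL !normcM; apply: ler_pM; rewrite ?mulr_ge0 ?normc_ge0//.
  rewrite normcR (gtr0_norm Li) -mulrA; apply: ler_wpM2l; first exact: ltW.
  apply: le_trans (normc_uc _ _) _; apply: ler_pM; rewrite ?esize_ge0// ?lam_ge//.
  by rewrite lerDr.
apply: le_trans (normc_sigma _) _; rewrite ler_expR ge_max; apply/andP; split; last first.
  by rewrite !mulr_ge0 ?lam_ge0// ltW.
rewrite cReB Re_i_scale/= -mulrA.
have h := ler_wpM2l (ltW Li) (Im_uc_ge q (@lsp ord0)).
have h2 : L^-1 * (m%:R * `|ls ord0| * `|rho Phi q|) <= L^-1 * (lam * `|rho Phi q|).
  by rewrite ler_pM2l// ler_wpM2r// lam_ge.
move: h h2; rewrite mulrN /u0; move: (_ * Im _) (L^-1 * _) (L^-1 * _) => x y z h h2; lra.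
Qed.

End regularizers.

(** * Point evaluations are bounded by L^p norms *)

Lemma shift_factor2 {R : realType} (B D U l : R) : 0 <= B -> 0 <= D -> 0 <= U -> 0 <= l ->
  l * ((1 + 4 * B) * ((1 + D) * (1 + U)) * (2 * ((l + 1) * (1 + 4 * B) * (1 + D)))^-1) <= 2^-1 * (1 + U).
Proof.
move=> B0 D0 U0 l0.
have b0 : 0 < 1 + 4 * B by rewrite ltr_pwDl// mulr_ge0.
have d0 : 0 < 1 + D by rewrite ltr_pwDl.
have l1 : 0 < l + 1 by rewrite ltr_wpDl.
rewrite [leLHS](_ : _ = 2^-1 * (1 + U) * (l / (l + 1))); last first.
  by field; rewrite !gt_eqF.
rewrite ler_piMr//; first by rewrite mulr_ge0// addr_ge0.
by rewrite ler_pdivrMr// mul1r lerDl.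
Qed.

Lemma shift_factor {R : realType} (B D U x : R) : 0 <= B -> 0 <= D -> 0 <= U -> x <= 1 + D * U ->
  1 + 4 * B * x <= (1 + 4 * B) * ((1 + D) * (1 + U)).
Proof.
move=> B0 D0 U0 hx; have h1 := ler_wpM2l B0 hx.
have h2 := mulr_ge0 D0 U0; have h3 := mulr_ge0 B0 D0; have h4 := mulr_ge0 B0 U0.
have h5 := mulr_ge0 B0 h2; lra.
Qed.

Lemma normc_near {R : realType} (z w : R[i]) : normc z - normc (w - z) <= normc w.
Proof. by have := ler_normcB z (z - w); rewrite (normcB w) subKr. Qed.

Section point_estimates.
Context {R : realType} {n m : nat}.
Local Notation C := R[i].
Local Notation EC := (EFC R n m).
Variable Phi : Espace R n -> Espace R n -> FCspace R m.
Hypothesis hPhi : hermitian_map Phi.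
Variables (ls : 'I_m.+1 -> Fspace R m) (D : R) (e : Fspace R m).
Hypothesis hf : frame Phi ls D e.
Variable p : R.
Local Notation TN := (Rtuple R n * Rtuple R n * Rtuple R m)%type.
Hypothesis p0 : 0 < p.
Implicit Types (f : EC -> C) (a b : Ngroup R n m).

Lemma powR_mono (x y : R) : 0 <= x -> x <= y -> x `^ p <= y `^ p.
Proof.
move=> x0 xy; have y0 := le_trans x0 xy.
by apply: ge0_ler_powR => //; exact: ltW.
Qed.

Definition pw f b : R := normc (f (bpt Phi b)) `^ p.

(** Far from the zeros of u0. *)
Definition farN (T : R) b : bool := T < normc (u0 ls (bpt Phi b)).

Lemma econt_u0 : econt (@ComplexField.Normc.normc R) (@u0 R n m ls).
Proof.
move=> q r r0; pose L := m%:R * `|ls ord0| + 1.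
have L0 : 0 < L by rewrite ltr_wpDl// mulr_ge0.
exists (r / L); first by rewrite divr_gt0.
move=> v; rewrite ltr_pdivlMr// => vr; apply: le_lt_trans vr.
have := uc_line (ls ord0) q v 1; rewrite scale1r mul1r /u0 => ->.
rewrite addrAC subrr add0r; apply: le_trans (normc_uc _ _) _.
by rewrite mulrC ler_wpM2l ?esize_ge0// /L lerDl.
Qed.

Lemma measurable_pow d (T : measurableType d) (Q : T -> EC) f : emeas Q ->
  econt (@ComplexField.Normc.normc R) f ->
  measurable_fun setT (fun t => normc (f (Q t)) `^ p).
Proof.
move=> mQ cf; apply: (measurableT_comp (measurable_powR p)).
by apply: measurable_normc; exact: cmeas_econt.
Qed.

Lemma measurable_far d (T : measurableType d) (b : T -> Ngroup R n m) (x : R) : nmeas b ->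
  measurable_fun setT (fun t => (farN x (b t))%:R : R).
Proof.
move=> mb; rewrite (_ : (fun t => _) = fun t => if farN x (b t) then 1 else 0); last first.
  by apply/funext => t; case: farN.
apply: measurable_fun_ifT => //; apply: measurable_fun_ltr; first exact: measurable_cst.
by apply: measurable_normc; apply: cmeas_econt (emeas_bpt hPhi mb) econt_u0.
Qed.

Lemma small_bpt (s : R) : 0 < s -> exists2 c0 : R, 0 < c0 & forall b, smallN c0 b -> esize (bpt Phi b) <= s.
Proof.
move=> s0; have [B B0 HB] := Phi_bound hPhi.
have B3 : 0 < 3 + 4 * B by rewrite ltr_pwDl// mulr_ge0.
pose c0 := Num.min 1 (s / (3 + 4 * B)).
have c00 : 0 < c0 by rewrite lt_min ltr01 divr_gt0.
exists c0 => // b /smallN_cn/(_ (ltW c00))[h1 h2].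
have c1 : c0 <= 1 by rewrite ge_min lexx.
have c2 : c0 * (3 + 4 * B) <= s by rewrite -ler_pdivlMr// ge_min lexx orbT.
rewrite /esize/= cn_complexV; have h3 := quad_bound HB b.1; have h4 := cn_ge0 b.1.
have h5 : B * cn b.1 * cn b.1 <= B * (2 * c0) * (2 * 1).
  apply: ler_pM; rewrite ?mulr_ge0//; first by rewrite ler_wpM2l.
  by apply: le_trans h1 _; rewrite ler_wpM2l.
move: (cn b.1) (`|b.2|) (`|quad Phi b.1|) h1 h2 h3 h5 => x y z h1 h2 h3 h5.
have : B * (2 * c0) * (2 * 1) = 4 * B * c0 by ring.
move: (B * x * x) (B * (2 * c0) * (2 * 1)) h3 h5 => t1 t2 h3 h5 h6.
lra.
Qed.

(** The displacement moves u0 by an amount linear in the E-component of b, whose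
    square is dominated by u0(b). *)
Lemma u0_shift : exists2 s : R, 0 < s & forall b q, esize q <= s ->
  normc (u0 ls (tau Phi b q)) >= normc (u0 ls (bpt Phi b)) / 2 - 1 / 2.
Proof.
have [B B0 HB] := Phi_bound hPhi.
have [D0 _ HD _ _] := hf.
pose L := (lam ls + 1) * (1 + 4 * B) * (1 + D).
have l0 : 0 <= lam ls by apply: lam_ge0.
have L0 : 0 < L.
  apply: mulr_gt0; last by rewrite addr_gt0.
  by apply: mulr_gt0; [rewrite ltr_wpDl|rewrite ltr_pwDl// mulr_ge0].
exists (2 * L)^-1 => [|b q qs]; first by rewrite invr_gt0 mulr_gt0.
set U := normc (u0 ls (bpt Phi b)); have U0 : 0 <= U by exact: normc_ge0.
have -> : u0 ls (tau Phi b q) = u0 ls (bpt Phi b) + u0 ls (tau_lin Phi b q).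
  by have := uc_line (ls ord0) (bpt Phi b) (tau_lin Phi b q) 1; rewrite scale1r mul1r -tau_affine.
have h1 := ler_normcB (u0 ls (bpt Phi b)) (- u0 ls (tau_lin Phi b q)).
rewrite opprK normcN in h1.
have h2 : normc (u0 ls (tau_lin Phi b q)) <= 2^-1 * (1 + U).
  apply: le_trans (normc_uc _ _) _.
  apply: (@le_trans _ _ (lam ls * ((1 + 4 * B) * ((1 + D) * (1 + U)) * (2 * L)^-1))).
    apply: ler_pM; rewrite ?mulr_ge0 ?esize_ge0//; first exact: lam_ge.
    apply: le_trans (esize_tau_lin b B0 HB q) _.
    apply: ler_pM; rewrite ?esize_ge0// ?addr_ge0 ?mulr_ge0 ?cn_ge0//.
    have hc : cn b.1 <= 1 + D * U.
      have := HD b; rewrite -/(u0 ls (bpt Phi b)) -/U; have := sqr_ge0 (cn b.1 - 1).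
      by rewrite sqrrB1; move: (cn b.1 ^+ 2) (D * U) => x y; have := cn_ge0 b.1; lra.
    by apply: shift_factor => //; exact: ltW.
  by apply: shift_factor2 => //; exact: ltW.
move: h1 h2; rewrite -/U; move: (normc (u0 ls (tau_lin _ _ _))) (normc (_ + _)) => x y h1 h2; lra.
Qed.

(** By left invariance a bound from below on a box around b gives a bound on the
    integral that does not depend on b. *)
Lemma integral_lebN_ge b (c0 r : R) (g : Ngroup R n m -> R) :
  (forall b, measurable_fun setT (fun u : TN => g (mulN Phi b (pointN u)))) -> (forall u, 0 <= g u) ->
  0 <= r -> 0 <= c0 ->
  (forall u, smallN c0 u -> r <= g (mulN Phi b u)) ->
  ((r * ((2 * c0) ^+ n * (2 * c0) ^+ n * (2 * c0) ^+ m))%:E <= \int[lebN R n m]_u (g (pointN u))%:E)%E.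
Proof.
move=> mg g0 r0 c00 H.
have mg0 : measurable_fun setT ((fun u => (g u)%:E) \o @pointN R n m).
  by apply/measurable_EFinP; have := mg 0; under eq_fun do rewrite (mul0N hPhi).
have e1 := @integral_lebN_left _ _ _ _ hPhi b (fun u => (g u)%:E) mg0 (fun u => g0 u).
have ms : measurable_fun setT (fun u : TN => (smallN c0 (pointN u))%:R : R).
  exact: measurable_smallN (nmeas_pointN (@measurable_id _ TN setT)).
apply: (@le_trans _ _ (\int[lebN R n m]_u (g (mulN Phi b (pointN u)))%:E)%E); last by rewrite e1.
have e2 := integral_smallN c00 : (\int[lebN R n m]_t _)%E = _.
rewrite EFinM -e2 -ge0_integralZl//; last by apply/measurable_EFinP.
apply: ge0_le_integral => //.
- by move=> u _; rewrite -EFinM lee_fin mulr_ge0.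
- by apply/measurable_EFinP; apply: measurable_funM.
- exact/measurable_EFinP.
- move=> u _; rewrite -EFinM lee_fin; case: (boolP (smallN c0 (pointN u))) => [/H h|_].
    by rewrite mulr1.
  by rewrite mulr0.
Qed.

(** The sup bound on the boundary extends to the strip |rho| <= 1 with the factor
    exp A, and small translates stay in this strip. *)
Lemma bdry_oscillation (A B M t : R) f b : 0 <= A -> 0 <= B ->
  (forall z z', cn (Phi z z') <= B * cn z * cn z') -> 0 <= M ->
  expclass Phi A f -> (forall a, normc (f (bpt Phi a)) <= M) -> t <= 1 ->
  forall q, esize q <= t * kappa B ->
  normc (f (tau Phi b q) - f (bpt Phi b)) <= 4 * (M * expR A) * t.
Proof.
move=> A0 B0 HB M0 cf bd t1 q qt.
have k0 : 0 < kappa B by rewrite invr_gt0 mulr_gt0// ltr_wpDr.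
apply: (oscillation hPhi cf.1 k0 _ t1 qt) => v vk.
have h : forall a, normc (f (tau Phi b (bpt Phi a))) <= M by move=> a; rewrite tau_bpt.
apply: le_trans (strip_bound A0 (expclass_tau hPhi b cf) h v) _.
rewrite ler_wpM2l// ler_expR -[leRHS]mulr1 ler_wpM2l//.
exact: rho_small HB vk.
Qed.

(** For a bounded function of type A the supremum on the boundary is controlled
    by an L^p norm away from the zeros of u0: near a point where the supremum is
    almost attained the function stays large, by Schwarz's lemma. *)
Lemma sup_le_Lp (A T : R) : 0 <= A -> 0 < T -> exists2 K : R, 0 < K &
  forall f, expclass Phi A f -> (exists M, forall a, normc (f (bpt Phi a)) <= M) ->
  forall a, ((pw f a)%:E <= K%:E * \int[lebN R n m]_t ((farN T (pointN t))%:R * pw f (pointN t))%:E)%E.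
Proof.
move=> A0 T0; have [B B0 HB] := Phi_bound hPhi; have [D0 _ HD _ le1] := hf.
pose T2 := 2 * T + 1; have T20 : 0 < T2 by rewrite addr_gt0// mulr_gt0.
pose C1 := expR (12 * (A * `|e|) * (2 * T2)).
have C11 : 1 <= C1.
  by rewrite /C1 -expR0 ler_expR !mulr_ge0// ltW.
have C10 : 0 < C1 by exact: lt_le_trans C11.
have k0 : 0 < kappa B by rewrite invr_gt0 mulr_gt0// ltr_wpDr.
pose t := (16 * C1 * expR A)^-1.
have eA : 1 <= expR A by rewrite -expR0 ler_expR.
have CA : 1 <= C1 * expR A by rewrite -[leLHS]mulr1; apply: ler_pM.
have t0 : 0 < t by rewrite invr_gt0 !mulr_gt0// expR_gt0.
have t1 : t <= 1 by rewrite invf_le1 -?mulrA ?mulr_gt0// ?expR_gt0//; lra.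
have [s s0 Hs] := u0_shift.
have [c0 c00 Hc] : exists2 c0 : R, 0 < c0 & forall b, smallN c0 b -> esize (bpt Phi b) <= Num.min (t * kappa B) s.
  by apply: small_bpt; rewrite lt_min s0 mulr_gt0.
pose vol := (2 * c0) ^+ n * (2 * c0) ^+ n * (2 * c0) ^+ m.
have vol0 : 0 < vol by rewrite !mulr_gt0// exprn_gt0// mulr_gt0.
exists ((4 * C1) `^ p / vol); first by rewrite divr_gt0// powR_gt0// mulr_gt0.
move=> f cf bf a.
have mh b : measurable_fun setT (fun u : TN =>
    (farN T (mulN Phi b (pointN u)))%:R * pw f (mulN Phi b (pointN u)) : R).
  have mb : nmeas (fun u : TN => mulN Phi b (pointN u)).
    by apply: nmeas_mulN => //; [exact: nmeas_cst|exact: nmeas_pointN].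
  apply: measurable_funM; first exact: measurable_far.
  by apply: measurable_pow; [exact: emeas_bpt|exact: (expclass_econt hPhi A0)].
set I := (\int[_]_u _)%E.
have I0 : (0 <= I)%E by apply: integral_ge0 => u _; rewrite lee_fin mulr_ge0// powR_ge0.
(* 0 is added so that the set is not empty *)
pose E := [set x : R | x = 0 \/ exists2 b, T2 < normc (u0 ls (bpt Phi b)) & x = normc (f (bpt Phi b))].
have E0 : E !=set0 by exists 0; left.
have ubE : has_ubound E.
  have [M HM] := bf; exists (Num.max 0 M) => _ [->|[b _ ->]]; first by rewrite le_max lexx.
  by rewrite le_max HM orbT.
pose M1 := sup E.
have fM1 b : T2 < normc (u0 ls (bpt Phi b)) -> normc (f (bpt Phi b)) <= M1.
  by move=> h; apply: ub_le_sup => //; right; exists b.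
have M10 : 0 <= M1 by apply: ub_le_sup => //; left.
have [M1z|M1n] := eqVneq M1 0.
  have f0 : normc (f (bpt Phi a)) = 0.
    apply/eqP; rewrite eq_le normc_ge0 andbT; apply/ler_addgt0Pr => r r0; rewrite add0r.
    have := sup_removal A0 cf T20 le1 bf (_ : 0 < r / C1) _ a.
    rewrite -/C1 divr_gt0// (mulrCA C1) divff ?gt_eqF// mulr1 => h; apply: h => // b hb.
    by apply: le_trans (fM1 b hb) _; rewrite M1z divr_ge0// ltW.
  by rewrite /pw f0 powR0 ?gt_eqF// mule_ge0// lee_fin divr_ge0 ?powR_ge0// ltW.
have M1p : 0 < M1 by rewrite lt_neqAle eq_sym M1n.
have bound := sup_removal A0 cf T20 le1 bf M1p fM1; rewrite -/C1 in bound.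
have [b bT bM] : exists2 b, T2 < normc (u0 ls (bpt Phi b)) & M1 / 2 < normc (f (bpt Phi b)).
  have : ~ ubound E (M1 / 2) by move=> /(ge_sup E0); rewrite -/M1 leNgt => /negP; apply; lra.
  move=> /existsNP[x /not_implyP[Ex /negP]]; rewrite -ltNge => xM.
  case: Ex => [x0|[b h1 h2]]; first by move: xM; rewrite x0; lra.
  by exists b; rewrite -?h2.
(* near an almost maximal point f stays above M1 / 4 and u0 stays large *)
have small u : smallN c0 u -> farN T (mulN Phi b u) /\ M1 / 4 <= normc (f (bpt Phi (mulN Phi b u))).
  move=> /Hc; rewrite le_min => /andP[u1 u2]; rewrite /farN -tau_bpt//; split.
    by apply: lt_le_trans (Hs b _ u2); move: bT; rewrite /T2; lra.
  have osc := bdry_oscillation b A0 B0 HB (mulr_ge0 (ltW C10) M10) cf bound t1 u1.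
  have -> : M1 / 4 = M1 / 2 - M1 / 4 by field.
  have e4 : 4 * (C1 * M1 * expR A) * t = M1 / 4.
    by rewrite /t; field; rewrite !gt_eqF// expR_gt0.
  have h := normc_near (f (bpt Phi b)) (f (tau Phi b (bpt Phi u))).
  apply: le_trans h; apply: lerB; first exact: ltW.
  by apply: le_trans osc _; rewrite e4.
have low : (((M1 / 4) `^ p * vol)%:E <= I)%E.
  apply: (@integral_lebN_ge b c0 _ (fun u => (farN T u)%:R * pw f u)); rewrite ?powR_ge0 ?ltW//.
    by move=> u; rewrite mulr_ge0// powR_ge0.
  by move=> u /small[-> h]; rewrite mul1r powR_mono// divr_ge0.
apply: le_trans (_ : ((C1 * M1) `^ p)%:E <= _)%E.
  by rewrite lee_fin powR_mono ?normc_ge0.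
apply: le_trans (lee_wpmul2l _ low); last by rewrite lee_fin divr_ge0 ?powR_ge0// ltW.
have E4 (x y : R) : 4 * x * (y / 4) = x * y by field.
have h4 : 0 <= 4 * C1 by rewrite mulr_ge0// ltW.
have h5 : 0 <= M1 / 4 by rewrite divr_ge0.
by rewrite -EFinM lee_fin mulrACA mulVf ?gt_eqF// mulr1 -(powRM _ h4 h5) E4.
Qed.

End point_estimates.

Lemma affine_le {R : realType} (D d s : R) : 0 < d -> 0 <= D -> 0 <= s ->
  1 + 1 + D * s <= (2 + D / d) * (1 + d * s).
Proof.
move=> d0 D0 s0; have e : (2 + D / d) * (1 + d * s) = 2 + 2 * (d * s) + D / d + D * s.
  by field; rewrite gt_eqF.
have h1 : 0 <= D / d by rewrite divr_ge0// ltW.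
have h2 : 0 <= d * s by rewrite mulr_ge0// ltW.
by rewrite e; lra.
Qed.

Lemma size_sum {R : realType} (B D x y z s : R) : x <= 1 + D * s -> y <= D * s -> z <= B * (D * s) ->
  1 + (x + (y + z)) <= 1 + 1 + (2 + B) * D * s.
Proof. by move=> h1 h2 h3; rewrite -mulrA; move: (D * s) h1 h2 h3 => t *; lra. Qed.

Lemma shrink_budget {R : realType} (k : nat) (s : R) : 0 < s -> s <= 1 ->
  exists t : R, [/\ 0 < t, t <= 4^-1 & k%:R * (2 * t) <= s * 2^-1].
Proof.
move=> s0 s1; have k0 : 0 < k.+1%:R :> R by [].
exists (s / (4 * k.+1%:R)); split; first by rewrite divr_gt0// mulr_gt0.
  rewrite ler_pdivrMr ?mulr_gt0// mulrA mulVf// mul1r; apply: le_trans s1 _.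
  by rewrite ler1n.
have e : k%:R * (2 * (s / (4 * k.+1%:R))) = s * 2^-1 * (k%:R / k.+1%:R).
  by move: k0; move: (k.+1%:R : R) => x x0; field; rewrite gt_eqF.
rewrite e ler_piMr//; first by rewrite mulr_ge0// ltW.
by rewrite ler_pdivrMr// mul1r ler_nat.
Qed.

Section weighted_estimates.
Context {R : realType} {n m : nat}.
Local Notation C := R[i].
Local Notation EC := (EFC R n m).
Local Notation TN := (Rtuple R n * Rtuple R n * Rtuple R m)%type.
Variable Phi : Espace R n -> Espace R n -> FCspace R m.
Hypothesis hPhi : hermitian_map Phi.
Variables (ls : 'I_m.+1 -> Fspace R m) (D : R) (e : Fspace R m).
Hypothesis hf : frame Phi ls D e.
Variable p : R.
Hypothesis p0 : 0 < p.
Implicit Types (f : EC -> C) (a b : Ngroup R n m).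

Let D0 : 0 < D. Proof. by case: hf. Qed.

Lemma cn_S b : cn b.1 ^+ 2 <= D * S Phi ls b.
Proof.
have [_ _ h _ _] := hf; apply: le_trans (h b) _; rewrite ler_pM2l// /S (bigD1 ord0)//=.
by rewrite lerDl sumr_ge0// => j _; exact: normc_ge0.
Qed.

Lemma norm_S b : `|b.2| <= D * S Phi ls b.
Proof. by have [_ _ _ h _] := hf; exact: h. Qed.

Lemma cn_S1 b : cn b.1 <= 1 + D * S Phi ls b.
Proof.
have := cn_S b; have := sqr_ge0 (cn b.1 - 1); have := cn_ge0 b.1.
rewrite sqrrB1; move: (D * _) (cn b.1 ^+ 2) (cn b.1) => x y z; lra.
Qed.

(** For this N the p-th power of chi decays at least as fast as W0. *)
Lemma chi_weight (d : R) N : 0 < d -> (2 * (n + n + m))%:R <= N%:R * p ->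
  exists2 K : R, 0 < K & forall b, normc (chi ls d N (bpt Phi b)) `^ p <= K * W0 b.
Proof.
move=> d0 NE; set E := (2 * (n + n + m))%N in NE *.
pose c1 := 2 + D / d; have c10 : 0 < c1 by rewrite addr_gt0// divr_gt0.
pose c3 : R := ((3 ^+ m.+1) ^+ N) `^ p.
have c30 : 0 < c3 by rewrite powR_gt0// !exprn_gt0.
exists (c3 * c1 ^+ E) => [|b]; first by rewrite mulr_gt0// exprn_gt0.
have S0 := S_ge0 Phi ls b; have s0 : 0 <= 1 + D * S Phi ls b by rewrite addr_ge0// mulr_ge0// ltW.
have y1 : 1 <= 1 + d * S Phi ls b by rewrite lerDl mulr_ge0// ltW.
have y0 : 0 < 1 + d * S Phi ls b by exact: lt_le_trans y1.
have lw := W0_lower s0 (cn_S1 b) (le_trans (norm_S b) (_ : _ <= 1 + D * S Phi ls b)).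
have {}lw := lw ltac:(by rewrite lerDr).
have sy : 1 + (1 + D * S Phi ls b) <= c1 * (1 + d * S Phi ls b).
  by rewrite addrA; apply: affine_le => //; exact: ltW.
have w1 : (c1 ^+ E * (1 + d * S Phi ls b) ^+ E)^-1 <= W0 b.
  apply: le_trans lw; rewrite lef_pV2 ?posrE ?mulr_gt0 ?exprn_gt0//; last by rewrite ltr_pwDl.
  have : 0 <= c1 * (1 + d * S Phi ls b) by rewrite mulr_ge0// ltW.
  by move=> h; rewrite -exprMn; apply: lerXn2r => //; rewrite nnegrE addr_ge0.
have w2 : normc (chi ls d N (bpt Phi b)) `^ p * (1 + d * S Phi ls b) ^+ E <= c3.
  apply: (@le_trans _ _ (normc (chi ls d N (bpt Phi b)) `^ p * ((1 + d * S Phi ls b) ^+ N) `^ p)).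
    have ek k := powR_mulrn k (ltW y0).
    by rewrite ler_wpM2l ?powR_ge0// -!ek -powRrM ler_powR.
  have yN : 0 <= (1 + d * S Phi ls b) ^+ N by rewrite exprn_ge0// ltW.
  rewrite -powRM ?normc_ge0//; apply: powR_mono => //.
    by rewrite mulr_ge0 ?normc_ge0.
  by apply: (chi_decay hf); exact: ltW.
have y2 : 0 < (1 + d * S Phi ls b) ^+ E by rewrite exprn_gt0.
apply: (@le_trans _ _ (c3 * c1 ^+ E * (c1 ^+ E * (1 + d * S Phi ls b) ^+ E)^-1)).
  have c1E : c1 ^+ E != 0 by rewrite gt_eqF// exprn_gt0.
  by rewrite invfM mulrA mulfK// ler_pdivlMr.
by apply: ler_wpM2l => //; apply: mulr_ge0; [exact: ltW|apply: exprn_ge0; exact: ltW].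
Qed.

(** The decay of chi compensates the polynomial growth of f along the boundary. *)
Lemma chi_bounded A f : expclass Phi A f -> exists N, forall d, 0 < d ->
  exists2 M : R, 0 < M & forall b, normc (f (bpt Phi b)) * normc (chi ls d N (bpt Phi b)) <= M.
Proof.
move=> [_ [K K0 [N gr]]]; exists N => d d0; have [B B0 HB] := Phi_bound hPhi.
pose c1 := 2 + (2 + B) * D / d.
have cD : 0 <= (2 + B) * D by rewrite mulr_ge0 ?addr_ge0// ltW.
have c10 : 0 < c1 by rewrite ltr_pwDl// divr_ge0// ltW.
exists (K * c1 ^+ N * (3 ^+ m.+1) ^+ N + 1) => [|b].
  by rewrite ltr_wpDl// !mulr_ge0// ?exprn_ge0// ?exprn_ge0// ltW.
have S0 := S_ge0 Phi ls b.
have y0 : 0 < 1 + d * S Phi ls b by rewrite ltr_pwDl// mulr_ge0// ltW.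
have sz : 1 + esize (bpt Phi b) <= c1 * (1 + d * S Phi ls b).
  apply: le_trans (affine_le d0 cD S0).
  rewrite /esize/= cn_complexV.
  have h1 := cn_S1 b; have h2 := norm_S b; have h3 := quad_bound HB b.1.
  have h4 : B * cn b.1 * cn b.1 <= B * (D * S Phi ls b).
    by rewrite -mulrA -expr2; apply: ler_wpM2l => //; exact: cn_S.
  apply: size_sum h1 h2 (le_trans h3 h4).
have gb := gr (bpt Phi b); rewrite rho_bpt normr0 mulr0 expR0 mulr1 in gb.
have dc := chi_decay hf N b (ltW d0).
apply: (@le_trans _ _ (K * (c1 * (1 + d * S Phi ls b)) ^+ N * normc (chi ls d N (bpt Phi b)))).
  apply: ler_wpM2r; first exact: normc_ge0.
  apply: le_trans gb _; rewrite ler_wpM2l// lerXn2r// nnegrE ?addr_ge0 ?esize_ge0//.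
  by rewrite mulr_ge0// ltW.
rewrite exprMn (mulrA K) -mulrA [_ ^+ N * normc _]mulrC.
apply: (@le_trans _ _ (K * c1 ^+ N * (3 ^+ m.+1) ^+ N)); last by rewrite lerDl.
by rewrite ler_wpM2l// mulr_ge0// exprn_ge0//; exact: ltW.
Qed.

Lemma exists_exponent : exists N : nat, (2 * (n + n + m))%:R <= N%:R * p.
Proof.
exists (Num.truncn ((2 * (n + n + m))%:R / p)).+1.
by rewrite -ler_pdivrMr// ltW// truncnS_gt.
Qed.

(** The sum of the exponents needed for boundedness and for the weight. *)
Lemma chi_regular A f : expclass Phi A f -> exists N, forall d, 0 < d ->
  exists2 M : R, 0 < M & forall b, normc (f (bpt Phi b) * chi ls d N (bpt Phi b)) <= M /\
    normc (f (bpt Phi b) * chi ls d N (bpt Phi b)) `^ p <= M * W0 b.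
Proof.
move=> cf; have [N1 H1] := chi_bounded cf; have [N2 HN2] := exists_exponent.
exists (N1 + N2)%N => d d0; have [M1 M10 HM1] := H1 d d0; have [M2 M20 HM2] := chi_weight d0 HN2.
exists (M1 + M1 `^ p * M2) => [|b].
  by rewrite addr_gt0// mulr_gt0// powR_gt0.
have -> : normc (f (bpt Phi b) * chi ls d (N1 + N2) (bpt Phi b)) =
    normc (f (bpt Phi b)) * normc (chi ls d N1 (bpt Phi b)) * normc (chi ls d N2 (bpt Phi b)).
  by rewrite /chi exprD mulrA !normcM.
have g0 : 0 <= normc (f (bpt Phi b)) * normc (chi ls d N1 (bpt Phi b)) by rewrite mulr_ge0 ?normc_ge0.
split.
  apply: (@le_trans _ _ (M1 * 1)); last by rewrite mulr1 lerDl mulr_ge0 ?powR_ge0// ltW.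
  by apply: ler_pM; rewrite ?normc_ge0//; apply: (normc_chi_bpt hf); exact: ltW.
rewrite powRM ?normc_ge0//; apply: (@le_trans _ _ (M1 `^ p * (M2 * W0 b))).
  by apply: ler_pM; rewrite ?powR_ge0//; apply: powR_mono.
rewrite mulrA ler_wpM2r//; first exact/ltW/W0_gt0.
by rewrite lerDr ltW.
Qed.

Lemma W0_ge0 b : 0 <= W0 b. Proof. exact/ltW/W0_gt0. Qed.

Definition Wint (T : R) f : \bar R :=
  (\int[lebN R n m]_t ((farN Phi ls T (pointN t))%:R * pw Phi p f (pointN t) * W0 (pointN t))%:E)%E.

Lemma Wint_ge0 (T : R) f b : 0 <= (farN Phi ls T b)%:R * pw Phi p f b * W0 b.
Proof. exact: mulr_ge0 (mulr_ge0 (ler0n _ _) (powR_ge0 _ _)) (W0_ge0 _). Qed.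

Lemma measurable_W0 d (T : measurableType d) (b : T -> Ngroup R n m) : nmeas b ->
  measurable_fun setT (fun t => W0 (b t)).
Proof.
move=> [m1 m2]; apply: measurable_funM; first apply: measurable_funM.
- apply: measurable_prod => j _; apply: (measurableT_comp measurable_phi); exact: (m1 j).1.
- apply: measurable_prod => j _; apply: (measurableT_comp measurable_phi); exact: (m1 j).2.
- apply: measurable_prod => j _; apply: (measurableT_comp measurable_phi); exact: m2.
Qed.

Lemma measurable_pw A f d (T : measurableType d) (b : T -> Ngroup R n m) : 0 <= A ->
  expclass Phi A f -> nmeas b -> measurable_fun setT (fun t => pw Phi p f (b t)).
Proof.
move=> A0 cf mb; apply: measurable_pow; first exact: emeas_bpt.
exact: (expclass_econt hPhi A0).
Qed.

Lemma le_of_shrink (x y : R) : 0 <= y -> (forall r : R, 0 < r -> r < 1 -> x * (1 - r) <= y) -> x <= y.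
Proof.
move=> y0 H; rewrite leNgt; apply/negP => yx.
have x0 : 0 < x by exact: le_lt_trans yx.
have := H ((x - y) / (2 * x)); rewrite divr_gt0 ?subr_gt0 ?mulr_gt0// => /(_ erefl).
have e1 : x * (1 - (x - y) / (2 * x)) = (x + y) / 2 by field; rewrite gt_eqF.
by rewrite e1 ltr_pdivrMr ?mulr_gt0//; lra.
Qed.

(** Apply sup_le_Lp to f chi_d chi_d0. The first factor makes the sup finite and
    disappears as d tends to 0; the second one, with d0 fixed, is bounded below near
    the origin and produces the weight. *)
Lemma weighted_estimate (A T r : R) : 0 <= A -> 0 < T -> 0 <= r -> exists2 K : R, 0 < K &
  forall f, expclass Phi A f -> forall q, esize q <= r ->
  ((normc (f q) `^ p)%:E <= K%:E * Wint T f)%E.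
Proof.
move=> A0 T0 r0; have [N HN] := exists_exponent.
have l0 := lam_ge0 ls; have [B B0 HB] := Phi_bound hPhi.
pose H := r + B * r ^+ 2; have H0 : 0 <= H by rewrite addr_ge0// mulr_ge0// sqr_ge0.
have [t [t0 t4 tN]] := shrink_budget (m.+1 * N) ltr01 (lexx (1 : R)).
pose d0 := Num.min 1 (t / (lam ls * r + 1)).
have lr0 : 0 < lam ls * r + 1 by rewrite ltr_wpDl// mulr_ge0.
have d00 : 0 < d0 by rewrite lt_min ltr01 divr_gt0.
have d01 : d0 <= 1 by rewrite ge_min lexx.
have chi_low q : esize q <= r -> 2^-1 <= normc (chi ls d0 N q).
  move=> qr; have h : d0 * (lam ls * esize q) <= t.
    apply: (@le_trans _ _ (d0 * (lam ls * r + 1))).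
      rewrite ler_pM2l//; apply: (@le_trans _ _ (lam ls * r)); last by rewrite lerDl.
      by rewrite ler_wpM2l.
    by rewrite -ler_pdivlMr// ge_min lexx orbT.
  apply: le_trans (chi_lower N (ltW d00) (ltW t0) t4 h).
  by move: tN; rewrite mul1r; move: (_ * (2 * t)) => x; lra.
have [Cw Cw0 HCw] := chi_weight d00 HN.
pose A1 := A + N%:R * lam ls + 1.
have Nl0 : 0 <= N%:R * lam ls by rewrite mulr_ge0.
have A10 : 0 <= A1 by rewrite !addr_ge0.
have [K1 K10 HK1] := @sup_le_Lp _ _ _ _ hPhi _ _ _ hf _ p0 A1 T A10 T0.
exists ((2 * expR (A1 * H)) `^ p * (K1 * Cw)) => [|f cf q qr].
  by rewrite !mulr_gt0// powR_gt0 ?mulr_gt0 ?expR_gt0.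
have I0 : (0 <= Wint T f)%E.
  by apply: integral_ge0 => u _; rewrite lee_fin; exact: Wint_ge0.
have [Iy|Ify] := eqVneq (Wint T f) +oo%E.
  rewrite Iy gt0_muley ?leey// lte_fin !mulr_gt0// powR_gt0 ?mulr_gt0 ?expR_gt0//.
have [I IE] : exists I : R, Wint T f = I%:E.
  by exists (fine (Wint T f)); rewrite fineK// ge0_fin_numE// ltey.
have Ige0 : 0 <= I by rewrite -lee_fin -IE.
pose J := (K1 * Cw * I) `^ p^-1.
have J0 : 0 <= J by exact: powR_ge0.
have [N' HN'] := chi_regular cf.
have Fbound d : 0 < d -> d * (N'%:R * lam ls) <= 1 ->
    normc (f q) * normc (chi ls d N' q) <= 2 * expR (A1 * H) * J.
  move=> dp dN; have [M M0 HM] := HN' d dp.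
  (* chi d makes F bounded; the fixed factor chi d0 produces the weight *)
  pose F q := f q * chi ls d N' q * chi ls d0 N q.
  have cF : expclass Phi A1 F.
    have e1 : 0 <= N'%:R * (d * lam ls) by rewrite !mulr_ge0// ltW.
    have e2 : 0 <= N%:R * (d0 * lam ls) by rewrite !mulr_ge0// ltW.
    have := expclassM (addr_ge0 A0 e1) e2 (expclassM A0 e1 cf (expclass_chi hf N' (ltW dp))) (expclass_chi hf N (ltW d00)).
    apply: expclassW; rewrite /A1.
    have : N%:R * (d0 * lam ls) <= N%:R * lam ls by rewrite ler_wpM2l// ler_piMl.
    move=> h; rewrite -!addrA lerD2l [leRHS]addrC; apply: lerD => //.
    by rewrite mulrCA.
  have bF b : normc (F (bpt Phi b)) <= M.
    rewrite /F normcM -[leRHS]mulr1; apply: ler_pM; rewrite ?normc_ge0//.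
      exact: (HM b).1.
    by apply: (normc_chi_bpt hf); exact: ltW.
  have Fle b : pw Phi p F b <= Cw * (pw Phi p f b * W0 b).
    rewrite /pw /F !normcM powRM ?mulr_ge0 ?normc_ge0// mulrCA.
    apply: ler_pM; rewrite ?powR_ge0//; apply: powR_mono; rewrite ?mulr_ge0 ?normc_ge0//.
    by rewrite ler_piMr ?normc_ge0//; apply: (normc_chi_bpt hf); exact: ltW.
  have Fint : (\int[lebN R n m]_u ((farN Phi ls T (pointN u))%:R * pw Phi p F (pointN u))%:E <= (Cw * I)%:E)%E.
    rewrite EFinM -IE -ge0_integralZl//; last 3 first.
    - apply/measurable_EFinP; apply: measurable_funM; first apply: measurable_funM.
      + by apply: measurable_far => //; exact: nmeas_pointN.
      + by apply: (measurable_pw A0 cf); exact: nmeas_pointN.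
      + by apply: measurable_W0; exact: nmeas_pointN.
    - by move=> u _; rewrite lee_fin; exact: Wint_ge0.
    - by rewrite lee_fin ltW.
    apply: ge0_le_integral => //.
    - by move=> u _; rewrite lee_fin mulr_ge0// powR_ge0.
    - apply/measurable_EFinP; apply: measurable_funM.
        by apply: measurable_far => //; exact: nmeas_pointN.
      by apply: (measurable_pw A10 cF); exact: nmeas_pointN.
    - apply/measurable_EFinP; apply: measurable_funM => //; apply: measurable_funM; first apply: measurable_funM.
      + by apply: measurable_far => //; exact: nmeas_pointN.
      + by apply: (measurable_pw A0 cf); exact: nmeas_pointN.
      + by apply: measurable_W0; exact: nmeas_pointN.
    move=> u _; rewrite -EFinM lee_fin -mulrA mulrCA; apply: ler_wpM2l => //.
  have FJ b : normc (F (bpt Phi b)) <= J.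
    have h : pw Phi p F b <= K1 * Cw * I.
      rewrite -lee_fin; apply: le_trans (HK1 F cF (ex_intro _ M bF) b) _.
      by rewrite -mulrA [in leRHS]EFinM; apply: lee_wpmul2l => //; rewrite lee_fin ltW.
    have e1 : normc (F (bpt Phi b)) = (pw Phi p F b) `^ p^-1.
      by rewrite /pw -powRrM mulfV ?gt_eqF// powRr1 ?normc_ge0.
    by rewrite e1; apply: ge0_ler_powR; rewrite ?nnegrE ?powR_ge0 ?invr_ge0 ?mulr_ge0//; exact: ltW.
  have Fq : normc (F q) <= J * expR (A1 * H).
    apply: le_trans (strip_bound A10 cF FJ q) _.
    rewrite ler_wpM2l// ler_expR ler_wpM2l//; apply: le_trans (rho_le q B0 HB) _.
    by rewrite /H lerD// ler_wpM2l// lerXn2r// nnegrE ?esize_ge0.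
  have : normc (f q) * normc (chi ls d N' q) * 2^-1 <= normc (F q).
    by rewrite /F !normcM; apply: ler_wpM2l; [rewrite mulr_ge0 ?normc_ge0|exact: chi_low].
  move=> h; have := le_trans h Fq; rewrite ler_pdivrMr//.
  by have -> : J * expR (A1 * H) * 2 = 2 * expR (A1 * H) * J by rewrite mulrC mulrA mulrAC.
have fq : normc (f q) <= 2 * expR (A1 * H) * J.
  (* chi d tends to 1 at q as d tends to 0 *)
  apply: le_of_shrink => [|s s0 s1]; first by rewrite !mulr_ge0// expR_ge0.
  have [ts [ts0 ts4 tsN]] := shrink_budget (m.+1 * N') s0 (ltW s1).
  pose d := Num.min (N'%:R * lam ls + 1)^-1 (ts / (lam ls * esize q + 1)).
  have q0 := esize_ge0 q.
  have e1 : 0 < N'%:R * lam ls + 1 by rewrite ltr_wpDl// mulr_ge0.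
  have e2 : 0 < lam ls * esize q + 1 by rewrite ltr_wpDl// mulr_ge0.
  have dp : 0 < d by rewrite lt_min invr_gt0 e1 divr_gt0.
  have dN : d * (N'%:R * lam ls) <= 1.
    apply: (@le_trans _ _ (d * (N'%:R * lam ls + 1))); first by rewrite ler_pM2l// lerDl.
    by rewrite -ler_pdivlMr// mul1r ge_min lexx.
  have dq : d * (lam ls * esize q) <= ts.
    apply: (@le_trans _ _ (d * (lam ls * esize q + 1))); first by rewrite ler_pM2l// lerDl.
    by rewrite -ler_pdivlMr// ge_min lexx orbT.
  apply: le_trans (Fbound d dp dN); apply: ler_wpM2l; first exact: normc_ge0.
  apply: le_trans (chi_lower N' (ltW dp) (ltW ts0) ts4 dq).
  rewrite lerD2l lerN2; apply: le_trans tsN _; rewrite ler_piMr ?ltW//.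
  by rewrite invf_lt1 ?ltr1n.
rewrite IE -EFinM lee_fin -mulrA.
have -> : K1 * Cw * I = J `^ p.
  rewrite /J -powRrM mulVf ?gt_eqF// powRr1// !mulr_ge0//; exact: ltW.
rewrite -powRM ?mulr_ge0 ?expR_ge0//; apply: powR_mono => //; exact: normc_ge0.
Qed.

End weighted_estimates.

(** * Translates and averages *)

Section convolution.
Context {R : realType} {n m : nat}.
Local Notation C := R[i].
Local Notation EC := (EFC R n m).
Local Notation TN := (Rtuple R n * Rtuple R n * Rtuple R m)%type.
Variable Phi : Espace R n -> Espace R n -> FCspace R m.
Hypothesis hPhi : hermitian_map Phi.
Local Open Scope ereal_scope.

Lemma tonelli_lebN d (T : measurableType d) (mu : {sigma_finite_measure set T -> \bar R})
  (h : T * TN -> \bar R) : measurable_fun setT h -> (forall x, 0 <= h x) ->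
  \int[mu]_x \int[lebN R n m]_t h (x, t) = \int[lebN R n m]_t \int[mu]_x h (x, t).
Proof. by move=> mh h0; exact: (@fubini_tonelli _ _ _ _ R mu lebNs h mh h0). Qed.

(** Measurability along all measurable families of points of N is stable under
    translations by such families. *)
Definition nmeasurable (g : Ngroup R n m -> R) : Prop :=
  forall d (T : measurableType d) (b : T -> Ngroup R n m), nmeas b ->
  measurable_fun setT (fun t => g (b t)).

Lemma nmeasurable_pointN (g : Ngroup R n m -> R) : nmeasurable g ->
  measurable_fun setT ((fun b => (g b)%:E) \o @pointN R n m).
Proof. by move=> mg; apply/measurable_EFinP; apply: mg; exact: nmeas_pointN. Qed.

(** By Tonelli and right invariance every translate contributes the same integral. *)
Lemma integral_average (g : Ngroup R n m -> R) : nmeasurable g -> (forall b, (0 <= g b)%R) ->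
  \int[lebN R n m]_a \int[lebN R n m]_t (g (mulN Phi (pointN a) (pointN t)) * W0 (pointN t))%:E =
  (\int[lebN R n m]_t (W0 (pointN t))%:E) * \int[lebN R n m]_a (g (pointN a))%:E.
Proof.
move=> mg g0.
have mh : measurable_fun setT (fun x : TN * TN => (g (mulN Phi (pointN x.1) (pointN x.2)) * W0 (pointN x.2))%:E).
  apply/measurable_EFinP; apply: measurable_funM.
    apply: mg; apply: nmeas_mulN => //; apply: nmeas_pointN; [exact: measurable_fst|exact: measurable_snd].
  by apply: measurable_W0; apply: nmeas_pointN; exact: measurable_snd.
have h0 (x : TN * TN) : 0 <= (g (mulN Phi (pointN x.1) (pointN x.2)) * W0 (pointN x.2))%:E.
  by rewrite lee_fin; apply: mulr_ge0 => //; exact: W0_ge0.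
rewrite [LHS](@tonelli_lebN _ _ lebNs _ mh h0).
have mW : measurable_fun setT (fun t : TN => (W0 (pointN t : Ngroup R n m))%:E).
  by apply/measurable_EFinP; apply: measurable_W0; exact: nmeas_pointN.
transitivity (\int[lebN R n m]_t ((W0 (pointN t))%:E * \int[lebN R n m]_a (g (pointN a))%:E)).
  apply: eq_integral => t _ /=.
  have e1 := @integral_lebN_right _ _ _ _ hPhi (pointN t) (fun b => (g b)%:E) (nmeasurable_pointN mg) (fun b => g0 b).
  rewrite -e1 -ge0_integralZl//; last 3 first.
  - apply/measurable_EFinP; apply: mg; apply: nmeas_mulN => //; first exact: nmeas_pointN.
    exact: nmeas_cst.
  - by move=> a _; rewrite lee_fin.
  - by rewrite lee_fin; exact: W0_ge0.
  by apply: eq_integral => a _; rewrite -EFinM mulrC.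
rewrite ge0_integralZr//; last by apply: integral_ge0 => a _; rewrite lee_fin.
by move=> t _; rewrite lee_fin; exact: W0_ge0.
Qed.

Variables (ls : 'I_m.+1 -> Fspace R m) (D : R) (e : Fspace R m).
Hypothesis hf : frame Phi ls D e.
Variable p : R.
Hypothesis p0 : (0 < p)%R.
Implicit Types (f : EC -> C) (a b : Ngroup R n m).

Lemma nmeasurable_pw A f : (0 <= A)%R -> expclass Phi A f -> nmeasurable (pw Phi p f).
Proof. by move=> A0 cf d T b mb; exact: (measurable_pw hPhi p A0 cf mb). Qed.

Lemma nmeasurable_far T : nmeasurable (fun b => (farN Phi ls T b)%:R : R).
Proof. by move=> d T' b mb; exact: measurable_far. Qed.

Lemma nmeasurableM g h : nmeasurable g -> nmeasurable h -> nmeasurable (fun b => g b * h b)%R.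
Proof. by move=> mg mh d T b mb; apply: measurable_funM; [exact: mg|exact: mh]. Qed.

(** The average of |f|^p around a with respect to the translated weight. *)
Definition Vp f a : \bar R :=
  \int[lebN R n m]_t (pw Phi p f (mulN Phi a (pointN t)) * W0 (pointN t))%:E.

Lemma pw_ge0 f b : (0 <= pw Phi p f b)%R. Proof. exact: powR_ge0. Qed.

Lemma Vp_ge0 f a : 0 <= Vp f a.
Proof. by apply: integral_ge0 => t _; rewrite lee_fin; apply: mulr_ge0; rewrite ?pw_ge0//; exact: W0_ge0. Qed.

Lemma pw_tau f a b : pw Phi p (fun q => f (tau Phi a q)) b = pw Phi p f (mulN Phi a b).
Proof. by rewrite /pw tau_bpt. Qed.

(** The weighted estimate at the origin, applied to the translates of f. *)
Lemma tau_estimate (A T r : R) : (0 <= A)%R -> (0 < T)%R -> (0 <= r)%R -> exists2 K : R, (0 < K)%R &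
  forall f, expclass Phi A f -> forall a q, (esize q <= r)%R ->
  (normc (f (tau Phi a q)) `^ p)%:E <= K%:E *
  \int[lebN R n m]_t ((farN Phi ls T (pointN t))%:R * pw Phi p f (mulN Phi a (pointN t)) * W0 (pointN t))%:E.
Proof.
move=> A0 T0 r0; have [K K0 HK] := weighted_estimate hPhi hf p0 A0 T0 r0.
exists K => // f cf a q qr; apply: le_trans (HK _ (expclass_tau hPhi a cf) q qr) _.
apply: lee_wpmul2l; first by rewrite lee_fin ltW.
rewrite le_eqVlt; apply/orP; left; apply/eqP; apply: eq_integral => t _.
by rewrite pw_tau.
Qed.

Lemma tau_le_Vp (A r : R) : (0 <= A)%R -> (0 <= r)%R -> exists2 K : R, (0 < K)%R &
  forall f, expclass Phi A f -> forall a q, (esize q <= r)%R ->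
  (normc (f (tau Phi a q)) `^ p)%:E <= K%:E * Vp f a.
Proof.
move=> A0 r0; have [K K0 HK] := tau_estimate A0 ltr01 r0.
exists K => // f cf a q qr; apply: le_trans (HK f cf a q qr) _.
apply: lee_wpmul2l; first by rewrite lee_fin ltW.
have mb : nmeas (fun t : TN => mulN Phi a (pointN t)).
  by apply: nmeas_mulN => //; [exact: nmeas_cst|exact: nmeas_pointN].
have mpw : measurable_fun setT (fun t : TN => pw Phi p f (mulN Phi a (pointN t))).
  exact: (nmeasurable_pw A0 cf).
have mW : measurable_fun setT (fun t : TN => W0 (pointN t : Ngroup R n m)).
  by apply: measurable_W0; exact: nmeas_pointN.
apply: ge0_le_integral => //.
- move=> t _; rewrite lee_fin; apply: mulr_ge0; last exact: W0_ge0.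
  by apply: mulr_ge0; rewrite ?pw_ge0.
- apply/measurable_EFinP; apply: measurable_funM => //; apply: measurable_funM => //.
  by apply: nmeasurable_far; exact: nmeas_pointN.
- by apply/measurable_EFinP; apply: measurable_funM.
move=> t _; rewrite lee_fin; apply: ler_wpM2r; first exact: W0_ge0.
by rewrite ler_piMl ?pw_ge0// lern1 leq_b1.
Qed.

Lemma integral_Vp A f : (0 <= A)%R -> expclass Phi A f ->
  \int[lebN R n m]_a Vp f (pointN a) =
  (\int[lebN R n m]_t (W0 (pointN t))%:E) * \int[lebN R n m]_a (pw Phi p f (pointN a))%:E.
Proof.
by move=> A0 cf; apply: integral_average; [exact: (nmeasurable_pw A0 cf)|exact: pw_ge0].
Qed.

Lemma measurable_Vp A f d (T : measurableType d) (b : T -> Ngroup R n m) : (0 <= A)%R ->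
  expclass Phi A f -> nmeas b -> measurable_fun setT (fun t => Vp f (b t)).
Proof.
move=> A0 cf mb; pose h (x : T * TN) := (pw Phi p f (mulN Phi (b x.1) (pointN x.2)) * W0 (pointN x.2))%:E.
have mb1 : nmeas (fun x : T * TN => b x.1).
  case: mb => m1 m2; split=> j; first split.
  - by apply: (measurableT_comp (m1 j).1); exact: measurable_fst.
  - by apply: (measurableT_comp (m1 j).2); exact: measurable_fst.
  - by apply: (measurableT_comp (m2 j)); exact: measurable_fst.
have mp : nmeas (fun x : T * TN => pointN x.2) by apply: nmeas_pointN; exact: measurable_snd.
have mh : measurable_fun setT h.
  apply/measurable_EFinP; apply: measurable_funM; last exact: measurable_W0.
  by apply: (nmeasurable_pw A0 cf); exact: nmeas_mulN.
apply: (@measurable_fun_fubini_tonelli_F _ _ _ _ R lebNs h mh) => x.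
by rewrite lee_fin; apply: mulr_ge0; [exact: pw_ge0|exact: W0_ge0].
Qed.

End convolution.

(** * Homogeneous distances are equivalent to an explicit gauge *)

Section homogeneous_norm.
Context {R : realType} {n m : nat}.
Local Notation C := R[i].
Local Notation EC := (EFC R n m).
Local Notation N := (Ngroup R n m).
Variable Phi : Espace R n -> Espace R n -> FCspace R m.
Hypothesis hPhi : hermitian_map Phi.
Variable dN : N -> N -> R.
Hypothesis hdN : homogeneous_distance Phi dN.

Definition nrm (a : N) : R := dN 0 a.

Local Notation th := (theta R n).

Lemma theta_gt0 : 0 < th.
Proof. by rewrite /theta; case: eqP => _ //; rewrite invr_gt0. Qed.

Lemma powR_le1 (x : R) : 0 <= x -> x <= 1 -> x `^ th <= 1.
Proof. by move=> x0 x1; have := powR_mono theta_gt0 x0 x1; rewrite powR1. Qed.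

Lemma dN_left c a b : dN (mulN Phi c a) (mulN Phi c b) = dN a b.
Proof. by case: hdN. Qed.

Lemma dNE a b : dN a b = nrm (mulN Phi (invN a) b).
Proof. by rewrite -(dN_left (invN a)) (mulVN hPhi). Qed.

Lemma nrm_ge0 a : 0 <= nrm a.
Proof. by case: hdN => -[h _ _ _] _ _; exact: h. Qed.

Lemma nrm0 : nrm 0 = 0.
Proof. by case: hdN => -[_ h _ _] _ _; exact/h. Qed.

Lemma nrm_gt0 a : a != 0 -> 0 < nrm a.
Proof.
move=> a0; rewrite lt_neqAle nrm_ge0 andbT eq_sym; apply: contra_neq a0 => a0.
by case: hdN => -[_ h _ _] _ _; apply/esym/h.
Qed.

Lemma nrm_mul a b : nrm (mulN Phi a b) <= nrm a + nrm b.
Proof.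
case: hdN => -[_ _ _ h] _ _; apply: le_trans (h 0 a _) _; rewrite lerD2l.
by rewrite -{1}(mulN0 hPhi a) dN_left.
Qed.

Lemma nrm_inv a : nrm (invN a) = nrm a.
Proof.
by rewrite /nrm -(dN_left a) (mulNV hPhi) (mulN0 hPhi); case: hdN => -[_ _ h _] _ _; exact: h.
Qed.

Lemma nrm_dil t a : 0 < t -> nrm (dilation t a) = t `^ th * nrm a.
Proof.
by move=> t0; case: hdN => _ _ h; rewrite -(h t 0 a t0); congr dN; rewrite /dilation/= !scaler0.
Qed.

Lemma nrm_mulr a b : `|nrm (mulN Phi a b) - nrm a| <= nrm b.
Proof.
rewrite ler_norml lerBlDl nrm_mul andbT lerBrDl lerBlDr.
have := nrm_mul (mulN Phi a b) (invN b).
by rewrite -(mulNA hPhi) (mulNV hPhi) (mulN0 hPhi) nrm_inv.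
Qed.

Lemma mulN_central (a : N) x : mulN Phi a (0, x) = (a.1, a.2 + x).
Proof. by rewrite /mulN/= (Phi0r hPhi) ImV0 scaler0 !addr0. Qed.

(** Dilations act on the centre by scaling, and inversion by -1. *)
Lemma nrm_central_le (c : R) (v : Fspace R m) : `|c| <= 1 -> nrm (0, c *: v) <= nrm (0, v).
Proof.
have H (d : R) : 0 <= d -> d <= 1 -> nrm (0, d *: v) <= nrm (0, v).
  rewrite le_eqVlt => /predU1P[<- _|d0 d1]; first by rewrite scale0r nrm0 nrm_ge0.
  have -> : (0, d *: v) = dilation d ((0, v) : N) by rewrite /dilation/= scaler0.
  by rewrite nrm_dil// ler_piMl ?nrm_ge0// powR_le1// ltW.
move=> c1; have [c0|c0] := leP 0 c; first by apply: H => //; rewrite -(ger0_norm c0).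
rewrite (_ : (0, c *: v) = invN ((0, (- c) *: v) : N)); last by rewrite /invN/= oppr0 scaleNr opprK.
by rewrite nrm_inv; apply: H; [rewrite oppr_ge0 ltW|rewrite -(ltr0_norm c0)].
Qed.

(** Bounded on the unit ball by decomposing x along the coordinate axes; the
    general case follows by dilation. *)
Lemma nrm_central : exists2 D : R, 0 <= D & forall x, nrm (0, x) <= D * `|x| `^ th.
Proof.
have H (s : seq 'I_m) : exists2 D : R, 0 <= D & forall x : Fspace R m, `|x| <= 1 ->
    nrm (0, \sum_(j <- s) x ord0 j *: delta_mx ord0 j) <= D.
  elim: s => [|j s [D D0 HD]].
    by exists 0 => // x _; rewrite big_nil nrm0.
  exists (nrm (0, delta_mx ord0 j) + D) => [|x x1]; first by rewrite addr_ge0 ?nrm_ge0.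
  rewrite big_cons; have := nrm_mul (0, x ord0 j *: delta_mx ord0 j) (0, \sum_(j <- s) x ord0 j *: delta_mx ord0 j).
  rewrite mulN_central/= => h; apply: le_trans h _; apply: lerD; last exact: HD.
  by apply: nrm_central_le; apply: le_trans x1; exact: le_coord_norm.
have [D D0 HD] := H (enum 'I_m); exists D => // x.
have [->|x0] := eqVneq x 0; first by rewrite nrm0 mulr_ge0// powR_ge0.
have nx : 0 < `|x| by rewrite normr_gt0.
have -> : (0, x) = dilation `|x| ((0, `|x|^-1 *: x) : N).
  by rewrite /dilation/= scaler0 scalerA divff ?scale1r// gt_eqF.
rewrite nrm_dil// mulrC ler_wpM2r ?powR_ge0//.
rewrite (row_sum_delta (`|x|^-1 *: x)) -big_enum/=; apply: HD.
by rewrite normrZ normfV normr_id mulVf// gt_eqF.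
Qed.

Lemma cn_sum_le (I : Type) (s : seq I) (F : I -> Espace R n) :
  cn (\sum_(i <- s) F i) <= \sum_(i <- s) cn (F i).
Proof.
elim: s => [|i s IH]; first by rewrite !big_nil cn0.
by rewrite !big_cons; apply: le_trans (cnD _ _) _; rewrite lerD2l.
Qed.

Lemma cn_gt0 k (z : 'rV[C]_k) : z != 0 -> 0 < cn z.
Proof.
move=> z0; rewrite lt_neqAle eq_sym cn_ge0 andbT; apply: contra_neq z0.
exact: cn_eq0.
Qed.

Lemma nrm_horizontal_le (c : R) (v : Espace R n) : `|c| <= 1 -> nrm (c%:C *: v, 0) <= nrm (v, 0).
Proof.
have H (d : R) : 0 <= d -> d <= 1 -> nrm (d%:C *: v, 0) <= nrm (v, 0).
  rewrite le_eqVlt => /predU1P[<- _|d0 d1]; first by rewrite scale0r nrm0 nrm_ge0.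
  have -> : (d%:C *: v, 0) = dilation (d ^+ 2) ((v, 0) : N).
    by rewrite /dilation/= scaler0 sqrtr_sqr gtr0_norm.
  have d20 : 0 < d ^+ 2 by rewrite exprn_gt0.
  rewrite nrm_dil// ler_piMl ?nrm_ge0// powR_le1//; first exact: ltW.
  by rewrite expr_le1// ltW.
move=> c1; have [c0|c0] := leP 0 c; first by apply: H => //; rewrite -(ger0_norm c0).
rewrite (_ : (c%:C *: v, 0) = invN (((- c)%:C *: v, 0) : N)); last first.
  by rewrite /invN/= oppr0 rmorphN/= scaleNr opprK.
by rewrite nrm_inv; apply: H; [rewrite oppr_ge0 ltW|rewrite -(ltr0_norm c0)].
Qed.

(** A real basis of E. *)
Definition hvec (k : 'I_n * bool) : Espace R n := (if k.2 then 'i else 1) *: delta_mx ord0 k.1.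

(** Boundedness on bounded sets follows from the triangle inequality along a
    product of one-parameter subgroups. *)
Lemma nrm_horizontal : exists2 M : R, 0 <= M & forall z, nrm (z, 0) <= M * (cn z ^+ 2) `^ th.
Proof.
have [D D0 HD] := nrm_central; have [B B0 HB] := Phi_bound hPhi.
pose sm (s : seq ('I_n * bool)) (c : 'I_n * bool -> R) := \sum_(k <- s) (c k)%:C *: hvec k.
have H (s : seq ('I_n * bool)) : exists2 M : R, 0 <= M & forall c, (forall k, `|c k| <= 1) ->
    nrm (sm s c, 0) <= M.
  elim: s => [|k s [M M0 HM]].
    by exists 0 => // c _; rewrite /sm big_nil nrm0.
  (* Y bounds the central correction in the group law *)
  pose Y := 2 * (B * cn (hvec k) * \sum_(i <- s) cn (hvec i)).
  exists (nrm (hvec k, 0) + M + D * Y `^ th) => [|c c1].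
    by rewrite !addr_ge0 ?nrm_ge0// mulr_ge0// powR_ge0.
  rewrite /sm big_cons -/(sm s c); set z := _ *: hvec k; set w := sm s c.
  have -> : (z + w, 0) = mulN Phi (mulN Phi (z, 0) (w, 0)) (0, - (2 *: ImV (Phi z w))).
    by rewrite mulN_central /mulN/= !add0r subrr.
  apply: le_trans (nrm_mul _ _) _; apply: lerD.
    apply: le_trans (nrm_mul _ _) _; apply: lerD; last exact: HM.
    exact: nrm_horizontal_le.
  apply: le_trans (HD _) _; apply: ler_wpM2l => //.
  have hz : cn z <= cn (hvec k) by rewrite cnZR ler_piMl ?cn_ge0.
  have hw : cn w <= \sum_(i <- s) cn (hvec i).
    apply: le_trans (cn_sum_le _ _) _; apply: ler_sum => i _.
    by rewrite cnZR ler_piMl ?cn_ge0.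
  have hY : `|- (2 *: ImV (Phi z w))| <= Y.
    rewrite normrN normrZ ger0_norm// ler_wpM2l//.
    apply: (@le_trans _ _ (cn (Phi z w))); first by rewrite /cn lerDr.
    exact: le_trans (HB _ _) (ler_pM (mulr_ge0 B0 (cn_ge0 _)) (cn_ge0 _) (ler_wpM2l B0 hz) hw).
  exact: powR_mono theta_gt0 _ _ _ hY.
have [M M0 HM] := H (enum predT); exists M => // z.
have [->|z0] := eqVneq z 0; first by rewrite nrm0 mulr_ge0// powR_ge0.
have nz := cn_gt0 z0.
have -> : (z, 0) = dilation (cn z ^+ 2) (((cn z)^-1%:C *: z, 0) : N).
  rewrite /dilation/= scaler0 sqrtr_sqr gtr0_norm// scalerA -rmorphM/= divff ?gt_eqF//.
  by rewrite scale1r.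
rewrite nrm_dil ?exprn_gt0// mulrC ler_wpM2r ?powR_ge0//.
set w := _ *: z; have w1 : cn w <= 1 by rewrite cnZR gtr0_norm ?invr_gt0// mulVf ?gt_eqF.
pose c (k : 'I_n * bool) := if k.2 then Im (w ord0 k.1) else Re (w ord0 k.1).
have -> : w = sm (enum predT) c.
  rewrite {1}(row_sum_delta w) /sm big_enum/= -(pair_bigA _ (fun j b => (c (j, b))%:C *: hvec (j, b)))/=.
  apply: eq_bigr => j _; rewrite big_bool/= /hvec/= /c/= scale1r scalerA -scalerDl; congr (_ *: _).
  by rewrite mulrC addrC -complexE; case: (w ord0 j).
apply: HM => k; rewrite /c; case: k.2.
  by apply: le_trans (normc_Im _) _; apply: le_trans (cn_coord _ _) _.
by apply: le_trans (normc_Re _) _; apply: le_trans (cn_coord _ _) _.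
Qed.

Lemma nrm_le : exists2 M : R, 0 <= M & forall a, nrm a <= M * (cn a.1 ^+ 2) `^ th + M * `|a.2| `^ th.
Proof.
have [M M0 HM] := nrm_horizontal; have [D D0 HD] := nrm_central.
exists (M + D) => [|a]; first exact: addr_ge0.
have -> : nrm a = nrm (mulN Phi (a.1, 0) (0, a.2)) by rewrite mulN_central/= add0r; case: a.
apply: le_trans (nrm_mul _ _) _; apply: lerD.
  by apply: le_trans (HM _) _; rewrite ler_wpM2r ?powR_ge0// lerDl.
by apply: le_trans (HD _) _; rewrite ler_wpM2r ?powR_ge0// lerDr.
Qed.

Lemma nrm_small (s : R) : 0 < s -> exists2 d : R, 0 < d & forall a, cn a.1 <= d -> `|a.2| <= d -> nrm a <= s.
Proof.
move=> s0; have [M M0 HM] := nrm_le; have M1 : 0 < 2 * M + 1 by rewrite ltr_wpDl// mulr_ge0.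
pose d := Num.min 1 ((s / (2 * M + 1)) `^ th^-1).
have d0 : 0 < d by rewrite lt_min ltr01 powR_gt0// divr_gt0.
exists d => // a h1 h2; apply: le_trans (HM a) _.
have dth : d `^ th <= s / (2 * M + 1).
  have -> : s / (2 * M + 1) = ((s / (2 * M + 1)) `^ th^-1) `^ th.
    by rewrite -powRrM mulVf ?gt_eqF ?theta_gt0// powRr1// divr_ge0// ltW.
  by apply: (powR_mono theta_gt0); [exact: ltW|rewrite ge_min lexx orbT].
have e1 : (cn a.1 ^+ 2) `^ th <= d `^ th.
  apply: (powR_mono theta_gt0); first exact: sqr_ge0.
  have d1 : d <= 1 by rewrite ge_min lexx.
  rewrite expr2 -[leRHS]mulr1; apply: ler_pM; rewrite ?cn_ge0//; exact: le_trans d1.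
have e2 : `|a.2| `^ th <= d `^ th by exact: (powR_mono theta_gt0).
apply: le_trans (lerD (ler_wpM2l M0 (le_trans e1 dth)) (ler_wpM2l M0 (le_trans e2 dth))) _.
have -> : M * (s / (2 * M + 1)) + M * (s / (2 * M + 1)) = s * (2 * M / (2 * M + 1)).
  by field; rewrite gt_eqF.
by rewrite ler_piMr ?(ltW s0)// ler_pdivrMr// mul1r lerDl.
Qed.

(** Smallness near the origin is transported by left translations and the triangle
    inequality. *)
Lemma econt_nrm : econt Num.norm (fun q : EC => nrm (base q)).
Proof.
have [B B0 HB] := Phi_bound hPhi => q s s0.
have [d d0 Hd] := @nrm_small (s / 2) ltac:(by rewrite divr_gt0).
pose L := 1 + 2 * (B * cn q.1); have L0 : 0 < L by rewrite ltr_pwDl// !mulr_ge0 ?cn_ge0.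
exists (d / L) => [|v]; first by rewrite divr_gt0.
rewrite ltr_pdivlMr// => vd.
pose b : N := (v.1, ReV v.2 - 2 *: ImV (Phi q.1 v.1)).
have -> : base (q + v) = mulN Phi (base q) b.
  rewrite /base /mulN/= ReVD; congr pair.
  by rewrite -addrA subrK.
apply: le_lt_trans (nrm_mulr _ _) _.
apply: le_lt_trans (_ : s / 2 < s); last by rewrite ltr_pdivrMr// ltr_pMr// ltr1n.
have v0 := esize_ge0 v; have L1 : 1 <= L by rewrite lerDl !mulr_ge0// cn_ge0.
have v1 : cn v.1 <= esize v by rewrite lerDl cn_ge0.
have vL : esize v <= esize v * L by rewrite ler_peMr.
apply: Hd => /=; first by apply: le_trans v1 _; apply: le_trans vL _; exact: ltW.
apply: le_trans (ler_normB _ _) _; rewrite normrZ ger0_norm//.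
have h1 : `|ReV v.2| <= cn v.2 by rewrite /cn lerDl.
have h2 : `|ImV (Phi q.1 v.1)| <= B * cn q.1 * esize v.
  apply: (@le_trans _ _ (cn (Phi q.1 v.1))); first by rewrite /cn lerDr.
  by apply: le_trans (HB _ _) _; rewrite ler_wpM2l// mulr_ge0// cn_ge0.
apply: le_trans (ltW vd); rewrite /L mulrDr mulr1; apply: lerD.
  by apply: le_trans h1 _; rewrite lerDr cn_ge0.
by rewrite mulrCA ler_wpM2l// mulrC.
Qed.

Lemma nmeasurable_nrm : nmeasurable nrm.
Proof.
move=> d T b mb; have := measurable_econt (emeas_bpt hPhi mb) econt_nrm.
by under eq_fun do rewrite base_bpt.
Qed.

Lemma lip_max (x y x' y' t : R) : `|x - x'| <= t -> `|y - y'| <= t ->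
  `|Num.max x y - Num.max x' y'| <= t.
Proof.
rewrite !ler_norml => /andP[h1 h2] /andP[h3 h4].
by case: (leP x y) => h; case: (leP x' y') => h'; apply/andP; split; lra.
Qed.

(** Comparison with the homogeneous gauge max(cn^2, norm), by compactness of its
    unit sphere. *)
Lemma nrm_ge : exists2 c : R, 0 < c & forall a s, 0 <= s -> nrm a <= s ->
  cn a.1 <= c * s /\ `|a.2| <= c * (s + s ^+ 2).
Proof.
(* h = 1 exactly over the unit sphere of the gauge, whatever Im z *)
pose h (q : EC) := Num.max (cn q.1) `|ReV q.2|.
have ch : econt Num.norm h.
  move=> q s s0; exists s => // v; apply: le_lt_trans; apply: lip_max.
    have /= h1 := cnD q.1 v.1; have h2 := cnD (q.1 + v.1) (- v.1).
    have h3 : cn v.1 <= esize v by rewrite lerDl cn_ge0.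
    have h4 : cn (- v.1) = cn v.1 by rewrite -scaleN1r -[-1](rmorphN1 (real_complex R)) cnZR normrN1 mul1r.
    rewrite addrK h4 in h2; apply: le_trans h3.
    by rewrite ler_norml lerBlDl h1 andbT lerBrDl lerBlDr.
  have -> : (q + v).2 = q.2 + v.2 by [].
  rewrite ReVD; apply: le_trans (ler_dist_dist _ _) _; rewrite addrAC subrr add0r.
  by apply: (@le_trans _ _ (cn v.2)); rewrite /cn /esize ?lerDl// lerDr cn_ge0.
have pos (q : EC) : esize q <= 2 -> h q = 1 -> 0 < nrm (base q).
  move=> _ hq; apply: nrm_gt0; apply/eqP => -[q1 q2].
  by move: hq; rewrite /h q1 q2 cn0 normr0 maxxx => /eqP; rewrite eq_sym oner_eq0.
have [c c0 Hc] := econt_compact_min econt_nrm ch pos.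
have Hc' (b : N) : cn b.1 + `|b.2| <= 2 -> Num.max (cn b.1) `|b.2| = 1 -> c <= nrm b.
  move=> h1 h2; have := Hc (b.1, complexV b.2 0).
  rewrite /h /esize /base/= ReV_complexV cn_complexV normr0 addr0; case: b h1 h2 => x y h1 h2.
  by move=> /(_ h1 h2).
have key a : a != 0 -> let t := Num.max (cn a.1 ^+ 2) `|a.2| in 0 < t /\ c * t `^ th <= nrm a.
  move=> a0 t; have t0 : 0 < t.
    rewrite lt_max; case: (eqVneq a.1 0) => [a1|a1]; last by rewrite exprn_gt0// cn_gt0.
    rewrite normr_gt0; apply/orP; right; apply: contra_neq a0 => a2.
    by case: (a) a1 a2 => x y /= -> ->.
  split => //; have ti : 0 < t^-1 by rewrite invr_gt0.
  have := nrm_dil a ti; set b := dilation _ _ => eb.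
  have b1 : cn b.1 = Num.sqrt t^-1 * cn a.1 by rewrite cnZR ger0_norm ?sqrtr_ge0.
  have b1' : cn b.1 ^+ 2 = t^-1 * cn a.1 ^+ 2 by rewrite b1 exprMn sqr_sqrtr// ltW.
  have b2 : `|b.2| = t^-1 * `|a.2| by rewrite normrZ ger0_norm// ltW.
  have le1 : cn b.1 <= 1.
    rewrite -(@ler_pXn2r _ 2)// ?nnegrE ?cn_ge0// b1' expr1n mulrC ler_pdivrMr// mul1r.
    by rewrite le_max lexx.
  have le2 : `|b.2| <= 1 by rewrite b2 mulrC ler_pdivrMr// mul1r le_max lexx orbT.
  have hb : Num.max (cn b.1) `|b.2| = 1.
    have ge1 : (1 <= cn b.1) || (1 <= `|b.2|).
      have : (t <= cn a.1 ^+ 2) || (t <= `|a.2|) by rewrite -le_max lexx.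
      case/orP => h1; apply/orP; [left|right].
        by rewrite -(@expr_ge1 _ 2)// ?cn_ge0// b1' mulrC ler_pdivlMr// mul1r.
      by rewrite b2 mulrC ler_pdivlMr// mul1r.
    by apply/eqP; rewrite eq_le ge_max le1 le2 le_max ge1.
  have : c <= nrm b by apply: Hc' => //; rewrite -[2]/(1 + 1) lerD.
  have e1 : t^-1 `^ th * t `^ th = 1.
    by rewrite -(powRM _ (ltW ti) (ltW t0)) mulVf ?gt_eqF// powR1.
  by rewrite eb => hc; have := ler_wpM2r (powR_ge0 t th) hc; rewrite mulrAC e1 mul1r.
exists (c^-1 + c^-1 ^+ 2 + 1) => [|a s s0 as_].
  by rewrite ltr_wpDl// addr_ge0// ?invr_ge0 ?sqr_ge0// ltW.
set c2 := _ + 1; have ci : 0 < c^-1 by rewrite invr_gt0.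
have k1 : c^-1 <= c2 by rewrite /c2 -addrA lerDl addr_ge0// sqr_ge0.
have k2 : c^-1 ^+ 2 <= c2 by rewrite /c2 addrAC lerDr addr_ge0// ltW.
have c20 : 0 <= c2 by apply: le_trans k1; exact: ltW.
have [->|a0] := eqVneq a 0.
  by rewrite cn0 normr0 !mulr_ge0// addr_ge0// sqr_ge0.
have [t0] := key a a0; set t := Num.max _ _ in t0 * => ct.
have tth : t `^ th <= c^-1 * s by rewrite mulrC ler_pdivlMr// mulrC; exact: le_trans as_.
have ct1 : cn a.1 ^+ 2 <= t by rewrite le_max lexx.
have ct2 : `|a.2| <= t by rewrite le_max lexx orbT.
(* the exponent theta distinguishes the case n = 0 *)
have [n0|n0] := boolP (n == 0%N).
  have a1 : a.1 = 0 by apply/rowP => -[j jn]; exfalso; move: jn; rewrite (eqP n0).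
  move: tth; rewrite /theta n0 (powRr1 (ltW t0)) => tth.
  split; first by rewrite a1 cn0 mulr_ge0.
  apply: le_trans ct2 _; apply: le_trans tth _; apply: ler_pM => //; first exact: ltW.
  by rewrite lerDl sqr_ge0.
have t2 : t <= (c^-1 * s) ^+ 2.
  move: tth; rewrite /theta (negbTE n0) => tth.
  have -> : t = (t `^ 2^-1) ^+ 2 by rewrite -powR_mulrn ?powR_ge0// -powRrM mulVf// (powRr1 (ltW t0)).
  by rewrite lerXn2r// nnegrE ?powR_ge0// mulr_ge0// ltW.
have cs0 : 0 <= c^-1 * s by rewrite mulr_ge0// ltW.
split.
  apply: (@le_trans _ _ (c^-1 * s)); last by rewrite ler_wpM2r.
  by rewrite -(@ler_pXn2r _ 2)// ?nnegrE ?cn_ge0//; exact: le_trans t2.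
apply: le_trans ct2 _; apply: le_trans t2 _; rewrite exprMn; apply: ler_pM; rewrite ?sqr_ge0//.
by rewrite lerDr.
Qed.

End homogeneous_norm.

(** * Elements of Hol_K have exponential type *)

Section holomorphic_class.
Context {R : realType} {n m : nat}.
Local Notation C := R[i].
Local Notation EC := (EFC R n m).

Lemma normC_le k (z : 'rV[C]_k) : normC z <= k%:R * cn z.
Proof.
have c0 := cn_ge0 z; rewrite -(@ler_pXn2r _ 2)// ?nnegrE ?sqrtr_ge0 ?mulr_ge0//.
rewrite sqr_sqrtr; last by apply: sumr_ge0 => j _; exact: sqr_ge0.
apply: (@le_trans _ _ (\sum_(j < k) cn z ^+ 2)).
  by apply: ler_sum => j _; rewrite lerXn2r// ?nnegrE ?normc_ge0// cn_coord.
rewrite sumr_const card_ord exprMn -[leLHS]mulr_natl ler_wpM2r ?sqr_ge0//.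
by rewrite -natrX ler_nat; case: k {z c0} => // k; rewrite expnS expn1 leq_pmulr.
Qed.

Lemma normR_le k (x : 'rV[R]_k) : normR x <= k%:R * `|x|.
Proof.
rewrite -(@ler_pXn2r _ 2)// ?nnegrE ?sqrtr_ge0 ?mulr_ge0//.
rewrite sqr_sqrtr; last by apply: sumr_ge0 => j _; exact: sqr_ge0.
apply: (@le_trans _ _ (\sum_(j < k) `|x| ^+ 2)).
  by apply: ler_sum => j _; rewrite -real_normK ?num_real// lerXn2r// ?nnegrE// le_coord_norm.
rewrite sumr_const card_ord exprMn -[leLHS]mulr_natl ler_wpM2r ?sqr_ge0//.
by rewrite -natrX ler_nat; case: k {x} => // k; rewrite expnS expn1 leq_pmulr.
Qed.

Lemma normR_ge k (x : 'rV[R]_k) : `|x| <= normR x.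
Proof.
apply: norm_rV_le => [|j]; first exact: sqrtr_ge0.
rewrite -(@ler_pXn2r _ 2)// ?nnegrE ?sqrtr_ge0//.
rewrite sqr_sqrtr; last by apply: sumr_ge0 => i _; exact: sqr_ge0.
by rewrite real_normK ?num_real// (bigD1 j)//= lerDl sumr_ge0// => i _; exact: sqr_ge0.
Qed.

Lemma quotient_eq (a b x : C) : x != 0 -> a = b + (a - b) / x * x.
Proof. by move=> x0; rewrite divfK// addrCA subrr addr0. Qed.

Lemma cdiff_differentiable (f : EC -> C) q v w : differentiable f (q + w *: v) ->
  cdiff (fun w => f (q + w *: v)) w.
Proof.
move=> df; have := diff_derivable (v := v) df.
rewrite /derivable; set l := lim _ => cl.
pose g z := if z == w then l else (f (q + z *: v) - f (q + w *: v)) / (z - w).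
exists g; split; last first.
  move=> z; rewrite /g; case: eqVneq => [->|zw]; first by rewrite subrr mulr0 addr0.
  by apply: quotient_eq; rewrite subr_eq0.
move=> r r0; have rC : 0 < r%:C :> C by rewrite -[0]/(0%:C) ltcR.
have := cl (ball l r%:C) (nbhsx_ballx _ _ rC).
move=> [d /= d0 H].
have [dr Id] : 0 < Re d /\ d = (Re d)%:C.
  by move: d0; rewrite ltcE/= => /andP[/eqP h ->]; split => //; move: h; case: (d) => a b /= ->.
exists (Re d) => // z zd; rewrite /g eqxx; case: eqVneq => [zw|zw].
  by rewrite subrr ComplexField.Normc.normc0.
have := H (z - w); rewrite /ball_/= sub0r normrN Id subr_eq0.
have -> : `|z - w| = (normc (z - w))%:C by [].
rewrite ltcR => /(_ zd zw); rewrite -ball_normE /= distrC.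
have -> : (z - w) *: v + (q + w *: v) = q + z *: v by rewrite scalerBl addrCA subrK.
set X := _ - l; have -> : `|X| = (normc X)%:C by [].
by rewrite ltcR /X -[_ *: _]/(_ * _) mulrC.
Qed.

Variable Phi : Espace R n -> Espace R n -> FCspace R m.

(** K is bounded. *)
Lemma Hsupp_le (K : set (Fspace R m)) : compact K -> exists2 A : R, 0 <= A &
  forall h, (Hsupp K h <= (A * `|h|)%:E)%E.
Proof.
move=> /compact_bounded[M [_ HM]].
have M1 l : K l -> `|l| <= `|M| + 1 by apply: HM; rewrite (le_lt_trans (ler_norm _))// ltrDl.
exists (m%:R * (`|M| + 1)) => [|h]; first by rewrite mulr_ge0// addr_ge0.
apply: ge_ereal_sup => _ [l Kl <-]; rewrite lee_fin.
apply: le_trans (ler_norm _) _; apply: le_trans (pairing_le _ _) _; rewrite normrN.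
by rewrite ler_wpM2r// ler_wpM2l// M1.
Qed.

(** H_K grows at most linearly, since K is bounded. *)
Lemma HolK_expclass (K : set (Fspace R m)) : compact K -> exists2 A : R, 0 <= A &
  forall f, HolK Phi K f -> expclass Phi A f.
Proof.
move=> cK; have [A A0 HA] := Hsupp_le cK; exists A => // f [df [N [c [N0 c0 gr]]] _].
split; first by move=> q v w; apply: cdiff_differentiable; exact: df.
pose k := (Num.truncn N).+1; pose W : R := 1 + (n + m)%:R.
have W1 : 1 <= W by rewrite lerDl.
exists (c * W ^+ k); first by rewrite mulr_ge0 ?exprn_ge0 ?addr_ge0// ltW.
exists k => q; have s0 := esize_ge0 q.
have h1 : 1 <= 1 + normC q.1 + normC q.2 by rewrite -addrA lerDl addr_ge0// sqrtr_ge0.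
have h2 : 1 + normC q.1 + normC q.2 <= W * (1 + esize q).
  have e1 := normC_le q.1; have e2 := normC_le q.2.
  have c1 := cn_ge0 q.1; have c2 := cn_ge0 q.2.
  have e3 : n%:R * cn q.1 <= (n + m)%:R * cn q.1 by rewrite ler_wpM2r// ler_nat leq_addr.
  have e4 : m%:R * cn q.2 <= (n + m)%:R * cn q.2 by rewrite ler_wpM2r// ler_nat leq_addl.
  rewrite /W mulrDl mul1r mulrDr mulr1 {2}/esize mulrDr.
  have : 0 <= (n + m)%:R :> R by [].
  move: s0 (le_trans e1 e3) (le_trans e2 e4); move: (normC q.1) (normC q.2) (_%:R * cn q.1) (_%:R * cn q.2).
  by move: (n + m)%:R (esize q) => *; lra.
have h3 : (1 + normC q.1 + normC q.2) `^ N <= (W * (1 + esize q)) ^+ k.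
  apply: (@le_trans _ _ ((1 + normC q.1 + normC q.2) `^ k%:R)).
    by apply: ler_powR => //; apply: ltW; exact: truncnS_gt.
  by rewrite powR_mulrn ?(le_trans ler01)// lerXn2r// nnegrE (le_trans ler01)// (le_trans h1).
have h4 : (expeR (Hsupp K (rho Phi q)) <= (expR (A * `|rho Phi q|))%:E)%E.
  by rewrite -[leRHS]/(expeR (A * `|rho Phi q|)%:E) lee_expeR.
rewrite -lee_fin; apply: le_trans (gr q) _; rewrite [leRHS]EFinM; apply: lee_pmul => //.
- by rewrite lee_fin mulr_ge0 ?powR_ge0// ltW.
- exact: expeR_ge0.
- by rewrite lee_fin -mulrA -exprMn ler_wpM2l// ltW.
Qed.

End holomorphic_class.

(** * The Carleson inequality *)

Section measure_tools.
Context d (T : measurableType d) (R : realType) (mu : {measure set T -> \bar R}).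
Local Open Scope ereal_scope.

Section sigma_finite_pack.
Hypothesis sf : sigma_finite setT mu.
(** The measure mu bundled with a proof of its sigma-finiteness. *)
Definition sfm : set T -> \bar R := let _ := sf in mu.
HB.instance Definition _ := Measure.on sfm.
HB.instance Definition _ := Measure_isSigmaFinite.Build _ _ _ sfm sf.
End sigma_finite_pack.

Lemma measurable_ind_le (g : T -> R) (c : R) : measurable_fun setT g ->
  measurable_fun setT (fun t => ((g t <= c)%R%:R : R)).
Proof.
move=> mg; rewrite (_ : (fun t => _) = fun t => if (g t <= c)%R then 1%R else 0%R); last first.
  by apply/funext => t; case: ifP.
by apply: measurable_fun_ifT => //; apply: measurable_fun_ler.
Qed.

Lemma integral_ind (b : T -> bool) : measurable [set t | b t] ->
  \int[mu]_t ((b t)%:R)%:E = mu [set t | b t].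
Proof.
move=> mb; rewrite -[in RHS](setIT [set t | b t]) -integral_indic//; apply: eq_integral => t _.
by rewrite indicE (_ : (t \in _) = b t)//; apply/idP/idP; rewrite inE.
Qed.

(** Also true when the whole space is a null set, where the essential supremum is
    0 by convention. *)
Lemma Linfty_ae (g : T -> \bar R) : (forall t, 0 <= g t) -> Linfty mu g ->
  exists2 M : R, (0 <= M)%R & {ae mu, forall t, g t <= M%:E}.
Proof.
move=> g0 [mg]; rewrite unlock; case: ifPn => [mu0|].
  move=> /ereal_inf_lt[y /= yP yoo].
  have [M M0 yM] : exists2 M : R, (0 <= M)%R & y <= M%:E.
    case: y yP yoo => [r _ _|_|_ _].
    - by exists `|r|%R => //; rewrite lee_fin ler_norm.
    - by rewrite ltxx.
    - by exists 0%R => //; rewrite leNye.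
  exists M => //; apply: filterS yP => t /= h; apply: le_trans yM.
  by apply: le_trans h; rewrite gee0_abs.
rewrite -leNgt => mu0 _; exists 0%R => //; exists setT; split => //.
by apply/eqP; rewrite eq_le mu0 measure_ge0.
Qed.

End measure_tools.

Section carleson.
Context {R : realType} {n m : nat}.
Local Notation C := R[i].
Local Notation EC := (EFC R n m).
Local Notation N := (Ngroup R n m).
Local Notation TN := (Rtuple R n * Rtuple R n * Rtuple R m)%type.
Local Notation TE := (Rtuple R n * Rtuple R n * Rtuple R m * Rtuple R m)%type.
Variable Phi : Espace R n -> Espace R n -> FCspace R m.
Hypothesis hPhi : hermitian_map Phi.
Variable dN : N -> N -> R.
Hypothesis hdN : homogeneous_distance Phi dN.

Lemma dEFCE (q q' : EC) : dEFC Phi dN q q' =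
  Num.max (nrm dN (mulN Phi (invN (base q)) (base q'))) (normR (rho Phi q - rho Phi q')).
Proof. by rewrite /dEFC -(dNE hPhi hdN). Qed.

Lemma measurable_normR d (T : measurableType d) k (x : T -> 'rV[R]_k) : rmeas x ->
  measurable_fun setT (fun t => normR (x t)).
Proof.
move=> mx; apply: (@measurableT_comp _ _ _ _ _ _ (@Num.sqrt R)).
  by apply: continuous_measurable_fun; exact: sqrt_continuous.
by apply: measurable_sum => j; apply: measurable_funX; exact: mx.
Qed.

Lemma measurable_dEFC d (T : measurableType d) (Q Q' : T -> EC) : emeas Q -> emeas Q' ->
  measurable_fun setT (fun t => dEFC Phi dN (Q t) (Q' t)).
Proof.
move=> mQ mQ'; under eq_fun do rewrite dEFCE; apply: measurable_maxr.
  apply: (nmeasurable_nrm hPhi hdN); apply: nmeas_mulN => //; last exact: nmeas_base.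
  by apply: nmeas_invN; exact: nmeas_base.
apply: measurable_normR; have h1 := rmeas_rho hPhi mQ; have h2 := rmeas_rho hPhi mQ'.
by have := rmeasD h1 (rmeasZ (-1) h2); under eq_fun do rewrite scaleN1r.
Qed.

(** The unit ball around q contains the product of a translated box of N and of a
    box around rho(q); both have a volume that does not depend on q. *)
Lemma ball_volume_ge : exists2 v : R, (0 < v)%R & forall q : EC,
  (v%:E <= \int[lebEFC R n m]_t ((dEFC Phi dN (pointEFC t) q <= 1)%R%:R)%:E)%E.
Proof.
have [d d0 Hd] := nrm_small hPhi hdN (ltr01 : 0 < 1 :> R)%R.
pose c0 := (d / 2)%R; have c00 : (0 < c0)%R by rewrite divr_gt0.
pose c1 := (m.+1%:R^-1)%R : R; have c10 : (0 < c1)%R by rewrite invr_gt0.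
exists ((2 * c1) ^+ m * ((2 * c0) ^+ n * (2 * c0) ^+ n * (2 * c0) ^+ m))%R => [|q].
  by rewrite !mulr_gt0 ?exprn_gt0 ?mulr_gt0.
pose b0 := base q; pose G (a : N) : R := (smallN c0 (mulN Phi (invN b0) a))%:R.
have mE d' (T : measurableType d') (t : T -> TE) : measurable_fun setT t ->
    measurable_fun setT (fun x => (((dEFC Phi dN (pointEFC (t x)) q <= 1)%R)%:R)%:E : \bar R).
  move=> mt; apply/measurable_EFinP; apply: measurable_ind_le; apply: measurable_dEFC.
    exact: emeas_pointEFC.
  by split=> j; exact: cmeas_cst.
rewrite integral_lebEFC; last 2 first.
- have h := mE _ TE id (@measurable_id _ TE setT).
  exact: h.
- by move=> t; rewrite lee_fin.
have mG d' (T : measurableType d') (a : T -> N) : nmeas a -> measurable_fun setT (fun x => G (a x)).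
  by move=> ma; apply: measurable_smallN; apply: nmeas_mulN => //; exact: nmeas_cst.
have inner (a : TN) : ((G (pointN a) * (2 * c1) ^+ m)%:E <=
    \int[leb R m]_y ((dEFC Phi dN (pointEFC (a, y)) q <= 1)%R%:R)%:E)%E.
  rewrite /G; case: (boolP (smallN _ _)) => [sm|_]; last first.
    by rewrite mul0r; apply: integral_ge0 => y _; rewrite lee_fin.
  rewrite mul1r -(@integral_smallF R m c1 (quad Phi (pointN a).1 + rho Phi q) (ltW c10)).
  apply: ge0_le_integral => //.
  - apply/measurable_EFinP.
    by apply: measurable_smallF; apply: rmeasD; [exact: rmeas_pointR|exact: rmeas_cst].
  - exact: (mE _ (Rtuple R m) (fun y => (a, y)) (pair1_measurable _)).
  move=> y _; rewrite lee_fin; case: (boolP (smallF _ _)) => [/forallP sF|_]; last by rewrite ler0n.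
  have -> : (dEFC Phi dN (pointEFC (a, y)) q <= 1)%R; last by [].
  rewrite dEFCE ge_max; apply/andP; split.
    have -> : nrm dN (mulN Phi (invN (base (pointEFC (a, y)))) (base q)) =
              nrm dN (mulN Phi (invN b0) (base (pointEFC (a, y)))).
      by rewrite -!(dNE hPhi hdN) /b0; case: hdN => -[_ _ sy _] _ _; exact: sy.
    have -> : base (pointEFC (a, y)) = pointN a :> N by rewrite /base /= ReV_complexV.
    have [h1 h2] := smallN_cn sm (ltW c00).
    apply: Hd; first by apply: le_trans h1 _; rewrite /c0 mulrC divfK.
    by apply: le_trans h2 _; rewrite /c0 ler_pdivrMr// ler_peMr ?ler1n//; exact: ltW.
  apply: le_trans (normR_le _) _.
  have h : (`|rho Phi (pointEFC (a, y)) - rho Phi q| <= c1)%R.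
    apply: norm_rV_le => [|j]; first exact: ltW.
    have := sF j; rewrite /rho /= ImV_complexV.
    by rewrite opprD addrA.
  apply: le_trans (ler_wpM2l _ h) _ => //.
  by rewrite ler_pdivrMr// mul1r ler_nat.
have w0 : (0 <= (2 * c1) ^+ m)%R by rewrite exprn_ge0// mulr_ge0// ltW.
apply: (@le_trans _ _ (\int[lebN R n m]_a ((2 * c1) ^+ m * G (pointN a))%:E)%E); last first.
  apply: ge0_le_integral => //.
  - by move=> a _; rewrite lee_fin; apply: mulr_ge0 => //; rewrite /G.
  - by apply/measurable_EFinP; apply: measurable_funM => //; apply: mG; exact: nmeas_pointN.
  - have := @measurable_fun_fubini_tonelli_F _ _ _ _ R (leb R m) (fun x : TN * Rtuple R m =>
      ((dEFC Phi dN (pointEFC x) q <= 1)%R%:R)%:E) (mE _ (TN * Rtuple R m)%type id (@measurable_id _ (TN * Rtuple R m)%type setT)).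
    by apply => x; rewrite lee_fin.
  by move=> a _; rewrite mulrC; exact: inner.
under eq_integral do rewrite EFinM.
have mG' : measurable_fun setT ((fun a => (G a)%:E) \o @pointN R n m).
  by apply/measurable_EFinP; apply: mG; exact: nmeas_pointN.
rewrite ge0_integralZl//; last by move=> a _; rewrite lee_fin.
rewrite EFinM; apply: lee_wpmul2l; first by rewrite lee_fin.
rewrite -(integral_smallN (ltW c00)).
have := @integral_lebN_left R n m Phi hPhi b0 (fun a => (G a)%:E) mG' _.
rewrite /G => <-; last by move=> a; rewrite lee_fin.
rewrite le_eqVlt; apply/orP; left; apply/eqP; apply: eq_integral => t _.
by rewrite (mulNA hPhi) (mulVN hPhi) (mul0N hPhi).
Qed.

End carleson.

Lemma chart_sum {R : realType} (c B s h : R) : 0 <= c -> 0 <= B -> 0 <= s -> s <= 2 ->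
  c * s + (c * (s + s ^+ 2) + (h + B * (c * s) * (c * s))) <= (4 * c + 2 * (B * c ^+ 2)) * s + h.
Proof.
move=> c0 B0 s0 s2; have cs : 0 <= c * s by rewrite mulr_ge0.
have Bs : 0 <= B * c ^+ 2 * s by rewrite !mulr_ge0// sqr_ge0.
have h1 := ler_wpM2l cs s2; have h2 := ler_wpM2l Bs s2.
by rewrite !expr2 in h1 h2 *; lra.
Qed.

Section carleson_inequality.
Context {R : realType} {n m : nat}.
Local Notation C := R[i].
Local Notation EC := (EFC R n m).
Local Notation N := (Ngroup R n m).
Local Notation TN := (Rtuple R n * Rtuple R n * Rtuple R m)%type.
Local Notation TE := (Rtuple R n * Rtuple R n * Rtuple R m * Rtuple R m)%type.
Variable Phi : Espace R n -> Espace R n -> FCspace R m.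
Hypothesis hPhi : hermitian_map Phi.
Variable dN : N -> N -> R.
Hypothesis hdN : homogeneous_distance Phi dN.

(** For s at most 2 the quadratic terms are absorbed into a linear bound. *)
Lemma esize_chart : exists2 c : R, 0 < c & forall (v : EC) s h, 0 <= s -> s <= 2 ->
  nrm dN (base v) <= s -> `|rho Phi v| <= h -> esize v <= c * s + h.
Proof.
have [c c0 Hc] := nrm_ge hPhi hdN; have [B B0 HB] := Phi_bound hPhi.
exists (4 * c + 2 * (B * c ^+ 2)) => [|v s h s0 s2 vs vh].
  apply: ltr_pwDl; first by rewrite mulr_gt0.
  by apply: mulr_ge0 => //; apply: mulr_ge0 => //; exact: sqr_ge0.
have [h1 h2] := Hc _ _ s0 vs.
have h3 : `|ImV v.2| <= h + B * (c * s) * (c * s).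
  have -> : ImV v.2 = rho Phi v + quad Phi v.1 by rewrite /rho subrK.
  apply: le_trans (ler_normD _ _) _; apply: lerD => //.
  apply: le_trans (quad_bound HB _) _; apply: ler_pM; rewrite ?mulr_ge0 ?cn_ge0//.
  by rewrite ler_wpM2l.
have h4 : esize v = cn (base v).1 + (`|(base v).2| + `|ImV v.2|) by [].
rewrite h4; apply: le_trans (lerD h1 (lerD h2 h3)) _.
exact: chart_sum (ltW c0) B0 s0 s2.
Qed.

Variables (ls : 'I_m.+1 -> Fspace R m) (D : R) (e : Fspace R m).
Hypothesis hf : frame Phi ls D e.
Variable p : R.
Hypothesis p0 : 0 < p.
Variable mu : {measure set (Borel EC) -> \bar R}.
Hypothesis sf : sigma_finite setT mu.

Lemma measurable_normc_pow A (f : EC -> C) d (T : measurableType d) (Q : T -> EC) : 0 <= A ->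
  expclass Phi A f -> emeas Q -> measurable_fun setT (fun t => normc (f (Q t)) `^ p).
Proof. by move=> A0 cf mQ; apply: measurable_pow => //; exact: (expclass_econt hPhi A0). Qed.

Lemma measurable_dEFC_ball (q : EC) (r : R) : measurable [set q' : Borel EC | (dEFC Phi dN q q' <= r)%R].
Proof.
have mq : emeas (fun _ : Borel EC => q) by split=> j; exact: cmeas_cst.
have md := measurable_dEFC hPhi hdN mq (@emeas_Borel R n m).
have := md measurableT _ (measurable_itv `]-oo, r]); rewrite setTI.
by congr measurable; apply/seteqP; split => q' /=; rewrite in_itv.
Qed.

Definition lebEFCs : {sigma_finite_measure set TE -> \bar R} := sfprod (@lebNs R n m) (leb R m).

Lemma emeas_fst d (T : measurableType d) : emeas (fun x : Borel EC * T => x.1 : EC).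
Proof.
have [m1 m2] := @emeas_Borel R n m; split=> j; split.
- by apply: (measurableT_comp (m1 j).1); exact: measurable_fst.
- by apply: (measurableT_comp (m1 j).2); exact: measurable_fst.
- by apply: (measurableT_comp (m2 j).1); exact: measurable_fst.
- by apply: (measurableT_comp (m2 j).2); exact: measurable_fst.
Qed.

Local Open Scope ereal_scope.

(** Over a fixed base point rho differs from Im z by a constant. *)
Lemma integral_strip (H : R) (h : N -> \bar R) : (0 <= H)%R ->
  measurable_fun setT (h \o @pointN R n m) -> (forall a, 0 <= h a) ->
  \int[lebEFC R n m]_t (((`|rho Phi (pointEFC t)| <= H)%R%:R)%:E * h (base (pointEFC t))) <=
  ((2 * H) ^+ m)%R%:E * \int[lebN R n m]_a h (pointN a).
Proof.
move=> H0 mh h0.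
have bE (a : TN) y : base (pointEFC (a, y)) = pointN a :> N by rewrite /base/= ReV_complexV.
have mr d (T : measurableType d) (t : T -> TE) : measurable_fun setT t ->
    measurable_fun setT (fun x => ((`|rho Phi (pointEFC (t x))| <= H)%R%:R)%:E : \bar R).
  move=> mt; apply/measurable_EFinP.
  rewrite (_ : (fun x => _) = \1_[set x | `|rho Phi (pointEFC (t x))| <= H]%R); last first.
    apply/funext => x; rewrite indicE; congr (_%:R)%R; congr nat_of_bool.
    by apply/idP/idP; rewrite inE.
  by apply: measurable_indic; apply: measurable_norm_rV; apply: rmeas_rho => //; exact: emeas_pointEFC.
have mb : measurable_fun setT (fun t : TE => h (base (pointEFC t))).
  have := measurableT_comp mh (@measurable_fst _ _ TN (Rtuple R m)).
  by apply: eq_measurable_fun => -[a y] _ /=; rewrite bE.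
rewrite integral_lebEFC; last 2 first.
- by apply: emeasurable_funM => //; exact: (mr _ _ id (@measurable_id _ TE setT)).
- by move=> t; apply: mule_ge0; rewrite ?lee_fin.
rewrite -ge0_integralZl//; last by rewrite lee_fin exprn_ge0// mulr_ge0.
have mF : measurable_fun setT (fubini_F (leb R m) (fun t : TE => ((`|rho Phi (pointEFC t)| <= H)%R%:R)%:E * h (base (pointEFC t)))).
  apply: measurable_fun_fubini_tonelli_F.
    by apply: emeasurable_funM => //; exact: (mr _ _ id (@measurable_id _ TE setT)).
  by move=> t; apply: mule_ge0; rewrite ?lee_fin.
apply: ge0_le_integral => //.
- by move=> a _; apply: integral_ge0 => y _; apply: mule_ge0; rewrite ?lee_fin.
- by apply: emeasurable_funM => //; exact: measurable_cst.
move=> a _; under eq_integral do rewrite bE.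
have mry : measurable_fun setT (fun y : Rtuple R m => ((`|rho Phi (pointEFC (a, y))| <= H)%R%:R)%:E : \bar R).
  exact: (mr _ _ (fun y => (a, y)) (pair1_measurable _)).
rewrite ge0_integralZr//.
apply: lee_wpmul2r => //; rewrite -(@integral_smallF R m H (quad Phi (pointN a).1) H0).
apply: ge0_le_integral => //.
- apply/measurable_EFinP.
  by apply: measurable_smallF; apply: rmeasD; [exact: rmeas_pointR|exact: rmeas_cst].
move=> y _; rewrite lee_fin ler_nat; case: (boolP (_ <= H)%R) => [h1|_]; last by [].
rewrite lt0b /smallF; apply/forallP => j; apply: le_trans (le_coord_norm _ _) _.
by move: h1; rewrite /rho/= ImV_complexV.
Qed.

Lemma integral_pw_ge0 (f : EC -> C) : 0 <= \int[lebN R n m]_a (pw Phi p f (pointN a))%:E.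
Proof. by apply: integral_ge0 => a _; rewrite lee_fin; exact: pw_ge0. Qed.

(** Carleson estimate: point evaluations are averaged over unit balls, and
    Tonelli's theorem brings in the mass of the unit balls. *)
Lemma carleson (A H M : R) : (0 <= A)%R -> (0 <= H)%R -> (0 <= M)%R ->
  mu [set q | ~ (`|rho Phi q| <= H)%R] = 0 ->
  {ae lebEFC R n m, forall t, ball_mass Phi dN mu 1 (pointEFC t) <= M%:E} ->
  exists2 K : R, (0 < K)%R & forall f, expclass Phi A f ->
  \int[mu]_q (normc (f q) `^ p)%:E <= K%:E * \int[lebN R n m]_a (pw Phi p f (pointN a))%:E.
Proof.
move=> A0 H0 M0 muH aeM.
have [v v0 Hv] := ball_volume_ge hPhi hdN.
have [c c0 Hc] := esize_chart.
have r0 : (0 <= c * 1 + H)%R by rewrite mulr1 addr_ge0// ltW.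
have [K1 K10 HK1] := tau_le_Vp hPhi hf p0 A0 r0.
have [I I0 HI] := @integral_W0 R n m.
pose K := (v^-1 * (K1 * (M * ((2 * (H + 1)) ^+ m * I))))%R.
have K0 : (0 <= K)%R.
  by rewrite /K !mulr_ge0// ?exprn_ge0// ?mulr_ge0 ?addr_ge0// ?invr_ge0; exact: ltW.
exists (K + 1)%R => [|f cf]; first by rewrite ltr_wpDl.
apply: (@le_trans _ _ (K%:E * \int[lebN R n m]_a (pw Phi p f (pointN a))%:E)); last first.
  by apply: lee_wpmul2r; [exact: integral_pw_ge0|rewrite lee_fin lerDl].
pose ball (t : TE) (q : EC) := (dEFC Phi dN (pointEFC t) q <= 1)%R.
pose strip (t : TE) := (`|rho Phi (pointEFC t)| <= H + 1)%R.
have mstrip d (T : measurableType d) (t : T -> TE) : measurable_fun setT t ->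
    measurable_fun setT (fun x => ((strip (t x))%:R)%:E : \bar R).
  move=> mt; apply/measurable_EFinP.
  rewrite (_ : (fun x => _) = \1_[set x | strip (t x)]); last first.
    apply/funext => x; rewrite indicE; congr (_%:R)%R; congr nat_of_bool.
    by apply/idP/idP; rewrite inE.
  by apply: measurable_indic; apply: measurable_norm_rV; apply: rmeas_rho => //; exact: emeas_pointEFC.
have mball d (T : measurableType d) (t : T -> TE) (q : T -> EC) : measurable_fun setT t -> emeas q ->
    measurable_fun setT (fun x => ((ball (t x) (q x))%:R)%:E : \bar R).
  move=> mt mq; apply/measurable_EFinP; apply: measurable_ind_le.
  by apply: measurable_dEFC => //; exact: emeas_pointEFC.
have mV d (T : measurableType d) (t : T -> TE) : measurable_fun setT t ->
    measurable_fun setT (fun x => Vp Phi p f (base (pointEFC (t x)))).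
  by move=> mt; apply: (measurable_Vp hPhi p A0 cf); apply: nmeas_base; exact: emeas_pointEFC.
pose W t : \bar R := ((strip t)%:R)%:E * Vp Phi p f (base (pointEFC t)).
have W0' t : 0 <= W t by apply: mule_ge0; [rewrite lee_fin|exact: Vp_ge0].
have mW d (T : measurableType d) (t : T -> TE) : measurable_fun setT t -> measurable_fun setT (fun x => W (t x)).
  by move=> mt; apply: emeasurable_funM; [exact: mstrip|exact: mV].
pose G (x : Borel EC * TE) : \bar R := ((ball x.2 x.1)%:R)%:E * W x.2.
have G0 x : 0 <= G x by apply: mule_ge0; rewrite ?lee_fin.
have mG : measurable_fun setT G.
  apply: emeasurable_funM; last exact: mW (@measurable_snd _ _ (Borel EC) TE).
  by apply: mball; [exact: measurable_snd|exact: emeas_fst].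
(* evaluation at q is controlled from each point of the unit ball around q *)
have pt q : (`|rho Phi q| <= H)%R -> v%:E * (normc (f q) `^ p)%:E <= K1%:E * \int[lebEFC R n m]_t G (q, t).
  move=> qH.
  have mb : measurable_fun setT (fun t : TE => ((ball t q)%:R)%:E : \bar R).
    by apply: (mball _ TE id (fun=> q)); [exact: measurable_id|split=> j; exact: cmeas_cst].
  have mGq : measurable_fun setT (fun t : TE => G (q, t)).
    by apply: emeasurable_funM; [exact: mb|exact: (mW _ TE id (@measurable_id _ TE setT))].
  apply: (@le_trans _ _ (\int[lebEFC R n m]_t (((ball t q)%:R)%:E * (normc (f q) `^ p)%:E))).
    rewrite ge0_integralZr//; last by rewrite lee_fin powR_ge0.
    by apply: lee_wpmul2r; [rewrite lee_fin powR_ge0|exact: Hv].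
  rewrite -ge0_integralZl//; last by rewrite lee_fin ltW.
  apply: ge0_le_integral; first exact: measurableT.
  - by move=> t _; apply: mule_ge0; rewrite lee_fin ?powR_ge0.
  - by apply: emeasurable_funM; [exact: mb|exact: measurable_cst].
  - by apply: emeasurable_funM; [exact: measurable_cst|exact: mGq].
  move=> t _; rewrite /G/=; case: (boolP (ball t q)) => [bq|_]; last by rewrite !mul0e mule0.
  have := bq; rewrite /ball dEFCE// ge_max => /andP[b1 b2].
  have st : strip t.
    rewrite /strip; have -> : rho Phi (pointEFC t) = (rho Phi q + (rho Phi (pointEFC t) - rho Phi q))%R.
      by rewrite addrC subrK.
    by apply: le_trans (ler_normD _ _) _; apply: lerD => //; apply: le_trans (normR_ge _) _.
  rewrite !mul1e /W st mul1e -{1}(tauK hPhi (base (pointEFC t)) q); apply: HK1 => //.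
  apply: Hc => //; first by rewrite ler1n.
    by rewrite base_tau.
  by rewrite rho_tau.
have mf : measurable_fun setT (fun q : Borel EC => (normc (f q) `^ p)%:E).
  by apply/measurable_EFinP; exact: (measurable_normc_pow A0 cf (@emeas_Borel R n m)).
have mIG : measurable_fun setT (fun q : Borel EC => \int[lebEFC R n m]_t G (q, t)).
  exact: (@measurable_fun_fubini_tonelli_F _ _ _ _ R lebEFCs G mG).
have step1 : v%:E * \int[mu]_q (normc (f q) `^ p)%:E <=
    K1%:E * \int[mu]_q \int[lebEFC R n m]_t G (q, t).
  rewrite -!ge0_integralZl//; last 4 first.
  - by move=> q _; apply: integral_ge0 => t _.
  - by rewrite lee_fin ltW.
  - by move=> q _; rewrite lee_fin powR_ge0.
  - by rewrite lee_fin ltW.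
  apply: ae_ge0_le_integral; first exact: measurableT.
  - by move=> q _; apply: mule_ge0; rewrite lee_fin ?powR_ge0//; exact: ltW.
  - by apply: emeasurable_funM; [exact: measurable_cst|exact: mf].
  - by move=> q _; apply: mule_ge0; [rewrite lee_fin ltW|apply: integral_ge0 => t _; exact: G0].
  - by apply: emeasurable_funM; [exact: measurable_cst|exact: mIG].
  exists [set q | ~ (`|rho Phi q| <= H)%R]; split => //.
    apply: measurableC; apply: (@measurable_norm_rV _ _ (Borel EC) _ (fun q => rho Phi q)).
    by apply: rmeas_rho => //; exact: emeas_Borel.
  by move=> q /= nq qH; apply: nq => _; exact: pt.
have swap : \int[mu]_q \int[lebEFC R n m]_t G (q, t) = \int[lebEFC R n m]_t \int[mu]_q G (q, t).
  exact: (@fubini_tonelli _ _ _ _ R (sfm sf) lebEFCs G mG G0).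
have inner t : \int[mu]_q G (q, t) = ball_mass Phi dN mu 1 (pointEFC t) * W t.
  rewrite /G/= ge0_integralZr//; last first.
    exact: (mball _ (Borel EC) (fun=> t) _ (@measurable_cst _ _ (Borel EC) TE setT t) (@emeas_Borel R n m)).
  by rewrite integral_ind//; exact: measurable_dEFC_ball.
have step2 : \int[lebEFC R n m]_t \int[mu]_q G (q, t) <= M%:E * \int[lebEFC R n m]_t W t.
  have mWt := mW _ TE id (@measurable_id _ TE setT).
  rewrite -(ge0_integralZl (lebEFC R n m) measurableT mWt); last 2 first.
  - by move=> t _; exact: W0'.
  - by rewrite lee_fin.
  apply: ae_ge0_le_integral; first exact: measurableT.
  - by move=> t _; apply: integral_ge0 => q _; exact: G0.
  - exact: (@measurable_fun_fubini_tonelli_G _ _ _ _ R (sfm sf) G mG).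
  - by move=> t _; apply: mule_ge0; [rewrite lee_fin|exact: W0'].
  - by apply: emeasurable_funM; [exact: measurable_cst|exact: (mW _ TE id (@measurable_id _ TE setT))].
  by apply: filterS aeM => t ht _; rewrite inner; apply: lee_wpmul2r; [exact: W0'|exact: ht].
have step3 : \int[lebEFC R n m]_t W t <=
   ((2 * (H + 1)) ^+ m)%R%:E * (I%:E * \int[lebN R n m]_a (pw Phi p f (pointN a))%:E).
  apply: le_trans (@integral_strip (H + 1) (Vp Phi p f) _ _ _) _.
  - by rewrite addr_ge0.
  - exact: (measurable_Vp hPhi p A0 cf (nmeas_pointN (@measurable_id _ TN setT))).
  - by move=> a; exact: Vp_ge0.
  - by rewrite (integral_Vp hPhi p A0 cf) HI.
have Ip := integral_pw_ge0 f; move: step1 step3; rewrite swap; set X := \int[mu]_q _; set J := \int[lebN R n m]_a _ in Ip *.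
move=> step1 step3.
have X0 : 0 <= X by apply: integral_ge0 => q _; rewrite lee_fin powR_ge0.
have chain : v%:E * X <= K1%:E * (M%:E * (((2 * (H + 1)) ^+ m)%R%:E * (I%:E * J))).
  apply: le_trans step1 _; apply: lee_wpmul2l; first by rewrite lee_fin ltW.
  by apply: le_trans step2 _; apply: lee_wpmul2l.
have -> : X = (v^-1)%:E * (v%:E * X) by rewrite muleA -EFinM mulVf ?gt_eqF// mul1e.
rewrite /K !EFinM -!muleA; apply: lee_wpmul2l; first by rewrite lee_fin invr_ge0 ltW.
exact: chain.
Qed.

End carleson_inequality.

(** * Recovering boundary values from heavy balls *)

Section sampling_inequality.
Context {R : realType} {n m : nat}.
Local Notation C := R[i].
Local Notation EC := (EFC R n m).
Local Notation N := (Ngroup R n m).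
Local Notation TN := (Rtuple R n * Rtuple R n * Rtuple R m)%type.
Variable Phi : Espace R n -> Espace R n -> FCspace R m.
Hypothesis hPhi : hermitian_map Phi.
Variable dN : N -> N -> R.
Hypothesis hdN : homogeneous_distance Phi dN.
Variables (ls : 'I_m.+1 -> Fspace R m) (D : R) (e : Fspace R m).
Hypothesis hf : frame Phi ls D e.
Variable p : R.
Hypothesis p0 : 0 < p.
Implicit Types (f : EC -> C) (a b : N).

Lemma powR_add2 (x y : R) : 0 <= x -> 0 <= y -> (x + y) `^ p <= 2 `^ p * (x `^ p + y `^ p).
Proof.
move=> x0 y0; wlog xy : x y x0 y0 / x <= y.
  by move=> H; case: (leP x y) => [|/ltW] h; [|rewrite addrC [X in _ * X]addrC]; exact: H.
apply: (@le_trans _ _ ((2 * y) `^ p)).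
  by apply: powR_mono => //; [exact: addr_ge0|rewrite mulr_natl mulr2n lerD2r].
by rewrite powRM// ler_wpM2l ?powR_ge0// lerDr powR_ge0.
Qed.

Lemma dEFC_bpt a q s : dEFC Phi dN (bpt Phi a) q <= s ->
  nrm dN (base (tau Phi (invN a) q)) <= s /\ `|rho Phi (tau Phi (invN a) q)| <= s.
Proof.
rewrite dEFCE// ge_max base_bpt rho_bpt sub0r => /andP[h1 h2].
rewrite (base_tau hPhi) (rho_tau hPhi); split => //; rewrite -normrN; apply: le_trans h2; exact: normR_ge.
Qed.

(** Up to an error C1 r^p V the value at a boundary point is recovered from any
    point of the ball of radius 2 r. The constants C1 and r0 are chosen before any
    measure is given, and this is what makes the final radius uniform. *)
Definition sampling_radius (A C1 r0 : R) : Prop := [/\ 0 < C1, 0 < r0, r0 <= 1 &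
  forall f, expclass Phi A f -> forall r, 0 < r -> r <= r0 -> forall a V, Vp Phi p f a = V%:E ->
  forall q, dEFC Phi dN (bpt Phi a) q <= 2 * r ->
  pw Phi p f a <= C1 * r `^ p * V + 2 `^ p * normc (f q) `^ p].

(** Schwarz's lemma bounds the oscillation over the ball of radius 2 r by a
    multiple of r times the sup over a ball of fixed size, and this sup is bounded
    by the average Vp. *)
Lemma sampling_point (A : R) : 0 <= A -> exists C1 r0 : R, sampling_radius A C1 r0.
Proof.
move=> A0; rewrite /sampling_radius; have [B B0 HB] := Phi_bound hPhi; have [c c0 Hc] := esize_chart hPhi hdN.
have k0 : 0 < kappa B by rewrite invr_gt0 mulr_gt0// ltr_wpDr.
have k20 : 0 <= 2 * kappa B by rewrite mulr_ge0// ltW.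
have [K1 K10 HK1] := tau_le_Vp hPhi hf p0 A0 k20.
pose c' := c * 2 + 2; have c'0 : 0 < c' by rewrite addr_gt0// mulr_gt0.
pose r0 := Num.min 1 (kappa B / c'); have r00 : 0 < r0 by rewrite lt_min ltr01 divr_gt0.
pose C2 := 4 * c' / kappa B; have C20 : 0 < C2 by rewrite divr_gt0// mulr_gt0.
exists (2 `^ p * (C2 `^ p * K1)), r0; split => //.
- by rewrite !mulr_gt0// powR_gt0.
- by rewrite ge_min lexx.
move=> f cf r rp rr0 a V VE q aq.
have r1 : r <= 1 by apply: le_trans rr0 _; rewrite ge_min lexx.
have V0 : 0 <= V by rewrite -lee_fin -VE; exact: Vp_ge0.
pose M := (K1 * V) `^ p^-1; have M0 : 0 <= M by exact: powR_ge0.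
have MV : M `^ p = K1 * V.
  by rewrite /M -powRrM mulVf ?gt_eqF// powRr1// mulr_ge0// ltW.
have bd v : esize v <= 2 * kappa B -> normc (f (tau Phi a v)) <= M.
  move=> hv; have := HK1 f cf a v hv; rewrite VE -EFinM lee_fin => h.
  have e1 : normc (f (tau Phi a v)) = (normc (f (tau Phi a v)) `^ p) `^ p^-1.
    by rewrite -powRrM mulfV ?gt_eqF// powRr1 ?normc_ge0.
  have pi0 : 0 < p^-1 by rewrite invr_gt0.
  by rewrite e1; apply: (powR_mono pi0) => //; exact: powR_ge0.
pose t := c' * r / kappa B.
have [n1 n2] := dEFC_bpt aq.
have sz : esize (tau Phi (invN a) q) <= t * kappa B.
  rewrite /t divfK ?gt_eqF//; apply: le_trans (Hc _ (2 * r) (2 * r) _ _ n1 n2) _.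
  - by rewrite mulr_ge0// ltW.
  - by rewrite -[leRHS]mulr1 ler_wpM2l.
  - by rewrite /c' [leRHS]mulrDl mulrA.
have t1 : t <= 1.
  rewrite /t ler_pdivrMr// mul1r mulrC -ler_pdivlMr//; apply: le_trans rr0 _.
  by rewrite ge_min lexx orbT.
have osc := oscillation hPhi cf.1 k0 bd t1 sz; rewrite (tauK hPhi) in osc.
have h1 : normc (f (bpt Phi a)) <= C2 * r * M + normc (f q).
  have := normc_near (f (bpt Phi a)) (f q); rewrite lerBlDr => h.
  apply: le_trans h _; rewrite addrC lerD2r; apply: le_trans osc _.
  rewrite le_eqVlt; apply/orP; left; apply/eqP; rewrite /t /C2.
  by move: (kappa B) (k0) => k kp; field; rewrite gt_eqF.
rewrite /pw; apply: (@le_trans _ _ ((C2 * r * M + normc (f q)) `^ p)).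
  by apply: powR_mono => //; exact: normc_ge0.
have C2r : 0 <= C2 * r := mulr_ge0 (ltW C20) (ltW rp).
apply: le_trans (powR_add2 (mulr_ge0 C2r M0) (normc_ge0 _)) _.
rewrite mulrDr lerD2r (powRM _ C2r M0) (powRM _ (ltW C20) (ltW rp)) MV.
rewrite le_eqVlt; apply/orP; left; apply/eqP.
by move: (2 `^ p) (C2 `^ p) (r `^ p) => x y z; ring.
Qed.

(** By left invariance the volume is that of a set contained in a fixed box. *)
Lemma near_volume_le : exists2 v : R, 0 < v & forall q r, 0 < r -> r <= 1 ->
  (\int[lebN R n m]_a ((dEFC Phi dN (bpt Phi (pointN a)) q <= 2 * r)%R%:R)%:E <= v%:E)%E.
Proof.
have aux (x : R) : 0 < x -> x * 2 <= 6 * x /\ x * (2 + 2 ^+ 2) <= 6 * x.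
  by move=> x0; split; rewrite ?expr2; lra.
have [c c0 Hc] := nrm_ge hPhi hdN; pose s := 6 * c; have s0 : 0 < s by rewrite mulr_gt0.
exists ((2 * s) ^+ n * (2 * s) ^+ n * (2 * s) ^+ m) => [|q r rp r1].
  by rewrite !mulr_gt0// exprn_gt0// mulr_gt0.
rewrite -(integral_smallN (ltW s0)).
have mG d' (T : measurableType d') (a : T -> N) : nmeas a -> measurable_fun setT (fun x => ((smallN s (a x))%:R)%:E : \bar R).
  by move=> ma; apply/measurable_EFinP; exact: measurable_smallN.
have mp := nmeas_pointN (@measurable_id _ TN setT).
have e1 := @integral_lebN_left R n m Phi hPhi (invN (base q)) (fun a => ((smallN s a)%:R)%:E) (mG _ TN _ mp) (fun a => _).
rewrite -e1; last by move=> a; rewrite lee_fin.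
apply: ge0_le_integral.
- exact: measurableT.
- by move=> a _; rewrite lee_fin.
- have mq : emeas (fun _ : TN => q) by split=> j; exact: cmeas_cst.
  apply/measurable_EFinP; apply: measurable_ind_le.
  exact: (measurable_dEFC hPhi hdN (emeas_bpt hPhi mp) mq).
- by apply: mG; apply: nmeas_mulN => //; exact: nmeas_cst.
move=> a _; rewrite lee_fin; case: (boolP (_ <= 2 * r)) => [h|_]; last by rewrite ler0n.
suff -> : smallN s (mulN Phi (invN (base q)) (pointN a)) by [].
move: h; rewrite dEFCE// ge_max base_bpt => /andP[h _].
have h' : nrm dN (mulN Phi (invN (base q)) (pointN a)) <= 2.
  rewrite -(dNE hPhi hdN); have -> : dN (base q) (pointN a) = dN (pointN a) (base q).
    by case: hdN => -[_ _ sy _] _ _; exact: sy.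
  by rewrite (dNE hPhi hdN); apply: le_trans h _; rewrite -[leRHS]mulr1 ler_wpM2l.
have [h1 h2] := Hc _ 2 ltac:(by []) h'.
apply: cn_smallN; rewrite /s.
  exact: le_trans h1 (aux c c0).1.
exact: le_trans h2 (aux c c0).2.
Qed.

Variable mu : {measure set (Borel EC) -> \bar R}.
Hypothesis sf : sigma_finite setT mu.
Local Open Scope ereal_scope.

(** Integrate the pointwise inequality over the heavy ball with respect to mu and
    over a with respect to Lebesgue measure. The averages Vp integrate to I times
    the full L^p integral, and by Tonelli the term with |f(q)|^p costs the volume
    of the set of a near q. *)
Lemma sampling_integrated (A C1 r0 I : R) : (0 <= A)%R -> sampling_radius A C1 r0 -> (0 < I)%R ->
  \int[lebN R n m]_t (W0 (pointN t))%:E = I%:E ->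
  forall (r r' eps : R), (0 < r)%R -> (r <= r0)%R -> (0 < eps)%R ->
  (forall a, (r' <= nrm dN a)%R -> eps%:E <= ball_mass Phi dN mu (2 * r) (bpt Phi a)) ->
  exists2 C3 : R, (0 < C3)%R & forall f, expclass Phi A f ->
  \int[lebN R n m]_a (((r' <= nrm dN (pointN a))%R)%:R * pw Phi p f (pointN a))%:E <=
  (C1 * I * r `^ p)%:E * \int[lebN R n m]_a (pw Phi p f (pointN a))%:E +
  C3%:E * \int[mu]_q (normc (f q) `^ p)%:E.
Proof.
move=> A0 [C10 r00 r01 H1] I0 HI; have [v v0 Hv] := near_volume_le.
move=> r r' eps rp rr0 eps0 He; have r1 := le_trans rr0 r01.
pose c2 : R := (2 `^ p / eps)%R; have c20 : (0 < c2)%R by rewrite divr_gt0// powR_gt0.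
exists (c2 * v)%R => [|f cf]; first by rewrite mulr_gt0.
pose far (a : N) := (r' <= nrm dN a)%R.
pose near (a : N) (q : EC) := (dEFC Phi dN (bpt Phi a) q <= 2 * r)%R.
pose fp (q : Borel EC) : \bar R := (normc (f q) `^ p)%:E.
have fp0 q : 0 <= fp q by rewrite lee_fin powR_ge0.
have mfp : measurable_fun setT fp.
  by apply/measurable_EFinP; exact: (measurable_normc_pow hPhi p A0 cf (@emeas_Borel R n m)).
pose G (x : Borel EC * TN) : \bar R := ((near (pointN x.2) x.1)%:R)%:E * fp x.1.
have G0 x : 0 <= G x by apply: mule_ge0; [rewrite lee_fin|exact: fp0].
have mp2 : nmeas (fun x : Borel EC * TN => pointN x.2 : N) by apply: nmeas_pointN; exact: measurable_snd.
have mG : measurable_fun setT G.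
  apply: emeasurable_funM; last by apply: (measurableT_comp mfp); exact: measurable_fst.
  apply/measurable_EFinP; apply: measurable_ind_le.
  exact: (measurable_dEFC hPhi hdN (emeas_bpt hPhi mp2) (emeas_fst _)).
pose J a := \int[mu]_q (((near a q)%:R)%:E * fp q).
have J0 a : 0 <= J a by apply: integral_ge0 => q _; apply: mule_ge0; [rewrite lee_fin|exact: fp0].
have cr0 : (0 <= C1 * r `^ p)%R by rewrite mulr_ge0 ?powR_ge0// ltW.
(* either the error term dominates, or |f|^p is bounded below on the heavy ball *)
have pt a : far a -> (pw Phi p f a)%:E <= (C1 * r `^ p)%:E * Vp Phi p f a + c2%:E * J a.
  move=> fa; have V0 := Vp_ge0 Phi p f a.
  have [Vy|Vfin] := eqVneq (Vp Phi p f a) +oo.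
    have Jn : 0 <= c2%:E * J a by apply: mule_ge0; [rewrite lee_fin ltW|exact: J0].
    have cp : (0 < C1 * r `^ p)%R by rewrite mulr_gt0// powR_gt0.
    by rewrite Vy gt0_muley ?lte_fin// addye ?leey// gt_eqF// (lt_le_trans ltNy0).
  have [V VE] : exists V : R, Vp Phi p f a = V%:E.
    by exists (fine (Vp Phi p f a)); rewrite fineK// ge0_fin_numE// ltey.
  rewrite VE -EFinM; set X := (C1 * r `^ p * V)%R.
  have [hX|hX] := leP (pw Phi p f a) X.
    apply: (@le_trans _ _ X%:E); first by rewrite lee_fin.
    by rewrite leeDl// mule_ge0// lee_fin ltW.
  rewrite -leeBlDl// -EFinB; pose Y := (pw Phi p f a - X)%R; rewrite -/Y.
  have Y0 : (0 < Y)%R by rewrite subr_gt0.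
  have mb : measurable [set q : Borel EC | near a q] by exact: (measurable_dEFC_ball hPhi hdN).
  have mi : measurable_fun setT (fun q : Borel EC => ((near a q)%:R)%:E : \bar R).
    apply/measurable_EFinP; apply: measurable_ind_le.
    have mq : emeas (fun _ : Borel EC => bpt Phi a) by split=> j; exact: cmeas_cst.
    exact: (measurable_dEFC hPhi hdN mq (@emeas_Borel R n m)).
  have lb : Y%:E * eps%:E <= (2 `^ p)%:E * J a.
    apply: (@le_trans _ _ (Y%:E * \int[mu]_q ((near a q)%:R)%:E)).
      apply: lee_wpmul2l; first by rewrite lee_fin ltW.
      by rewrite (integral_ind mu mb); exact: He.
    rewrite -ge0_integralZl//; last by rewrite lee_fin ltW.
    rewrite /J -ge0_integralZl//; last 2 first.
    - by apply: emeasurable_funM; [exact: mi|exact: mfp].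
    - by move=> q _; apply: mule_ge0; [rewrite lee_fin|exact: fp0].
    apply: ge0_le_integral.
    - exact: measurableT.
    - by move=> q _; apply: mule_ge0; rewrite lee_fin// ltW.
    - by apply: emeasurable_funM; [exact: measurable_cst|exact: mi].
    - apply: emeasurable_funM; [exact: measurable_cst|].
      by apply: emeasurable_funM; [exact: mi|exact: mfp].
    move=> q _; case: (boolP (near a q)) => [nq|_]; last by rewrite mul0e !mule0.
    have h := H1 f cf r rp rr0 a V VE q nq.
    rewrite mule1 mul1e /fp -EFinM lee_fin /Y lerBlDl /X.
    exact: h.
  rewrite /c2 EFinM muleAC -[Y%:E]mule1.
  rewrite (_ : 1 = eps%:E * (eps^-1)%:E); last by rewrite -EFinM mulfV// gt_eqF.
  by rewrite muleA; apply: lee_wpmul2r; [rewrite lee_fin invr_ge0 ltW|exact: lb].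
have mpT := nmeas_pointN (@measurable_id _ TN setT).
have mV : measurable_fun setT (fun t : TN => Vp Phi p f (pointN t)) := measurable_Vp hPhi p A0 cf mpT.
have mJ : measurable_fun setT (fun t : TN => J (pointN t)).
  exact: (@measurable_fun_fubini_tonelli_G _ _ _ _ R (sfm sf) G mG G0).
have mL : measurable_fun setT (fun t : TN => ((far (pointN t))%:R * pw Phi p f (pointN t))%:E).
  apply/measurable_EFinP; apply: measurable_funM; last exact: (nmeasurable_pw hPhi p A0 cf mpT).
  rewrite (_ : (fun x => _) = fun x => if far (pointN x) then 1%R else 0%R); last first.
    by apply/funext => t; case: ifP.
  by apply: measurable_fun_ifT => //; apply: measurable_fun_ler => //; exact: (nmeasurable_nrm hPhi hdN mpT).
apply: (@le_trans _ _ (\int[lebN R n m]_a ((C1 * r `^ p)%:E * Vp Phi p f (pointN a) + c2%:E * J (pointN a)))).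
  apply: ge0_le_integral.
  - exact: measurableT.
  - by move=> t _; rewrite lee_fin mulr_ge0 ?pw_ge0.
  - exact: mL.
  - by apply: emeasurable_funD; apply: emeasurable_funM => //; exact: measurable_cst.
  move=> t _; rewrite -/(far (pointN t)); case: (boolP (far (pointN t))) => [ft|_]; first by rewrite mul1r; exact: pt.
  rewrite mul0r; apply: adde_ge0; apply: mule_ge0.
  - by rewrite lee_fin.
  - exact: Vp_ge0.
  - by rewrite lee_fin ltW.
  - exact: J0.
have mVc : measurable_fun setT (fun t : TN => (C1 * r `^ p)%:E * Vp Phi p f (pointN t)).
  by apply: emeasurable_funM; [exact: measurable_cst|exact: mV].
have mJc : measurable_fun setT (fun t : TN => c2%:E * J (pointN t)).
  by apply: emeasurable_funM; [exact: measurable_cst|exact: mJ].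
rewrite (ge0_integralD _ measurableT _ mVc _ mJc); last 2 first.
- by move=> t _; apply: mule_ge0; [rewrite lee_fin|exact: Vp_ge0].
- by move=> t _; apply: mule_ge0; [rewrite lee_fin ltW|exact: J0].
apply: leeD.
  rewrite (ge0_integralZl _ measurableT mV); last 2 first.
  - by move=> t _; exact: Vp_ge0.
  - by rewrite lee_fin.
  by rewrite (integral_Vp hPhi p A0 cf) HI muleA -EFinM mulrAC.
rewrite (ge0_integralZl _ measurableT mJ); last 2 first.
- by move=> t _; exact: J0.
- by rewrite lee_fin ltW.
rewrite [(c2 * v)%:E]EFinM -(muleA c2%:E); apply: lee_wpmul2l; first by rewrite lee_fin ltW.
have swap : \int[mu]_q \int[lebN R n m]_t G (q, t) = \int[lebN R n m]_t J (pointN t).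
  exact: (@tonelli_lebN R n m _ _ (sfm sf) G mG G0).
rewrite -swap -(ge0_integralZl mu measurableT mfp); last 2 first.
- by move=> q _; exact: fp0.
- by rewrite lee_fin ltW.
apply: ge0_le_integral.
- exact: measurableT.
- by move=> q _; apply: integral_ge0 => t _; exact: G0.
- exact: (@measurable_fun_fubini_tonelli_F _ _ _ _ R lebNs G mG G0).
- by apply: emeasurable_funM; [exact: measurable_cst|exact: mfp].
move=> q _; rewrite /G/=.
have mn : measurable_fun setT (fun t : TN => ((near (pointN t) q)%:R)%:E : \bar R).
  have mq : emeas (fun _ : TN => q) by split=> j; exact: cmeas_cst.
  apply/measurable_EFinP; apply: measurable_ind_le.
  exact: (measurable_dEFC hPhi hdN (emeas_bpt hPhi mpT) mq).
rewrite (ge0_integralZr _ measurableT mn); last 2 first.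
- by move=> t _; rewrite lee_fin.
- exact: fp0.
by apply: lee_wpmul2r; [exact: fp0|exact: Hv].
Qed.

End sampling_inequality.

(** * Removing sets from the integral *)

Section removal_of_balls.
Context {R : realType} {n m : nat}.
Local Notation C := R[i].
Local Notation EC := (EFC R n m).
Local Notation N := (Ngroup R n m).
Local Notation TN := (Rtuple R n * Rtuple R n * Rtuple R m)%type.
Variable Phi : Espace R n -> Espace R n -> FCspace R m.
Hypothesis hPhi : hermitian_map Phi.
Variables (ls : 'I_m.+1 -> Fspace R m) (D : R) (e : Fspace R m).
Hypothesis hf : frame Phi ls D e.
Variable p : R.
Hypothesis p0 : 0 < p.
Implicit Types (f : EC -> C) (a b : N).

Lemma W0_le1 (b : N) : W0 b <= 1.
Proof.
have phi1 (x : R) : 0 <= phi x <= 1.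
  by rewrite ltW ?phi_gt0//= /phi invf_le1 ?lerDl ?sqr_ge0// ltr_pwDl// sqr_ge0.
have P (I : finType) (u : I -> R) : 0 <= \prod_i phi (u i) <= 1.
  apply/andP; split; first by apply: prodr_ge0 => i _; case/andP: (phi1 (u i)).
  by apply: prodr_ile1 => i _; exact: phi1.
have /andP[a1 a2] := P _ (fun j => Re (b.1 ord0 j)).
have /andP[b1 b2] := P _ (fun j => Im (b.1 ord0 j)).
have /andP[c1 c2] := P _ (fun j => b.2 ord0 j).
by rewrite /W0 /gN; apply: mulr_ile1 => //; [exact: mulr_ge0|exact: mulr_ile1].
Qed.

Lemma uc_add (l : Fspace R m) (v w : EC) : uc l (v + w) = uc l v + uc l w.
Proof. by have := uc_line l v w 1; rewrite scale1r mul1r. Qed.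

(** If u0 is small at a, then the E-component of a is bounded, so translation by a
    changes u0(b) by a constant and a term linear in the E-component of b, which is
    of the order of the square root of u0(b). *)
Lemma far_product (rho1 : R) : 0 < rho1 -> exists2 T : R, 0 < T & forall a b,
  ~~ farN Phi ls rho1 a -> farN Phi ls T b -> farN Phi ls rho1 (mulN Phi a b).
Proof.
move=> r0; have [D0 _ HD _ _] := hf; have [B B0 HB] := Phi_bound hPhi.
(* with this weight the arithmetic-geometric mean inequality costs at most half of u0(b) *)
have l0 := lam_ge0 ls; pose s := 4 * lam ls * B * D + 1.
have s0 : 0 < s by rewrite ltr_wpDl// !mulr_ge0// ltW.
pose T := 2 * (2 * rho1 + 2 * lam ls * B * s * D * rho1).
have T0 : 0 < T.
  by rewrite /T mulr_gt0// ltr_pwDl ?mulr_gt0// !mulr_ge0// ltW.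
exists T => // a b; rewrite /farN -leNgt => ua ub.
set U := normc (u0 ls (bpt Phi b)) in ub.
have h1 : u0 ls (bpt Phi (mulN Phi a b)) = u0 ls (bpt Phi b) + (u0 ls (bpt Phi a) + u0 ls ((0, (0 +i* 2) *: Phi b.1 a.1) : EC)).
  have e1 : tau_lin Phi a (bpt Phi b) = bpt Phi b + (0, (0 +i* 2) *: Phi b.1 a.1).
    by rewrite /tau_lin/=; congr pair; rewrite /= addr0.
  by rewrite -(tau_bpt hPhi) (tau_affine hPhi) /u0 uc_add e1 uc_add addrCA.
have h2 : normc (u0 ls ((0, (0 +i* 2) *: Phi b.1 a.1) : EC)) <= 4 * lam ls * B * (cn a.1 * cn b.1).
  apply: le_trans (normc_uc _ _) _; rewrite /esize/= cn0 add0r.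
  apply: le_trans (ler_wpM2r (cn_ge0 _) (lam_ge ls ord0)) _.
  apply: le_trans (ler_wpM2l l0 (cnZ _ _)) _; rewrite normc_2i.
  have := ler_wpM2l l0 (HB b.1 a.1); move: (cn (Phi _ _)) (cn a.1) (cn b.1) => x y z; lra.
have h3 : 4 * lam ls * B * (cn a.1 * cn b.1) <= 2 * lam ls * B * (s * cn a.1 ^+ 2 + cn b.1 ^+ 2 / s).
  rewrite (_ : 4 * lam ls * B * _ = 2 * lam ls * B * (2 * (cn a.1 * cn b.1))); last by ring.
  apply: ler_wpM2l; first by rewrite !mulr_ge0.
  have : 0 <= (s * cn a.1 - cn b.1) ^+ 2 / s by rewrite divr_ge0 ?sqr_ge0// ltW.
  rewrite (_ : _ / s = s * cn a.1 ^+ 2 + cn b.1 ^+ 2 / s - 2 * (cn a.1 * cn b.1)); first by rewrite subr_ge0.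
  by move: (cn a.1) (cn b.1) s s0 {T T0 ub} => x y z z0; field; rewrite gt_eqF.
have h4 : s * cn a.1 ^+ 2 <= s * (D * rho1).
  by rewrite ler_pM2l//; apply: le_trans (HD a) _; rewrite ler_pM2l.
have h5 : 2 * lam ls * B * (cn b.1 ^+ 2 / s) <= U / 2.
  apply: (@le_trans _ _ (2 * lam ls * B * (D * U / s))).
    apply: ler_wpM2l; first by rewrite !mulr_ge0.
    by apply: ler_wpM2r; [rewrite invr_ge0 ltW|exact: HD].
  rewrite (_ : _ * _ = (4 * lam ls * B * D / s) * (U / 2)); last first.
    by move: (lam ls) s s0 {T T0 ub l0 h1 h2 h3 h4} => x z z0; field; rewrite gt_eqF.
  rewrite ler_piMl//; first by rewrite divr_ge0// normc_ge0.
  by rewrite ler_pdivrMr// mul1r /s lerDl.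
have h6 := ler_normcB (u0 ls (bpt Phi b)) (- (u0 ls (bpt Phi a) + u0 ls ((0, (0 +i* 2) *: Phi b.1 a.1) : EC))).
rewrite opprK normcN -h1 -/U in h6.
have h7 := le_normcD (u0 ls (bpt Phi a)) (u0 ls ((0, (0 +i* 2) *: Phi b.1 a.1) : EC)).
have h8 : 2 * lam ls * B * (s * cn a.1 ^+ 2) <= 2 * lam ls * B * (s * (D * rho1)).
  by apply: ler_wpM2l => //; rewrite !mulr_ge0.
rewrite (mulrDr (2 * lam ls * B)) in h3.
have ub' : 2 * rho1 + 2 * lam ls * B * (s * (D * rho1)) < U / 2.
  rewrite ltr_pdivlMr// mulrC; move: ub; rewrite /T.
  by rewrite (_ : 2 * lam ls * B * (s * (D * rho1)) = 2 * lam ls * B * s * D * rho1)//; ring.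
have hX := le_trans h2 (le_trans h3 (lerD h8 h5)).
apply: lt_le_trans h6.
rewrite ltrBrDl; apply: le_lt_trans (_ : (rho1 + (2 * lam ls * B * (s * (D * rho1)) + U / 2)) + rho1 < U).
  by rewrite lerD2r; apply: le_trans h7 _; apply: lerD.
by move: ub'; move: (2 * lam ls * B * _) => y; lra.
Qed.

Local Open Scope ereal_scope.

Lemma far_pw_ge0 (T : R) f b : (0 <= (farN Phi ls T b)%:R * pw Phi p f b)%R.
Proof. by rewrite mulr_ge0 ?pw_ge0. Qed.

(** Where u0 is small, evaluate by the weighted estimate over the points b with
    u0(b) large; u0(a b) is then large too, and averaging over a gives back the
    integral over the points where u0 is large. *)
Lemma tail_estimate (A rho1 : R) : (0 <= A)%R -> (0 < rho1)%R -> exists2 K : R, (0 < K)%R &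
  forall f, expclass Phi A f ->
  \int[lebN R n m]_a (pw Phi p f (pointN a))%:E <=
  K%:E * \int[lebN R n m]_a ((farN Phi ls rho1 (pointN a))%:R * pw Phi p f (pointN a))%:E.
Proof.
move=> A0 r0; have [T T0 HT] := far_product r0.
have [K2 K20 HK2] := tau_estimate hPhi hf p0 A0 T0 (lexx 0%R).
have [I I0 HI] := @integral_W0 R n m.
exists (1 + K2 * I)%R => [|f cf]; first by rewrite addr_gt0// mulr_gt0.
pose g b := ((farN Phi ls rho1 b)%:R * pw Phi p f b)%R.
have g0 b : (0 <= g b)%R := far_pw_ge0 rho1 f b.
have mg : nmeasurable g.
  by apply: nmeasurableM; [exact: nmeasurable_far|exact: (nmeasurable_pw hPhi p A0 cf)].
pose V a := \int[lebN R n m]_t (g (mulN Phi a (pointN t)) * W0 (pointN t))%:E.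
have gW0 a (t : TN) : 0 <= (g (mulN Phi a (pointN t)) * W0 (pointN t))%:E.
  by rewrite lee_fin mulr_ge0// W0_ge0.
have V0 a : 0 <= V a by apply: integral_ge0 => t _; exact: gW0.
have mp := nmeas_pointN (@measurable_id _ TN setT).
have pt a : (pw Phi p f a)%:E <= (g a)%:E + K2%:E * V a.
  rewrite /g; case: (boolP (farN Phi ls rho1 a)) => fa.
    by rewrite mul1r leeDl// mule_ge0// lee_fin ltW.
  rewrite mul0r add0e; have := HK2 f cf a (0%R : EC) ltac:(by rewrite /esize !cn0 addr0).
  rewrite (tau_0 hPhi) => h; apply: le_trans h _; apply: lee_wpmul2l.
    by rewrite lee_fin ltW.
  have mb : nmeas (fun t : TN => mulN Phi a (pointN t)).
    by apply: nmeas_mulN => //; exact: nmeas_cst.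
  apply: ge0_le_integral.
  - exact: measurableT.
  - move=> t _; rewrite lee_fin; apply: mulr_ge0; last exact: W0_ge0.
    by apply: mulr_ge0; rewrite ?pw_ge0.
  - apply/measurable_EFinP; apply: measurable_funM; last exact: measurable_W0.
    apply: measurable_funM; first exact: (nmeasurable_far hPhi ls T mp).
    exact: (nmeasurable_pw hPhi p A0 cf mb).
  - by apply/measurable_EFinP; apply: measurable_funM; [exact: mg|exact: measurable_W0].
  move=> t _; rewrite lee_fin; apply: ler_wpM2r; first exact: W0_ge0.
  rewrite /g; case: (boolP (farN Phi ls T _)) => ft; last by rewrite mul0r far_pw_ge0.
  by rewrite HT.
have mV : measurable_fun setT (fun t : TN => V (pointN t)).
  have mh : measurable_fun setT (fun x : TN * TN => (g (mulN Phi (pointN x.1) (pointN x.2)) * W0 (pointN x.2))%:E).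
    apply/measurable_EFinP; apply: measurable_funM.
      by apply: mg; apply: nmeas_mulN => //; apply: nmeas_pointN; [exact: measurable_fst|exact: measurable_snd].
    by apply: measurable_W0; apply: nmeas_pointN; exact: measurable_snd.
  exact: (@measurable_fun_fubini_tonelli_F _ _ _ _ R lebNs _ mh (fun x => gW0 (pointN x.1) x.2)).
have mgp : measurable_fun setT (fun t : TN => (g (pointN t))%:E).
  by apply/measurable_EFinP; exact: mg.
have mVc : measurable_fun setT (fun t : TN => K2%:E * V (pointN t)).
  by apply: emeasurable_funM; [exact: measurable_cst|exact: mV].
apply: (@le_trans _ _ (\int[lebN R n m]_a ((g (pointN a))%:E + K2%:E * V (pointN a)))).
  apply: ge0_le_integral.
  - exact: measurableT.
  - by move=> t _; rewrite lee_fin pw_ge0.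
  - by apply/measurable_EFinP; exact: (nmeasurable_pw hPhi p A0 cf mp).
  - exact: emeasurable_funD.
  - by move=> t _; exact: pt.
rewrite (ge0_integralD _ measurableT _ mgp _ mVc); last 2 first.
- by move=> t _; rewrite lee_fin.
- by move=> t _; apply: mule_ge0; [rewrite lee_fin ltW|exact: V0].
rewrite (ge0_integralZl _ measurableT mV); last 2 first.
- by move=> t _; exact: V0.
- by rewrite lee_fin ltW.
rewrite (integral_average hPhi mg g0) HI muleA -EFinM.
have J0 : 0 <= \int[lebN R n m]_t (g (pointN t))%:E by apply: integral_ge0 => t _; rewrite lee_fin.
by rewrite [(1 + _)%:E]EFinD ge0_muleDl ?lee_fin ?mulr_ge0 ?mul1e// ltW.
Qed.

End removal_of_balls.

Section lower_bound.
Context {R : realType} {n m : nat}.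
Local Notation C := R[i].
Local Notation EC := (EFC R n m).
Local Notation N := (Ngroup R n m).
Local Notation TN := (Rtuple R n * Rtuple R n * Rtuple R m)%type.
Variable Phi : Espace R n -> Espace R n -> FCspace R m.
Hypothesis hPhi : hermitian_map Phi.
Variable dN : N -> N -> R.
Hypothesis hdN : homogeneous_distance Phi dN.
Variables (ls : 'I_m.+1 -> Fspace R m) (D : R) (e : Fspace R m).
Hypothesis hf : frame Phi ls D e.
Variable p : R.
Hypothesis p0 : 0 < p.
Implicit Types (f : EC -> C) (a b : N).

Lemma exists_power (x : R) : exists k : nat, x <= (2 ^+ k) `^ p.
Proof.
pose j := (Num.truncn x).+1; pose k := (Num.truncn (j%:R / p)).+1; exists k.
have kj : j%:R <= k%:R * p by rewrite -ler_pdivrMr//; apply: ltW; rewrite /k; exact: truncnS_gt.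
have xj : x <= j%:R by apply: ltW; rewrite /j; exact: truncnS_gt.
apply: le_trans xj _; apply: (@le_trans _ _ (2 ^+ j)).
  by rewrite -natrX ler_nat ltnW// ltn_expl.
by rewrite -!powR_mulrn// -powRrM ler_powR// ler1n.
Qed.

(** x/(2(x+1)) is increasing and is at least x/4 for x <= 1. *)
Lemma gL_far (x x1 : R) : 0 < x1 -> x1 <= 1 -> x1 < x -> x1 / 4 <= x / (2 * (x + 1)).
Proof.
move=> x10 x11 xx; have x0 : 0 < x by exact: lt_trans xx.
rewrite ler_pdivlMr ?mulr_gt0 ?addr_gt0//.
have h : x1 * x <= x by rewrite ler_piMl// ltW.
by rewrite mulrAC ler_pdivrMr// mulrCA mulrDr mulr1; lra.
Qed.

Lemma bounded_ball (r' : R) : 0 < r' -> exists s : R, [/\ 0 < s,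
  forall a, nrm dN a < r' -> smallN s a & forall a, nrm dN a < r' -> esize (bpt Phi a) <= s].
Proof.
move=> r0; have [c c0 Hc] := nrm_ge hPhi hdN; have [B B0 HB] := Phi_bound hPhi.
pose s1 := c * r'; pose s2 := c * (r' + r' ^+ 2).
have s10 : 0 < s1 by rewrite mulr_gt0.
have s20 : 0 < s2 by rewrite mulr_gt0// addr_gt0// exprn_gt0.
pose s := s1 + (s2 + B * s1 * s1).
have b0 : 0 <= B * s1 * s1 by rewrite !mulr_ge0// ltW.
have ss1 : s1 <= s by rewrite lerDl addr_ge0// ltW.
have ss2 : s2 <= s by rewrite /s addrCA lerDl addr_ge0// ltW.
exists s; split.
- exact: lt_le_trans ss1.
- move=> a /ltW ar; have [h1 h2] := Hc _ _ (ltW r0) ar.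
  by apply: cn_smallN; [exact: le_trans ss1|exact: le_trans ss2].
- move=> a /ltW ar; have [h1 h2] := Hc _ _ (ltW r0) ar.
  rewrite /esize/= cn_complexV; apply: lerD => //; apply: lerD => //.
  apply: le_trans (quad_bound HB _) _; have h0 := cn_ge0 a.1.
  apply: ler_pM => //; first exact: mulr_ge0.
  by rewrite ler_wpM2l.
Qed.

Local Open Scope ereal_scope.

Definition outer (r' : R) a : R := ((r' <= nrm dN a)%R%:R)%R.

Lemma nmeasurable_outer r' : nmeasurable (outer r').
Proof.
move=> d T b mb; rewrite /outer (_ : (fun x => _) = fun x => if (r' <= nrm dN (b x))%R then 1%R else 0%R); last first.
  by apply/funext => t; case: ifP.
by apply: measurable_fun_ifT => //; apply: measurable_fun_ler => //; exact: (nmeasurable_nrm hPhi hdN mb).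
Qed.

(** On the ball |gL| is at most w, and where |u0| > rho1 it is at least 2 w, so the
    k-th power gains a factor 2^k. As the values of F on the ball are bounded by its
    integral over |u0| > rho1, a large k makes the ball negligible; the division by
    gL there costs only a constant. *)
Lemma zero_removal (A r' : R) : (0 <= A)%R -> (0 < r')%R -> exists (L rho1 c : R) (k : nat),
  [/\ (0 < L)%R, (0 < rho1)%R, (0 < c)%R, (k%:R * (L^-1 * lam ls) <= 1)%R &
  forall F, expclass Phi A F -> let G := fun q => (F q * gL ls L q ^+ k)%R in
  \int[lebN R n m]_a ((1 - outer r' (pointN a)) * pw Phi p G (pointN a))%:E <=
    \int[lebN R n m]_a (outer r' (pointN a) * pw Phi p G (pointN a))%:E /\
  \int[lebN R n m]_a ((farN Phi ls rho1 (pointN a))%:R * pw Phi p F (pointN a))%:E <=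
    c%:E * \int[lebN R n m]_a (outer r' (pointN a) * pw Phi p G (pointN a))%:E].
Proof.
move=> A0 r0; have [s [s0 Hs1 Hs2]] := bounded_ball r0; have l0 := lam_ge0 ls.
pose rho0 := (lam ls * s + 1)%R; have rho00 : (0 < rho0)%R by rewrite ltr_wpDl// mulr_ge0// ltW.
have Hu a : (nrm dN a < r')%R -> (normc (u0 ls (bpt Phi a)) <= rho0)%R.
  move=> ar; apply: le_trans (normc_uc _ _) _; apply: (@le_trans _ _ (lam ls * s)%R); last by rewrite lerDl.
  apply: ler_pM; [by rewrite mulr_ge0|exact: esize_ge0|exact: lam_ge|exact: Hs2].
pose rho1 := (16 * rho0)%R; have rho10 : (0 < rho1)%R by rewrite mulr_gt0.
have rho01 : (rho0 <= rho1)%R by rewrite /rho1 ler_peMl ?ler1n// ltW.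
pose vB := ((2 * s) ^+ n * (2 * s) ^+ n * (2 * s) ^+ m)%R.
have [C' C'0 HC'] := weighted_estimate hPhi hf p0 A0 rho10 (ltW s0).
(* the gain 2^(k p) compensates the volume of the ball and the constant of evaluation *)
have [k Hk] := exists_power (vB * C').
(* L is large enough for the type of gL^k to be at most 1 *)
pose L := Num.max rho1 (k%:R * lam ls + 1)%R.
have L0 : (0 < L)%R by rewrite lt_max rho10.
have L1 : (rho1 <= L)%R by rewrite le_max lexx.
have Lk : (k%:R * (L^-1 * lam ls) <= 1)%R.
  rewrite mulrCA mulrC ler_pdivrMr// mul1r; apply: (@le_trans _ _ (k%:R * lam ls + 1)%R).
    by rewrite lerDl.
  by rewrite le_max lexx orbT.
(* |gL| <= w on the ball, whereas |gL| >= 2 w where |u0| > rho1 *)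
pose w := (2 * rho0 / L)%R; have w0 : (0 < w)%R by rewrite divr_gt0// mulr_gt0.
have w20 : (0 < 2 * w)%R by rewrite mulr_gt0.
pose c := (((2 * w) ^+ k) `^ p)%R; have c0 : (0 < c)%R by rewrite powR_gt0// exprn_gt0.
have gin a : (nrm dN a < r')%R -> (normc (gL ls L (bpt Phi a)) <= w)%R.
  move=> ar; have [_ h _] := gL_bpt hf a L0; apply: le_trans h _.
  by rewrite /w -mulrA ler_pM2l// ler_pM2r ?invr_gt0// Hu.
have gfar a : farN Phi ls rho1 a -> (2 * w <= normc (gL ls L (bpt Phi a)))%R.
  move=> fa; have [_ _ h] := gL_bpt hf a L0; apply: le_trans h.
  have e1 : (2 * w = (rho1 / L) / 4)%R.
    by rewrite /w /rho1; move: (L) (L0) => l lp; field; rewrite gt_eqF.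
  rewrite e1; apply: gL_far; first by rewrite divr_gt0.
    by rewrite ler_pdivrMr// mul1r.
  by rewrite ltr_pM2r ?invr_gt0.
have far_out a : farN Phi ls rho1 a -> outer r' a = 1%R.
  move=> fa; rewrite /outer; case: (leP r' (nrm dN a)) => // ar.
  by have := lt_le_trans fa (le_trans (Hu a ar) rho01); rewrite ltxx.
have mp := nmeas_pointN (@measurable_id _ TN setT).
exists L, rho1, c^-1%R, k; split => //; first by rewrite invr_gt0.
move=> F cF G.
have GE a : pw Phi p G a = (pw Phi p F a * ((normc (gL ls L (bpt Phi a)) ^+ k) `^ p))%R.
  by rewrite /pw /G normcM normcX powRM ?normc_ge0// exprn_ge0// normc_ge0.
have Lp0 : (0 <= L^-1 * lam ls)%R by rewrite mulr_ge0// invr_ge0 ltW.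
have cG : expclass Phi (A + k%:R * (L^-1 * lam ls)) G.
  have cg := expclass_gL hf L0; have k0 : (0 <= k%:R * (L^-1 * lam ls))%R by exact: mulr_ge0.
  exact: (expclassM A0 k0 cF (expclassX k Lp0 cg)).
have AG : (0 <= A + k%:R * (L^-1 * lam ls))%R by rewrite addr_ge0// mulr_ge0.
have mpG := nmeasurable_pw hPhi p AG cG mp.
have mpF := nmeasurable_pw hPhi p A0 cF mp.
have mo := nmeasurable_outer r' mp.
have mfar := nmeasurable_far hPhi ls rho1 mp.
have o0 a : (0 <= outer r' a)%R by rewrite /outer.
have o1 a : (0 <= 1 - outer r' a)%R by rewrite /outer; case: (r' <= _)%R; rewrite ?subrr ?subr0.
set Out := \int[lebN R n m]_a (outer r' (pointN a) * pw Phi p G (pointN a))%:E.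
set Far := \int[lebN R n m]_a ((farN Phi ls rho1 (pointN a))%:R * pw Phi p F (pointN a))%:E.
have Far0 : 0 <= Far by apply: integral_ge0 => a _; rewrite lee_fin far_pw_ge0.
have FarOut : c%:E * Far <= Out.
  rewrite /Far -ge0_integralZl; last 4 first.
  - exact: measurableT.
  - by apply/measurable_EFinP; apply: measurable_funM.
  - by move=> a _; rewrite lee_fin far_pw_ge0.
  - by rewrite lee_fin ltW.
  apply: ge0_le_integral.
  - exact: measurableT.
  - by move=> a _; apply: mule_ge0; rewrite lee_fin ?far_pw_ge0// ltW.
  - by apply: emeasurable_funM; [exact: measurable_cst|apply/measurable_EFinP; exact: measurable_funM].
  - by apply/measurable_EFinP; exact: measurable_funM.
  move=> a _; rewrite -EFinM lee_fin; case: (boolP (farN Phi ls rho1 (pointN a))) => [fa|_]; last first.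
    by rewrite mul0r mulr0 mulr_ge0 ?pw_ge0.
  rewrite mul1r far_out// mul1r GE mulrC ler_wpM2l ?pw_ge0// /c; apply: powR_mono => //.
    by rewrite exprn_ge0// ltW.
  by rewrite lerXn2r ?nnegrE ?normc_ge0 ?(ltW w20)// gfar.
split; last first.
  have -> : Far = (c^-1)%:E * (c%:E * Far) by rewrite muleA -EFinM mulVf ?gt_eqF// mul1e.
  by apply: lee_wpmul2l => //; rewrite lee_fin invr_ge0 ltW.
have inside a : (nrm dN a < r')%R -> (pw Phi p G a)%:E <= ((w ^+ k) `^ p * C')%:E * Far.
  move=> ar; apply: (@le_trans _ _ (((w ^+ k) `^ p)%:E * (pw Phi p F a)%:E)).
    rewrite -EFinM lee_fin GE mulrC; apply: ler_wpM2r; first exact: pw_ge0.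
    apply: powR_mono => //; first by rewrite exprn_ge0// normc_ge0.
    by rewrite lerXn2r ?nnegrE ?normc_ge0 ?(ltW w0)// gin.
  rewrite EFinM -muleA; apply: lee_wpmul2l; first by rewrite lee_fin powR_ge0.
  apply: le_trans (HC' F cF _ (Hs2 a ar)) _; apply: lee_wpmul2l; first by rewrite lee_fin ltW.
  apply: ge0_le_integral.
  - exact: measurableT.
  - by move=> t _; rewrite lee_fin; exact: Wint_ge0.
  - apply/measurable_EFinP; apply: measurable_funM; last exact: measurable_W0.
    exact: measurable_funM.
  - by apply/measurable_EFinP; exact: measurable_funM.
  by move=> t _; rewrite lee_fin ler_piMr ?W0_le1 ?far_pw_ge0.
have wC : (0 <= (w ^+ k) `^ p * C')%R by rewrite mulr_ge0 ?powR_ge0// ltW.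
have ms : measurable_fun setT (fun a : TN => (smallN s (pointN a))%:R : R).
  exact: measurable_smallN mp.
apply: le_trans FarOut.
apply: (@le_trans _ _ (\int[lebN R n m]_a (((smallN s (pointN a))%:R)%:E * (((w ^+ k) `^ p * C')%:E * Far)))).
  apply: ge0_le_integral.
  - exact: measurableT.
  - by move=> a _; rewrite lee_fin mulr_ge0 ?pw_ge0.
  - apply/measurable_EFinP; apply: measurable_funM => //.
    by apply: measurable_funB => //; exact: measurable_cst.
  - apply: emeasurable_funM; last exact: measurable_cst.
    exact/measurable_EFinP.
  move=> a _; rewrite {1}/outer; case: (leP r' _) => ar.
    by rewrite subrr mul0r; apply: mule_ge0; [rewrite lee_fin|apply: mule_ge0; rewrite ?lee_fin].
  by rewrite subr0 mul1r Hs1// mul1e; exact: inside.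
have e1 := integral_smallN (ltW s0) : \int[lebN R n m]_t _ = _.
rewrite ge0_integralZr; last 4 first.
- exact: measurableT.
- exact/measurable_EFinP.
- by move=> a _; rewrite lee_fin.
- by apply: mule_ge0; rewrite ?lee_fin.
rewrite e1 muleA -EFinM; apply: lee_wpmul2r => //; rewrite lee_fin -/vB /c (exprMn_comm _ (mulrC 2%R w)) (powRM _ (exprn_ge0 _ _) (exprn_ge0 _ (ltW w0)))//.
by rewrite mulrCA mulrC; apply: ler_wpM2r; [exact: powR_ge0|exact: Hk].
Qed.

End lower_bound.

(** * The lower sampling inequality *)

Section lower_inequality.
Context {R : realType} {n m : nat}.
Local Notation C := R[i].
Local Notation EC := (EFC R n m).
Local Notation N := (Ngroup R n m).
Local Notation TN := (Rtuple R n * Rtuple R n * Rtuple R m)%type.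
Variable Phi : Espace R n -> Espace R n -> FCspace R m.
Hypothesis hPhi : hermitian_map Phi.
Variable dN : N -> N -> R.
Hypothesis hdN : homogeneous_distance Phi dN.
Variables (ls : 'I_m.+1 -> Fspace R m) (D : R) (e : Fspace R m).
Hypothesis hf : frame Phi ls D e.
Variable p : R.
Hypothesis p0 : 0 < p.
Implicit Types (f : EC -> C) (a b : N).
Local Open Scope ereal_scope.

Lemma small_radius (c r0 : R) : (0 < c)%R -> (0 < r0)%R ->
  exists r : R, [/\ (0 < r)%R, (r <= r0)%R & (c * r `^ p <= 4^-1)%R].
Proof.
move=> c0 r00; have c4 : (0 < (4 * c)^-1)%R by rewrite invr_gt0 mulr_gt0.
exists (Num.min r0 ((4 * c)^-1 `^ p^-1)%R); split.
- by rewrite lt_min r00 powR_gt0.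
- by rewrite ge_min lexx.
apply: (@le_trans _ _ (c * (4 * c)^-1)%R); last first.
  by rewrite invfM mulrCA mulfV ?gt_eqF// mulr1.
apply: ler_wpM2l; first exact: ltW.
apply: (@le_trans _ _ (((4 * c)^-1 `^ p^-1) `^ p)%R).
  apply: powR_mono => //; last by rewrite ge_min lexx orbT.
  by rewrite le_min (ltW r00) powR_ge0.
by rewrite -powRrM mulVf ?gt_eqF// powRr1// ltW.
Qed.

(** If In <= Out and k <= 1/4, the term k (In + Out) is at most Out/2 and can be
    subtracted from both sides, provided that the integrals are finite. *)
Lemma absorb (In Out X : \bar R) (k : R) : (k <= 4^-1)%R -> 0 <= In -> 0 <= Out -> 0 <= X ->
  In + Out < +oo -> In <= Out -> Out <= k%:E * (In + Out) + X -> Out <= 2%:E * X.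
Proof.
move=> k4; case: In => [i| |]//; case: Out => [z| |]//; case: X => [x| |]//; last first.
  by move=> *; rewrite gt0_muley ?leey// lte_fin.
rewrite -!EFinD -!EFinM !lee_fin => i0 z0 x0 _ iz h.
have : (k * (i + z) <= 4^-1 * (i + z))%R by apply: ler_wpM2r => //; exact: addr_ge0.
by lra.
Qed.

Lemma exhaustion (g : N -> R) (X : \bar R) : (forall a, 0 <= g a)%R -> nmeasurable g ->
  (forall s : R, \int[lebN R n m]_a ((esize (bpt Phi (pointN a)) <= s)%R%:R * g (pointN a))%:E <= X) ->
  \int[lebN R n m]_a (g (pointN a))%:E <= X.
Proof.
move=> g0 mg HX; have mp := nmeas_pointN (@measurable_id _ TN setT).
pose G (k : nat) (a : TN) := ((esize (bpt Phi (pointN a)) <= k%:R)%R%:R * g (pointN a))%:E.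
have G0 k (a : TN) : setT a -> 0 <= G k a by move=> _; rewrite lee_fin mulr_ge0.
have mG k : measurable_fun setT (G k).
  apply/measurable_EFinP; apply: measurable_funM; last exact: mg.
  apply: measurable_ind_le; apply: measurable_econt; last exact: econt_esize.
  exact: emeas_bpt.
have ndG (a : TN) : setT a -> nondecreasing_seq (G^~ a).
  move=> _ j k jk; rewrite lee_fin; apply: ler_wpM2r => //; rewrite ler_nat.
  by case: (leP _ j%:R) => // h; rewrite (le_trans h)// ler_nat.
have e1 : \int[lebN R n m]_a (g (pointN a))%:E = limn (fun k => \int[lebN R n m]_a G k a).
  rewrite -(monotone_convergence _ measurableT mG G0 ndG); apply: eq_integral => a _.
  apply/esym/cvg_lim => //; apply: cvg_near_cst.
  exists (Num.truncn (esize (bpt Phi (pointN a)))).+1 => // k /= hk; rewrite /G.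
  suff -> : (esize (bpt Phi (pointN a)) <= k%:R)%R by rewrite mul1r.
  by apply: ltW; apply: lt_le_trans (truncnS_gt _) _; rewrite ler_nat.
rewrite e1; apply: lime_le; last by apply: nearW => k; exact: HX.
apply: ereal_nondecreasing_is_cvgn => j k jk; apply: ge0_le_integral.
- exact: measurableT.
- by move=> a; exact: G0.
- exact: mG.
- exact: mG.
by move=> a _; exact: ndG.
Qed.

(** A bound that is uniform in d passes to f: on each bounded set chi d is at least
    1/2 for small d, and bounded sets exhaust N. *)
Lemma unregularize (A rho1 : R) f k (X : \bar R) : (0 <= A)%R -> expclass Phi A f ->
  (forall d : R, (0 < d)%R -> (k%:R * (d * lam ls) <= 1)%R ->
   \int[lebN R n m]_a ((farN Phi ls rho1 (pointN a))%:R *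
     pw Phi p (fun q => (f q * chi ls d k q)%R) (pointN a))%:E <= X) ->
  \int[lebN R n m]_a ((farN Phi ls rho1 (pointN a))%:R * pw Phi p f (pointN a))%:E <=
    (2 `^ p)%:E * X.
Proof.
move=> A0 cf HX; have l0 := lam_ge0 ls.
have mp := nmeas_pointN (@measurable_id _ TN setT).
have mg : nmeasurable (fun b => (farN Phi ls rho1 b)%:R * pw Phi p f b)%R.
  by apply: nmeasurableM; [exact: (nmeasurable_far hPhi)|exact: (nmeasurable_pw hPhi p A0 cf)].
apply: (exhaustion (fun a => far_pw_ge0 Phi ls p rho1 f a) mg) => s.
have [t [t0 t4 kt]] := shrink_budget (m.+1 * k) (@ltr01 R) (lexx _).
pose s' := Num.max s 0%R; have s'0 : (0 <= s')%R by rewrite le_max lexx orbT.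
(* small enough for chi d >= 1/2 on the bounded set, and for the type *)
pose d := Num.min (t / (lam ls * s' + 1))%R (k%:R * lam ls + 1)^-1%R.
have w1 : (0 < lam ls * s' + 1)%R by rewrite ltr_wpDl// mulr_ge0.
have w2 : (0 < k%:R * lam ls + 1)%R by rewrite ltr_wpDl// mulr_ge0.
have d0 : (0 < d)%R by rewrite lt_min divr_gt0// invr_gt0.
have d1 : (d <= t / (lam ls * s' + 1))%R by rewrite ge_min lexx.
have d2 : (d <= (k%:R * lam ls + 1)^-1)%R by rewrite ge_min lexx orbT.
have dk : (k%:R * (d * lam ls) <= 1)%R.
  rewrite mulrCA; apply: (@le_trans _ _ ((k%:R * lam ls + 1)^-1 * (k%:R * lam ls + 1))%R).
    apply: ler_pM => //; [exact: ltW|exact: mulr_ge0|by rewrite lerDl].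
  by rewrite mulVf ?gt_eqF.
have ck0 : (0 <= k%:R * (d * lam ls))%R by rewrite !mulr_ge0// ltW.
have cfc := expclassM A0 ck0 cf (expclass_chi hf k (ltW d0)).
have mF : measurable_fun setT (fun a : TN => (((farN Phi ls rho1 (pointN a))%:R *
     pw Phi p (fun q => (f q * chi ls d k q)%R) (pointN a))%:E)).
  apply/measurable_EFinP; apply: measurable_funM; first exact: (nmeasurable_far hPhi).
  exact: (nmeasurable_pw hPhi p (addr_ge0 A0 ck0) cfc).
apply: (@le_trans _ _ ((2 `^ p)%:E * \int[lebN R n m]_a ((farN Phi ls rho1 (pointN a))%:R *
     pw Phi p (fun q => (f q * chi ls d k q)%R) (pointN a))%:E)); last first.
  by apply: lee_wpmul2l; [rewrite lee_fin powR_ge0|exact: HX].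
rewrite -ge0_integralZl; last 4 first.
- exact: measurableT.
- exact: mF.
- by move=> a _; rewrite lee_fin far_pw_ge0.
- by rewrite lee_fin powR_ge0.
apply: ge0_le_integral.
- exact: measurableT.
- by move=> a _; rewrite lee_fin; apply: mulr_ge0 => //; exact: far_pw_ge0.
- apply/measurable_EFinP; apply: measurable_funM; last exact: mg.
  apply: measurable_ind_le; apply: measurable_econt; last exact: econt_esize.
  exact: emeas_bpt.
- by apply: emeasurable_funM; [exact: measurable_cst|exact: mF].
move=> a _; rewrite -EFinM lee_fin; case: (leP (esize _) s) => [hs|_]; last first.
  by rewrite mul0r mulr_ge0 ?powR_ge0 ?far_pw_ge0.
rewrite mul1r mulrCA; apply: ler_wpM2l => //.
have h : (2^-1 <= normc (chi ls d k (bpt Phi (pointN a))))%R.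
  apply: le_trans (chi_lower k (ltW d0) (ltW t0) t4 _); first by move: kt; rewrite mul1r; lra.
  apply: (@le_trans _ _ (t / (lam ls * s' + 1) * (lam ls * s' + 1))%R); last first.
    by rewrite divfK// gt_eqF.
  apply: ler_pM => //; [exact: ltW|by rewrite mulr_ge0 ?esize_ge0|].
  apply: (@le_trans _ _ (lam ls * s')%R); last by rewrite lerDl.
  by apply: ler_wpM2l => //; rewrite le_max hs.
rewrite /pw -powRM ?normc_ge0// ; apply: powR_mono => //; first exact: normc_ge0.
rewrite normcM mulrCA -{1}(mulr1 (normc (f _))); apply: ler_wpM2l; first exact: normc_ge0.
by move: h; lra.
Qed.

End lower_inequality.

Section lower_inequality_strip.
Context {R : realType} {n m : nat}.
Local Notation C := R[i].
Local Notation EC := (EFC R n m).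
Local Notation N := (Ngroup R n m).
Local Notation TN := (Rtuple R n * Rtuple R n * Rtuple R m)%type.
Variable Phi : Espace R n -> Espace R n -> FCspace R m.
Hypothesis hPhi : hermitian_map Phi.
Variable dN : N -> N -> R.
Hypothesis hdN : homogeneous_distance Phi dN.
Variables (ls : 'I_m.+1 -> Fspace R m) (D : R) (e : Fspace R m).
Hypothesis hf : frame Phi ls D e.
Variable p : R.
Hypothesis p0 : 0 < p.
Implicit Types (f : EC -> C) (a b : N).
Local Open Scope ereal_scope.

(** mu lives on the strip |rho| <= H, where multipliers of bounded type are bounded. *)
Lemma strip_transfer (mu : {measure set (Borel EC) -> \bar R}) (A B H c : R) f g :
  (0 <= A)%R -> (0 <= B)%R -> (0 <= c)%R ->
  expclass Phi A f -> expclass Phi B g -> mu [set q | ~ (`|rho Phi q| <= H)%R] = 0 ->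
  (forall q, `|rho Phi q| <= H -> normc (g q) <= c * normc (f q))%R ->
  \int[mu]_q (normc (g q) `^ p)%:E <= (c `^ p)%:E * \int[mu]_q (normc (f q) `^ p)%:E.
Proof.
move=> A0 B0 c0 cf cg muH gf.
have mf : measurable_fun setT (fun q : Borel EC => (normc (f q) `^ p)%:E).
  by apply/measurable_EFinP; exact: (measurable_normc_pow hPhi p A0 cf (@emeas_Borel R n m)).
have mg : measurable_fun setT (fun q : Borel EC => (normc (g q) `^ p)%:E).
  by apply/measurable_EFinP; exact: (measurable_normc_pow hPhi p B0 cg (@emeas_Borel R n m)).
rewrite -ge0_integralZl; last 4 first.
- exact: measurableT.
- exact: mf.
- by move=> q _; rewrite lee_fin powR_ge0.
- by rewrite lee_fin powR_ge0.
apply: ae_ge0_le_integral; first exact: measurableT.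
- by move=> q _; rewrite lee_fin powR_ge0.
- exact: mg.
- by move=> q _; apply: mule_ge0; rewrite lee_fin powR_ge0.
- by apply: emeasurable_funM; [exact: measurable_cst|exact: mf].
exists [set q | ~ (`|rho Phi q| <= H)%R]; split => //.
  apply: measurableC; apply: (@measurable_norm_rV _ _ (Borel EC) _ (fun q => rho Phi q)).
  by apply: rmeas_rho => //; exact: emeas_Borel.
move=> q /= nq qH; apply: nq => _; rewrite -EFinM lee_fin -powRM ?normc_ge0//.
by apply: powR_mono => //; [exact: normc_ge0|exact: gf].
Qed.

Lemma integral_outerD (A r' : R) f : (0 <= A)%R -> expclass Phi A f ->
  \int[lebN R n m]_a ((1 - outer dN r' (pointN a)) * pw Phi p f (pointN a))%:E +
  \int[lebN R n m]_a (outer dN r' (pointN a) * pw Phi p f (pointN a))%:E =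
  \int[lebN R n m]_a (pw Phi p f (pointN a))%:E.
Proof.
move=> A0 cf; have mp := nmeas_pointN (@measurable_id _ TN setT).
have mo := nmeasurable_outer hPhi hdN r' mp.
have mw := nmeasurable_pw hPhi p A0 cf mp.
rewrite -ge0_integralD; last 5 first.
- exact: measurableT.
- move=> a _; rewrite lee_fin mulr_ge0 ?pw_ge0// /outer.
  by case: (r' <= _)%R; rewrite ?subrr ?subr0.
- apply/measurable_EFinP; apply: measurable_funM => //.
  by apply: measurable_funB => //; exact: measurable_cst.
- by move=> a _; rewrite lee_fin mulr_ge0 ?pw_ge0// /outer.
- by apply/measurable_EFinP; exact: measurable_funM.
by apply: eq_integral => a _; rewrite -EFinD -mulrDl subrK mul1r.
Qed.

Lemma integral_pw_finite (A M : R) f : (0 <= A)%R -> expclass Phi A f ->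
  (forall a, pw Phi p f a <= M * W0 a)%R ->
  \int[lebN R n m]_a (pw Phi p f (pointN a))%:E < +oo.
Proof.
move=> A0 cf HM; have [I I0 HI] := @integral_W0 R n m.
have mp := nmeas_pointN (@measurable_id _ TN setT).
apply: (@le_lt_trans _ _ (\int[lebN R n m]_a ((`|M|)%:E * (W0 (pointN a))%:E))).
  apply: ge0_le_integral.
  - exact: measurableT.
  - by move=> a _; rewrite lee_fin pw_ge0.
  - by apply/measurable_EFinP; exact: (nmeasurable_pw hPhi p A0 cf mp).
  - apply: emeasurable_funM; first exact: measurable_cst.
    by apply/measurable_EFinP; exact: measurable_W0.
  move=> a _; rewrite -EFinM lee_fin; apply: le_trans (HM _) _.
  by apply: ler_wpM2r; [exact: W0_ge0|exact: ler_norm].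
rewrite ge0_integralZl; last 4 first.
- exact: measurableT.
- by apply/measurable_EFinP; exact: measurable_W0.
- by move=> a _; rewrite lee_fin W0_ge0.
- by rewrite lee_fin.
by rewrite HI -EFinM ltry.
Qed.

(** The radius r is fixed by the class of type A + 2, which leaves room for both
    multipliers: chi, which makes all integrals finite, and a power of gL, which
    removes the unsampled ball. For G = f chi gL^k the ball is dominated by its
    complement, where the sampling inequality applies with an error of a quarter
    of the whole; this error is absorbed. Then gL is removed where u0 is large, chi
    by letting d tend to 0, and the points where u0 is small by tail_estimate. *)
Lemma lower_inequality (A : R) : (0 <= A)%R -> exists2 r : R, (0 < r)%R &
  forall (mu : {measure set (Borel EC) -> \bar R}) (r' eps H : R), sigma_finite setT mu ->
  (0 < r')%R -> (0 < eps)%R -> (0 <= H)%R -> mu [set q | ~ (`|rho Phi q| <= H)%R] = 0 ->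
  (forall a, (r' <= nrm dN a)%R -> eps%:E <= ball_mass Phi dN mu (2 * r) (bpt Phi a)) ->
  exists2 K : R, (0 < K)%R & forall f, expclass Phi A f ->
  \int[lebN R n m]_a (pw Phi p f (pointN a))%:E <= K%:E * \int[mu]_q (normc (f q) `^ p)%:E.
Proof.
move=> A0; have A1 : (0 <= A + 1)%R by rewrite addr_ge0.
have A2 : (0 <= A + 1 + 1)%R by rewrite addr_ge0.
have [C1 [r0 sr]] := sampling_point hPhi hdN hf p0 A2; have [I I0 HI] := @integral_W0 R n m.
have [C10 r00 r01 _] := sr.
have [r [rp rr0 Hr]] := small_radius p0 (mulr_gt0 C10 I0) r00.
exists r => // mu r' eps H sf r'0 eps0 H0 muH He.
have [C3 C30 HC3] := sampling_integrated hPhi hdN sf A2 sr I0 HI rp rr0 eps0 He.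
have [L [rho1 [c [k [L0 rho10 c0 Lk HZ]]]]] := zero_removal hPhi hdN hf p0 A1 r'0.
have [K1 K10 HK1] := tail_estimate hPhi hf p0 A0 rho10.
pose c5 := (expR H * (2 ^+ k * expR H))%R.
have c50 : (0 < c5)%R by rewrite !mulr_gt0// ?expR_gt0// exprn_gt0.
exists (K1 * (2 `^ p * (c * (2 * (C3 * c5 `^ p)))))%R => [|f cf].
  by rewrite !mulr_gt0// powR_gt0.
have [Nn HN] := chi_regular hPhi hf p0 cf.
apply: le_trans (HK1 f cf) _; rewrite EFinM -muleA; apply: lee_wpmul2l.
  by rewrite lee_fin ltW.
rewrite EFinM -muleA; apply: (unregularize hPhi hf p0 A0 cf (k := Nn)) => d d0 dk.
have [M M0 HM] := HN d d0; have l0 := lam_ge0 ls.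
have dk0 : (0 <= Nn%:R * (d * lam ls))%R by rewrite !mulr_ge0// ltW.
have cF : expclass Phi (A + 1) (fun q => f q * chi ls d Nn q)%R.
  apply: expclassW (expclassM A0 dk0 cf (expclass_chi hf Nn (ltW d0))).
  by rewrite lerD2l.
have [h1 h2] := HZ _ cF; apply: le_trans h2 _; rewrite EFinM -muleA; apply: lee_wpmul2l.
  by rewrite lee_fin ltW.
have Lp0 : (0 <= L^-1 * lam ls)%R by rewrite mulr_ge0// invr_ge0 ltW.
have k0 : (0 <= k%:R * (L^-1 * lam ls))%R by exact: mulr_ge0.
have cgL := expclass_gL hf L0.
move: h1; set G := fun q => (f q * chi ls d Nn q * gL ls L q ^+ k)%R => h1.
have cG : expclass Phi (A + 1 + 1) G.
  by apply: expclassW (expclassM A1 k0 cF (expclassX k Lp0 cgL)); rewrite lerD2l.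
have gL2 a : (normc (gL ls L (bpt Phi a)) <= 2)%R by have [] := gL_bpt hf a L0.
have tot := integral_outerD r' A2 cG.
have fin : \int[lebN R n m]_a (pw Phi p G (pointN a))%:E < +oo.
  apply: (integral_pw_finite (M := ((2 ^+ k) `^ p * M)%R) A2 cG) => a.
  have [_ h] := HM a; rewrite /pw /G normcM normcX powRM ?exprn_ge0 ?normc_ge0//.
  rewrite -mulrA mulrC; apply: ler_pM; rewrite ?powR_ge0//.
  apply: powR_mono => //; first by rewrite exprn_ge0// normc_ge0.
  by apply: lerXn2r (gL2 a); rewrite nnegrE ?normc_ge0.
have transfer : \int[mu]_q (normc (G q) `^ p)%:E <= (c5 `^ p)%:E * \int[mu]_q (normc (f q) `^ p)%:E.
  apply: (strip_transfer A0 A2 (ltW c50) cf cG muH) => q qH.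
  have b1 : (normc (chi ls d Nn q) <= expR H)%R.
    apply: le_trans (normc_chi hf Nn q (ltW d0)) _; rewrite ler_expR.
    by rewrite -[leRHS]mul1r; apply: ler_pM.
  have b2 : (normc (gL ls L q) ^+ k <= 2 ^+ k * expR H)%R.
    have h := strip_bound Lp0 cgL gL2 q.
    apply: (@le_trans _ _ ((2 * expR (L^-1 * lam ls * `|rho Phi q|)) ^+ k)%R).
      by apply: lerXn2r h; rewrite nnegrE ?normc_ge0// mulr_ge0// expR_ge0.
    rewrite exprMn; apply: ler_wpM2l; first exact: exprn_ge0.
    rewrite -expRM_natl ler_expR mulrA -[leRHS]mul1r; apply: ler_pM => //.
  rewrite /G !normcM normcX -mulrA mulrC /c5; apply: ler_wpM2r; first exact: normc_ge0.
  by apply: ler_pM => //; rewrite ?exprn_ge0 ?normc_ge0.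
apply: (@le_trans _ _ (2%:E * (C3%:E * \int[mu]_q (normc (G q) `^ p)%:E))); last first.
  rewrite EFinM -muleA; apply: lee_wpmul2l; first by rewrite lee_fin.
  by rewrite EFinM -muleA; apply: lee_wpmul2l => //; rewrite lee_fin ltW.
apply: (absorb (k := (C1 * I * r `^ p)%R) Hr _ _ _ _ h1); last 1 first.
- by rewrite tot; exact: HC3.
- apply: integral_ge0 => a _; rewrite lee_fin mulr_ge0 ?pw_ge0// /outer.
  by case: (r' <= _)%R; rewrite ?subrr ?subr0.
- by apply: integral_ge0 => a _; rewrite lee_fin mulr_ge0 ?pw_ge0// /outer.
- apply: mule_ge0; first by rewrite lee_fin ltW.
  by apply: integral_ge0 => q _; rewrite lee_fin powR_ge0.
- by rewrite tot.
Qed.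

End lower_inequality_strip.

(** * Norm inequalities and the triangle inequality for the distance *)

Section assembly.
Context {R : realType} {n m : nat}.
Local Notation C := R[i].
Local Notation EC := (EFC R n m).
Local Notation N := (Ngroup R n m).
Local Notation TN := (Rtuple R n * Rtuple R n * Rtuple R m)%type.

(** Cauchy-Schwarz is obtained by summing (Y x_j - X y_j)^2 >= 0. *)
Lemma normR_triangle k (x y : 'rV[R]_k) : normR (x + y) <= normR x + normR y.
Proof.
have [->|x0] := eqVneq x 0; first by rewrite add0r lerDr sqrtr_ge0.
have [->|y0] := eqVneq y 0; first by rewrite addr0 lerDl sqrtr_ge0.
have X0 : 0 < normR x by apply: lt_le_trans (normR_ge x); rewrite normr_gt0.
have Y0 : 0 < normR y by apply: lt_le_trans (normR_ge y); rewrite normr_gt0.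
have sE (z : 'rV[R]_k) : normR z ^+ 2 = \sum_j z ord0 j ^+ 2.
  by rewrite sqr_sqrtr// sumr_ge0// => j _; exact: sqr_ge0.
set X := normR x in X0 *; set Y := normR y in Y0 *.
have cs : \sum_j x ord0 j * y ord0 j <= X * Y.
  rewrite -(ler_pM2l (mulr_gt0 (mulr_gt0 (@ltr0n R 2) X0) Y0)).
  have -> : 2 * X * Y * (X * Y) = Y ^+ 2 * (\sum_j x ord0 j ^+ 2) + X ^+ 2 * (\sum_j y ord0 j ^+ 2).
    by rewrite -!sE -/X -/Y; ring.
  rewrite !mulr_sumr -big_split/=; apply: ler_sum => j _.
  rewrite -subr_ge0; have := sqr_ge0 (Y * x ord0 j - X * y ord0 j).
  by congr (_ <= _); ring.
rewrite -(@ler_pXn2r _ 2)// ?nnegrE ?sqrtr_ge0 ?addr_ge0 ?(ltW X0) ?(ltW Y0)//.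
rewrite sE; under eq_bigr do rewrite mxE sqrrD.
rewrite (eq_bigr (fun j => x ord0 j ^+ 2 + y ord0 j ^+ 2 + 2 * (x ord0 j * y ord0 j))); last by move=> j _; ring.
rewrite !big_split/= -mulr_sumr -!sE -/X -/Y (_ : (X + Y) ^+ 2 = X ^+ 2 + Y ^+ 2 + 2 * (X * Y)); last by ring.
by rewrite lerD2l ler_pM2l.
Qed.

Lemma LpnormCE d (T : measurableType d) (mu : {measure set T -> \bar R}) (p : R) (g : T -> C) :
  LpnormC mu p%:E g = ((\int[mu]_x (normc (g x) `^ p)%:E) `^ p^-1)%E.
Proof.
rewrite /LpnormC unlock; congr (_ `^ _)%E; apply: eq_integral => x _.
by rewrite /= ger0_norm ?normc_ge0.
Qed.

Lemma LpC_finite d (T : measurableType d) (mu : {measure set T -> \bar R}) (p : R) (g : T -> C) : 0 < p ->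
  cmeas g -> LpC mu p%:E g <-> (\int[mu]_x (normc (g x) `^ p)%:E < +oo)%E.
Proof.
move=> p0 [mr mi]; split=> [[_ _]|h]; last by split => //; rewrite LpnormCE; exact: poweR_lty.
rewrite LpnormCE => /(poweR_lty p); rewrite -poweRrM mulVf ?gt_eqF// poweRe1//.
by apply: integral_ge0 => x _; rewrite lee_fin powR_ge0.
Qed.

Lemma LpnormC_le d d' (T : measurableType d) (T' : measurableType d')
    (mu : {measure set T -> \bar R}) (mu' : {measure set T' -> \bar R}) (p K : R)
    (g : T -> C) (h : T' -> C) : 0 < p -> 0 < K ->
  (\int[mu]_x (normc (g x) `^ p)%:E <= K%:E * \int[mu']_x (normc (h x) `^ p)%:E)%E ->
  (LpnormC mu p%:E g <= (K `^ p^-1)%:E * LpnormC mu' p%:E h)%E.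
Proof.
move=> p0 K0 gh; rewrite !LpnormCE -poweR_EFin -poweRM; last 2 first.
- by rewrite lee_fin ltW.
- by apply: integral_ge0 => x _; rewrite lee_fin powR_ge0.
have h0 : (0 <= K%:E * \int[mu']_x (normc (h x) `^ p)%:E)%E.
  apply: mule_ge0; first by rewrite lee_fin ltW.
  by apply: integral_ge0 => x _; rewrite lee_fin powR_ge0.
apply: gt0_ler_poweR => //; first by rewrite invr_ge0 ltW.
  rewrite in_itv/= leey andbT; apply: integral_ge0 => x _; by rewrite lee_fin powR_ge0.
by rewrite in_itv/= leey andbT.
Qed.

Variable Phi : Espace R n -> Espace R n -> FCspace R m.
Hypothesis hPhi : hermitian_map Phi.
Variable dN : N -> N -> R.
Hypothesis hdN : homogeneous_distance Phi dN.

Lemma dEFC_triangle q1 q2 q3 : dEFC Phi dN q1 q3 <= dEFC Phi dN q1 q2 + dEFC Phi dN q2 q3.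
Proof.
case: hdN => -[_ _ _ tri] _ _; rewrite /dEFC ge_max; apply/andP; split.
  by apply: le_trans (tri _ (q2.1, ReV q2.2) _) _; apply: lerD; rewrite le_max lexx.
have -> : rho Phi q1 - rho Phi q3 = (rho Phi q1 - rho Phi q2) + (rho Phi q2 - rho Phi q3) by rewrite addrA subrK.
by apply: le_trans (normR_triangle _ _) _; apply: lerD; rewrite le_max lexx orbT.
Qed.

(** A ball that meets the set of heavy points contains the heavy ball after
    doubling its radius. *)
Lemma heavy_ball (mu nu : {measure set (Borel EC) -> \bar R}) (eps c r : R) q : 0 < c ->
  (c%:E <= nu (Gset Phi dN mu eps r `&` ballEFC Phi dN q r))%E ->
  (eps%:E <= ball_mass Phi dN mu (2 * r) q)%E.
Proof.
move=> c0 h; have [q1 [/= g1 b1]] : (Gset Phi dN mu eps r `&` ballEFC Phi dN q r) !=set0.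
  by apply/set0P/eqP => e0; move: h; rewrite e0 measure0 lee_fin leNgt c0.
apply: le_trans g1 _; apply: le_measure; rewrite ?inE; [exact: measurable_dEFC_ball|exact: measurable_dEFC_ball|].
move=> q2; rewrite /closed_ballEFC/= => h2; apply: le_trans (dEFC_triangle _ q1 _) _.
by rewrite mulr_natl mulr2n; apply: lerD => //; exact: ltW.
Qed.

End assembly.


Theorem corollary4p13 (R : realType) (n m : nat) (hnm : (0 < n + m)%N)
    (Phi : Espace R n -> Espace R n -> FCspace R m)
    (hPhi : hermitian_map Phi) (hLambda : Lambda_plus Phi !=set0)
    (dN : Ngroup R n m -> Ngroup R n m -> R)
    (hdN : homogeneous_distance Phi dN)
    (p eps C : R) (hp : 0 < p) (heps : 0 < eps) (hC : 0 < C)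
    (K : set (Fspace R m)) (cptK : compact K)
    (subK : K `<=` closure (Lambda_plus Phi))
    (nu : {measure set (Borel (EFC R n m)) -> \bar R}) (hnu : radon nu) :
  exists2 r : R, 0 < r &
    forall r' : R, 0 < r' ->
    forall mu : {measure set (Borel (EFC R n m)) -> \bar R}, radon mu ->
      bounded_set (rho Phi @` msupport mu) ->
      Linfty (lebEFC R n m) (ball_mass Phi dN mu 1 \o @pointEFC R n m) ->
      (forall (zeta : Espace R n) (x : Fspace R m),
         ~ ballN dN (0, 0) r' (zeta, x) ->
         (C%:E <= nu (Gset Phi dN mu eps r `&`
                      ballEFC Phi dN (zeta, complexV x (quad Phi zeta)) r))%E) ->
      strongly_sampling Phi p%:E K mu.
Proof.
have [A A0 HA] := HolK_expclass Phi cptK.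
have [ls [D [e hf]]] := frame_exists hPhi hnm hLambda.
have [r r0 lower] := lower_inequality hPhi hdN hf hp A0.
exists r => // r' r'0 mu rmu bmu Mmu heavy.
have sf := radon_sigma_finite rmu.
have [H H0 muH] := bounded_rho_support hPhi bmu.
have bm0 t : (0 <= (ball_mass Phi dN mu 1 \o @pointEFC R n m) t)%E by exact: measure_ge0.
have [M M0 aeM] := Linfty_ae bm0 Mmu.
have [Ku Ku0 upper] := carleson hPhi hdN hf hp sf A0 H0 M0 muH aeM.
have hv a : r' <= nrm dN a -> (eps%:E <= ball_mass Phi dN mu (2 * r) (bpt Phi a))%E.
  case: a => z x ra; apply: (heavy_ball hPhi hdN hC (heavy z x _)).
  by rewrite /ballN/=; apply/negP; rewrite -leNgt.
have [Kl Kl0 {}lower] := lower mu r' eps H sf r'0 heps H0 muH hv.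
have sE f : slice Phi f 0 \o @pointN R n m = fun t => f (bpt Phi (pointN t)).
  by apply/funext => t; rewrite /= slice0E.
have mf f : HolK Phi K f -> cmeas (f : Borel (EFC R n m) -> R[i]).
  by move=> /HA cf; exact: (cmeas_econt (@emeas_Borel R n m) (expclass_econt hPhi A0 cf)).
have mb f : HolK Phi K f -> cmeas (slice Phi f 0 \o @pointN R n m).
  move=> /HA cf; rewrite sE; apply: cmeas_econt (expclass_econt hPhi A0 cf).
  exact: emeas_bpt (nmeas_pointN (@measurable_id _ _ setT)).
have up f : HolK Phi K f -> (\int[mu]_q (normc (f q) `^ p)%:E <=
    Ku%:E * \int[lebN R n m]_t (normc ((slice Phi f 0 \o @pointN R n m) t) `^ p)%:E)%E.
  by move=> /HA cf; rewrite sE; exact: upper.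
have lo f : HolK Phi K f -> (\int[lebN R n m]_t (normc ((slice Phi f 0 \o @pointN R n m) t) `^ p)%:E <=
    Kl%:E * \int[mu]_q (normc (f q) `^ p)%:E)%E.
  by move=> /HA cf; rewrite sE; exact: lower.
have bL f : HolK Phi K f -> LpC (lebN R n m) p%:E (slice Phi f 0 \o @pointN R n m) -> LpC mu p%:E f.
  move=> hK /(LpC_finite _ hp (mb f hK)) fin; apply/(LpC_finite _ hp (mf f hK)).
  by apply: le_lt_trans (up f hK) _; rewrite lte_mul_pinfty// lee_fin ltW.
have Lb f : HolK Phi K f -> LpC mu p%:E f -> LpC (lebN R n m) p%:E (slice Phi f 0 \o @pointN R n m).
  move=> hK /(LpC_finite _ hp (mf f hK)) fin; apply/(LpC_finite _ hp (mb f hK)).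
  by apply: le_lt_trans (lo f hK) _; rewrite lte_mul_pinfty// lee_fin ltW.
split; last by move=> f; split=> -[hK h]; split => //; [exact: bL|exact: Lb].
split.
- by move=> f [hK h]; exact: bL.
- exists (Ku `^ p^-1) => [|f [hK h]]; first by rewrite powR_gt0.
  by apply: LpnormC_le => //; exact: up.
- exists (Kl `^ p^-1) => [|f [hK h]]; first by rewrite powR_gt0.
  by apply: LpnormC_le => //; exact: lo.
Qed.
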